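(* Let $z_1,\dots,z_n\in\mathbb{C}$ be distinct points, let $p,q\in\{1,\dots,n\}$, and let $\gamma$ be a path starting at the tangential base point $(z_p,1)$ and ending at the tangential base point $(z_q,1)$, with finitely many transverse self-intersection points $\gamma(t_l)=\gamma(s_l)$, $t_l<s_l$, $l=1,\dots,m$, with signs $\varepsilon_l$. Let $\mathcal{A}=\frac{1}{2\pi i}\sum_{i=1}^n x_i\,d\log(z-z_i)$ and let $H=\mathrm{Hol}^{\mathrm{reg}}(\mathcal{A},\gamma)\in A=\mathbb{C}\langle\langle x_1,\dots,x_n\rangle\rangle$ be the regularized holonomy. Then $$\bar\mu_{\mathrm{KKS}}(H)=H\,r_\zeta(-x_p)+\mathrm{rot}(\gamma)\,H-r_\zeta(x_q)\,H+\sum_{l=1}^m\varepsilon_l\,\mathrm{Hol}(\mathcal{A},\gamma_{[s_l,1]})\,\mathrm{Hol}(\mathcal{A},\gamma_{[0,t_l]})-d^L_p(H)-d^R_q(H),$$ where $\mathrm{Hol}(\mathcal{A},\gamma_{[s_l,1]})$ and $\mathrm{Hol}(\mathcal{A},\gamma_{[0,t_l]})$ are the holonomies of $\mathcal{A}$ along the indicated portions of $\gamma$, regularized at the tangential end point.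
   Context: Algebra. $A=\mathbb{C}\langle\langle x_1,\dots,x_n\rangle\rangle$ is the degree-completed free associative algebra, with counit (augmentation) $\varepsilon:A\to\mathbb{C}$, $\varepsilon(x_i)=0$. The left and right Fox derivatives $d^L_i,d^R_i:A\to A$ are defined by the unique presentations $a=\varepsilon(a)+\sum_i d^L_i(a)x_i=\varepsilon(a)+\sum_i x_i d^R_i(a)$. The reduced KKS (Kirillov-Kostant-Souriau) coaction $\bar\mu_{\mathrm{KKS}}:A\to A$ is the continuous linear map with $\bar\mu_{\mathrm{KKS}}(1)=0$ and, on monomials $h_1\cdots h_k$ with $h_i\in\{x_1,\dots,x_n\}$, $\bar\mu_{\mathrm{KKS}}(h_1\cdots h_k)=\sum_{i=1}^{k-1}\delta_{h_i,h_{i+1}}h_1\cdots h_i h_{i+2}\cdots h_k$. The function $r_\zeta$ is the power series $$r_\zeta(x)=-\frac{1}{2\pi i}\sum_{k=2}^\infty\zeta(k)\left(\frac{x}{2\pi i}\right)^{k-1},$$ with $\zeta(k)$ the values of the Riemann zeta function. Paths. $\Sigma=\mathbb{C}\setminus\{z_1,\dots,z_n\}$. A path from $(z_p,1)$ to $(z_q,1)$ is a smooth map $\gamma:[0,1]\to\mathbb{C}$ with $\dot\gamma\neq0$, $\gamma(t)\in\Sigma$ for $0<t<1$, $\gamma(t)=z_p+t$ for small $t\geq 0$, and $\gamma(t)=z_q+(1-t)$ for small $1-t\geq 0$. The signs of the self-intersections are taken relative to the standard (blackboard) orientation of $\mathbb{C}$: $\varepsilon_l=+1$ if $(\dot\gamma(t_l),\dot\gamma(s_l))$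 is a positively oriented basis of $\mathbb{C}=\mathbb{R}^2$ and $\varepsilon_l=-1$ otherwise. The rotation number (in the blackboard framing) is $\mathrm{rot}(\gamma)=\frac{1}{2\pi}\mathrm{Im}\int_0^1 d\log\dot\gamma(t)$. Holonomy. Consider $A$-valued solutions of the Knizhnik-Zamolodchikov equation $d\Psi=\mathcal{A}\Psi$. For a tangential end point $(z_p,1)$, $\Psi_p$ is the solution with asymptotics $\Psi_p(z)\sim(z-z_p)^{x_p/2\pi i}$ as $z\to z_p$, i.e. of the form $\Psi_p(z)=f(z)(z-z_p)^{x_p/2\pi i}$ with $f$ analytic near $z_p$, $f(z_p)=1$, the branch of $\log(z-z_p)$ being real on the ray $z_p+\mathbb{R}_{>0}$ along which $\gamma$ leaves (or arrives at) $z_p$. For a regular end point $z_0\in\Sigma$ the corresponding solution is normalized by $\Psi(z_0)=1$. The (regularized) holonomy along a path is $\mathrm{Hol}^{\mathrm{reg}}(\mathcal{A},\gamma)=\Psi_{\mathrm{end}}(z)^{-1}\Psi_{\mathrm{start}}(z)$, where both solutions are analytically continued along the path to a common point $z$ on it. *)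

(* Defs.v *)
From HB Require Import structures.
From Stdlib Require Import Reals FunctionalExtensionality.
Set Warnings "-notation-overridden,-ambiguous-paths,-redundant-canonical-projection".
From mathcomp Require Import all_boot.
From Coquelicot Require Import Coquelicot.

Set Implicit Arguments.
Unset Strict Implicit.
Unset Printing Implicit Defensive.

Local Open Scope R_scope.

HB.instance Definition _ :=
  Monoid.isComLaw.Build C (RtoC 0) Cplus Cplus_assoc Cplus_comm Cplus_0_l.

Notation "\csum_ ( i < n ) E" := (\big[Cplus/RtoC 0]_(i < n) E%C)
  (at level 41, i name, E at level 41).
Notation "\csum_ ( i : T ) E" := (\big[Cplus/RtoC 0]_(i : T) E%C)
  (at level 41, i name, E at level 41).

(** * The algebra of noncommutative formal power series *)

(* An element of C<<x_1, .., x_n>> is given by its coefficients: [a w] is the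
   coefficient of the monomial spelled by the word [w].  The letters are
   indexed by 'I_n, that is from 0. *)
Definition series (n : nat) : Type := seq 'I_n -> C.

Declare Scope series_scope.
Delimit Scope series_scope with S.
Bind Scope series_scope with series.

Definition monomial n (h : seq 'I_n) : series n :=
  fun w => if w == h then RtoC 1 else RtoC 0.
Definition szero n : series n := fun=> RtoC 0.
Definition sone n : series n := monomial [::].
Definition letter n (i : 'I_n) : series n := monomial [:: i].
Definition sadd n (a b : series n) : series n := fun w => Cplus (a w) (b w).
Definition sopp n (a : series n) : series n := fun w => Copp (a w).
Definition sscale n (c : C) (a : series n) : series n := fun w => Cmult c (a w).
Definition smul n (a b : series n) : series n :=
  fun w => \csum_(k < (size w).+1) (a (take k w) * b (drop k w)).
Definition spow n (a : series n) (k : nat) : series n := iter k (smul a) (@sone n).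

Arguments szero {n}.
Arguments sone {n}.

Notation "1" := sone : series_scope.
Notation "a + b" := (sadd a b) : series_scope.
Notation "- a" := (sopp a) : series_scope.
Notation "a - b" := (sadd a (sopp b)) : series_scope.
Notation "a * b" := (smul a b) : series_scope.
Notation "c *: a" := (sscale c%C a) (at level 40) : series_scope.
Notation "\ssum_ ( i < n ) E" := (\big[@sadd _/szero]_(i < n) E%S)
  (at level 41, i name, E at level 41) : series_scope.

Definition is_inverse n (a b : series n) : Prop :=
  (a * b)%S = 1%S /\ (b * a)%S = 1%S.

Definition augmentation n (a : series n) : C := a [::].

(* The power series sum_k f_k x^k evaluated at [a].  It is meant for [a] of
   augmentation 0: then [spow a k] vanishes on the words shorter than k, and the
   sum over all k is the finite sum below. *)
Definition subst_series n (f : nat -> C) (a : series n) : series n :=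
  fun w => \csum_(k < (size w).+1) (f k * spow a k w).

Definition sexp n (a : series n) : series n :=
  subst_series (fun k => RtoC (/ INR k`!)) a.

(** * Fox derivatives and the reduced KKS coaction *)

Definition foxL n (i : 'I_n) (a : series n) : series n := fun w => a (rcons w i).
Definition foxR n (i : 'I_n) (a : series n) : series n := fun w => a (i :: w).

Lemma ssumE n m (F : 'I_m -> series n) w :
  (\ssum_(i < m) F i)%S w = \csum_(i < m) (F i w).
Proof. by elim/big_rec2: _ => //= i x y _ <-. Qed.

Lemma smul_letterr n (a : series n) (i x : 'I_n) v :
  (a * letter i)%S (rcons v x) = if x == i then a v else RtoC 0.
Proof.
rewrite /smul /letter /monomial size_rcons big_ord_recr big_ord_recr /=.
rewrite big1 => [|j _]; last first.
  case: eqP => [E|_]; last by rewrite Cmult_0_r.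
  have := congr1 size E; rewrite size_drop size_rcons /=.
  by rewrite subSn ?(ltnW (ltn_ord j)) // => -[/eqP]; rewrite subn_eq0 leqNgt ltn_ord.
rewrite Cplus_0_l -cats1 drop_size_cat // take_size_cat // eqseq_cons andbT.
rewrite drop_oversize; last by rewrite size_cat addn1.
by case: ifP => _; rewrite /= ?Cmult_1_r ?Cmult_0_r Cplus_0_r.
Qed.

Lemma smul_letterl n (a : series n) (i : 'I_n) w :
  (letter i * a)%S w = if w is x :: v then
    if x == i then a v else RtoC 0 else RtoC 0.
Proof.
rewrite /smul /letter /monomial; case: w => [|x v].
  by rewrite big_ord_recl big_ord0 /= Cmult_0_l Cplus_0_l.
rewrite big_ord_recl big_ord_recl big1 /= => [|j _].
  rewrite take0 drop0 eqseq_cons andbT Cmult_0_l Cplus_0_l Cplus_0_r.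
  by case: ifP => _; rewrite ?Cmult_1_l ?Cmult_0_l.
case: v j => [|y v] [j lt_j] //=.
by rewrite !eqseq_cons andbF Cmult_0_l.
Qed.

Lemma csum_pick n (j : 'I_n) (F : 'I_n -> C) :
  \csum_(i < n) (if j == i then F i else RtoC 0) = F j.
Proof.
rewrite (bigD1 j) //= eqxx big1 ?Cplus_0_r // => i.
by rewrite eq_sym => /negbTE ->.
Qed.

(* [foxL] and [foxR] are the Fox derivatives: the coefficients of the unique
   presentations a = eps(a) + sum_i d_i x_i and a = eps(a) + sum_i x_i d_i. *)
Lemma foxLP n (a : series n) (c : C) (d : 'I_n -> series n) :
  a = (c *: 1 + \ssum_(i < n) (d i * letter i))%S <->
  c = augmentation a /\ (forall i, d i = foxL i a).
Proof.
set b := (X in a = X).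
have b0 : b [::] = c.
  rewrite /b /sadd /sscale /sone /monomial ssumE big1 => [|i _].
    by rewrite Cplus_0_r Cmult_1_r.
  by rewrite /smul /letter /monomial big_ord_recl big_ord0 /= Cmult_0_r Cplus_0_r.
have bS v x : b (rcons v x) = d x v.
  rewrite /b /sadd /sscale /sone /monomial ssumE.
  under eq_bigr do rewrite smul_letterr.
  rewrite (csum_pick _ (fun i => d i v)) -size_eq0 size_rcons.
  by rewrite Cmult_0_r Cplus_0_l.
split=> [->|[cE dE]].
  split=> [|i]; first by rewrite /augmentation b0.
  by apply: functional_extensionality => w; rewrite /foxL bS.
apply: functional_extensionality => w.
by case/lastP: w => [|v x]; rewrite ?b0 ?cE // bS dE.
Qed.

Lemma foxRP n (a : series n) (c : C) (d : 'I_n -> series n) :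
  a = (c *: 1 + \ssum_(i < n) (letter i * d i))%S <->
  c = augmentation a /\ (forall i, d i = foxR i a).
Proof.
set b := (X in a = X).
have bE w : b w = if w is x :: v then d x v else c.
  rewrite /b /sadd /sscale /sone /monomial ssumE.
  under eq_bigr do rewrite smul_letterl.
  case: w => [|x v] /=; first by rewrite big1 // Cplus_0_r Cmult_1_r.
  by rewrite (csum_pick _ (fun i => d i v)) Cmult_0_r Cplus_0_l.
split=> [->|[cE dE]].
  split=> [|i]; first by rewrite /augmentation bE.
  by apply: functional_extensionality => w; rewrite /foxR bE.
apply: functional_extensionality => w.
by rewrite bE; case: w => [|x v]; rewrite ?cE ?dE.
Qed.

(* Positions are counted from 0: the equal letters at i and i+1 are merged. *)
Definition KKS_word n (h : seq 'I_n) : series n :=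
  (\ssum_(i < (size h).-1)
    (if onth h i == onth h i.+1
     then monomial (take i.+1 h ++ drop i.+2 h) else szero))%S.

(* The continuous linear extension, a |-> sum_h a_h KKS_word(h): as KKS_word(h)
   is supported on words of length |h| - 1, only the words h of length |w| + 1
   contribute to the coefficient of w. *)
Definition KKS n (a : series n) : series n :=
  fun w => \csum_(h : (size w).+1.-tuple 'I_n) (a h * KKS_word h w).

Lemma KKS_monomial n (h : seq 'I_n) : KKS (monomial h) = KKS_word h.
Proof.
apply: functional_extensionality => w; rewrite /KKS /monomial.
have [sz_h|sz_h] := eqVneq (size h) (size w).+1.
  have sz_hb : size h == (size w).+1 by rewrite sz_h.
  rewrite (bigD1 (Tuple sz_hb)) //= eqxx Cmult_1_l big1 ?Cplus_0_r // => k.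
  by rewrite -val_eqE /= => /negbTE ->; rewrite Cmult_0_l.
rewrite big1 => [|k _].
  rewrite /KKS_word ssumE big1 // => i _; case: ifP => // _.
  rewrite /monomial; case: eqP => // wE.
  have lt_i : (i.+1 < size h)%N by rewrite -ltn_predRL.
  case/eqP: sz_h; rewrite wE size_cat size_drop size_takel ?(ltnW lt_i) //.
  by rewrite -addSn subnKC.
case: eqP => [kE|_]; last by rewrite Cmult_0_l.
by rewrite -kE size_tuple eqxx in sz_h.
Qed.

(** * The function r_zeta *)

Definition two_pi_i : C := (RtoC (2 * PI) * Ci)%C.

(* Only used for k >= 2, where the series converges. *)
Definition zeta (k : nat) : R := Series (fun j => / INR j.+1 ^ k).

Definition r_zeta_coef (j : nat) : C :=
  if j is 0%N then RtoC 0
  else (- / two_pi_i * (RtoC (zeta j.+1) / two_pi_i ^ j))%C.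

Definition r_zeta n (a : series n) : series n := subst_series r_zeta_coef a.

(** * Paths between tangential base points *)

Definition in_Sigma n (z : 'I_n -> C) (u : C) : Prop := forall i, u <> z i.

Definition path_deriv (k : nat) (gamma : R -> C) (t : R) : C :=
  (Derive_n (fun u => Re (gamma u)) k t, Derive_n (fun u => Im (gamma u)) k t).
Definition velocity := path_deriv 1.

(* Only the values of gamma on [0,1] matter.  Smoothness and nonvanishing of the
   derivative are required on ]0,1[ only, since at 0 and 1 they follow from the
   last two conditions. *)
Record tangential_path n (z : 'I_n -> C) (p q : 'I_n) (gamma : R -> C) : Prop := {
  path_smooth : forall k t, 0 < t < 1 ->
    ex_derive_n (fun u => Re (gamma u)) k t /\
    ex_derive_n (fun u => Im (gamma u)) k t;
  path_immersed : forall t, 0 < t < 1 -> velocity gamma t <> RtoC 0;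
  path_in_Sigma : forall t, 0 < t < 1 -> in_Sigma z (gamma t);
  path_start : exists2 delta, 0 < delta & forall t, 0 <= t < delta ->
    gamma t = (z p + RtoC t)%C;
  path_end : exists2 delta, 0 < delta & forall t, 0 <= 1 - t < delta ->
    gamma t = (z q + RtoC (1 - t))%C
}.

Definition det2 (u v : C) : R := Re u * Im v - Im u * Re v.

(* The pairs (t_l, s_l) list every self-intersection of gamma exactly once.  This
   forces p <> q: when p = q, the two ends of gamma run along the same ray. *)
Record transverse_crossings (gamma : R -> C) m (t s : 'I_m -> R) : Prop := {
  crossing_transverse : forall l, 0 < t l < s l /\ s l < 1 /\
    gamma (t l) = gamma (s l) /\
    det2 (velocity gamma (t l)) (velocity gamma (s l)) <> 0;
  crossing_complete : forall u v, 0 < u < v -> v < 1 -> gamma u = gamma v ->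
    exists! l, u = t l /\ v = s l
}.

Definition crossing_sign (gamma : R -> C) (t s : R) : R :=
  if Rlt_dec 0 (det2 (velocity gamma t) (velocity gamma s)) then 1 else - 1.

Definition rotation_number (gamma : R -> C) : R :=
  / (2 * PI) * Im (RInt (V := C_R_CompleteNormedModule)
    (fun t => path_deriv 2 gamma t / path_deriv 1 gamma t)%C 0 1).

(** * The KZ equation and its holonomy *)

(* The coefficient of du in the form A at the point u. *)
Definition KZ_form n (z : 'I_n -> C) (u : C) : series n :=
  (/ two_pi_i *: \ssum_(i < n) (/ (u - z i) *: letter i))%S.

Definition KZ_solution n (z : 'I_n -> C) (U : C -> Prop) (Psi : C -> series n) : Prop :=
  forall u, U u -> in_Sigma z u /\
    forall w, is_derive (K := C_AbsRing) (V := C_NormedModule)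
      (fun v => Psi v w) u ((KZ_form z u * Psi u)%S w).

Definition disk (c : C) (r : R) (u : C) : Prop := Cmod (u - c)%C < r.

(* The principal branch of the logarithm, on the complex plane without the
   half-line of nonpositive reals: arg u = 2 atan (Im u / (|u| + Re u)). *)
Definition slit_plane (u : C) : Prop := 0 < Re u \/ Im u <> 0.
Definition Clog (u : C) : C := (ln (Cmod u), 2 * atan (Im u / (Cmod u + Re u))).

Definition analytic_on_disk n (c : C) (r : R) (f : C -> series n) : Prop :=
  exists a : nat -> series n, forall u, disk c r u -> forall w,
    is_pseries (K := C_AbsRing) (V := C_NormedModule)
      (fun k => a k w) (u - c)%C (f u w).

(* Psi is, near z_p, the solution Psi_p(u) = f(u) (u - z_p)^(x_p / 2 pi i). *)
Definition is_tangential_solution n (z : 'I_n -> C) (p : 'I_n) (r : R)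
    (Psi : C -> series n) : Prop :=
  KZ_solution z (fun u => disk (z p) r u /\ slit_plane (u - z p)%C) Psi /\
  exists f : C -> series n,
    [/\ analytic_on_disk (z p) r f, f (z p) = 1%S &
      forall u, disk (z p) r u -> slit_plane (u - z p)%C ->
        Psi u = (f u * sexp (Clog (u - z p) / two_pi_i *: letter p))%S].

(* The parameters of the portion gamma_[a,b]; the tangential end points, at the
   parameters 0 and 1, are not points of Sigma and are left out. *)
Definition portion (a b u : R) : Prop := a <= u <= b /\ 0 < u < 1.

(* Phi is the analytic continuation of a solution along gamma_[a,b]: Phi t is the
   value at gamma(t) of the branch obtained there. *)
Definition continued_solution n (z : 'I_n -> C) (gamma : R -> C) (a b : R)
    (Phi : R -> series n) : Prop :=
  forall t, portion a b t -> exists (r : R) (Psi : C -> series n),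
    [/\ 0 < r, KZ_solution z (disk (gamma t) r) Psi &
      exists2 delta, 0 < delta & forall u, portion a b u -> Rabs (u - t) < delta ->
        disk (gamma t) r (gamma u) /\ Phi u = Psi (gamma u)].

Variant end_point (n : nat) : Type := Tangential of 'I_n | Regular.
Arguments Regular {n}.

(* The continued solution Phi is the one normalized at the end point [e], which
   gamma_[a,b] reaches at the parameter c (equal to a or b). *)
Definition normalized_at n (z : 'I_n -> C) (gamma : R -> C) (a b : R)
    (Phi : R -> series n) (c : R) (e : end_point n) : Prop :=
  match e with
  | Tangential p => exists (r : R) (Psi : C -> series n),
      [/\ 0 < r, is_tangential_solution z p r Psi &
        exists2 delta, 0 < delta & forall u, portion a b u -> Rabs (u - c) < delta ->
          [/\ disk (z p) r (gamma u), slit_plane (gamma u - z p)%C &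
              Phi u = Psi (gamma u)]]
  | Regular => Phi c = 1%S
  end.

(* H is the (regularized) holonomy Psi_end^-1 Psi_start along gamma_[a,b]. *)
Definition is_holonomy n (z : 'I_n -> C) (gamma : R -> C)
    (a : R) (ea : end_point n) (b : R) (eb : end_point n) (H : series n) : Prop :=
  exists Phi_start Phi_end : R -> series n,
    [/\ continued_solution z gamma a b Phi_start,
        normalized_at z gamma a b Phi_start a ea,
        continued_solution z gamma a b Phi_end,
        normalized_at z gamma a b Phi_end b eb &
        exists t G, [/\ portion a b t, is_inverse G (Phi_end t) &
                        H = (G * Phi_start t)%S]].

(* Main.v *)
Require Import Defs.
From Stdlib Require Import Reals Lra FunctionalExtensionality.
Set Warnings "-notation-overridden,-ambiguous-paths,-redundant-canonical-projection".
From mathcomp Require Import all_boot.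
From Coquelicot Require Import Coquelicot.

Set Implicit Arguments.
Unset Strict Implicit.
Unset Printing Implicit Defensive.

Local Open Scope R_scope.

(** Let P(s) be the holonomy from the tangential start to gamma(s), R(t) the holonomy from
    gamma(t) to the tangential end, and F(t,s) = R(t) P(s). On the triangle s < t consider the
    kernel

      F(t,s) gamma'(s) ds / (gamma(s) - gamma(t)).

    The KZ equation and the identity of partial fractions
    1/((u - z)(v - z)) = (1/(u - v)) (1/(v - z) - 1/(u - z)) show that its derivative in t is the
    derivative in s of an expression in F(t,s) and
    W(t,s) = sum_i R(t) a_i(t) x_i foxR_i(P(s)). Here a_i(t) x_i is the connection along gamma, and
    in W the letter created at time t is merged with an equal first letter of P(s)
    (KZ_green_data, green_derive). Integration over the triangle therefore leaves boundary terms
    only (stokes), and each of them yields terms of the formula.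

    - The kernel is singular at the self-intersections. When t passes s_l, the integral jumps by
      2 pi i eps_l F(s_l,t_l), as one sees on the linear model (lkern_jump, kern_jump).
    - W(t,t) - W(t,a) is the derivative of R(t) KKS(P(t) P(a)^-1) P(a), because
      KKS(ab) = KKS(a) b + a KKS(b) + the terms merged across the product (KKS_mul,
      KKS_primitive_Cder). This gives KKS(H).
    - On the diagonal the kernel becomes F(t,t) gamma''/gamma' with F(t,t) = H, which gives
      rot(gamma) H (turning_limit, turn_integral).
    - The two sides t = 1 - tau and s = tau run along the ends of gamma. There the pole at
      gamma(tau), or gamma(1 - tau), is compared with the pole at z_p, or z_q. The latter produces
      the Fox derivative (start_pole_integral, end_pole_integral). In the difference of the two, F is a polynomial in the logarithm of the
      distance, and the substitution x = ln(v/tau) leads to the integrals of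
      x^k/k! dx/(exp x - 1), equal to zeta(k+1) for k > 0 (bose_integral, side_limit); they add up
      to r_zeta (start_side_limit, end_side_limit).

    All of this is done at a cut-off tau > 0, the diagonal being avoided by tau^3, one coefficient
    at a time (stokes_identity). As tau tends to 0 the solutions are the local factors
    tau^(x_p/2 pi i) and tau^(x_q/2 pi i) up to O(tau^(1 - al)). The logarithms of tau cancel
    between KKS(H) and the Fox derivatives, by conjugated_KKS, which uses p <> q, and between the
    two sides. *)

(** * Complex-valued functions of a real variable *)

(** Derivatives, continuity and integrals of complex functions are taken on real and
    imaginary parts, so that the real theory applies to each of them. *)
Definition Cder (f : R -> C) (t : R) (l : C) : Prop :=
  is_derive (fun u => Re (f u)) t (Re l) /\ is_derive (fun u => Im (f u)) t (Im l).
Definition Ccts (T : UniformSpace) (f : T -> C) (t : T) : Prop :=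
  continuous (fun u => Re (f u)) t /\ continuous (fun u => Im (f u)) t.
Definition CInt (f : R -> C) (a b : R) : C :=
  (RInt (fun u => Re (f u)) a b, RInt (fun u => Im (f u)) a b).

Ltac cring := rewrite /minus /plus /opp /scal /= /mult /= /Re /Im /=; ring.

Lemma C_ext (x y : C) : Re x = Re y -> Im x = Im y -> x = y.
Proof. by case: x => a b; case: y => c d /= -> ->. Qed.

Lemma Cder_eq f t l l' : Cder f t l -> l = l' -> Cder f t l'.
Proof. by move=> H <-. Qed.

Lemma Cder_cont f t l : Cder f t l -> Ccts f t.
Proof.
by move=> [H1 H2]; split; apply: ex_derive_continuous; eexists; eassumption.
Qed.

Lemma Cder_ext_loc f g t l :
  locally t (fun u => f u = g u) -> Cder f t l -> Cder g t l.
Proof.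
move=> E [H1 H2]; split.
  by apply: (is_derive_ext_loc _ _ _ _ _ H1); apply: filter_imp E => u ->.
by apply: (is_derive_ext_loc _ _ _ _ _ H2); apply: filter_imp E => u ->.
Qed.

Lemma Cder_ext f g t l : (forall u, f u = g u) -> Cder f t l -> Cder g t l.
Proof. by move=> E; apply: Cder_ext_loc; apply: filter_forall. Qed.

Lemma Cder_const c t : Cder (fun=> c) t 0.
Proof. by split; apply: is_derive_const. Qed.

Lemma Cder_id t : Cder (fun u => RtoC u) t 1.
Proof. by split; [apply: is_derive_id | apply: is_derive_const]. Qed.

Lemma Cder_plus f g t l m :
  Cder f t l -> Cder g t m -> Cder (fun u => f u + g u)%C t (l + m)%C.
Proof. by move=> [? ?] [? ?]; split; apply: is_derive_plus. Qed.

Lemma Cder_opp f t l : Cder f t l -> Cder (fun u => - f u)%C t (- l)%C.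
Proof. by move=> [? ?]; split; apply: is_derive_opp. Qed.

Lemma Cder_minus f g t l m :
  Cder f t l -> Cder g t m -> Cder (fun u => f u - g u)%C t (l - m)%C.
Proof. by move=> ? ?; apply: Cder_plus => //; apply: Cder_opp. Qed.

Lemma is_derive_multR (f g : R -> R) t l m :
  is_derive f t l -> is_derive g t m ->
  is_derive (fun u => f u * g u) t (l * g t + f t * m).
Proof. by move=> Hf Hg; apply: (is_derive_mult f g t l m Hf Hg Rmult_comm). Qed.

Lemma Cder_mult f g t l m :
  Cder f t l -> Cder g t m ->
  Cder (fun u => f u * g u)%C t (l * g t + f t * m)%C.
Proof.
move=> [f1 f2] [g1 g2]; split => /=.
  have := is_derive_minus _ _ _ _ _ (is_derive_multR f1 g1) (is_derive_multR f2 g2).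
  by move=> H; evar_last; [exact: H | cring].
have := is_derive_plus _ _ _ _ _ (is_derive_multR f1 g2) (is_derive_multR f2 g1).
by move=> H; evar_last; [exact: H | cring].
Qed.

Lemma Cder_scal c f t l : Cder f t l -> Cder (fun u => c * f u)%C t (c * l)%C.
Proof.
move=> H; apply: Cder_eq (Cder_mult (Cder_const c t) H) _.
by rewrite Cmult_0_l Cplus_0_l.
Qed.

Lemma Cnz (x : C) : x <> RtoC 0 -> 0 < Re x ^ 2 + Im x ^ 2.
Proof.
move=> x0; have H : Re x <> 0 \/ Im x <> 0.
  case: (Req_dec (Re x) 0) => [r0|]; last by left.
  by right => i0; apply: x0; apply: C_ext.
by case: H => H; have := pow2_gt_0 _ H; have := pow2_ge_0 (Re x); have := pow2_ge_0 (Im x); lra.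
Qed.

Lemma Cder_inv f t l :
  Cder f t l -> f t <> RtoC 0 -> Cder (fun u => / f u)%C t (- (l / (f t * f t)))%C.
Proof.
move=> [f1 f2] /Cnz nz.
have nz' : Re (f t) * (Re (f t) * 1) + Im (f t) * (Im (f t) * 1) <> 0.
  by move: nz => /=; lra.
pose N := fun u => Re (f u) ^ 2 + Im (f u) ^ 2.
have HN : is_derive N t (2 * (Re (f t) * Re l + Im (f t) * Im l)).
  have H := is_derive_plus _ _ _ _ _ (is_derive_multR f1 f1) (is_derive_multR f2 f2).
  apply: (is_derive_ext _ N) (_ : is_derive _ _ _) => [u|]; last first.
    by evar_last; [exact: H | cring].
  by rewrite /N; cring.
have nzN : N t <> 0 by move: nz; rewrite /N; lra.
have HI := is_derive_inv _ _ _ HN nzN.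
move: f1 f2 HI nzN; rewrite /N /Re /Im /= => f1 f2 HI nzN.
have e1 : (f t).1 * ((f t).1 * 1) + (f t).2 * ((f t).2 * 1) =
          (f t).1 * (f t).1 + (f t).2 * (f t).2 by ring.
rewrite e1 in HI nzN.
have nz2 : ((f t).1 * (f t).1 - (f t).2 * (f t).2) *
           ((f t).1 * (f t).1 - (f t).2 * (f t).2) +
           ((f t).1 * (f t).2 + (f t).2 * (f t).1) *
           ((f t).1 * (f t).2 + (f t).2 * (f t).1) <> 0.
  have -> : ((f t).1 * (f t).1 - (f t).2 * (f t).2) *
           ((f t).1 * (f t).1 - (f t).2 * (f t).2) +
           ((f t).1 * (f t).2 + (f t).2 * (f t).1) *
           ((f t).1 * (f t).2 + (f t).2 * (f t).1) =
           ((f t).1 * (f t).1 + (f t).2 * (f t).2) *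
           ((f t).1 * (f t).1 + (f t).2 * (f t).2) by ring.
  exact: Rmult_integral_contrapositive_currified.
split; rewrite /Re /Im /=.
  apply: (is_derive_ext (fun u => (f u).1 * / (((f u).1 * ((f u).1 * 1) + (f u).2 * ((f u).2 * 1))))) => [u|].
    by rewrite /Rdiv.
  evar_last; first exact: is_derive_multR f1 HI.
  by rewrite /= e1; field; do !split; rewrite ?Rmult_1_r; assumption.
apply: (is_derive_ext (fun u => (- (f u).2) * / (((f u).1 * ((f u).1 * 1) + (f u).2 * ((f u).2 * 1))))) => [u|].
  by rewrite /Rdiv.
evar_last; first exact: is_derive_multR (is_derive_opp _ _ _ f2) HI.
by rewrite /opp /= e1; field; do !split; rewrite ?Rmult_1_r; assumption.
Qed.

Section Ccts.
Variable T : UniformSpace.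
Implicit Types (f g : T -> C) (t : T).

Lemma Ccts_const c t : Ccts (fun=> c : C) t.
Proof. by split; apply: continuous_const. Qed.

Lemma Ccts_plus f g t : Ccts f t -> Ccts g t -> Ccts (fun u => f u + g u)%C t.
Proof. by move=> [? ?] [? ?]; split; apply: continuous_plus. Qed.

Lemma Ccts_opp f t : Ccts f t -> Ccts (fun u => - f u)%C t.
Proof. by move=> [? ?]; split; apply: continuous_opp. Qed.

Lemma Ccts_minus f g t : Ccts f t -> Ccts g t -> Ccts (fun u => f u - g u)%C t.
Proof. by move=> ? ?; apply: Ccts_plus => //; apply: Ccts_opp. Qed.

Lemma Ccts_mult f g t : Ccts f t -> Ccts g t -> Ccts (fun u => f u * g u)%C t.
Proof.
move=> [? ?] [? ?]; split; rewrite /Re /Im /=.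
  by apply: (@continuous_minus T R_AbsRing R_NormedModule (fun u => (f u).1 * (g u).1)); apply: (@continuous_mult T R_AbsRing).
by apply: (@continuous_plus T R_AbsRing R_NormedModule (fun u => (f u).1 * (g u).2)); apply: (@continuous_mult T R_AbsRing).
Qed.

Lemma Ccts_RtoC (h : T -> R) t : continuous h t -> Ccts (fun u => RtoC (h u)) t.
Proof. by move=> H; split => //; apply: continuous_const. Qed.

Lemma Ccts_inv f t : Ccts f t -> f t <> RtoC 0 -> Ccts (fun u => / f u)%C t.
Proof.
move=> [f1 f2] /Cnz nz.
have H : continuous (fun u => / (Re (f u) * Re (f u) + Im (f u) * Im (f u))) t.
  apply: (continuous_comp _ Rinv).
    by apply: (@continuous_plus T R_AbsRing R_NormedModule (fun u => Re (f u) * Re (f u))); apply: (@continuous_mult T R_AbsRing).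
  by apply: continuous_Rinv; lra.
have E u : / (Re (f u) * Re (f u) + Im (f u) * Im (f u)) =
  / ((f u).1 * ((f u).1 * 1) + (f u).2 * ((f u).2 * 1)).
  by rewrite /Re /Im !Rmult_1_r.
split; rewrite /Re /Im /=.
  by apply: (@continuous_mult T R_AbsRing) => //; apply: continuous_ext H.
apply: (@continuous_mult T R_AbsRing (fun u => - (f u).2)); first exact: continuous_opp.
by apply: continuous_ext H.
Qed.

Lemma Ccts_ext_loc f g t :
  locally t (fun u => f u = g u) -> Ccts f t -> Ccts g t.
Proof.
move=> E [H1 H2]; split.
  by apply: (continuous_ext_loc _ _ _ _ H1); apply: filter_imp E => u ->.
by apply: (continuous_ext_loc _ _ _ _ H2); apply: filter_imp E => u ->.
Qed.

Lemma Ccts_ext f g t : (forall u, f u = g u) -> Ccts f t -> Ccts g t.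
Proof. by move=> E; apply: Ccts_ext_loc; apply: filter_forall. Qed.

Lemma Ccts_sum (I : finType) (F : I -> T -> C) t :
  (forall i, Ccts (F i) t) -> Ccts (fun u => \csum_(i : I) F i u) t.
Proof.
move=> H; elim: (index_enum I) => [|i r IH].
  by apply: Ccts_ext (Ccts_const 0 t) => u; rewrite big_nil.
by apply: Ccts_ext (Ccts_plus (H i) IH) => u; rewrite big_cons.
Qed.
End Ccts.

Lemma Ccts_comp (T U : UniformSpace) (g : T -> U) (f : U -> C) t :
  continuous g t -> Ccts f (g t) -> Ccts (fun u => f (g u)) t.
Proof. by move=> H [H1 H2]; split; [exact: (continuous_comp g (fun x => Re (f x)) t H H1) | exact: (continuous_comp g (fun x => Im (f x)) t H H2)]. Qed.

Lemma Cder_sum (I : finType) (F : I -> R -> C) (l : I -> C) t :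
  (forall i, Cder (F i) t (l i)) ->
  Cder (fun u => \csum_(i : I) F i u) t (\csum_(i : I) l i).
Proof.
move=> H; elim: (index_enum I) => [|i r IH].
  by rewrite big_nil; apply: Cder_ext (Cder_const 0 t) => u; rewrite big_nil.
by rewrite big_cons; apply: Cder_ext (Cder_plus (H i) IH) => u; rewrite big_cons.
Qed.

Lemma Cmod_sq (z : C) : Cmod z * Cmod z = Re z * Re z + Im z * Im z.
Proof.
rewrite /Cmod sqrt_sqrt; last by have := pow2_ge_0 z.1; have := pow2_ge_0 z.2; lra.
by rewrite /Re /Im /=; ring.
Qed.

Lemma Re_le_Cmod z : Rabs (Re z) <= Cmod z.
Proof.
have := Cmod_sq z; have := Cmod_ge_0 z => m0 E.
by apply: Rabs_le; split; nra.
Qed.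

Lemma Im_le_Cmod z : Rabs (Im z) <= Cmod z.
Proof.
have := Cmod_sq z; have := Cmod_ge_0 z => m0 E.
by apply: Rabs_le; split; nra.
Qed.

Lemma Cmod_le_parts z : Cmod z <= Rabs (Re z) + Rabs (Im z).
Proof.
have := Cmod_sq z; have := Cmod_ge_0 z => m0 E.
have := Rabs_pos (Re z); have := Rabs_pos (Im z).
have := Rsqr_abs (Re z); have := Rsqr_abs (Im z); rewrite /Rsqr => e1 e2 p1 p2.
by nra.
Qed.

Lemma CcontP (T : UniformSpace) (f : T -> C) t :
  Ccts f t <-> forall e, 0 < e -> locally t (fun u => Cmod (f u - f t)%C < e).
Proof.
split=> [[H1 H2] e e0|H].
  have e2 : 0 < e / 2 by lra.
  have FF := locally_filter t.
  move/filterlim_locally: H1 => /(_ (mkposreal _ e2)) L1.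
  move/filterlim_locally: H2 => /(_ (mkposreal _ e2)) L2.
  apply: (filter_imp _ _ _ (filter_and _ _ L1 L2)) => u [].
  rewrite /ball /= /AbsRing_ball /abs /minus /plus /opp /= => A B.
  apply: Rle_lt_trans (Cmod_le_parts _) _.
  by rewrite /Re /Im /= in A B *; lra.
have FF := locally_filter t.
split; apply/filterlim_locally => e; move: (H e (cond_pos e)); apply: filter_imp => u.
  rewrite /ball /= /AbsRing_ball /abs /minus /plus /opp /=.
  by apply: Rle_lt_trans; have := Re_le_Cmod (f u - f t)%C.
rewrite /ball /= /AbsRing_ball /abs /minus /plus /opp /=.
by apply: Rle_lt_trans; have := Im_le_Cmod (f u - f t)%C.
Qed.

Definition Con (f : R -> C) a b := forall x, a <= x <= b -> Ccts f x.

Lemma Con_Re f a b : a <= b -> Con f a b -> ex_RInt (fun u => Re (f u)) a b.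
Proof.
move=> ab H; apply: (@ex_RInt_continuous R_CompleteNormedModule) => x.
by rewrite Rmin_left // Rmax_right // => /H [].
Qed.
Lemma Con_Im f a b : a <= b -> Con f a b -> ex_RInt (fun u => Im (f u)) a b.
Proof.
move=> ab H; apply: (@ex_RInt_continuous R_CompleteNormedModule) => x.
by rewrite Rmin_left // Rmax_right // => /H [].
Qed.

Lemma CInt_ext f g a b : a <= b ->
  (forall x, a < x < b -> f x = g x) -> CInt f a b = CInt g a b.
Proof.
by move=> ab H; congr pair; apply: RInt_ext => x;
  rewrite Rmin_left // Rmax_right // => /H ->.
Qed.

Lemma CInt_plus f g a b : a <= b -> Con f a b -> Con g a b ->
  CInt (fun u => f u + g u)%C a b = (CInt f a b + CInt g a b)%C.
Proof.
move=> ab Hf Hg; congr pair; apply: (@RInt_plus R_CompleteNormedModule);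
  by [apply: Con_Re | apply: Con_Im].
Qed.

Lemma CInt_scal c f a b : a <= b -> Con f a b ->
  CInt (fun u => c * f u)%C a b = (c * CInt f a b)%C.
Proof.
move=> ab H; have H1 := Con_Re ab H; have H2 := Con_Im ab H.
congr pair; rewrite /Re /Im /=.
  etransitivity; first apply: (@RInt_minus R_CompleteNormedModule
     (fun u => scal c.1 (f u).1) (fun u => scal c.2 (f u).2));
    try exact: (@ex_RInt_scal R_NormedModule).
  by rewrite !(@RInt_scal R_CompleteNormedModule).
etransitivity; first apply: (@RInt_plus R_CompleteNormedModule
     (fun u => scal c.1 (f u).2) (fun u => scal c.2 (f u).1));
    try exact: (@ex_RInt_scal R_NormedModule).
by rewrite !(@RInt_scal R_CompleteNormedModule).
Qed.

Lemma CInt_opp f a b : a <= b -> Con f a b ->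
  CInt (fun u => - f u)%C a b = (- CInt f a b)%C.
Proof.
move=> ab H; rewrite (_ : (- CInt f a b)%C = (- RtoC 1 * CInt f a b)%C); last by ring.
by rewrite -CInt_scal //; apply: CInt_ext => // x _; ring.
Qed.

Lemma CInt_minus f g a b : a <= b -> Con f a b -> Con g a b ->
  CInt (fun u => f u - g u)%C a b = (CInt f a b - CInt g a b)%C.
Proof.
move=> ab Hf Hg; rewrite CInt_plus ?CInt_opp // => x /Hg; exact: Ccts_opp.
Qed.

Lemma CInt_point f a : CInt f a a = RtoC 0.
Proof. by rewrite /CInt !RInt_point. Qed.

Lemma Con_const c a b : Con (fun=> c) a b.
Proof. by move=> x _; apply: Ccts_const. Qed.

Lemma CInt_sum (I : finType) (F : I -> R -> C) a b : a <= b ->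
  (forall i, Con (F i) a b) ->
  CInt (fun u => \csum_(i : I) F i u) a b = \csum_(i : I) CInt (F i) a b.
Proof.
move=> ab H; elim: (index_enum I) => [|i r IH].
  rewrite big_nil (CInt_ext (g := fun=> 0%C)) // => [|x _]; last by rewrite big_nil.
  by congr pair; rewrite /= RInt_const /scal /= /mult /=; ring.
rewrite big_cons -IH -CInt_plus //.
  by apply: CInt_ext => // x _; rewrite big_cons.
move=> x Hx; elim: r {IH} => [|j r IH].
  by apply: Ccts_ext (Ccts_const 0 x) => u; rewrite big_nil.
by apply: Ccts_ext (Ccts_plus (H j x Hx) IH) => u; rewrite big_cons.
Qed.

Lemma CInt_Chasles f a b c : a <= b <= c -> Con f a c ->
  CInt f a c = (CInt f a b + CInt f b c)%C.
Proof.
move=> [ab bc] H.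
have H1 : Con f a b by move=> x Hx; apply: H; lra.
have H2 : Con f b c by move=> x Hx; apply: H; lra.
by congr pair; symmetry; apply: (@RInt_Chasles R_CompleteNormedModule);
  by [apply: Con_Re | apply: Con_Im].
Qed.

(** The factor 2 comes from bounding the real and the imaginary part separately. *)
Lemma CInt_bound f a b M : a <= b -> Con f a b ->
  (forall x, a <= x <= b -> Cmod (f x) <= M) -> Cmod (CInt f a b) <= 2 * M * (b - a).
Proof.
move=> ab Hf H.
have H1 := abs_RInt_le_const _ _ _ M ab (Con_Re ab Hf).
have H2 := abs_RInt_le_const _ _ _ M ab (Con_Im ab Hf).
apply: Rle_trans (Cmod_le_parts _) _; rewrite {1}/CInt /=.
have := H1 (fun t Ht => Rle_trans _ _ _ (Re_le_Cmod _) (H t Ht)).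
have := H2 (fun t Ht => Rle_trans _ _ _ (Im_le_Cmod _) (H t Ht)).
by rewrite /Re /Im /=; lra.
Qed.

Lemma CInt_le f g a b : a <= b -> Con f a b -> (forall x, a <= x <= b -> continuous g x) ->
  (forall x, a <= x <= b -> Cmod (f x) <= g x) -> Cmod (CInt f a b) <= 2 * RInt g a b.
Proof.
move=> ab Hf Hg H.
have Ig : ex_RInt g a b.
  apply: (@ex_RInt_continuous R_CompleteNormedModule) => x.
  by rewrite Rmin_left // Rmax_right //; apply: Hg.
have B h : ex_RInt h a b -> (forall x, a <= x <= b -> Rabs (h x) <= g x) ->
    Rabs (RInt h a b) <= RInt g a b.
  move=> Ih Hh.
  have Io : ex_RInt (fun x => - g x) a b by apply: (@ex_RInt_opp R_NormedModule).
  apply: Rabs_le; split.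
    rewrite -[X in X <= _](_ : RInt (fun x => - g x) a b = _); last first.
      exact: (@RInt_opp R_CompleteNormedModule).
    by apply: RInt_le => // x Hx; have := Hh x; have := Rle_abs (- h x);
       rewrite Rabs_Ropp; lra.
  by apply: RInt_le => // x Hx; have := Hh x; have := Rle_abs (h x); lra.
have H1 := B _ (Con_Re ab Hf) (fun t Ht => Rle_trans _ _ _ (Re_le_Cmod _) (H t Ht)).
have H2 := B _ (Con_Im ab Hf) (fun t Ht => Rle_trans _ _ _ (Im_le_Cmod _) (H t Ht)).
apply: Rle_trans (Cmod_le_parts _) _; rewrite {1}/CInt /= in H1 H2 *.
by rewrite /Re /Im /= in H1 H2 *; lra.
Qed.

Lemma CInt_FTC f df a b : a <= b -> (forall x, a <= x <= b -> Cder f x (df x)) ->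
  Con df a b -> CInt df a b = (f b - f a)%C.
Proof.
move=> ab H Hc; congr pair; apply: is_RInt_unique.
  apply: (@is_RInt_derive R_CompleteNormedModule (fun u => Re (f u)) (fun u => Re (df u)));
    move=> x; rewrite Rmin_left // Rmax_right // => Hx;
    by case: (H x Hx) (Hc x Hx) => ? ? [].
apply: (@is_RInt_derive R_CompleteNormedModule (fun u => Im (f u)) (fun u => Im (df u)));
  move=> x; rewrite Rmin_left // Rmax_right // => Hx; by case: (H x Hx) (Hc x Hx) => ? ? [].
Qed.

Lemma CInt_rev f a b : a <= b -> Con f (1 - b) (1 - a) ->
  CInt (fun v => f (1 - v)) a b = CInt f (1 - b) (1 - a).
Proof.
move=> ab Hf.
have ab' : 1 - b <= 1 - a by lra.
have H (h : R -> R) : ex_RInt h (1 - b) (1 - a) ->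
    RInt (fun v => h (1 - v)) a b = RInt h (1 - b) (1 - a).
  move=> Ih.
  have := @RInt_comp_lin R_CompleteNormedModule h (-1) 1 a b.
  rewrite (_ : -1 * a + 1 = 1 - a); last by ring.
  rewrite (_ : -1 * b + 1 = 1 - b); last by ring.
  move=> /(_ (ex_RInt_swap _ _ _ Ih)) E.
  have Ic : ex_RInt (fun y => scal (-1) (h (-1 * y + 1))) a b.
    apply: (@ex_RInt_comp_lin R_NormedModule h (-1) 1).
    rewrite (_ : -1 * a + 1 = 1 - a); last by ring.
    rewrite (_ : -1 * b + 1 = 1 - b); last by ring.
    exact: ex_RInt_swap.
  rewrite -(opp_RInt_swap h (1 - a)); last exact: ex_RInt_swap.
  rewrite -E -(@RInt_opp R_CompleteNormedModule) //.
  apply: RInt_ext => x _; rewrite /opp /scal /= /mult /=.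
  by rewrite (_ : -1 * x + 1 = 1 - x); [ring|ring].
by congr pair; [apply: (H (fun u => Re (f u))) | apply: (H (fun u => Im (f u)))];
   [apply: Con_Re | apply: Con_Im].
Qed.

Lemma Cder0_const f a b : a <= b -> (forall x, a <= x <= b -> Cder f x 0) -> f b = f a.
Proof.
move=> ab H; have := CInt_FTC ab H (@Con_const 0 a b).
have -> : CInt (fun=> RtoC 0) a b = RtoC 0.
  by congr pair; rewrite /= RInt_const /scal /= /mult /=; ring.
by move=> /esym E; rewrite -[f a]Cplus_0_l -E; ring.
Qed.

Lemma Cder_CInt f a b c : a < b < c -> Con f a c -> Cder (fun u => CInt f a u) b (f b).
Proof.
move=> [ab bc] H; have Hb : a <= b <= c by lra.
have nb : locally b (fun u : R => a <= u <= c).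
  have d0 : 0 < Rmin (b - a) (c - b) by apply: Rmin_pos; lra.
  exists (mkposreal _ d0) => u.
  rewrite /ball /= /AbsRing_ball /abs /minus /plus /opp /= => /Rabs_lt_between'.
  by have := Rmin_l (b - a) (c - b); have := Rmin_r (b - a) (c - b); lra.
split; rewrite /=.
  apply: (@is_derive_RInt R_NormedModule (fun x => Re (f x)) _ a); last by case: (H b Hb).
  apply: filter_imp nb => u Hu; apply: (@RInt_correct R_CompleteNormedModule); apply: Con_Re; first by lra.
  by move=> x Hx; apply: H; lra.
apply: (@is_derive_RInt R_NormedModule (fun x => Im (f x)) _ a); last by case: (H b Hb).
apply: filter_imp nb => u Hu; apply: (@RInt_correct R_CompleteNormedModule); apply: Con_Im; first by lra.
by move=> x Hx; apply: H; lra.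
Qed.

(** * Exceptional points: Cousin's lemma, bounded convergence, integrals with a parameter *)

(** Compactness of [a,b] in the form used below: a property of intervals that is additive
    and holds for all small intervals around each point holds for [a,b]. *)
Lemma cousin (P : R -> R -> Prop) (a b : R) : a <= b ->
  (forall c d e, a <= c <= d -> d <= e <= b -> P c d -> P d e -> P c e) ->
  (forall x, a <= x <= b -> exists2 delta, 0 < delta & forall c d,
     a <= c -> x - delta < c -> c <= x <= d -> d < x + delta -> d <= b -> P c d) ->
  P a b.
Proof.
move=> ab Padd Ploc.
pose S d := a <= d <= b /\ P a d.
have Sa : S a.
  split; first by lra.
  by have [|dl d0] := Ploc a; [lra | apply; lra].
have [|| sig [ub lub]] := completeness S.
- by exists b => d [[]].
- by exists a.
have as_ : a <= sig by apply: ub.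
have sb : sig <= b by apply: lub => d [[]].
have [|dl d0 H] := Ploc sig; first by lra.
have [d [[[ad db] Pd] dsig]] : exists d, S d /\ sig - dl < d.
  case: (Classical_Prop.classic (exists d, S d /\ sig - dl < d)) => // N.
  suff : sig <= sig - dl by lra.
  by apply: lub => d Sd; apply: Rnot_lt_le => ?; apply: N; exists d.
have dsig' : d <= sig by apply: ub.
have Pe : forall e, sig <= e -> e < sig + dl -> e <= b -> P a e.
  move=> e e1 e2 e3; apply: (Padd a d e) => //; [lra | lra |].
  by apply: H; lra.
case: (Rle_lt_or_eq_dec _ _ sb) => [lt_sb|<-]; last by apply: Pe; lra.
pose e := Rmin b (sig + dl / 2).
have : e <= sig.
  apply: ub; split; first by rewrite /e /Rmin; case: Rle_dec; lra.
  by apply: Pe; rewrite /e /Rmin; case: Rle_dec; lra.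
by rewrite /e /Rmin; case: Rle_dec; lra.
Qed.

(** The mean value theorem with finitely many exceptional points: at such a point only the
    symmetric difference phi(x + h) - phi(x - h) has to tend to 0. This is what remains of
    continuity when phi is an integral that jumps at x and the jump has been subtracted. *)
Lemma eq_off_finite (L : list R) (phi : R -> C) (u v : R) : u <= v ->
  (forall x, u <= x <= v -> ~ List.In x L -> Cder phi x 0) ->
  (forall x, u < x < v -> List.In x L -> forall e, 0 < e ->
     exists2 r, 0 < r & forall h, 0 < h < r -> Cmod (phi (Rplus x h) - phi (Rminus x h))%C < e) ->
  ~ List.In u L -> ~ List.In v L -> phi v = phi u.
Proof.
elim: L u v => [|x L IH] u v uv Hd Hj uL vL.
  by apply: Cder0_const => // y Hy; apply: Hd.
have [uL' vL'] : ~ List.In u L /\ ~ List.In v L by split => ?; [apply: uL | apply: vL]; right.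
have [ux vx] : u <> x /\ v <> x by split => E; [apply: uL | apply: vL]; left.
case: (Classical_Prop.classic (u < x < v)) => [[lux lxv]|N]; last first.
  apply: IH => // [y Hy yL|y Hy yL].
    by apply: Hd => // -[E|//]; lra.
  by apply: Hj => //; right.
have [r0 r0_gt Hr0] : exists2 r, 0 < r & forall h, 0 < h < r ->
    ~ List.In (x + h) L /\ ~ List.In (x - h) L.
  elim: L {IH Hd Hj uL vL uL' vL'} => [|y L [r r0 Hr]]; first by exists 1; [lra | move=> h _; split].
  case: (Req_dec x y) => [E0|xy]; first subst y.
    exists r => // h Hh; have [H1 H2] := Hr h Hh.
    by split; case=> [E|]; [lra | exact: H1 | lra | exact: H2].
  exists (Rmin r (Rabs (x - y))); first by apply: Rmin_pos => //; apply: Rabs_pos_lt; lra.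
  move=> h [h0 /Rlt_le_trans Hh].
  have h1 := Hh _ (Rmin_l _ _); have h2 := Hh _ (Rmin_r _ _).
  have [H1 H2] := Hr h (conj h0 h1).
  by split; case=> [E|]; [move: h2; rewrite /Rabs; case: Rcase_abs; lra | exact: H1 |
    move: h2; rewrite /Rabs; case: Rcase_abs; lra | exact: H2].
suff E e : 0 < e -> Cmod (phi v - phi u)%C < e.
  have : Cmod (phi v - phi u)%C = 0.
    apply: Rle_antisym; last exact: Cmod_ge_0.
    by apply: Rnot_lt_le => /E; lra.
  by move/Cmod_eq_0 => E0; rewrite -[phi u]Cplus_0_l -E0; ring.
move=> e0.
have [r r_gt Hr] := Hj x (conj lux lxv) (or_introl (erefl x)) e e0.
(* cross x symmetrically, at a distance that meets no other exceptional point *)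
pose h := Rmin (Rmin r r0) (Rmin (x - u) (v - x)) / 2.
have Hm : 0 < Rmin (Rmin r r0) (Rmin (x - u) (v - x)) by do !apply: Rmin_pos => //; lra.
have m1 := Rmin_l (Rmin r r0) (Rmin (x - u) (v - x)).
have m2 := Rmin_r (Rmin r r0) (Rmin (x - u) (v - x)).
have m3 := Rmin_l r r0; have m4 := Rmin_r r r0.
have m5 := Rmin_l (x - u) (v - x); have m6 := Rmin_r (x - u) (v - x).
have h0 : 0 < h by rewrite /h; lra.
have [hr hr0] : h < r /\ h < r0 by rewrite /h; lra.
have [hu hv] : h < x - u /\ h < v - x by rewrite /h; lra.
have [xp xm] := Hr0 h (conj h0 hr0).
have <- : phi (x - h) = phi u.
  apply: IH => // [|y Hy yL|y Hy yL]; first by lra.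
    by apply: Hd => [|[E|//]]; lra.
  by apply: Hj; [lra | right].
have -> : phi v = phi (x + h).
  apply: IH => // [|y Hy yL|y Hy yL]; first by lra.
    by apply: Hd => [|[E|//]]; lra.
  by apply: Hj; [lra | right].
exact: Hr.
Qed.

(** The square root extended to an odd function: increasing, with infinite slope at 0. *)
Definition ssqrt (u : R) : R := sqrt u - sqrt (- u).

Lemma ssqrt_incr u v : u <= v -> ssqrt u <= ssqrt v.
Proof.
move=> uv; rewrite /ssqrt.
have H1 := sqrt_le_1_alt u v uv.
by have := sqrt_le_1_alt (- v) (- u); lra.
Qed.

(** Around 0 the increment of the signed square root dominates any multiple of the length. *)
Lemma ssqrt_gap M e : 0 <= M -> 0 < e -> exists2 rho, 0 < rho & forall c d,
  - rho < c -> c <= 0 <= d -> d < rho -> M * (d - c) <= e * (ssqrt d - ssqrt c).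
Proof.
move=> M0 e0; pose k := e / (M + 1).
have k0 : 0 < k by apply: Rdiv_lt_0_compat; lra.
have Mk : M * k <= e.
  rewrite /k; have -> : M * (e / (M + 1)) = e - e / (M + 1) by field; lra.
  by move: k0; rewrite /k; lra.
exists (k * k); first by nra.
move=> c d kc [c0 d0] dk; rewrite /ssqrt.
rewrite (sqrt_neg_0 (- d)) ?(sqrt_neg_0 c); try lra.
have h1 := sqrt_sqrt d d0.
have c0' : 0 <= - c by lra.
have h2 := sqrt_sqrt _ c0'.
have p1 := sqrt_pos d; have p2 := sqrt_pos (- c).
have q1 : sqrt d <= k by nra.
have q2 : sqrt (- c) <= k by nra.
have r1 : M * d <= e * sqrt d.
  have : M * sqrt d <= M * k by apply: Rmult_le_compat_l.
  by nra.
have r2 : M * - c <= e * sqrt (- c).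
  have : M * sqrt (- c) <= M * k by apply: Rmult_le_compat_l.
  by nra.
by lra.
Qed.

(** An increasing function with infinite slope at each point of L and slope at least 1
    elsewhere. Its increments serve as a gauge: they absorb bounded integrands near the
    points of L and small integrands away from them. *)
Fixpoint spread (L : list R) (s : R) : R :=
  if L is x :: L' then ssqrt (s - x) + spread L' s else s.

Lemma spread_incr L c d : c <= d -> d - c <= spread L d - spread L c.
Proof.
move=> cd; elim: L => [|x L IH] /=; first by lra.
by have := @ssqrt_incr (c - x) (d - x); lra.
Qed.

Lemma spread_in L x c d : List.In x L -> c <= d ->
  ssqrt (d - x) - ssqrt (c - x) <= spread L d - spread L c.
Proof.
move=> xL cd; elim: L xL => //= y L IH [->|/IH].
  by have := @spread_incr L _ _ cd; lra.
by have := @ssqrt_incr (c - y) (d - y); lra.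
Qed.

(** Convergence to 0 of integrals of continuous functions that are locally bounded and tend
    to 0 locally uniformly off the finite set L. Each short interval contributes at most a
    small multiple of the increment of the gauge, and these increments add up. *)
Lemma bounded_convergence (L : list R) (f : R -> R -> C) a b r0 : a <= b -> 0 < r0 ->
  (forall h, 0 < h < r0 -> Con (f h) a b) ->
  (forall x, a <= x <= b -> exists M, exists2 rho, 0 < rho & forall h y,
     0 < h < rho -> Rabs (y - x) < rho -> Cmod (f h y) <= M) ->
  (forall x, a <= x <= b -> ~ List.In x L -> forall e, 0 < e ->
     exists2 rho, 0 < rho & forall h y,
     0 < h < rho -> Rabs (y - x) < rho -> Cmod (f h y) < e) ->
  forall e, 0 < e -> exists2 rho, 0 < rho & forall h, 0 < h < rho ->
    Cmod (CInt (f h) a b) < e.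
Proof.
move=> ab r0_gt Hc Hb Hl e e0.
pose T := spread L b - spread L a.
have T0 : 0 <= T by have := @spread_incr L _ _ ab; rewrite /T; lra.
(* e' times the total increment of the gauge is e - e' < e *)
pose e' := e / (T + 1).
have e'0 : 0 < e' by apply: Rdiv_lt_0_compat; lra.
suff [rho rho0 H] : exists2 rho, 0 < rho & forall h, 0 < h < rho ->
    Cmod (CInt (f h) a b) <= e' * (spread L b - spread L a).
  exists rho => // h /H; rewrite -/T.
  have -> : e' * T = e - e' by rewrite /e'; field; lra.
  by lra.
pose P c d := exists2 rho, 0 < rho & forall h, 0 < h < rho ->
    Cmod (CInt (f h) c d) <= e' * (spread L d - spread L c).
apply: (@cousin P) => // [c d k [ac cd] [dk kb] [r1 r10 H1] [r2 r20 H2]|x Hx].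
  exists (Rmin r0 (Rmin r1 r2)); first by do !apply: Rmin_pos.
  move=> h [h0 hh].
  have m1 := Rmin_l r0 (Rmin r1 r2); have m2 := Rmin_r r0 (Rmin r1 r2).
  have m3 := Rmin_l r1 r2; have m4 := Rmin_r r1 r2.
  rewrite (@CInt_Chasles _ c d k) //; last first.
    by move=> y Hy; apply: (Hc h); lra.
  apply: Rle_trans (Cmod_triangle _ _) _.
  by have := H1 h; have := H2 h; lra.
case: (Classical_Prop.classic (List.In x L)) => xL; last first.
  have [|rho rho0 Hr] := Hl x Hx xL (e' / 2); first by lra.
  exists rho => // c d ac xc [cx xd] dx db; exists (Rmin r0 rho); first exact: Rmin_pos.
  move=> h [h0 hh]; have m1 := Rmin_l r0 rho; have m2 := Rmin_r r0 rho.
  have B : Cmod (CInt (f h) c d) <= 2 * (e' / 2) * (d - c).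
    apply: CInt_bound; first by lra.
      by move=> y Hy; apply: (Hc h); lra.
    by move=> y Hy; apply: Rlt_le; apply: Hr; [lra | apply: Rabs_def1; lra].
  have cd : c <= d by lra.
  by have := @spread_incr L _ _ cd; nra.
have [M [rho rho0 Hr]] := Hb x Hx.
have M0 : 0 <= M.
  apply: Rle_trans (Cmod_ge_0 _) (Hr (rho / 2) x _ _); first by lra.
  by rewrite Rminus_diag Rabs_R0.
have [|rho' rho'0 Hr'] := @ssqrt_gap (2 * M) e' _ e'0; first by lra.
exists (Rmin rho rho'); first exact: Rmin_pos.
have n1 := Rmin_l rho rho'; have n2 := Rmin_r rho rho'.
move=> c d ac xc [cx xd] dx db; exists (Rmin r0 rho); first exact: Rmin_pos.
move=> h [h0 hh]; have m1 := Rmin_l r0 rho; have m2 := Rmin_r r0 rho.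
have B : Cmod (CInt (f h) c d) <= 2 * M * (d - c).
  apply: CInt_bound; first by lra.
    by move=> y Hy; apply: (Hc h); lra.
  by move=> y Hy; apply: Hr; [lra | apply: Rabs_def1; lra].
have cd : c <= d by lra.
have := @spread_in L x c d xL cd.
by have := Hr' (c - x) (d - x); nra.
Qed.

(** Leibniz's rule with a variable upper bound. *)
Lemma is_derive_RInt_upper (f ft : R -> R -> R) a (b : R -> R) x db rho :
  0 < rho -> a <= b x -> is_derive b x db ->
  (forall t s, Rabs (t - x) < rho -> a - rho < s < b x + rho ->
     [/\ is_derive (f^~ s) t (ft t s), continuity_2d_pt ft t s & continuity_2d_pt f t s]) ->
  is_derive (fun t => RInt (f t) a (b t)) x (RInt (ft x) a (b x) + f x (b x) * db).
Proof.
move=> r0 ab Hb H.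
have r2 : 0 < rho / 2 by lra.
have Hc t s : Rabs (t - x) < rho -> a - rho < s < b x + rho -> continuous (f t) s.
  move=> Ht Hs; have [_ _ /continuity_2d_pt_filterlim K] := H t s Ht Hs.
  apply/filterlim_locally => e.
  move/filterlim_locally: K => /(_ e) [d Hd]; exists d => y Hy.
  by apply: (Hd (t, y)); split => //=; apply: ball_center.
have nb : locally x (fun t => Rabs (t - x) < rho) by exists (mkposreal _ r0).
have Lx : Rabs (x - x) < rho by rewrite Rminus_diag Rabs_R0.
have D2 t s : Rabs (t - x) < rho -> a - rho < s < b x + rho ->
    continuity_2d_pt (fun u v : R => Derive (f^~ v) u) t s.
  move=> Ht Hs; have [_ K _] := H t s Ht Hs.
  apply: continuity_2d_pt_ext_loc K.
  pose d := Rmin (rho - Rabs (t - x)) (Rmin (s - (a - rho)) (b x + rho - s)).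
  have d0 : 0 < d by rewrite /d; do !apply: Rmin_pos; lra.
  exists (mkposreal _ d0) => u v /= Hu Hv.
  have m1 := Rmin_l (rho - Rabs (t - x)) (Rmin (s - (a - rho)) (b x + rho - s)).
  have m2 := Rmin_r (rho - Rabs (t - x)) (Rmin (s - (a - rho)) (b x + rho - s)).
  have m3 := Rmin_l (s - (a - rho)) (b x + rho - s).
  have m4 := Rmin_r (s - (a - rho)) (b x + rho - s).
  have [||/is_derive_unique -> //] := H u v.
    have -> : u - x = (u - t) + (t - x) by ring.
    by apply: Rle_lt_trans (Rabs_triang _ _) _; rewrite -/d in m1; lra.
  by move/Rabs_lt_between: Hv; rewrite -/d in m1 m2; lra.
have -> : RInt (ft x) a (b x) = RInt (fun t => Derive (f^~ t) x) a (b x).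
  apply: RInt_ext => s; rewrite Rmin_left // Rmax_right // => Hs.
  by have [||/is_derive_unique -> //] := H x s; lra.
apply: is_derive_RInt_param_bound_comp_aux3 => //.
- apply: filter_imp nb => t Ht; apply: (@ex_RInt_continuous R_CompleteNormedModule) => s.
  by rewrite Rmin_left // Rmax_right // => Hs; apply: Hc; lra.
- exists (mkposreal _ r2); apply: filter_imp nb => t Ht /=.
  apply: (@ex_RInt_continuous R_CompleteNormedModule) => s.
  by rewrite Rmin_left ?Rmax_right; try lra; move=> Hs; apply: Hc; lra.
- exists (mkposreal _ r2); apply: filter_imp nb => t Ht s /=.
  move=> Hs; have {}Hs : a - rho < s < b x + rho.
    by move: Hs; rewrite /Rmin /Rmax; do 2!case: Rle_dec; lra.
  by have [||K _ _] := H t s; try lra; eexists; exact: K.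
- by move=> s; rewrite Rmin_left // Rmax_right // => Hs; apply: D2; lra.
- exists (mkposreal _ r2) => u v /= Hu Hv; apply: D2; first by lra.
  by move/Rabs_lt_between: Hv; lra.
by apply/continuity_pt_filterlim; apply: Hc; lra.
Qed.

Definition open2 (G : R -> R -> Prop) := forall t s, G t s ->
  exists2 rho, 0 < rho & forall t' s', Rabs (t' - t) < rho -> Rabs (s' - s) < rho -> G t' s'.

Lemma tube (G : R -> R -> Prop) a b x : a <= b -> open2 G ->
  (forall s, a <= s <= b -> G x s) ->
  exists2 rho, 0 < rho & forall t s, Rabs (t - x) < rho -> a - rho < s < b + rho -> G t s.
Proof.
move=> ab oG HG.
pose P c d := exists2 rho, 0 < rho & forall t s,
  Rabs (t - x) < rho -> c - rho < s < d + rho -> G t s.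
apply: (@cousin P) => // [c d e _ _ [r1 r10 H1] [r2 r20 H2]|y Hy].
  exists (Rmin r1 r2) => [|t s]; first exact: Rmin_pos.
  have m1 := Rmin_l r1 r2; have m2 := Rmin_r r1 r2 => Ht Hs.
  by case: (Rlt_le_dec s (d + r1)) => ?; [apply: H1 | apply: H2]; lra.
have [r r0 Hr] := oG _ _ (HG y Hy).
exists (r / 2) => [|c d _ yc [cy yd] dy _]; first by lra.
exists (r / 2) => [|t s Ht Hs]; first by lra.
by apply: Hr; [lra | apply: Rabs_def1; lra].
Qed.

Definition Ccts2 (f : R -> R -> C) t s := Ccts (fun p : R * R => f p.1 p.2) (t, s).

Lemma Cder_CInt_param (G : R -> R -> Prop) (f ft : R -> R -> C) a (b : R -> R) x (db : R) :
  a <= b x -> is_derive b x db -> open2 G ->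
  (forall t s, G t s -> [/\ Cder (f^~ s) t (ft t s), Ccts2 ft t s & Ccts2 f t s]) ->
  (forall s, a <= s <= b x -> G x s) ->
  Cder (fun t => CInt (f t) a (b t)) x (CInt (ft x) a (b x) + f x (b x) * RtoC db)%C.
Proof.
move=> ab Hb oG H HG; have [rho r0 Hr] := tube ab oG HG.
split; rewrite /Re /Im /=.
  evar_last.
    apply: (is_derive_RInt_upper (f := fun t s => Re (f t s)) (ft := fun t s => Re (ft t s))) r0 ab Hb _.
    move=> t s Ht Hs; have [[K _] [K2 _] [K3 _]] := H t s (Hr t s Ht Hs).
    by split; [exact: K | apply/continuity_2d_pt_filterlim; exact: K2 |
       apply/continuity_2d_pt_filterlim; exact: K3].
  by rewrite /Re /Im /=; ring.
evar_last.
  apply: (is_derive_RInt_upper (f := fun t s => Im (f t s)) (ft := fun t s => Im (ft t s))) r0 ab Hb _.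
  move=> t s Ht Hs; have [[_ K] [_ K2] [_ K3]] := H t s (Hr t s Ht Hs).
  by split; [exact: K | apply/continuity_2d_pt_filterlim; exact: K2 |
     apply/continuity_2d_pt_filterlim; exact: K3].
by rewrite /Re /Im /=; ring.
Qed.

(** * One-sided limits and the variation of the kernel integral *)

Definition Clim0 (f : R -> C) (l : C) := forall e, 0 < e ->
  exists2 r, 0 < r & forall h, 0 < h < r -> Cmod (f h - l)%C < e.

Lemma Cnorm_sym (x y : C) : Cmod (x - y)%C = Cmod (y - x)%C.
Proof. by rewrite -Cmod_opp; congr Cmod; ring. Qed.

Lemma Clim0_ext f g l r0 : 0 < r0 -> (forall h, 0 < h < r0 -> f h = g h) ->
  Clim0 f l -> Clim0 g l.
Proof.
move=> r00 E H e e0; have [r r_gt Hr] := H e e0.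
exists (Rmin r0 r); first exact: Rmin_pos.
move=> h Hh; have m1 := Rmin_l r0 r; have m2 := Rmin_r r0 r.
by rewrite -E; [apply: Hr|]; lra.
Qed.

Lemma Clim0_const c : Clim0 (fun=> c) c.
Proof.
by move=> e e0; exists 1 => [|h _]; [lra | rewrite (_ : (c - c)%C = RtoC 0) ?Cmod_0 //; ring].
Qed.

Lemma Clim0_plus f g l k : Clim0 f l -> Clim0 g k -> Clim0 (fun h => f h + g h)%C (l + k)%C.
Proof.
move=> Hf Hg e e0.
have [|r r_gt Hr] := Hf (e / 2); first by lra.
have [|r' r'_gt Hr'] := Hg (e / 2); first by lra.
exists (Rmin r r'); first exact: Rmin_pos.
move=> h Hh; have m1 := Rmin_l r r'; have m2 := Rmin_r r r'.
rewrite (_ : (_ - _)%C = ((f h - l) + (g h - k))%C); last by ring.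
apply: Rle_lt_trans (Cmod_triangle _ _) _.
by have := Hr h; have := Hr' h; lra.
Qed.

Lemma Clim0_scal c f l : Clim0 f l -> Clim0 (fun h => c * f h)%C (c * l)%C.
Proof.
move=> H e e0; have c0 := Cmod_ge_0 c.
have [|r r_gt Hr] := H (e / (Cmod c + 1)); first by apply: Rdiv_lt_0_compat; lra.
exists r => // h /Hr => K; have -> : (c * f h - c * l = c * (f h - l))%C by ring.
rewrite Cmod_mult; apply: (Rle_lt_trans _ (Cmod c * (e / (Cmod c + 1)))).
  by apply: Rmult_le_compat_l => //; lra.
have -> : Cmod c * (e / (Cmod c + 1)) = e - e / (Cmod c + 1) by field; lra.
have : 0 < e / (Cmod c + 1) by apply: Rdiv_lt_0_compat; lra.
by lra.
Qed.

Lemma Clim0_opp f l : Clim0 f l -> Clim0 (fun h => - f h)%C (- l)%C.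
Proof.
move=> H e /H [r r0 Hr]; exists r => // h /Hr.
by have -> : (- f h - - l = - (f h - l))%C by [ring]; rewrite Cmod_opp.
Qed.

Lemma Clim0_minus f g l k : Clim0 f l -> Clim0 g k -> Clim0 (fun h => f h - g h)%C (l - k)%C.
Proof. by move=> Hf Hg; apply: Clim0_plus => //; apply: Clim0_opp. Qed.

Lemma Clim0_sum (I : finType) (F : I -> R -> C) (l : I -> C) :
  (forall i, Clim0 (F i) (l i)) ->
  Clim0 (fun h => \csum_(i : I) F i h) (\csum_(i : I) l i).
Proof.
move=> H; elim: (index_enum I) => [|i r IH].
  rewrite big_nil; apply: Clim0_ext (Clim0_const 0%C); first exact: Rlt_0_1.
  by move=> h _; rewrite big_nil.
rewrite big_cons; apply: Clim0_ext (Clim0_plus (H i) IH); first exact: Rlt_0_1.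
by move=> h _; rewrite big_cons.
Qed.

Lemma Clim0_unique c l : Clim0 (fun=> c) l -> c = l.
Proof.
move=> H; suff : Cmod (c - l)%C = 0.
  by move/Cmod_eq_0 => E0; rewrite -[l]Cplus_0_l -E0; ring.
apply: Rle_antisym; last exact: Cmod_ge_0.
apply: Rnot_lt_le => /H [r r0 Hr].
by have := Hr (r / 2); lra.
Qed.

Lemma Clim0_cont f x : Ccts f x -> Clim0 (fun h => f (Rplus x h) - f (Rminus x h))%C 0%C.
Proof.
move=> /CcontP Hf e e0.
have [|d Hd] := Hf (e / 2); first by lra.
exists d => [|h Hh]; first exact: cond_pos.
have B y : Rabs (y - x) < d -> Cmod (f y - f x)%C < e / 2 by move=> Hy; apply: Hd.
have -> : (f (Rplus x h) - f (Rminus x h) - 0 =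
   (f (Rplus x h) - f x) + - (f (Rminus x h) - f x))%C by ring.
apply: Rle_lt_trans (Cmod_triangle _ _) _; rewrite Cmod_opp.
have := B (x + h); have := B (x - h).
rewrite (_ : x - h - x = - h); last by ring.
rewrite (_ : x + h - x = h); last by ring.
by rewrite Rabs_Ropp Rabs_pos_eq; lra.
Qed.

(** What the integration over the triangle uses: gd_eq says that the kernel
    F(t,s) g'(s) / (g(s) - g(t)), differentiated in t, is a derivative in s. For F built from
    two solutions of the KZ equation, gd_eq is the partial fraction expansion of
    1/((u - z_i)(v - z_i)), and W is the result of merging the two equal letters. *)
Record green_data (g g1 g2 : R -> C) (F Ft Fs W w : R -> R -> C) : Prop := {
  gd_g : forall t, 0 < t < 1 -> Cder g t (g1 t);
  gd_g1 : forall t, 0 < t < 1 -> Cder g1 t (g2 t);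
  gd_Ft : forall t s, 0 < t < 1 -> 0 < s < 1 -> Cder (F^~ s) t (Ft t s);
  gd_Fs : forall t s, 0 < t < 1 -> 0 < s < 1 -> Cder (F t) s (Fs t s);
  gd_cF : forall t s, 0 < t < 1 -> 0 < s < 1 -> Ccts2 F t s;
  gd_cFt : forall t s, 0 < t < 1 -> 0 < s < 1 -> Ccts2 Ft t s;
  gd_cW : forall t s, 0 < t < 1 -> 0 < s < 1 -> Ccts2 W t s;
  gd_W : forall t s, 0 < t < 1 -> 0 < s < 1 -> Cder (W t) s (w t s);
  gd_cw : forall t s, 0 < t < 1 -> 0 < s < 1 -> Ccts (w t) s;
  gd_lip : forall t s, 0 < t < 1 -> 0 < s < 1 -> exists M, exists2 rho, 0 < rho &
    forall t' s', Rabs (t' - t) < rho -> Rabs (s' - s) < rho ->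
    Cmod (F t' s' - F t s)%C <= M * (Rabs (t' - t) + Rabs (s' - s));
  gd_eq : forall t s, 0 < t < 1 -> 0 < s < 1 ->
    (Ft t s * g1 s + Fs t s * g1 t = - two_pi_i * ((g s - g t) * w t s))%C
}.

Definition kern (g g1 : R -> C) (F : R -> R -> C) t s : C := (F t s * (g1 s / (g s - g t)))%C.

Lemma near_itv a b x : a < x < b ->
  exists2 r, 0 < r & forall y, Rabs (y - x) < r -> a < y < b.
Proof.
move=> [ax xb]; exists (Rmin (x - a) (b - x)); first by apply: Rmin_pos; lra.
move=> y /Rabs_lt_between'; have := Rmin_l (x - a) (b - x); have := Rmin_r (x - a) (b - x).
by lra.
Qed.

Lemma Csub_neq (x y : C) : x <> y -> (x - y)%C <> 0%C.
Proof. by move=> xy E; apply: xy; rewrite -[y]Cplus_0_l -E; ring. Qed.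

Lemma Cts_fst (f : R -> C) t s : Ccts f t -> Ccts2 (fun t _ => f t) t s.
Proof.
move=> H; apply: (@Ccts_comp (prod_UniformSpace R_UniformSpace R_UniformSpace)
  R_UniformSpace fst f (t, s)) => //.
exact: continuous_fst.
Qed.

Lemma Cts_snd (f : R -> C) t s : Ccts f s -> Ccts2 (fun _ s => f s) t s.
Proof.
move=> H; apply: (@Ccts_comp (prod_UniformSpace R_UniformSpace R_UniformSpace)
  R_UniformSpace snd f (t, s)) => //.
exact: continuous_snd.
Qed.

Lemma Ccts2P (f : R -> R -> C) t s : Ccts2 f t s ->
  forall e, 0 < e -> exists2 r, 0 < r & forall t' s',
    Rabs (t' - t) < r -> Rabs (s' - s) < r -> Cmod (f t' s' - f t s)%C < e.
Proof.
move=> /CcontP H e /H [d Hd]; exists d => [|t' s' Ht Hs]; first exact: cond_pos.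
by apply: (Hd (t', s')); split.
Qed.

Lemma Ccts2_slice (f : R -> R -> C) t s : Ccts2 f t s -> Ccts (f t) s.
Proof.
move=> /Ccts2P H; apply/CcontP => e /H [r r0 Hr].
exists (mkposreal _ r0) => y Hy; apply: Hr => //.
by rewrite Rminus_diag Rabs_R0.
Qed.

Lemma Ccts2_curve (f : R -> R -> C) (b : R -> R) t : Ccts2 f t (b t) -> continuous b t ->
  Ccts (fun t => f t (b t)) t.
Proof.
move=> H Hb; apply: (Ccts_comp (g := fun t => (t, b t)) (f := fun p => f p.1 p.2)) H.
by apply: (continuous_comp_2 (fun t : R => t) b (fun u v : R => (u, v))) => //; apply/filterlim_locally => e; exists e => y.
Qed.

Section Green.
Variables (g g1 g2 : R -> C) (F Ft Fs W w : R -> R -> C).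
Hypothesis GD : green_data g g1 g2 F Ft Fs W w.

Let dom t s := [/\ 0 < t < 1, 0 < s < 1 & g s <> g t].

Lemma open2_dom : open2 dom.
Proof.
move=> t s [Ht Hs ne].
have [r1 r10 H1] := near_itv Ht; have [r2 r20 H2] := near_itv Hs.
have c2 : Ccts2 (fun t s => g s - g t)%C t s.
  apply: Ccts_minus; [apply: Cts_snd | apply: Cts_fst]; apply: Cder_cont; exact: (gd_g GD).
have m0 : 0 < Cmod (g s - g t)%C by apply Cmod_gt_0; apply: Csub_neq.
have [r3 r30 H3] := Ccts2P c2 m0.
exists (Rmin r1 (Rmin r2 r3)); first by do !apply: Rmin_pos.
move=> t' s' Ht' Hs'; have n1 := Rmin_l r1 (Rmin r2 r3); have n2 := Rmin_r r1 (Rmin r2 r3).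
have n3 := Rmin_l r2 r3; have n4 := Rmin_r r2 r3.
split; [apply: H1; lra | apply: H2; lra |] => E.
have := H3 t' s'; rewrite E (_ : (g t' - g t' - (g s - g t))%C = (- (g s - g t))%C); last by ring.
by rewrite Cmod_opp; lra.
Qed.

Lemma kern_cts2 t s : dom t s -> Ccts2 (kern g g1 F) t s.
Proof.
move=> [Ht Hs ne]; apply: Ccts_mult; first exact: (gd_cF GD).
apply: Ccts_mult; first by apply: Cts_snd; apply: Cder_cont; apply: (gd_g1 GD).
apply: Ccts_inv; last exact: Csub_neq.
by apply: Ccts_minus; [apply: Cts_snd | apply: Cts_fst]; apply: Cder_cont; apply: (gd_g GD).
Qed.

(** The integrand differentiated in t is, by gd_eq, the derivative in s of
    - 2 pi i W(t,s) - F(t,s) g'(t) / (g(s) - g(t)), so that only end point terms remain. *)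
Lemma green_derive a (b : R -> R) x (db : R) :
  0 < a -> a <= b x -> b x < 1 -> 0 < x < 1 -> is_derive b x db ->
  (forall s, a <= s <= b x -> g s <> g x) ->
  Cder (fun t => CInt (kern g g1 F t) a (b t)) x
    (- two_pi_i * (W x (b x) - W x a) - F x (b x) * (g1 x / (g (b x) - g x))
     + F x a * (g1 x / (g a - g x)) + kern g g1 F x (b x) * RtoC db)%C.
Proof.
move=> a0 ab b1 Hx Hb ne.
pose ft t s := (Ft t s * (g1 s / (g s - g t)) +
   F t s * (g1 s * (g1 t / ((g s - g t) * (g s - g t)))))%C.
have cg u : 0 < u < 1 -> Ccts g u by move=> Hu; apply: Cder_cont; apply: (gd_g GD).
have cg1 u : 0 < u < 1 -> Ccts g1 u by move=> Hu; apply: Cder_cont; apply: (gd_g1 GD).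
have Hdom s : a <= s <= b x -> dom x s by move=> Hs; split => //; [lra | apply: ne].
have ft_cts t s : dom t s -> Ccts2 ft t s.
  move=> [Ht Hs n]; have n' := Csub_neq n.
  have cd : Ccts2 (fun t s => g s - g t)%C t s.
    by apply: Ccts_minus; [apply: Cts_snd | apply: Cts_fst]; apply: cg.
  apply: Ccts_plus; apply: Ccts_mult; [exact: (gd_cFt GD) | | exact: (gd_cF GD) |].
    by apply: Ccts_mult; [apply: Cts_snd; apply: cg1 | apply: Ccts_inv].
  apply: Ccts_mult; first by apply: Cts_snd; apply: cg1.
  apply: Ccts_mult; first by apply: Cts_fst; apply: cg1.
  apply: Ccts_inv; first exact: Ccts_mult.
  exact: Cmult_neq_0.
apply: Cder_eq; first apply: (@Cder_CInt_param dom (kern g g1 F) ft a b x db) => //.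
- exact: @open2_dom.
- move=> t s D; have [Ht Hs n] := D; split; [|exact: ft_cts | exact: kern_cts2].
  have n' := Csub_neq n.
  apply: Cder_eq; first apply: Cder_mult; first exact: (gd_Ft GD).
    apply: Cder_mult; first exact: Cder_const.
    apply: Cder_inv => //; apply: Cder_minus; first exact: Cder_const.
    exact: (gd_g GD).
  by rewrite /ft /=; field.
congr Cplus.
have -> : CInt (ft x) a (b x) = CInt (fun s => - two_pi_i * w x s - (Fs x s * (g1 x / (g s - g x))
     - F x s * (g1 x * g1 s / ((g s - g x) * (g s - g x)))))%C a (b x).
  apply: CInt_ext => // s Hs; have [_ Hs' n] : dom x s by apply: Hdom; lra.
  have n' := Csub_neq n.
  rewrite /ft (_ : (- two_pi_i * w x s)%C = ((- two_pi_i * ((g s - g x) * w x s)) / (g s - g x))%C);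
    last by field.
  by rewrite -(gd_eq GD) //; field.
rewrite (@CInt_FTC (fun s => - two_pi_i * W x s - F x s * (g1 x / (g s - g x)))%C) //; first by ring.
  move=> s Hs; have [_ Hs' n] := Hdom _ Hs; have n' := Csub_neq n.
  apply: Cder_minus; first by apply: Cder_scal; apply: (gd_W GD).
  apply: Cder_eq; first apply: Cder_mult; first exact: (gd_Fs GD).
    apply: Cder_mult; first exact: Cder_const.
    apply: Cder_inv => //; apply: Cder_minus; last exact: Cder_const.
    exact: (gd_g GD).
  by rewrite /=; field.
move=> s Hs; have [_ Hs' n] := Hdom _ Hs; have n' := Csub_neq n.
have H := Ccts2_slice (ft_cts _ _ (Hdom _ Hs)).
apply: Ccts_ext_loc H.
have [r r0 Hr] := open2_dom (Hdom _ Hs).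
exists (mkposreal _ r0) => u Hu; have [|//|_ Hu' nu] := Hr x u.
  by rewrite Rminus_diag Rabs_R0.
have nu' := Csub_neq nu.
rewrite /ft (_ : (- two_pi_i * w x u)%C = ((- two_pi_i * ((g u - g x) * w x u)) / (g u - g x))%C);
  last by field.
by rewrite -(gd_eq GD) //; field.
Qed.
End Green.

(** * The jump of the kernel at a linear crossing *)

Lemma continuous_deriv (f : R -> R) x l : is_derive f x l -> continuous f x.
Proof. by move=> H; apply: ex_derive_continuous; exists l. Qed.

Lemma atan_inv_pm y : y <> 0 ->
  atan (/ y) = (if Rlt_dec 0 y then PI / 2 else - (PI / 2)) - atan y.
Proof.
move=> y0; case: Rlt_dec => H /=; first by rewrite atan_inv.
have H' : 0 < - y by lra.
have E := atan_inv _ H'; rewrite atan_opp in E.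
have E2 : / y = - / - y by rewrite Rinv_opp Ropp_involutive.
by rewrite E2 atan_opp E /=; lra.
Qed.

(** An antiderivative in p of 1/(p - h (al + i be)) for h be <> 0. The real part is continuous
    across h = 0, and the arc tangent carries the jump. *)
Definition linlog (al be h p : R) : C :=
  (/ 2 * ln ((p - h * al) * (p - h * al) + (h * be) * (h * be)),
   atan ((p - h * al) / (h * be))).

(** As h changes sign the argument (p - h al) / (h be) passes from one infinity to the other,
    so that the arc tangent jumps by pi. *)
Lemma linlog_jump al be p : be <> 0 -> p <> 0 ->
  Clim0 (fun h => linlog al be h p - linlog al be (- h) p)%C
        (0, if Rlt_dec 0 (p * be) then PI else - PI).
Proof.
move=> be0 p0.
pose c h : C := (/ 2 * ln ((p - h * al) * (p - h * al) + (h * be) * (h * be)),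
   - atan (h * be / (p - h * al))).
have pp : 0 < p * p by nra.
have cc : Ccts c 0.
  split; rewrite /c /=.
    apply: (@continuous_deriv _ _ (- al / p)); auto_derive; first by nra.
    by field.
  apply: (@continuous_deriv _ _ (- be / p)); auto_derive; first by lra.
  by field; lra.
have H := Clim0_plus (Clim0_const (0, if Rlt_dec 0 (p * be) then PI else - PI)) (Clim0_cont cc).
rewrite Cplus_0_r in H.
pose r0 := Rabs p / (2 * (Rabs al + 1)).
have al1 := Rabs_pos al; have pa := Rabs_pos_lt _ p0.
have r00 : 0 < r0 by apply: Rdiv_lt_0_compat; lra.
apply: (Clim0_ext r00) H => h [h0 hr].
have hal : Rabs (h * al) < Rabs p / 2.
  rewrite Rabs_mult (Rabs_pos_eq h); last by lra.
  have : r0 * (Rabs al + 1) = Rabs p / 2 by rewrite /r0; field; lra.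
  by nra.
have sg u : u = h * al \/ u = - (h * al) -> (0 < p -> 0 < p - u) /\ (p < 0 -> p - u < 0).
  move=> Hu; have : Rabs u < Rabs p / 2 by case: Hu => ->; rewrite ?Rabs_Ropp.
  by move/Rabs_lt_between => K; split => ps; move: K; rewrite /Rabs; case: Rcase_abs; lra.
have [s1 s2] := sg _ (or_introl erefl); have [s3 s4] := sg _ (or_intror erefl).
have n1 : p - h * al <> 0 by lra.
have n2 : p + h * al <> 0 by lra.
have hb : h * be <> 0 by apply: Rmult_integral_contrapositive_currified; lra.
have E1 : (p - h * al) / (h * be) = / (h * be / (p - h * al)) by field; lra.
have E2 : (p - - h * al) / (- h * be) = / (- h * be / (p - - h * al)) by field; lra.
rewrite /linlog /c Rplus_0_l Rminus_0_l; apply: C_ext; rewrite /Re /Im /=; first by ring.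
rewrite E1 E2 !atan_inv_pm; last first.
- by apply: Rmult_integral_contrapositive_currified => //; apply: Rinv_neq_0_compat.
- have -> : - h * be / (p - - h * al) = - (h * be) * / (p + h * al) by field; lra.
  by apply: Rmult_integral_contrapositive_currified; [lra | apply: Rinv_neq_0_compat].
have Q1 : h * be / (p - h * al) = p * be * (h / (p * (p - h * al))) by field; lra.
have Q2 : - h * be / (p - - h * al) = - (p * be * (h / (p * (p + h * al)))) by field; lra.
have d1 : 0 < h / (p * (p - h * al)) by apply: Rdiv_lt_0_compat => //; case: (Rdichotomy _ _ p0); nra.
have d2 : 0 < h / (p * (p + h * al)) by apply: Rdiv_lt_0_compat => //; case: (Rdichotomy _ _ p0); nra.
have pb : p * be <> 0 by apply: Rmult_integral_contrapositive_currified.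
have K1 : 0 < h * be / (p - h * al) <-> 0 < p * be by rewrite Q1; split => ?; nra.
have K2 : 0 < - h * be / (p - - h * al) <-> p * be < 0 by rewrite Q2; split => ?; nra.
case: (Rlt_dec 0 (p * be)) => K; case: (Rlt_dec 0 (h * be / (p - h * al))) => L1;
  case: (Rlt_dec 0 (- h * be / (p - - h * al))) => L2 /=; try lra; exfalso;
  first [by apply: L1; apply/K1 | by move/K1: L1 | by move/K2: L2; lra | by apply: L2; apply/K2; lra].
Qed.

(** The kernel A ds / ((s - x) A - h B) of two straight lines with directions A and B that cross at
    parameter x. *)
Definition lkern (A B : C) (x h s : R) : C := (A / (RtoC (s - x) * A - RtoC h * B))%C.

Lemma det2_Cmod A B : Rabs (det2 A B) <= 2 * Cmod A * Cmod B.
Proof.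
rewrite /det2; have := Re_le_Cmod A; have := Im_le_Cmod A.
have := Re_le_Cmod B; have := Im_le_Cmod B => b1 b2 a1 a2.
apply: Rle_trans (Rabs_triang _ _) _; rewrite Rabs_Ropp !Rabs_mult.
have := Rabs_pos (Re A); have := Rabs_pos (Im A).
by have := Rabs_pos (Re B); have := Rabs_pos (Im B); nra.
Qed.

(** Two independent directions: the norm of p A - h B controls both p and h. *)
Lemma transverse_lower A B : det2 A B <> 0 -> exists2 c, 0 < c & forall p h,
  c * (Rabs p + Rabs h) <= Cmod (RtoC p * A - RtoC h * B)%C.
Proof.
move=> D0; have D := Rabs_pos_lt _ D0.
have DAB := det2_Cmod A B.
have a0 := Cmod_ge_0 A; have b0 := Cmod_ge_0 B.
have ab0 : 0 < Cmod A + Cmod B.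
  apply: Rnot_le_lt => H; have : Cmod A = 0 by lra.
  by move=> E; rewrite E in DAB; lra.
exists (Rabs (det2 A B) / (2 * (Cmod A + Cmod B))); first by apply: Rdiv_lt_0_compat; lra.
move=> p h; set l := (_ - _)%C.
have H1 : Rabs h * Rabs (det2 A B) <= 2 * Cmod A * Cmod l.
  rewrite -Rabs_mult -(Rabs_Ropp (h * _)).
  have -> : - (h * det2 A B) = det2 A l by rewrite /det2 /l /Re /Im /=; ring.
  exact: det2_Cmod.
have H2 : Rabs p * Rabs (det2 A B) <= 2 * Cmod l * Cmod B.
  rewrite -Rabs_mult.
  have -> : p * det2 A B = det2 l B by rewrite /det2 /l /Re /Im /=; ring.
  exact: det2_Cmod.
have -> : Rabs (det2 A B) / (2 * (Cmod A + Cmod B)) * (Rabs p + Rabs h) =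
  (Rabs p * Rabs (det2 A B) + Rabs h * Rabs (det2 A B)) / (2 * (Cmod A + Cmod B)) by field; lra.
by apply/Rle_div_l; lra.
Qed.

Lemma lkern_den A B p h : det2 A B <> 0 -> p <> 0 \/ h <> 0 ->
  (RtoC p * A - RtoC h * B)%C <> 0%C.
Proof.
move=> /transverse_lower [c c0 H] ph E; have := H p h; rewrite E Cmod_0.
have := Rabs_pos p; have := Rabs_pos h.
by case: ph => /Rabs_pos_lt; nra.
Qed.

Lemma lkern_cts2 A B x h s : det2 A B <> 0 -> s - x <> 0 \/ h <> 0 ->
  Ccts2 (fun h s => lkern A B x h s) h s.
Proof.
move=> D ph; apply: Ccts_mult; first exact: Ccts_const.
apply: Ccts_inv; last exact: lkern_den.
apply: Ccts_minus; apply: Ccts_mult; try exact: Ccts_const; last first.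
  by apply: (@Cts_fst RtoC); apply: Cder_cont; apply: Cder_id.
apply: (@Cts_snd (fun s => RtoC (s - x))); apply: Ccts_RtoC.
by apply: (@continuous_minus R_UniformSpace R_AbsRing R_NormedModule);
  [exact: continuous_id | exact: continuous_const].
Qed.

Lemma Cinv_conj u v : 0 < u * u + v * v ->
  (/ (u, Ropp v))%C = (u / (u * u + v * v), v / (u * u + v * v)).
Proof.
move=> N; have N' : u * (u * 1) + - v * (- v * 1) <> 0 by lra.
by apply: C_ext; rewrite /Re /Im /=; field; lra.
Qed.

Lemma lkern_int A B x a d h : det2 A B <> 0 -> a <= d -> h <> 0 ->
  CInt (lkern A B x h) a d =
    (linlog (Re (B / A)) (Im (B / A)) h (d - x) - linlog (Re (B / A)) (Im (B / A)) h (a - x))%C.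
Proof.
move=> D ad h0.
have A0 : A <> 0%C.
  by move=> E; apply: D; rewrite E /det2 /Re /Im /=; ring.
set al := Re (B / A); set be := Im (B / A).
have EB : B = (A * (al, be))%C by rewrite /al /be -surjective_pairing; field.
have be0 : be <> 0.
  move=> E; apply: D; rewrite EB E /det2 /Re /Im /=; ring.
have hb : h * be <> 0 by apply: Rmult_integral_contrapositive_currified.
apply: (@CInt_FTC (fun s => linlog al be h (s - x))) => //.
  move=> s Hs; have N : 0 < (s - x - h * al) * (s - x - h * al) + h * be * (h * be).
    by have := Rlt_0_sqr _ hb; have := Rle_0_sqr (s - x - h * al); rewrite /Rsqr; lra.
  have E : lkern A B x h s = ((s - x - h * al) / ((s - x - h * al) * (s - x - h * al) + h * be * (h * be)),
     (h * be) / ((s - x - h * al) * (s - x - h * al) + h * be * (h * be))).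
    rewrite /lkern EB; pose u := s - x - h * al; pose v := h * be.
    rewrite -/u -/v in N *.
    have -> : (RtoC (s - x) * A - RtoC h * (A * (al, be)) = A * (u, Ropp v))%C.
      by apply: C_ext; rewrite /u /v /Re /Im /=; ring.
    have Z : ((u, Ropp v) : C) <> RtoC 0 by case=> e1 e2; nra.
    by rewrite -Cinv_conj //; field.
  rewrite E; split; rewrite /linlog /Re /Im /=; auto_derive; try (split; [nra|done]); try done.
    by field; nra.
  by field; nra.
by move=> s Hs; apply: (Ccts2_slice (f := lkern A B x)); apply: lkern_cts2 => //; right.
Qed.

(** The logarithm of (s - x) A - h B changes by 2 pi i between h < 0 and h > 0, the sign being
    that of the crossing. *)
Lemma lkern_jump A B x a d : det2 A B <> 0 -> a < x < d ->
  Clim0 (fun h => CInt (fun s => lkern A B x h s - lkern A B x (- h) s)%C a d)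
    (two_pi_i * RtoC (if Rlt_dec 0 (det2 A B) then 1 else - 1))%C.
Proof.
move=> D [ax xd].
have A0 : A <> 0%C.
  by move=> E; apply: D; rewrite E /det2 /Re /Im /=; ring.
have A2 := Cnz A0.
set al := Re (B / A); set be := Im (B / A).
have Ebe : be * (Re A ^ 2 + Im A ^ 2) = det2 A B.
  by rewrite /be /det2 /Re /Im /=; field; move: A2; rewrite /Re /Im /=; lra.
have be0 : be <> 0 by move=> E; apply: D; rewrite -Ebe E; ring.
have p1 : d - x <> 0 by lra.
have p2 : a - x <> 0 by lra.
have H := Clim0_minus (linlog_jump al be0 p1) (linlog_jump al be0 p2).
have E h : 0 < h < 1 -> ((linlog al be h (d - x) - linlog al be (- h) (d - x)) -
    (linlog al be h (a - x) - linlog al be (- h) (a - x)))%C =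
    CInt (fun s => lkern A B x h s - lkern A B x (- h) s)%C a d.
  move=> Hh; rewrite CInt_minus; first last.
  - by move=> s Hs; apply: (Ccts2_slice (f := lkern A B x)); apply: lkern_cts2 => //; right; lra.
  - by move=> s Hs; apply: (Ccts2_slice (f := lkern A B x)); apply: lkern_cts2 => //; right; lra.
  - by lra.
  rewrite !lkern_int //; try lra.
  by rewrite -/al -/be; ring.
apply: (Clim0_ext Rlt_0_1 E).
move: H; congr Clim0; rewrite /two_pi_i; apply: C_ext; rewrite /Re /Im /=; first by ring.
have sg : 0 < be <-> 0 < det2 A B by rewrite -Ebe; split => ?; nra.
case: (Rlt_dec 0 (det2 A B)) => K.
  have b0 : 0 < be by apply/sg.
  by case: Rlt_dec => ? /=; case: Rlt_dec => ? /=; nra.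
have b0 : be < 0 by case: (Rdichotomy _ _ be0) => // /sg.
by case: Rlt_dec => ? /=; case: Rlt_dec => ? /=; nra.
Qed.

(** * The jump of the kernel at a transverse crossing *)

Lemma is_derive_lip (f : R -> R) x l : is_derive f x l ->
  exists2 rho, 0 < rho & forall y, Rabs (y - x) < rho ->
    Rabs (f y - f x) <= (Rabs l + 1) * Rabs (y - x).
Proof.
move/is_derive_Reals => H; have [d Hd] := H 1 Rlt_0_1.
exists d => [|y Hy]; first exact: cond_pos.
case: (Req_dec y x) => [->|yx]; first by rewrite !Rminus_diag Rabs_R0; lra.
have n : y - x <> 0 by lra.
have := Hd _ n Hy; rewrite (_ : x + (y - x) = y); last by ring.
move=> K; have -> : f y - f x = (((f y - f x) / (y - x) - l) + l) * (y - x) by field.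
rewrite Rabs_mult; apply: Rmult_le_compat_r; first exact: Rabs_pos.
by apply: Rle_trans (Rabs_triang _ _) _; lra.
Qed.

Lemma Cder_lip f x l : Cder f x l -> exists2 M, 0 <= M & exists2 rho, 0 < rho & forall y,
  Rabs (y - x) < rho -> Cmod (f y - f x)%C <= M * Rabs (y - x).
Proof.
move=> [/is_derive_lip [r1 r10 H1] /is_derive_lip [r2 r20 H2]].
exists (Rabs (Re l) + 1 + (Rabs (Im l) + 1)).
  by have := Rabs_pos (Re l); have := Rabs_pos (Im l); lra.
exists (Rmin r1 r2) => [|y Hy]; first exact: Rmin_pos.
have n1 := Rmin_l r1 r2; have n2 := Rmin_r r1 r2.
have K1 := H1 y; have K2 := H2 y.
apply: Rle_trans (Cmod_le_parts _) _; rewrite /Re /Im /= in K1 K2 *.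
rewrite Rmult_plus_distr_r; apply: Rplus_le_compat; [apply: K1 | apply: K2]; lra.
Qed.

Lemma Cder_taylor g g1 x a b l : a < x < b -> (forall y, a < y < b -> Cder g y (g1 y)) ->
  (forall y, a < y < b -> Ccts g1 y) -> Cder g1 x l ->
  exists2 M, 0 <= M & exists2 rho, 0 < rho & forall y, Rabs (y - x) < rho ->
    Cmod (g1 y - g1 x)%C <= M * Rabs (y - x) /\
    Cmod (g y - g x - RtoC (y - x) * g1 x)%C <= M * (Rabs (y - x) * Rabs (y - x)).
Proof.
move=> Hx Hg Hc /Cder_lip [M M0 [r r0 Hr]].
have [r' r'0 Hr'] := near_itv Hx.
exists (2 * M); first by lra.
exists (Rmin r r'); first exact: Rmin_pos.
move=> y Hy; have n1 := Rmin_l r r'; have n2 := Rmin_r r r'.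
have yx0 := Rabs_pos (y - x).
have Hy1 := Hr y; have Hy2 := Hr' y.
split; first by have := Hy1; nra.
have FT p q : p <= q -> (forall u, p <= u <= q -> Rabs (u - x) <= Rabs (y - x)) ->
    Cmod (g q - g p - RtoC (q - p) * g1 x)%C <= 2 * M * (Rabs (y - x) * (q - p)).
  move=> pq Hu; have -> : (g q - g p - RtoC (q - p) * g1 x)%C = CInt (fun u => g1 u - g1 x)%C p q.
    rewrite (@CInt_FTC (fun u => g u - RtoC u * g1 x)%C) //.
    - by rewrite RtoC_minus; ring.
    - move=> u Hpu; apply: Cder_eq; first apply: Cder_minus.
      + by apply: Hg; apply: Hr'; have := Hu u Hpu; lra.
      + by apply: Cder_mult; [exact: Cder_id | exact: Cder_const].
      by rewrite /=; ring.
    move=> u Hpu; apply: Ccts_minus; last exact: Ccts_const.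
    by apply: Hc; apply: Hr'; have := Hu u Hpu; lra.
  have -> : 2 * M * (Rabs (y - x) * (q - p)) = 2 * (M * Rabs (y - x)) * (q - p) by ring.
  apply: CInt_bound => // u Hpu.
    apply: Ccts_minus; last exact: Ccts_const.
    by apply: Hc; apply: Hr'; have := Hu u Hpu; lra.
  apply: Rle_trans (Hr u _) _; first by have := Hu u Hpu; lra.
  by apply: Rmult_le_compat_l => //; apply: Hu.
case: (Rle_lt_dec x y) => xy.
  have := FT x y xy; rewrite (Rabs_pos_eq (y - x)); last by lra.
  by apply=> u Hu; rewrite Rabs_pos_eq; lra.
have := FT y x (Rlt_le _ _ xy); rewrite (Rabs_left1 (y - x)); last by lra.
rewrite -Cmod_opp (_ : (- (g x - g y - RtoC (Rminus x y) * g1 x))%C = (g y - g x - RtoC (y - x) * g1 x)%C).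
  rewrite (_ : - (y - x) = x - y); last by ring.
  by apply=> u Hu; rewrite Rabs_left1; lra.
by rewrite !RtoC_minus; ring.
Qed.

Section Jump.
Variables (g g1 g2 : R -> C) (F Ft Fs W w : R -> R -> C).
Hypothesis GD : green_data g g1 g2 F Ft Fs W w.

(** Near a transverse crossing g(y) - g(sg + h) agrees with its linear part to second order,
    and the square of the distance to the crossing is also the order of the product of the
    two denominators; so the kernel and its linear model differ by a bounded function. *)
Lemma kern_singular sg x : 0 < sg < 1 -> 0 < x < 1 -> g x = g sg ->
  det2 (g1 x) (g1 sg) <> 0 ->
  exists M, exists2 rho, 0 < rho & forall h y, h <> 0 -> Rabs h < rho -> Rabs (y - x) < rho ->
    Cmod (kern g g1 F (sg + h) y - F sg x * lkern (g1 x) (g1 sg) x h y)%C <= M.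
Proof.
move=> Hsg Hx gx D.
have cg1 u : 0 < u < 1 -> Ccts g1 u by move=> Hu; apply: Cder_cont; apply: (gd_g1 GD).
have [M1 M10 [r1 r10 H1]] := Cder_taylor Hx (gd_g GD) cg1 (gd_g1 GD Hx).
have [M2 M20 [r2 r20 H2]] := Cder_taylor Hsg (gd_g GD) cg1 (gd_g1 GD Hsg).
have [M3 [r3 r30 H3]] := gd_lip GD Hsg Hx.
have [c c0 Hc] := transverse_lower D.
set A := g1 x in H1 Hc *; set B := g1 sg in H2 Hc *; set F0 := F sg x in H3 *.
have a0 := Cmod_ge_0 A; have f0 := Cmod_ge_0 F0.
pose C0 := M1 + M2.
pose C1 := Rabs M3 * (Cmod A + M1) + Cmod F0 * M1.
have m3 := Rabs_pos M3.
have C00 : 0 <= C0 by rewrite /C0; lra.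
have C10 : 0 <= C1 by rewrite /C1; nra.
exists (2 * C1 / c + 2 * (Cmod F0 * Cmod A * C0) / (c * c)).
pose r4 := c / (4 * (C0 + 1)).
have r40 : 0 < r4 by apply: Rdiv_lt_0_compat; lra.
exists (Rmin (Rmin (Rmin r1 1) (Rmin r2 r3)) r4); first by do !apply: Rmin_pos; lra.
move=> h y h0 Hh Hy.
have n0 := Rmin_l (Rmin (Rmin r1 1) (Rmin r2 r3)) r4.
have n1 := Rmin_r (Rmin (Rmin r1 1) (Rmin r2 r3)) r4.
have n2 := Rmin_l (Rmin r1 1) (Rmin r2 r3); have n3 := Rmin_r (Rmin r1 1) (Rmin r2 r3).
have n4 := Rmin_l r1 1; have n5 := Rmin_r r1 1.
have n6 := Rmin_l r2 r3; have n7 := Rmin_r r2 r3.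
have sgh : sg + h - sg = h by ring.
have [|K1 K1'] := H1 y; first by lra.
have [|K2 K2'] := H2 (sg + h); first by rewrite sgh; lra.
have K3 : Cmod (F (Rplus sg h) y - F0)%C <= M3 * (Rabs h + Rabs (y - x)).
  by have := H3 (sg + h) y; rewrite sgh; apply; lra.
rewrite sgh in K2 K2'.
set u := y - x in Hy K1 K1' K3 *.
have u0 := Rabs_pos u; have hh := Rabs_pos_lt _ h0.
set r := Rabs u + Rabs h.
have r0 : 0 < r by rewrite /r; lra.
have Hl := Hc u h; rewrite -/r in Hl.
set l := (RtoC u * A - RtoC h * B)%C in Hl *.
set W0 := (g y - g (Rplus sg h))%C.
have wl : Cmod (W0 - l)%C <= C0 * (r * r).
  have -> : (W0 - l = (g y - g x - RtoC u * A) - (g (Rplus sg h) - g sg - RtoC h * B))%C.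
    by rewrite /W0 /l gx; ring.
  apply: Rle_trans (Cmod_triangle _ _) _; rewrite Cmod_opp /C0.
  have q1 : Rabs u * Rabs u <= r * r by rewrite /r; nra.
  have q2 : Rabs h * Rabs h <= r * r by rewrite /r; nra.
  by nra.
have rr : C0 * r <= c / 2.
  have : r <= 2 * r4 by rewrite /r; lra.
  have -> : c / 2 = 2 * r4 * (C0 + 1) by rewrite /r4; field; lra.
  by nra.
have Hw : c / 2 * r <= Cmod W0.
  have := Cmod_triangle W0 (l - W0)%C.
  rewrite (_ : (W0 + (l - W0))%C = l); last by ring.
  rewrite Cnorm_sym; have : C0 * (r * r) <= c / 2 * r by nra.
  by lra.
have l0 : 0 < Cmod l by nra.
have w0 : 0 < Cmod W0 by nra.
have nl : l <> 0%C by move=> E; rewrite E Cmod_0 in l0; lra.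
have nw : W0 <> 0%C by move=> E; rewrite E Cmod_0 in w0; lra.
rewrite /kern /lkern -/u -/l -/W0.
rewrite (_ : (_ - _)%C = ((F (Rplus sg h) y * g1 y - F0 * A) / W0 - F0 * A * ((W0 - l) / (W0 * l)))%C); last by field.
apply: Rle_trans (Cmod_triangle _ _) _; rewrite Cmod_opp.
apply: Rplus_le_compat.
  rewrite Cmod_div //.
  have N : Cmod (F (Rplus sg h) y * g1 y - F0 * A)%C <= C1 * r.
    rewrite (_ : (_ - _)%C = ((F (Rplus sg h) y - F0) * g1 y + F0 * (g1 y - A))%C); last by ring.
    apply: Rle_trans (Cmod_triangle _ _) _; rewrite !Cmod_mult.
    have g1y : Cmod (g1 y) <= Cmod A + M1.
      have := Cmod_triangle A (g1 y - A)%C; rewrite (_ : (A + (g1 y - A))%C = g1 y); last by ring.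
      by nra.
    have p1 : Cmod (F (Rplus sg h) y - F0)%C <= Rabs M3 * r.
      have := Rle_abs M3; rewrite /r; nra.
    have p2 : Cmod (F (Rplus sg h) y - F0)%C * Cmod (g1 y) <= (Rabs M3 * r) * (Cmod A + M1).
      by apply: Rmult_le_compat => //; apply: Cmod_ge_0.
    have p3 : Cmod F0 * Cmod (g1 y - A)%C <= Cmod F0 * (M1 * r).
      by apply: Rmult_le_compat_l => //; rewrite /r; nra.
    by rewrite /C1; lra.
  apply/Rle_div_l => //; apply: Rle_trans N _.
  have -> : C1 * r = 2 * C1 / c * (c / 2 * r) by field; lra.
  apply: Rmult_le_compat_l => //.
  by apply: Rmult_le_pos; [lra | apply: Rlt_le; apply: Rinv_0_lt_compat].
rewrite (Cmod_mult (F0 * A)%C) Cmod_div ?Cmod_mult; last exact: Cmult_neq_0.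
have K : Cmod (W0 - l)%C / (Cmod W0 * Cmod l) <= 2 * C0 / (c * c).
  apply/Rle_div_l; first exact: Rmult_lt_0_compat.
  apply: Rle_trans wl _.
  have -> : C0 * (r * r) = 2 * C0 / (c * c) * ((c / 2 * r) * (c * r)) by field; lra.
  apply: Rmult_le_compat_l.
    by apply: Rmult_le_pos; [lra | apply: Rlt_le; apply: Rinv_0_lt_compat; nra].
  by apply: Rmult_le_compat => //; nra.
have -> : 2 * (Cmod F0 * Cmod A * C0) / (c * c) = Cmod F0 * Cmod A * (2 * C0 / (c * c)).
  by rewrite /Rdiv; ring.
by apply: Rmult_le_compat_l => //; nra.
Qed.
End Jump.

Lemma near_all (I : finType) (Q : I -> R -> R -> Prop) x :
  (forall i, exists2 rho, 0 < rho & forall h y, 0 < h < rho -> Rabs (y - x) < rho -> Q i h y) ->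
  exists2 rho, 0 < rho & forall h y, 0 < h < rho -> Rabs (y - x) < rho -> forall i, Q i h y.
Proof.
move=> H; suff [rho r0 Hr] : exists2 rho, 0 < rho & forall h y, 0 < h < rho -> Rabs (y - x) < rho ->
   forall i, i \in enum I -> Q i h y.
  by exists rho => // h y Hh Hy i; apply: Hr => //; rewrite mem_enum.
elim: (enum I) => [|i r [rho r0 Hr]]; first by exists 1; first exact: Rlt_0_1.
have [rho' r'0 Hr'] := H i.
exists (Rmin rho rho') => [|h y Hh Hy j]; first exact: Rmin_pos.
have n1 := Rmin_l rho rho'; have n2 := Rmin_r rho rho'.
rewrite inE => /orP [/eqP ->|jr]; first by apply: Hr'; lra.
by apply: Hr => //; lra.
Qed.

Lemma Cmod_sum (I : finType) (P : pred I) (f : I -> C) e : 0 <= e ->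
  (forall i, P i -> Cmod (f i) <= e) ->
  Cmod (\big[Cplus/RtoC 0]_(i | P i) f i) <= INR #|I| * e.
Proof.
move=> e0 H; rewrite cardE -[index_enum I]/(index_enum I).
have -> : enum I = index_enum I by rewrite enumT.
elim: (index_enum I) => [|i r IH]; first by rewrite big_nil Cmod_0 /=; lra.
rewrite big_cons; rewrite -/(size _) [size (i :: r)]/= S_INR.
case: ifP => Pi; last by lra.
by apply: Rle_trans (Cmod_triangle _ _) _; have := H i Pi; lra.
Qed.

Lemma In_mem (T : eqType) (x : T) (s : seq T) : x \in s -> List.In x s.
Proof.
by elim: s => //= y s IH; rewrite inE => /orP [/eqP ->|/IH]; [left | right].
Qed.

Section Jump.
Variables (g g1 g2 : R -> C) (F Ft Fs W w : R -> R -> C).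
Hypothesis GD : green_data g g1 g2 F Ft Fs W w.

Lemma Rabs_lt_opp h r : 0 < h < r -> Rabs h < r /\ Rabs (- h) < r.
Proof. by move=> Hh; rewrite Rabs_Ropp Rabs_pos_eq; lra. Qed.

Lemma lkern_small A B x y e : det2 A B <> 0 -> y <> x -> 0 < e ->
  exists2 rho, 0 < rho & forall h s, 0 < h < rho -> Rabs (s - y) < rho ->
    Cmod (lkern A B x h s - lkern A B x (- h) s)%C <= e.
Proof.
move=> D yx e0.
have e2 : 0 < e / 2 by lra.
have [|r r0 Hr] := Ccts2P (lkern_cts2 (x := x) (h := 0) (s := y) D _) e2; first by left; lra.
exists r => // h s Hh Hs; have [h1 h2] := Rabs_lt_opp Hh.
have K1 := Hr h s; have K2 := Hr (- h) s.
rewrite !Rminus_0_r in K1 K2.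
rewrite (_ : (_ - _)%C = ((lkern A B x h s - lkern A B x 0 y) - (lkern A B x (Ropp h) s - lkern A B x 0 y))%C); last by ring.
apply: Rle_trans (Cmod_triangle _ _) _; rewrite Cmod_opp.
by have := K1 h1 Hs; have := K2 h2 Hs; lra.
Qed.

(** After subtraction of the linear models, what is left of the difference between the kernels
    at sg + h and sg - h is bounded and tends to 0 off the crossings, so that its integral
    tends to 0; the linear models contribute the jumps. *)
Lemma kern_jump a d sg (I : finType) (act : pred I) (tt : I -> R) :
  0 < a -> a <= d -> d < 1 -> 0 < sg < 1 ->
  (forall l, act l -> [/\ a < tt l < d, g (tt l) = g sg & det2 (g1 (tt l)) (g1 sg) <> 0]) ->
  (forall l l', act l -> act l' -> tt l = tt l' -> l = l') ->
  (forall s, a <= s <= d -> g s = g sg -> exists2 l, act l & s = tt l) ->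
  (exists2 r0, 0 < r0 & forall h s, h <> 0 -> Rabs h < r0 -> a <= s <= d -> g s <> g (sg + h)) ->
  Clim0 (fun h => CInt (kern g g1 F (sg + h)) a d - CInt (kern g g1 F (sg - h)) a d)%C
    (\csum_(l : I) (if act l then two_pi_i *
       RtoC (if Rlt_dec 0 (det2 (g1 (tt l)) (g1 sg)) then 1 else - 1) * F sg (tt l) else 0)).
Proof.
move=> a0 ad d1 Hsg Hact Hinj Hcomp [r0 r00 Hr0].
pose LK l h s := lkern (g1 (tt l)) (g1 sg) (tt l) h s.
pose D l h s : C := if act l then (F sg (tt l) * (LK l h s - LK l (Ropp h) s))%C else RtoC 0.
(* subtract, at each active crossing, the difference of the linear models at h and - h *)
pose phi h s := (kern g g1 F (sg + h) s - kern g g1 F (sg - h) s - \csum_(l : I) D l h s)%C.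
have [rs rs0 Hrs] := near_itv Hsg.
pose r1 := Rmin r0 rs.
have r10 : 0 < r1 by apply: Rmin_pos.
have n0 : r1 <= r0 := Rmin_l _ _; have n1 : r1 <= rs := Rmin_r _ _.
have dom h s : h <> 0 -> Rabs h < r1 -> a <= s <= d -> [/\ 0 < sg + h < 1, 0 < s < 1 & g s <> g (sg + h)].
  move=> h0 Hh Hs; split; [|lra | by apply: Hr0 => //; lra].
  by apply: Hrs; rewrite (_ : sg + h - sg = h); [lra | ring].
have Kc h s : h <> 0 -> Rabs h < r1 -> a <= s <= d -> Ccts (kern g g1 F (sg + h)) s.
  by move=> h0 Hh Hs; apply: (Ccts2_slice (f := kern g g1 F)); apply: (kern_cts2 GD); apply: dom.
have Dc l h s : h <> 0 -> Ccts (D l h) s.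
  move=> h0; rewrite /D; case al: (act l); last exact: Ccts_const.
  have [_ _ Dl] := Hact _ al.
  apply: Ccts_mult; first exact: Ccts_const.
  apply: Ccts_minus; apply: (Ccts2_slice (f := lkern _ _ _)); apply: lkern_cts2 => //; right; lra.
have phc h : 0 < h < r1 -> Con (phi h) a d.
  move=> Hh s Hs; have [h1 h2] := Rabs_lt_opp Hh.
  apply: Ccts_minus; last by apply: Ccts_sum => l; apply: Dc; lra.
  by apply: Ccts_minus; apply: Kc => //; lra.
have Dsm l y e : ~ (act l /\ y = tt l) -> 0 < e -> exists2 rho, 0 < rho & forall h s, 0 < h < rho ->
    Rabs (s - y) < rho -> Cmod (D l h s) <= e.
  move=> yl e0; rewrite /D; case al: (act l); last first.
    by exists 1 => [|h s _ _]; [lra | rewrite Cmod_0; lra].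
  have [_ _ Dl] := Hact _ al.
  have ne : y <> tt l by move=> E; apply: yl.
  have f0 := Cmod_ge_0 (F sg (tt l)).
  have e'0 : 0 < e / (Cmod (F sg (tt l)) + 1) by apply: Rdiv_lt_0_compat; lra.
  have [r r_0 Hr] := lkern_small Dl ne e'0.
  exists r => // h s Hh Hs; rewrite Cmod_mult.
  apply: Rle_trans (_ : Cmod (F sg (tt l)) * (e / (Cmod (F sg (tt l)) + 1)) <= _).
    by apply: Rmult_le_compat_l => //; apply: Hr.
  have -> : Cmod (F sg (tt l)) * (e / (Cmod (F sg (tt l)) + 1)) = e - e / (Cmod (F sg (tt l)) + 1) by field; lra.
  by lra.
have lim0 : Clim0 (fun h => CInt (phi h) a d) 0%C.
  suff H e : 0 < e -> exists2 rho, 0 < rho & forall h, 0 < h < rho -> Cmod (CInt (phi h) a d) < e.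
    move=> e /H [rho rho0 Hrho]; exists rho => // h /Hrho.
    by rewrite (_ : (CInt (phi h) a d - 0)%C = CInt (phi h) a d) //; ring.
  move=> e0; have N0 : 0 <= INR #|I| := pos_INR _.
  apply: (@bounded_convergence [seq tt l | l <- enum I & act l] phi a d r1) => // x Hx.
    case: (Classical_Prop.classic (exists2 l, act l & x = tt l)) => [[l al xl]|N].
      have [Hl gl Dl] := Hact _ al; subst x.
      have Hl1 : 0 < tt l < 1 by lra.
      have [M [rho rho0 HM]] := kern_singular GD Hsg Hl1 gl Dl.
      have [|r' r'0 Hr'] := @near_all I (fun l' h s => l' != l -> Cmod (D l' h s) <= 1) (tt l).
        move=> l'; case: (eqVneq l' l) => [_|ll].
          by exists 1 => //; exact: Rlt_0_1.
        have [[al' E]||r r_0 Hr] := Dsm l' (tt l) 1; last by exists r => // h s Hh Hs _; apply: Hr.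
          by case/eqP: ll; apply: Hinj.
        exact: Rlt_0_1.
      exists (2 * M + INR #|I| * 1); exists (Rmin (Rmin rho r') r1); first by do !apply: Rmin_pos.
      move=> h y Hh Hy; have m0 := Rmin_l (Rmin rho r') r1; have m1 := Rmin_r (Rmin rho r') r1.
      have m2 := Rmin_l rho r'; have m3 := Rmin_r rho r'.
      have Hh' : 0 < h < rho by lra.
      have [h1 h2] := Rabs_lt_opp Hh'.
      rewrite /phi (bigD1 l) //= {1}/D al.
      have S1 : Cmod (\big[Cplus/RtoC 0]_(i | i != l) D i h y) <= INR #|I| * 1.
        by apply: Cmod_sum => [|i il]; [lra | apply: Hr' => //; lra].
      set S := \big[_/_]_(_ | _) _ in S1 *.
      rewrite (_ : (_ - _)%C = ((kern g g1 F (Rplus sg h) y - F sg (tt l) * LK l h y)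
         - (kern g g1 F (Rplus sg (Ropp h)) y - F sg (tt l) * LK l (Ropp h) y) - S)%C); last first.
        by rewrite /Rminus; ring.
      apply: Rle_trans (Cmod_triangle _ _) _; rewrite Cmod_opp; apply: Rplus_le_compat => //.
      apply: Rle_trans (Cmod_triangle _ _) _; rewrite Cmod_opp.
      have := HM h y; have := HM (- h) y; rewrite -/(LK l _ _) => K1 K2.
      have := K1 _ h2; have := K2 _ h1.
      by move=> /(_ _ _) A1 /(_ _ _) A2; have := A1 ltac:(lra) ltac:(lra);
         have := A2 ltac:(lra) ltac:(lra); rewrite /LK; lra.
    have Hx1 : 0 < x < 1 by lra.
    have ne : g x <> g sg by move=> E; apply: N; apply: Hcomp.
    have kc : Ccts2 (kern g g1 F) sg x by apply: (kern_cts2 GD).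
    have [r r_0 Hr] := Ccts2P kc Rlt_0_1.
    have [|r' r'0 Hr'] := @near_all I (fun l' h s => Cmod (D l' h s) <= 1) x.
      move=> l; apply: Dsm; last exact: Rlt_0_1.
      by move=> [al E]; apply: N; exists l.
    exists (2 + INR #|I| * 1); exists (Rmin r r'); first exact: Rmin_pos.
    move=> h y Hh Hy; have m0 := Rmin_l r r'; have m1 := Rmin_r r r'.
    have Hh' : 0 < h < r by lra.
    have [h1 h2] := Rabs_lt_opp Hh'.
    have S1 : Cmod (\csum_(l : I) D l h y) <= INR #|I| * 1.
      by apply: Cmod_sum => [|i _]; [lra | apply: Hr' => //; lra].
    rewrite /phi (_ : (_ - _)%C = ((kern g g1 F (Rplus sg h) y - kern g g1 F sg x)
       - (kern g g1 F (Rplus sg (Ropp h)) y - kern g g1 F sg x) - \csum_(l : I) D l h y)%C); last first.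
      by rewrite /Rminus; ring.
    apply: Rle_trans (Cmod_triangle _ _) _; rewrite Cmod_opp; apply: Rplus_le_compat => //.
    apply: Rle_trans (Cmod_triangle _ _) _; rewrite Cmod_opp.
    have := Hr (sg + h) y; have := Hr (sg + - h) y.
    rewrite (_ : sg + - h - sg = - h); last by ring.
    rewrite (_ : sg + h - sg = h); last by ring.
    by move=> A1 A2; have := A1 h2 ltac:(lra); have := A2 h1 ltac:(lra); lra.
  move=> xL eps eps0.
  have N l : act l -> x <> tt l.
    move=> al E; apply: xL; rewrite E; apply/List.in_map_iff; exists l; split => //.
    by apply/List.filter_In; split => //; apply/(@In_mem I); rewrite mem_enum.
  have Hx1 : 0 < x < 1 by lra.
  have ne : g x <> g sg by move=> E; have [l al xl] := Hcomp x Hx E; apply: (N l).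
  have kc : Ccts2 (kern g g1 F) sg x by apply: (kern_cts2 GD).
  have e4 : 0 < eps / 4 by lra.
  have [r r_0 Hr] := Ccts2P kc e4.
  have ek : 0 < eps / (4 * (INR #|I| + 1)) by apply: Rdiv_lt_0_compat; lra.
  have [|r' r'0 Hr'] := @near_all I (fun l' h s => Cmod (D l' h s) <= eps / (4 * (INR #|I| + 1))) x.
    move=> l; apply: Dsm => //.
    by move=> [al E]; apply: (N l).
  exists (Rmin r r'); first exact: Rmin_pos.
  move=> h y Hh Hy; have m0 := Rmin_l r r'; have m1 := Rmin_r r r'.
  have Hh' : 0 < h < r by lra.
  have [h1 h2] := Rabs_lt_opp Hh'.
  have S1 : Cmod (\csum_(l : I) D l h y) <= INR #|I| * (eps / (4 * (INR #|I| + 1))).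
    by apply: Cmod_sum => [|i _]; [lra | apply: Hr' => //; lra].
  have S2 : INR #|I| * (eps / (4 * (INR #|I| + 1))) <= eps / 4.
    have -> : INR #|I| * (eps / (4 * (INR #|I| + 1))) = eps / 4 - eps / (4 * (INR #|I| + 1)) by field; lra.
    by lra.
  rewrite /phi (_ : (_ - _)%C = ((kern g g1 F (Rplus sg h) y - kern g g1 F sg x)
     - (kern g g1 F (Rplus sg (Ropp h)) y - kern g g1 F sg x) - \csum_(l : I) D l h y)%C); last first.
    by rewrite /Rminus; ring.
  apply: Rle_lt_trans (Cmod_triangle _ _) _; rewrite Cmod_opp.
  have T2 : Cmod ((kern g g1 F (Rplus sg h) y - kern g g1 F sg x)
     - (kern g g1 F (Rplus sg (Ropp h)) y - kern g g1 F sg x))%C <= eps / 2.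
    apply: Rle_trans (Cmod_triangle _ _) _; rewrite Cmod_opp.
    have := Hr (sg + h) y; have := Hr (sg + - h) y.
    rewrite (_ : sg + - h - sg = - h); last by ring.
    rewrite (_ : sg + h - sg = h); last by ring.
    by move=> A1 A2; have := A1 h2 ltac:(lra); have := A2 h1 ltac:(lra); lra.
  by lra.
pose Dint l h := CInt (D l h) a d.
have limD l : Clim0 (Dint l) (if act l then two_pi_i *
       RtoC (if Rlt_dec 0 (det2 (g1 (tt l)) (g1 sg)) then 1 else - 1) * F sg (tt l) else 0)%C.
  rewrite /Dint /D; case al: (act l); last first.
    apply: Clim0_ext (Clim0_const _); first exact: Rlt_0_1.
    move=> h _; by have := @CInt_FTC (fun=> 0%C) (fun=> 0%C) a d ad (fun x _ => Cder_const 0 x) (@Con_const 0%C a d) => ->; ring.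
  have [Hl _ Dl] := Hact _ al.
  have H := Clim0_scal (F sg (tt l)) (lkern_jump Dl Hl).
  rewrite Cmult_comm; apply: (Clim0_ext Rlt_0_1) H => h Hh.
  rewrite CInt_scal // => s Hs.
  by apply: Ccts_minus; apply: (Ccts2_slice (f := lkern _ _ _)); apply: lkern_cts2 => //; right; lra.
have H := Clim0_plus lim0 (Clim0_sum limD).
rewrite Cplus_0_l in H.
apply: (Clim0_ext r10) H => h Hh.
have [h1 h2] := Rabs_lt_opp Hh.
have h0 : h <> 0 by lra.
have h0' : - h <> 0 by lra.
have c1 : Con (kern g g1 F (sg + h)) a d by move=> s Hs; apply: Kc.
have c2 : Con (kern g g1 F (sg - h)) a d by move=> s Hs; apply: Kc.
have c3 : Con (fun s => \csum_(l : I) D l h s) a d by move=> s Hs; apply: Ccts_sum => l; apply: Dc.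
rewrite /phi CInt_minus // ?CInt_minus //; last first.
  by move=> s Hs; apply: Ccts_minus; [apply: c1 | apply: c2].
have -> : \csum_(l : I) Dint l h = CInt (fun s => \csum_(l : I) D l h s) a d.
  by rewrite CInt_sum // => l s Hs; apply: Dc.
by ring.
Qed.
End Jump.

(** * Integration of the kernel over a triangle with crossings *)

Lemma finite_between (I : finType) (P : pred I) (f : I -> R) lo hi : lo < hi ->
  (forall i, P i -> f i < hi) ->
  exists2 d, lo < d < hi & forall i, P i -> f i < d.
Proof.
move=> lh H.
suff [d Hd K] : exists2 d, lo < d < hi & forall i, i \in enum I -> P i -> f i < d.
  by exists d => // i; apply: K; rewrite mem_enum.
elim: (enum I) => [|i r [d Hd K]]; first by exists ((lo + hi) / 2) => //; lra.
case Pi: (P i); last first.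
  by exists d => // j; rewrite inE => /orP [/eqP ->|/K //]; rewrite Pi.
have fh := H i Pi.
exists ((Rmax d (f i) + hi) / 2); first by rewrite /Rmax; case: Rle_dec; lra.
move=> j; rewrite inE => /orP [/eqP -> _|jr Pj].
  by have := Rmax_r d (f i); lra.
by have := K j jr Pj; have := Rmax_l d (f i); have := Rmax_r d (f i);
   rewrite /Rmax; case: Rle_dec; lra.
Qed.

Lemma near_all1 (I : finType) (Q : I -> R -> Prop) x :
  (forall i, exists2 rho, 0 < rho & forall y, Rabs (y - x) < rho -> Q i y) ->
  exists2 rho, 0 < rho & forall y, Rabs (y - x) < rho -> forall i, Q i y.
Proof.
move=> H; have [|rho r0 Hr] := @near_all I (fun i _ y => Q i y) x.
  by move=> i; have [r r0 Hr] := H i; exists r => // h y _; apply: Hr.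
by exists rho => // y Hy; apply: (Hr (rho / 2)) => //; lra.
Qed.

Section Stokes.
Variables (g g1 g2 : R -> C) (F Ft Fs W w : R -> R -> C).
Hypothesis GD : green_data g g1 g2 F Ft Fs W w.
Variables (I : finType) (tt ss : I -> R) (a b eta : R).
Hypotheses (a0 : 0 < a) (b1 : b < 1) (eta0 : 0 < eta) (ab : a + eta < b).
Hypothesis Hts : forall l, [/\ a < tt l, tt l + eta < ss l & ss l < b].
Hypothesis Hx : forall l, g (tt l) = g (ss l) /\ det2 (g1 (tt l)) (g1 (ss l)) <> 0.
Hypothesis Hinj : forall l l', tt l = tt l' -> ss l = ss l' -> l = l'.
Hypothesis Hcomp : forall u v, 0 < u < v -> v < 1 -> g u = g v -> exists2 l, u = tt l & v = ss l.

(** The boundary form obtained from green_derive with the moving end t - eta. *)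
Definition side_form (t : R) : C :=
  (- two_pi_i * (W t (Rminus t eta) - W t a)
   - F t (Rminus t eta) * (g1 t / (g (Rminus t eta) - g t))
   + F t a * (g1 t / (g a - g t)) + kern g g1 F t (Rminus t eta) * RtoC 1)%C.

Definition jump_at (l : I) : C := (two_pi_i *
  RtoC (if Rlt_dec 0 (det2 (g1 (tt l)) (g1 (ss l))) then 1 else - 1) * F (ss l) (tt l))%C.

(** J(t), the integral of the kernel over [a, t - eta], has derivative side_form off the
    parameters s_l and jumps there. The jumps are independent of eta as soon as eta is smaller
    than all the s_l - t_l. *)
Lemma stokes :
  (CInt (kern g g1 F b) a (b - eta) - \csum_(l : I) jump_at l)%C = CInt side_form (a + eta) b.
Proof.
pose L := [seq ss l | l <- enum I].
have inL l : List.In (ss l) L.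
  by apply/List.in_map_iff; exists l; split => //; apply: In_mem; rewrite mem_enum.
have cg u : 0 < u < 1 -> Ccts g u by move=> Hu; apply: Cder_cont; apply: (gd_g GD).
have cg1 u : 0 < u < 1 -> Ccts g1 u by move=> Hu; apply: Cder_cont; apply: (gd_g1 GD).
have offL t s : 0 < s < t -> t < 1 -> ~ List.In t L -> g s <> g t.
  by move=> Hs Ht tL E; have [l _ El] := Hcomp Hs Ht E; apply: tL; rewrite El.
have ne_eta t : eta < t < 1 -> g (t - eta) <> g t.
  move=> Ht E; have Ht1 : 0 < t - eta < t by lra.
  have Ht2 : t < 1 by lra.
  by have [l E1 E2] := Hcomp Ht1 Ht2 E; have [] := Hts l; lra.
have ne_a t : a < t < 1 -> g a <> g t.
  move=> Ht E; have Ht1 : 0 < a < t by lra.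
  have Ht2 : t < 1 by lra.
  by have [l E1 E2] := Hcomp Ht1 Ht2 E; have [] := Hts l; lra.
pose lo := (Rmax a eta + (a + eta)) / 2; pose hi := (b + 1) / 2.
have [lo1 lo2 lo3] : [/\ a < lo, eta < lo & lo < a + eta].
  by rewrite /lo /Rmax; case: Rle_dec; split; lra.
have [hi1 hi2] : b < hi /\ hi < 1 by rewrite /hi; lra.
have csf : Con side_form lo hi.
  move=> t Ht.
  have Ht0 : 0 < t < 1 by lra.
  have Hte : 0 < t - eta < 1 by lra.
  have ct : continuous (fun t => t - eta) t.
    by apply: (@continuous_minus R_UniformSpace R_AbsRing R_NormedModule);
      [exact: continuous_id | exact: continuous_const].
  have ca : continuous (fun t : R => a) t by exact: continuous_const.
  have n1 : g (t - eta) <> g t by apply: ne_eta; lra.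
  have n2 : g a <> g t by apply: ne_a; lra.
  have q1 : Ccts (fun t => g (t - eta)) t by apply: (Ccts_comp ct); apply: cg.
  apply: Ccts_plus; first apply: Ccts_plus; first apply: Ccts_minus.
  - apply: Ccts_mult; first exact: Ccts_const.
    by apply: Ccts_minus; apply: (Ccts2_curve (f := W)) => //; apply: (gd_cW GD) => //; lra.
  - apply: Ccts_mult; first by apply: (Ccts2_curve (f := F)) => //; apply: (gd_cF GD).
    apply: Ccts_mult; first exact: cg1.
    by apply: Ccts_inv; [apply: Ccts_minus => //; apply: cg | apply: Csub_neq].
  - apply: Ccts_mult; first by apply: (Ccts2_curve (f := F)) => //; apply: (gd_cF GD) => //; lra.
    apply: Ccts_mult; first exact: cg1.
    by apply: Ccts_inv; [apply: Ccts_minus; [exact: Ccts_const | exact: cg] | apply: Csub_neq].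
  apply: Ccts_mult; last exact: Ccts_const.
  by apply: (Ccts2_curve (f := kern g g1 F)) => //; apply: (kern_cts2 GD).
pose S t := \csum_(l : I) (if Rlt_dec (ss l) t then jump_at l else RtoC 0).
pose J t := CInt (kern g g1 F t) a (t - eta).
pose phi t := (J t - S t - CInt side_form lo t)%C.
have Sa : S (a + eta) = 0%C.
  rewrite /S big1 // => l _; case: Rlt_dec => //= K; have [] := Hts l; lra.
have Sb : S b = \csum_(l : I) jump_at l.
  by apply: eq_bigr => l _; case: Rlt_dec => //= K; have [] := Hts l; lra.
have Ja : J (a + eta) = 0%C by rewrite /J (_ : a + eta - eta = a) ?CInt_point //; ring.
have dte x : is_derive (fun t => t - eta) x 1 by auto_derive => //; ring.
have Lab x : List.In x L -> a + eta < x < b.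
  by move/List.in_map_iff => [l [<- _]]; have [] := Hts l; lra.
have Con_kern t c : 0 < c -> t - eta < 1 -> c <= t - eta -> t < 1 -> ~ List.In t L -> Con (kern g g1 F t) c (t - eta).
  move=> c0 t1 ct t1' tL s Hs; apply: (Ccts2_slice (f := kern g g1 F)); apply: (kern_cts2 GD).
  by split; try lra; apply: offL => //; lra.
have E : phi b = phi (a + eta).
  apply: (@eq_off_finite L) => [|x Hxab xL|x Hxab xL| |]; first by lra.
  - have jd : Cder J x (side_form x).
      apply: (green_derive GD a0 _ _ _ (dte x)); try lra.
      by move=> s Hs; apply: offL => //; lra.
    have Sd : Cder S x 0.
      have [|r r0 Hr] := @near_all1 I (fun l y => (ss l < y) <-> (ss l < x)) x.
        move=> l; have nx : ss l <> x by move=> El; apply: xL; rewrite -El.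
        exists (Rabs (x - ss l)); first by apply: Rabs_pos_lt; lra.
        move=> y; move/Rabs_lt_between; rewrite /Rabs; case: Rcase_abs => K1 K2; split; lra.
      apply: (Cder_ext_loc (f := fun=> S x)); last exact: Cder_const.
      exists (mkposreal _ r0) => y Hy; apply: eq_bigr => l _.
      have K := Hr y Hy l; case: (Rlt_dec (ss l) x) => K1; case: (Rlt_dec (ss l) y) => K2 //=; exfalso; tauto.
    have Id : Cder (fun t => CInt side_form lo t) x (side_form x).
      by apply: (@Cder_CInt _ lo x hi) => //; lra.
    apply: Cder_eq; first apply: Cder_minus; first apply: Cder_minus; [exact: jd | exact: Sd | exact: Id |].
    by ring.
  (* several crossings may share the parameter x = ss l; they jump together *)
  - pose act l := if Req_EM_T (ss l) x then true else false.
    have actP l : act l = true <-> ss l = x by rewrite /act; case: Req_EM_T.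
    have x01 : 0 < x < 1 by lra.
    (* cut at d so that all crossings of parameter x lie in [a,d], where kern_jump applies,
     while the integral over [d, t - eta] is continuous at x *)
    have [||d Hd Hdt] := @finite_between I act tt a (x - eta); [by lra | |].
    by move=> l /actP <-; have [] := Hts l; lra.
    have [|r r0 Hr] := @near_all1 I (fun l y => y <> x -> ss l <> y /\ ((act l = false) -> (ss l < y <-> ss l < x))) x.
      move=> l; case al: (act l).
        by exists 1 => [|y _ yx]; [lra | split => // /esym yl; apply: yx; rewrite yl; apply/actP].
      have nx : ss l <> x by move=> /actP; rewrite al.
      exists (Rabs (x - ss l)); first by apply: Rabs_pos_lt; lra.
      move=> y; move/Rabs_lt_between; rewrite /Rabs; case: Rcase_abs => K1 K2; split; lra.
    have yL y : Rabs (y - x) < r -> y <> x -> ~ List.In y L.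
      by move=> Hy yx /List.in_map_iff [l [El _]]; have [] := Hr y Hy l yx.
    have KJ := @kern_jump g g1 g2 F Ft Fs W w GD a d x I act tt.
    have {}KJ : Clim0 (fun h => CInt (kern g g1 F (x + h)) a d - CInt (kern g g1 F (x - h)) a d)%C
       (\csum_(l : I) (if act l then two_pi_i *
       RtoC (if Rlt_dec 0 (det2 (g1 (tt l)) (g1 x)) then 1 else - 1) * F x (tt l) else 0)).
      apply: KJ; try lra.
      + move=> l al; have ax := proj1 (actP l) al; have [] := Hts l; have [] := Hx l.
        by rewrite -ax => ? ? ? ? ?; split => //; split => //; apply: Hdt.
      + by move=> l l' /actP al /actP al' tl; apply: Hinj => //; rewrite al al'.
      + move=> s Hs gs; have Hsx : 0 < s < x by lra.
        have [l tl sl] := Hcomp Hsx (proj2 x01) gs.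
        by exists l => //; apply/actP.
      have dx : 0 < x - d by lra.
      exists (Rmin r (Rmin (x - d) (1 - x))); first by do !apply: Rmin_pos; lra.
      move=> h s h0 Hh Hs; have m1 := Rmin_l r (Rmin (x - d) (1 - x)).
      have m2 := Rmin_r r (Rmin (x - d) (1 - x)).
      have m3 := Rmin_l (x - d) (1 - x); have m4 := Rmin_r (x - d) (1 - x).
      have [hh1 hh2] := Rabs_def2 _ _ Hh.
      apply: offL; [lra | lra |]; apply: yL; last by lra.
      by rewrite (_ : x + h - x = h); [lra | ring].
    have c2 : Ccts (fun t => CInt (kern g g1 F t) d (t - eta)) x.
      apply: Cder_cont; apply: (green_derive GD _ _ _ _ (dte x)); try lra.
      move=> s Hs gs; have Hsx : 0 < s < x by lra.
      have [l tl sl] := Hcomp Hsx (proj2 x01) gs.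
      by have := Hdt l (proj2 (actP l) (esym sl)); lra.
    have c3 : Ccts (fun t => CInt side_form lo t) x.
      by apply: Cder_cont; apply: (@Cder_CInt _ lo x hi) => //; lra.
    have Lm := Clim0_minus (Clim0_plus KJ (Clim0_cont c2)) (Clim0_plus (Clim0_const
       (\csum_(l : I) (if act l then jump_at l else 0))) (Clim0_cont c3)).
    set l1 := (_ - _)%C in Lm.
    have l10 : l1 = 0%C.
      rewrite /l1 (_ : \csum_(l : I) (if act l then two_pi_i *
       RtoC (if Rlt_dec 0 (det2 (g1 (tt l)) (g1 x)) then 1 else - 1) * F x (tt l) else 0) =
       \csum_(l : I) (if act l then jump_at l else 0)); first by ring.
      by apply: eq_bigr => l _; case al: (act l) => //; rewrite /jump_at (proj1 (actP l) al).
    rewrite l10 in Lm; move=> e /Lm [r2 r20 Hr2].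
    exists (Rmin r2 (Rmin r (Rmin (1 - x) (x - eta - d)))); first by do !apply: Rmin_pos; lra.
    move=> h Hh; have m1 := Rmin_l r2 (Rmin r (Rmin (1 - x) (x - eta - d))).
    have m2 := Rmin_r r2 (Rmin r (Rmin (1 - x) (x - eta - d))).
    have m3 := Rmin_l r (Rmin (1 - x) (x - eta - d)); have m4 := Rmin_r r (Rmin (1 - x) (x - eta - d)).
    have m5 := Rmin_l (1 - x) (x - eta - d); have m6 := Rmin_r (1 - x) (x - eta - d).
    have {}Hr2 := Hr2 h ltac:(lra).
    have hp : Rabs (x + h - x) < r by rewrite (_ : x + h - x = h); [rewrite Rabs_pos_eq; lra | ring].
    have hm : Rabs (x - h - x) < r.
      by rewrite (_ : x - h - x = - h); [rewrite Rabs_Ropp Rabs_pos_eq; lra | ring].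
    have xpL : ~ List.In (x + h) L by apply: yL => //; lra.
    have xmL : ~ List.In (x - h) L by apply: yL => //; lra.
    have Jsplit t : t < 1 -> d <= t - eta -> ~ List.In t L ->
        J t = (CInt (kern g g1 F t) a d + CInt (kern g g1 F t) d (t - eta))%C.
      by move=> t1 dt tL; apply: CInt_Chasles; [lra | apply: Con_kern => //; lra].
    have SS : (S (Rplus x h) - S (Rminus x h))%C = \csum_(l : I) (if act l then jump_at l else 0).
      rewrite /S; have subE : forall A B D : C, A = (B + D)%C -> (A - B)%C = D by move=> A B D ->; ring.
      apply: subE.
      rewrite -big_split /=; apply: eq_bigr => l _; case al: (act l).
        have sl := proj1 (actP l) al.
        case: (Rlt_dec (ss l) (x + h)) => [K1|K1]; last by lra.
        case: (Rlt_dec (ss l) (x - h)) => [K2|K2] /=; first by lra.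
        by rewrite Cplus_0_l.
      have [_ /(_ al) E1] := Hr _ hp l ltac:(lra).
      have [_ /(_ al) E2] := Hr _ hm l ltac:(lra).
      rewrite Cplus_0_r; case: (Rlt_dec (ss l) (x + h)) => K1; case: (Rlt_dec (ss l) (x - h)) => K2 //=;
        exfalso; tauto.
    move: Hr2; rewrite /phi !Jsplit //; try lra.
    rewrite -SS; congr (Cmod _ < _); by ring.
  - by move/Lab; lra.
  by move/Lab; lra.
move: E; rewrite /phi Sa Sb Ja (@CInt_Chasles side_form lo (a + eta) b); [|lra|]; last first.
  by move=> t Ht; apply: csf; lra.
move=> E; rewrite -/(J b).
have -> : (J b - \csum_(l : I) jump_at l = (J b - \csum_(l : I) jump_at l -
  (CInt side_form lo (a + eta) + CInt side_form (a + eta) b)) + 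
  (CInt side_form lo (a + eta) + CInt side_form (a + eta) b))%C by ring.
by rewrite E; ring.
Qed.
End Stokes.

(** * The diagonal side: turning of the tangent *)

(** The step is |h|^3, extended by the derivative at h = 0 so that the passage to the limit is
    continuity at a point of the plane. *)
Definition diff_quot (k k1 : R -> C) (u : R * R) : C :=
  if Req_dec_T u.1 0 then k1 u.2
  else ((k u.2 - k (Rminus u.2 (Rabs u.1 ^ 3))) / RtoC (Rabs u.1 ^ 3))%C.

Lemma abs_cube_le r : Rabs r < 1 -> 0 <= Rabs r ^ 3 <= Rabs r.
Proof.
move=> r1; have r0 := Rabs_pos r; split; first exact: pow_le.
have : 0 <= Rabs r * Rabs r <= 1 by nra.
by rewrite /=; nra.
Qed.

Lemma diff_quot_cts (k k1 : R -> C) x : 0 < x < 1 ->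
  (forall y, 0 < y < 1 -> Cder k y (k1 y)) -> (forall y, 0 < y < 1 -> Ccts k1 y) ->
  Ccts (diff_quot k k1) (0, x).
Proof.
move=> Hx Hk Hk1; apply/CcontP => e e0.
have [r Hr] := proj1 (CcontP _ _) (Hk1 x Hx) (e / 4) ltac:(lra).
have [r' r'0 Hr'] := near_itv Hx.
have nearx y : Rabs (y - x) < Rmin r r' -> Cmod (k1 y - k1 x)%C < e / 4 /\ 0 < y < 1.
  move=> Hy; have m1 := Rmin_l r r'; have m2 := Rmin_r r r'.
  by split; [apply: Hr; apply: Rlt_le_trans Hy _ | apply: Hr'; lra].
have rm : 0 < Rmin r r' by apply: Rmin_pos => //; exact: cond_pos.
pose rho := Rmin (Rmin r r' / 2) (1 / 2).
have rho0 : 0 < rho by apply: Rmin_pos; lra.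
have m1 := Rmin_l (Rmin r r' / 2) (1 / 2); have m2 := Rmin_r (Rmin r r' / 2) (1 / 2).
rewrite -/rho in m1 m2.
exists (mkposreal _ rho0) => -[h y] [/= Bh By].
have {Bh} Hh : Rabs h < rho.
  by move: Bh; rewrite /ball /= /AbsRing_ball /abs /minus /plus /opp /= Ropp_0 Rplus_0_r.
have {By} Hy : Rabs (y - x) < rho.
  by move: By; rewrite /ball /= /AbsRing_ball /abs /minus /plus /opp /=.
rewrite /diff_quot /=; case: (Req_dec_T 0 0) => // ? /=.
have [n1 n2] := nearx y ltac:(lra).
case: (Req_dec_T h 0) => h0 /=; first by lra.
have [c0 c1] := @abs_cube_le h ltac:(lra).
have a0 : 0 < Rabs h by apply: Rabs_pos_lt.
have {}c0 : 0 < Rabs h ^ 3 by apply: pow_lt.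
set eta := Rabs h ^ 3 in c0 c1 *.
have Hn s : y - eta <= s <= y -> Cmod (k1 s - k1 x)%C < e / 4 /\ 0 < s < 1.
  move=> Hs; apply: nearx; move/Rabs_lt_between: Hy => Hy.
  by apply: Rabs_def1; lra.
have cs : Con k1 (Rminus y eta) y by move=> s Hs; apply: Hk1; have [] := Hn s Hs.
have le : Rminus y eta <= y by lra.
have E : ((k y - k (Rminus y eta)) / RtoC eta - k1 x =
    / RtoC eta * CInt (fun s => k1 s - k1 x) (Rminus y eta) y)%C.
  rewrite CInt_minus //; last exact: Con_const.
  rewrite (@CInt_FTC k k1) //; last by move=> s Hs; apply: Hk; have [] := Hn s Hs.
  rewrite (@CInt_FTC (fun s => k1 x * RtoC s)%C (fun=> k1 x)) //; last exact: Con_const.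
    by rewrite RtoC_minus; field; case; lra.
  move=> s _; apply: Cder_eq (Cder_mult (Cder_const (k1 x) s) (Cder_id s)) _.
  by rewrite /=; ring.
rewrite E Cmod_mult Cmod_inv; last by case; lra.
rewrite Cmod_R Rabs_pos_eq; last by lra.
have B : Cmod (CInt (fun s => k1 s - k1 x)%C (Rminus y eta) y) <= 2 * (e / 4) * (y - (y - eta)).
  apply: CInt_bound => //.
    by move=> s Hs; apply: Ccts_minus; [apply: cs | exact: Ccts_const].
  by move=> s Hs; have [] := Hn s Hs; lra.
apply: Rle_lt_trans (_ : / eta * (2 * (e / 4) * (y - (y - eta))) < _).
  by apply: Rmult_le_compat_l => //; apply: Rlt_le; apply: Rinv_0_lt_compat.
rewrite (_ : / eta * (2 * (e / 4) * (y - (y - eta))) = e / 2); [lra | field; lra].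
Qed.

Lemma shift_cts x : continuous (fun u : R * R => Rminus u.2 (Rabs u.1 ^ 3)) ((0, x) : R * R).
Proof.
apply: (@continuous_minus (prod_UniformSpace R_UniformSpace R_UniformSpace) R_AbsRing R_NormedModule).
  exact: continuous_snd.
apply: (continuous_comp (fun u : R * R => Rabs u.1) (fun r => r ^ 3)).
  apply: (continuous_comp (U := prod_UniformSpace R_UniformSpace R_UniformSpace) fst Rabs).
    exact: continuous_fst.
  exact: continuous_Rabs.
by apply: (@ex_derive_continuous R_AbsRing R_NormedModule); auto_derive.
Qed.

Section Turning.
Variables (g g1 g2 : R -> C) (F : R -> R -> C) (c : C) (a b e0 : R).
Hypothesis Hg : forall y, 0 < y < 1 -> Cder g y (g1 y).
Hypothesis Hg1 : forall y, 0 < y < 1 -> Cder g1 y (g2 y).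
Hypothesis Hg2 : forall y, 0 < y < 1 -> Ccts g2 y.
Hypothesis g1_neq0 : forall y, 0 < y < 1 -> g1 y <> RtoC 0.
Hypothesis F_shift : forall x, 0 < x < 1 -> Ccts (fun u : R * R => F u.2 (Rminus u.2 (Rabs u.1 ^ 3))) (0, x).
Hypothesis F_diag : forall y, 0 < y < 1 -> F y y = c.
Hypothesis ab : 0 < a <= b /\ b < 1.
Hypothesis e00 : 0 < e0 < a.
Hypothesis sep : forall h y, 0 < h < e0 -> 0 < y - h ^ 3 -> y < 1 -> g (Rminus y (h ^ 3)) <> g y.
Hypothesis F_cts : forall h y, 0 < h < e0 -> a <= y <= b -> Ccts (fun s => F s (Rminus s (h ^ 3))) y.

(** The two boundary terms on the diagonal combine to
    (g'(s - eta) - g'(s)) / (g(s - eta) - g(s)), which tends to g'' / g'. The difference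
    quotients are jointly continuous, hence the convergence is locally uniform. *)
Lemma turning_limit : Clim0 (fun h => CInt (fun s => F s (Rminus s (h ^ 3)) *
    ((g1 (Rminus s (h ^ 3)) - g1 s) / (g (Rminus s (h ^ 3)) - g s)))%C a b)
  (c * CInt (fun s => g2 s / g1 s)%C a b)%C.
Proof.
have cube_bound h : 0 < h < e0 -> 0 < h ^ 3 <= h.
  move=> Hh; have := @abs_cube_le h; rewrite Rabs_pos_eq; last by lra.
  by have : 0 < h ^ 3; [apply: pow_lt; lra | lra].
pose f h s := (F s (Rminus s (h ^ 3)) * ((g1 (Rminus s (h ^ 3)) - g1 s) / (g (Rminus s (h ^ 3)) - g s)))%C.
have cg y : 0 < y < 1 -> Ccts g y by move=> Hy; apply: Cder_cont (Hg Hy).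
have cg1 y : 0 < y < 1 -> Ccts g1 y by move=> Hy; apply: Cder_cont (Hg1 Hy).
have cq y : 0 < y < 1 -> Ccts (fun s => c * (g2 s / g1 s))%C y.
  move=> Hy; apply: Ccts_mult; first exact: Ccts_const.
  by apply: Ccts_mult; [exact: Hg2 | apply: Ccts_inv; [exact: cg1 | exact: g1_neq0]].
have csh (k : R -> C) h y : 0 < y - h ^ 3 < 1 -> (forall x, 0 < x < 1 -> Ccts k x) ->
    Ccts (fun s => k (Rminus s (h ^ 3))) y.
  move=> Hs Hk; apply: (Ccts_comp (f := k)); last by apply: Hk.
  by apply: (@continuous_minus R_UniformSpace R_AbsRing R_NormedModule);
    [exact: continuous_id | exact: continuous_const].
have cf h : 0 < h < e0 -> Con (f h) a b.
  move=> Hh y Hy; have [h3 h3h] := @cube_bound h Hh.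
  have s1 : 0 < y - h ^ 3 by lra.
  have s2 := @sep h y Hh s1 ltac:(lra).
  apply: Ccts_mult; first exact: F_cts.
  apply: Ccts_mult; first by apply: Ccts_minus; [apply: (csh g1) => //; lra | apply: cg1; lra].
  apply: Ccts_inv; last exact: Csub_neq.
  by apply: Ccts_minus; [apply: (csh g) => //; lra | apply: cg; lra].
have local x : a <= x <= b -> forall e, 0 < e -> exists2 rho, 0 < rho & forall h y,
    0 < h < rho -> Rabs (y - x) < rho -> Cmod (f h y - c * (g2 y / g1 y))%C < e.
  move=> Hx e epos; have Hx' : 0 < x < 1 by lra.
  pose Phi (u : R * R) := (F u.2 (Rminus u.2 (Rabs u.1 ^ 3)) * (diff_quot g1 g2 u / diff_quot g g1 u) -
    c * (g2 u.2 / g1 u.2))%C.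
  have cP : Ccts Phi (0, x).
    apply: Ccts_minus; last first.
      apply: (Ccts_comp (g := snd) (f := fun y => c * (g2 y / g1 y))%C); last exact: cq.
      exact: continuous_snd.
    apply: Ccts_mult; first exact: F_shift.
    apply: Ccts_mult; first exact: diff_quot_cts.
    apply: Ccts_inv; first exact: diff_quot_cts.
    by rewrite /diff_quot /=; case: (Req_dec_T 0 0) => // ? /=; apply: g1_neq0.
  have P0 : Phi (0, x) = RtoC 0.
    rewrite /Phi /diff_quot /=; case: (Req_dec_T 0 0) => // ? /=.
    rewrite (_ : x - Rabs 0 * (Rabs 0 * (Rabs 0 * 1)) = x) ?F_diag //; last by rewrite Rabs_R0; ring.
    by ring.
  have [r Hr] := proj1 (CcontP _ _) cP e epos.
  have [r' r'0 Hr'] := near_itv Hx'.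
  exists (Rmin (Rmin r r') (Rmin e0 (a / 4))) => [|h y Hh Hy].
    by do !apply: Rmin_pos => //; [exact: cond_pos | lra | lra].
  have m1 := Rmin_l (Rmin r r') (Rmin e0 (a / 4)); have m2 := Rmin_r (Rmin r r') (Rmin e0 (a / 4)).
  have m3 := Rmin_l r r'; have m4 := Rmin_r r r'; have m5 := Rmin_l e0 (a / 4); have m6 := Rmin_r e0 (a / 4).
  have yx := Hr' y ltac:(lra).
  have [h3 h3h] := @cube_bound h ltac:(lra).
  have ya : 0 < y - h ^ 3 by move/Rabs_lt_between: Hy; lra.
  have B : ball ((0, x) : R * R) r ((h, y) : R * R).
    split; rewrite /ball /= /AbsRing_ball /abs /minus /plus /opp /=; last by apply: Rlt_le_trans Hy _; lra.
    by rewrite Ropp_0 Rplus_0_r Rabs_pos_eq; lra.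
  have := Hr _ B; rewrite P0 /Phi /diff_quot /=; case: (Req_dec_T h 0) => h0 /=; first by lra.
  rewrite Rabs_pos_eq; last by lra.
  have h3' : RtoC (h ^ 3) <> RtoC 0 by case; lra.
  have n1 : (g (Rminus y (h ^ 3)) - g y)%C <> RtoC 0 by apply: Csub_neq; apply: sep; lra.
  have n2 : (g y - g (Rminus y (h ^ 3)))%C <> RtoC 0 by apply: Csub_neq => /esym; apply: sep; lra.
  have -> : ((f h y - c * (g2 y / g1 y)) = F y (Rminus y (h ^ 3)) *
     ((g1 y - g1 (Rminus y (h ^ 3))) / RtoC (h ^ 3) / ((g y - g (Rminus y (h ^ 3))) / RtoC (h ^ 3))) -
     c * (g2 y / g1 y) - RtoC 0)%C by rewrite /f; field; split; [|split]; try done; apply: g1_neq0.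
  by [].
move=> e epos.
have [|h Hh|x Hx|x Hx _ e' e'0|rho rho0 Hrho] := @bounded_convergence [::]
  (fun h s => f h s - c * (g2 s / g1 s))%C a b e0 ltac:(lra) _ _ _ _ e epos; first by lra.
- by move=> y Hy; apply: Ccts_minus; [exact: cf | apply: cq; lra].
- by have [rho r0 Hr] := local x Hx 1 Rlt_0_1; exists 1, rho => // h y h1 h2; apply: Rlt_le; apply: Hr.
- by have [rho r0 Hr] := local x Hx e' e'0; exists rho.
exists (Rmin rho e0) => [|h Hh]; first by apply: Rmin_pos; lra.
have m1 := Rmin_l rho e0; have m2 := Rmin_r rho e0.
have cqq : Con (fun s => c * (g2 s / g1 s))%C a b by move=> y Hy; apply: cq; lra.
have := Hrho h ltac:(lra); rewrite CInt_minus //; try lra; last by apply: cf; lra.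
rewrite CInt_scal //; first by lra.
move=> y Hy; apply: Ccts_mult; first by apply: Hg2; lra.
by apply: Ccts_inv; [apply: cg1; lra | apply: g1_neq0; lra].
Qed.
End Turning.

(** * The Bose integrals of the zeta values *)

(** Up to the factor exp(j x), the integral of t^k/k! exp(-j t) over t > x: the closed form
    given by repeated integration by parts. *)
Fixpoint incgam (k : nat) (j x : R) : R :=
  (x ^ k / INR k`! + (if k is k'.+1 then incgam k' j x else 0)) / j.

Lemma INR_factS k : INR (k.+1)`! = INR k.+1 * INR k`!.
Proof. by rewrite factS -multE mult_INR. Qed.

Lemma INR_fact_gt0 k : 0 < INR k`!.
Proof. by apply: lt_0_INR; apply/ltP; exact: fact_gt0. Qed.

Lemma INR_S_gt0 k : 0 < INR k.+1.
Proof. by apply: lt_0_INR; apply/ltP. Qed.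

Lemma is_derive_pow_fact k x :
  is_derive (fun x => x ^ k.+1 / INR (k.+1)`!) x (x ^ k / INR k`!).
Proof.
have f0 := INR_fact_gt0 k; have f1 := INR_S_gt0 k.
rewrite INR_factS; auto_derive => //=; move: f1; rewrite -/(INR k.+1) => f1.
by field; lra.
Qed.

Lemma is_derive_incgam k j x : 0 < j ->
  is_derive (incgam k j) x (j * incgam k j x - x ^ k / INR k`!).
Proof.
move=> j0; elim: k => [|k IH].
  apply: (is_derive_ext (fun=> 1 / 1 / j)) => [t|]; first by rewrite /= Rplus_0_r.
  by evar_last; [exact: is_derive_const | rewrite /=; rewrite /zero /=; field; lra].
have f0 := INR_fact_gt0 k.+1; have f1 := INR_fact_gt0 k.
apply: (is_derive_ext (fun x => (x ^ k.+1 / INR (k.+1)`! + incgam k j x) * / j)) => [t //|].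
evar_last.
  apply: is_derive_multR; last exact: is_derive_const.
  by apply: is_derive_plus; [exact: is_derive_pow_fact | exact: IH].
rewrite /zero /plus [in RHS]/incgam -/(incgam k j x) /=.
by field; split => //; lra.
Qed.

Definition egam k j x := exp (- (j * x)) * incgam k j x.

Lemma is_derive_egam k j x : 0 < j ->
  is_derive (egam k j) x (- (exp (- (j * x)) * (x ^ k / INR k`!))).
Proof.
move=> j0.
have H : is_derive (fun u => exp (- (j * u))) x (- j * exp (- (j * x))).
  by auto_derive => //; ring.
evar_last; first exact: is_derive_multR H (is_derive_incgam k x j0).
by rewrite /=; ring.
Qed.

Lemma incgam_0 k j : 0 < j -> incgam k j 0 = / j ^ k.+1.
Proof.
move=> j0; elim: k => [|k IH] /=; first by field; lra.
have jk : j ^ k <> 0 by apply: pow_nonzero; lra.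
have -> : incgam k j 0 = / j ^ k.+1 by [].
rewrite Rmult_0_l /Rdiv Rmult_0_l Rplus_0_l /=; field; lra.
Qed.

Lemma incgam_ge k j x : 0 < j -> 0 <= x -> x ^ k / INR k`! / j <= incgam k j x.
Proof.
move=> j0 x0; have ij : 0 < / j by apply: Rinv_0_lt_compat.
have P i : 0 <= x ^ i / INR i`!.
  by apply: Rmult_le_pos; [exact: pow_le | apply: Rlt_le; apply: Rinv_0_lt_compat; exact: INR_fact_gt0].
have N : 0 <= incgam k j x.
  elim: k => [|k IH] /=; apply: Rmult_le_pos; try lra; have := P k.+1 => /=; lra.
case: k N => [|k] N; first by rewrite /= Rplus_0_r; lra.
rewrite [incgam _ _ _]/=; apply: Rmult_le_compat_r; first by lra.
suff : 0 <= incgam k j x by move=> /=; lra.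
elim: k {N} => [|k IH] /=; apply: Rmult_le_pos; try lra; have := P k.+1 => /=; lra.
Qed.

Lemma egam_bounds k j x : 0 < j -> 0 <= x -> 0 <= egam k j x <= / j ^ k.+1.
Proof.
move=> j0 x0.
have P i t : 0 <= t -> 0 <= t ^ i / INR i`!.
  by move=> t0; apply: Rmult_le_pos; [exact: pow_le | apply: Rlt_le; apply: Rinv_0_lt_compat; exact: INR_fact_gt0].
split.
  apply: Rmult_le_pos; first exact: Rlt_le (exp_pos _).
  apply: Rle_trans (incgam_ge k j0 x0).
  by apply: Rmult_le_pos; [exact: P | apply: Rlt_le; apply: Rinv_0_lt_compat].
have <- : egam k j 0 = / j ^ k.+1.
  by rewrite /egam Rmult_0_r Ropp_0 exp_0 Rmult_1_l incgam_0.
case: (Rle_lt_or_eq_dec _ _ x0) => [lx|<-]; last by lra.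
have [||c [Hc E]] := MVT_gen (egam k j) 0 x (fun x => - (exp (- (j * x)) * (x ^ k / INR k`!))).
- by move=> y _; exact: is_derive_egam.
- move=> y _; apply/continuity_pt_filterlim; apply: (@ex_derive_continuous R_AbsRing R_NormedModule).
  by eexists; exact: is_derive_egam.
rewrite Rmin_left // in Hc.
have := Rmult_le_pos _ _ (Rlt_le _ _ (exp_pos (- (j * c)))) (P k c (proj1 Hc)).
by move=> Q; nra.
Qed.

Lemma exp_pow_small i j e : 1 <= j -> 0 < e ->
  exists X, forall x, X < x -> 0 <= exp (- (j * x)) * (x ^ i / INR i`!) < e.
Proof.
move=> j1 e0; have j0 : 0 < j by lra.
  exists (Rmax 0 (INR i.+1 / e)) => x Hx.
  have x0 : 0 < x by have := Rmax_l 0 (INR i.+1 / e); lra.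
  have xe : INR i.+1 / e < x by have := Rmax_r 0 (INR i.+1 / e); lra.
  have [_ B] := @egam_bounds i.+1 1 x Rlt_0_1 (Rlt_le _ _ x0).
  have G := @incgam_ge i.+1 1 x Rlt_0_1 (Rlt_le _ _ x0).
  have ep := exp_pos (- (1 * x)).
  have B2 : exp (- (1 * x)) * (x ^ i.+1 / INR (i.+1)`! / 1) <= 1.
    apply: Rle_trans (_ : egam i.+1 1 x <= _); first by apply: Rmult_le_compat_l => //; lra.
    by apply: Rle_trans B _; rewrite pow1 Rinv_1; lra.
  have Ei : x ^ i.+1 / INR (i.+1)`! / 1 = x ^ i / INR i`! * (x / INR i.+1).
    have Fi := INR_fact_gt0 i; have Si := INR_S_gt0 i.
    by rewrite INR_factS [x ^ i.+1]/=; field; lra.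
  have P : 0 <= x ^ i / INR i`!.
    by apply: Rmult_le_pos; [apply: pow_le; lra | apply: Rlt_le; apply: Rinv_0_lt_compat; exact: INR_fact_gt0].
  have ej : exp (- (j * x)) <= exp (- (1 * x)).
    by case: (Req_dec j 1) => [->|?]; [lra | apply: Rlt_le; apply: exp_increasing; nra].
  have Si := INR_S_gt0 i.
  rewrite Ei in B2; set q := exp (- (1 * x)) * (x ^ i / INR i`!).
  have B3 : q * (x / INR i.+1) <= 1 by rewrite /q Rmult_assoc; exact: B2.
  have q0 : 0 <= q by rewrite /q; apply: Rmult_le_pos => //; lra.
  have xe' : INR i.+1 < x * e by apply/Rlt_div_l.
  have B4 : q * x <= INR i.+1.
    have -> : q * x = q * (x / INR i.+1) * INR i.+1 by field; lra.
    by rewrite -[X in _ <= X]Rmult_1_l; apply: Rmult_le_compat_r => //; lra.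
  split; first by apply: Rmult_le_pos => //; exact: Rlt_le (exp_pos _).
  apply: Rle_lt_trans (_ : q < _); first exact: Rmult_le_compat_r.
  by nra.
Qed.

Lemma egam_infty k j e : 1 <= j -> 0 < e ->
  exists X, forall x, X < x -> egam k j x < e.
Proof.
move=> j1 e0; elim: k e e0 => [|k IH] e e0.
  have [X HX] := exp_pow_small 0 j1 e0; exists X => x /HX; rewrite /egam [incgam _ _ _]/= Rplus_0_r.
  rewrite /Rdiv -[in X in _ -> X]Rmult_assoc; set q := exp _ * _ => -[q0 qe].
  by apply/Rlt_div_l; [lra | nra].
have e2 : 0 < e / 2 by lra.
have [X HX] := exp_pow_small k.+1 j1 e2; have [Y HY] := IH _ e2.
exists (Rmax (Rmax X Y) 0) => x Hx.
have := HX x; have := HY x; rewrite /egam [incgam k.+1 _ _]/=.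
have m1 := Rmax_l (Rmax X Y) 0; have m2 := Rmax_r (Rmax X Y) 0.
have m3 := Rmax_l X Y; have m4 := Rmax_r X Y.
have j0 : 0 < j by lra.
have x0 : 0 <= x by lra.
have [K _] := egam_bounds k j0 x0; rewrite /egam in K.
rewrite -[x * x ^ k]/(x ^ k.+1).
set q := exp _ * (_ / _); set p := exp _ * incgam _ _ _ in K *.
move=> A B; have {}A := A ltac:(lra); have {}B := B ltac:(lra).
rewrite (_ : exp _ * _ = (q + p) / j); last by rewrite /q /p /Rdiv; ring.
by apply/Rlt_div_l; [lra | nra].
Qed.

Lemma zeta_cvg k e : 0 < e -> exists N0, forall N, (N0 <= N)%N ->
  Rabs (sum_n (fun j => / INR j.+1 ^ k.+2) N - zeta k.+2) < e.
Proof.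
move=> e0.
have pos m j : 0 <= / INR j.+1 ^ m.
  by apply: Rlt_le; apply: Rinv_0_lt_compat; apply: pow_lt; exact: INR_S_gt0.
have S2 : ex_series (fun j => / INR j.+1 ^ 2).
  have [] := ex_finite_lim_seq_incr (sum_n (fun j => / INR j.+1 ^ 2)) 2.
  - move=> n; rewrite sum_Sn /plus /=; have := pos 2%N n.+1 => /=; lra.
  - suff H n : sum_n (fun j => / INR j.+1 ^ 2) n <= 2 - / INR n.+1.
      by move=> n; have := H n; have := Rinv_0_lt_compat _ (INR_S_gt0 n); lra.
    elim: n => [|n IH]; first by rewrite sum_O /=; lra.
    rewrite sum_Sn /plus; apply: Rle_trans (Rplus_le_compat_r _ _ _ IH) _.
    have Sn := INR_S_gt0 n; rewrite (S_INR n.+1); set x := INR n.+1 in Sn *.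
    have -> : / (x + 1) ^ 2 = / x - / (x + 1) - / (x * (x + 1) * (x + 1)) by field; lra.
    have : 0 < / (x * (x + 1) * (x + 1)) by apply: Rinv_0_lt_compat; apply: Rmult_lt_0_compat; nra.
    by move=> /=; lra.
  by move=> l Hl; exists l.
have Sk : ex_series (fun j => / INR j.+1 ^ k.+2).
  apply: (@ex_series_le R_AbsRing R_CompleteNormedModule) S2 => n.
  rewrite /norm /= /abs /= Rabs_pos_eq; last exact: (pos k.+2).
  have Sn := INR_S_gt0 n.
  have S1 : 1 <= INR n.+1 by have := pos_INR n; rewrite S_INR; lra.
  have p1 : 1 <= INR n.+1 ^ k by apply: pow_R1_Rle.
  rewrite -/(INR n.+1); apply: Rinv_le_contravar; first by nra.
  by rewrite /=; rewrite -/(INR n.+1); nra.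
have := Series_correct _ Sk; rewrite /is_series -/(zeta k.+2).
move/filterlim_locally => /(_ (mkposreal _ e0)) [N0 H].
by exists N0 => N /leP HN; apply: H.
Qed.

(** The integrand of zeta(k+1), shifted by exp(-N x): the remainder after N terms of the
    geometric expansion of 1/(exp x - 1). *)
Definition bose k N x := exp (- (INR N * x)) * (x ^ k / INR k`!) / (exp x - 1).

Lemma exp_m1_gt x : 0 < x -> x < exp x - 1.
Proof. by move=> x0; have := exp_ineq1 x; lra. Qed.

Lemma continuous_bose k N x : 0 < x -> continuous (bose k N) x.
Proof.
move=> x0; have := exp_m1_gt x0 => ex.
apply: (@ex_derive_continuous R_AbsRing R_NormedModule); rewrite /bose.
by auto_derive; rewrite ?Rplus_0_r; lra.
Qed.

Lemma ex_RInt_cont (f : R -> R) a b : a <= b -> (forall x, a <= x <= b -> continuous f x) ->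
  ex_RInt f a b.
Proof.
move=> ab H; apply: (@ex_RInt_continuous R_CompleteNormedModule) => x.
by rewrite Rmin_left // Rmax_right //; apply: H.
Qed.

Lemma RInt_exp_pow k j x1 x2 : 0 < j -> x1 <= x2 ->
  RInt (fun x => exp (- (j * x)) * (x ^ k / INR k`!)) x1 x2 = egam k j x1 - egam k j x2.
Proof.
move=> j0 x12; apply: is_RInt_unique.
have -> : egam k j x1 - egam k j x2 = minus (- egam k j x2) (- egam k j x1).
  by rewrite /minus /plus /opp /=; ring.
apply: (@is_RInt_derive R_CompleteNormedModule (fun x => - egam k j x)) => x _.
  by evar_last; [apply: is_derive_opp; exact: is_derive_egam | rewrite /opp /=; ring].
apply: (@ex_derive_continuous R_AbsRing R_NormedModule).
by auto_derive.
Qed.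

Lemma bose_rec k N x1 x2 : 0 < x1 -> x1 <= x2 ->
  RInt (bose k 0) x1 x2 =
  sum_n (fun j => egam k (INR j.+1) x1 - egam k (INR j.+1) x2) N + RInt (bose k N.+1) x1 x2.
Proof.
move=> x10 x12.
have S M : RInt (bose k M) x1 x2 =
    (egam k (INR M.+1) x1 - egam k (INR M.+1) x2) + RInt (bose k M.+1) x1 x2.
  rewrite -RInt_exp_pow //; last exact: INR_S_gt0.
  rewrite -[X in _ = X]/(@plus R_CompleteNormedModule (RInt _ _ _) (RInt _ _ _)) -(@RInt_plus R_CompleteNormedModule); first last.
  - by apply: ex_RInt_cont => // x Hx; apply: continuous_bose; lra.
  - apply: ex_RInt_cont => // x Hx; apply: (@ex_derive_continuous R_AbsRing R_NormedModule).
    by auto_derive.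
  apply: RInt_ext => x; rewrite Rmin_left // Rmax_right // => Hx.
  rewrite /plus /= /bose; rewrite -/(INR M.+1) S_INR.
  have ex : exp x - 1 <> 0 by have := @exp_m1_gt x; lra.
  have -> : exp (- (INR M * x)) = exp (- ((INR M + 1) * x)) * exp x.
    by rewrite -exp_plus; congr exp; ring.
  by field; split => //; apply: Rgt_not_eq; exact: INR_fact_gt0.
elim: N => [|N IH]; first by rewrite sum_O; apply: S.
by rewrite sum_Sn IH S /plus /=; ring.
Qed.

(** The factor x / (exp x - 1) <= 1 removes the singularity at 0. *)
Lemma bose_bound k N x1 x2 : 0 < x1 -> x1 <= x2 ->
  0 <= RInt (bose k.+1 N.+1) x1 x2 <= / INR N.+1.
Proof.
move=> x10 x12.
have Eb : ex_RInt (bose k.+1 N.+1) x1 x2.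
  by apply: ex_RInt_cont => // x Hx; apply: continuous_bose; lra.
have N0 := INR_S_gt0 N; have Fk := INR_fact_gt0 k; have K0 := INR_S_gt0 k.
have K1 : 1 <= INR k.+1 by have := pos_INR k; rewrite S_INR; lra.
have B x : 0 < x -> 0 <= bose k.+1 N.+1 x <= exp (- (INR N.+1 * x)) * (x ^ k / INR k`!).
  move=> x0; have ex := exp_m1_gt x0; have ep := exp_pos (- (INR N.+1 * x)).
  have pk : 0 < x ^ k by apply: pow_lt.
  have q0 : 0 < x ^ k / INR k`! by apply: Rdiv_lt_0_compat.
  have -> : bose k.+1 N.+1 x = exp (- (INR N.+1 * x)) * (x ^ k / INR k`!) * (x / (INR k.+1 * (exp x - 1))).
    by rewrite /bose INR_factS [x ^ k.+1]/= -/(INR k.+1); field; lra.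
  have d0 : 0 < INR k.+1 * (exp x - 1) by apply: Rmult_lt_0_compat; lra.
  have r1 : 0 <= x / (INR k.+1 * (exp x - 1)) <= 1.
    split; first by apply: Rlt_le; apply: Rdiv_lt_0_compat.
    by apply/Rle_div_l => //; nra.
  have := Rmult_lt_0_compat _ _ ep q0; set u := exp _ * _; nra.
split.
  rewrite -(_ : RInt (fun=> 0) x1 x2 = 0); last by rewrite RInt_const /scal /= /mult /=; ring.
  apply: RInt_le => //; first exact: ex_RInt_const.
  by move=> x Hx; have := B x; lra.
apply: Rle_trans (_ : egam k (INR N.+1) x1 <= _).
  apply: Rle_trans (_ : RInt (fun x => exp (- (INR N.+1 * x)) * (x ^ k / INR k`!)) x1 x2 <= _).
    apply: RInt_le => //; last by move=> x Hx; have := B x; lra.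
    apply: ex_RInt_cont => // x Hx; apply: (@ex_derive_continuous R_AbsRing R_NormedModule).
    by auto_derive.
  rewrite RInt_exp_pow //.
  by have [] := @egam_bounds k _ x2 N0; lra.
have x1' : 0 <= x1 by lra.
have [_ H] := egam_bounds k N0 x1'; apply: Rle_trans H _.
apply: Rinv_le_contravar => //.
have N1 : 1 <= INR N.+1 by have := pos_INR N; rewrite S_INR; lra.
have := pow_R1_Rle _ k N1; rewrite [INR N.+1 ^ k.+1]/= -/(INR N.+1); nra.
Qed.

(** The integral of x^(k+1)/(k+1)! / (exp x - 1) over the half-line is zeta(k+2): each term
    x^(k+1)/(k+1)! exp(-j x) of the geometric expansion integrates to j^-(k+2). *)
Lemma bose_integral k e : 0 < e -> exists x0, exists2 X, 0 < x0 & forall x1 x2,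
  0 < x1 < x0 -> X < x2 -> x1 <= x2 -> Rabs (RInt (bose k.+1 0) x1 x2 - zeta k.+2) < e.
Proof.
move=> e0; have e4 : 0 < e / 4 by lra.
have [N0 HN0] := zeta_cvg k e4.
have [N [HN1 HN2]] : exists N, (N0 <= N)%N /\ / INR N.+1 < e / 4.
  have [M HM] := archimed_cor1 _ e4.
  exists (maxn N0 M); split; first exact: leq_maxl.
  case: HM => h1 /lt_0_INR h2; apply: Rlt_trans h1.
  apply: Rinv_lt_contravar; first by apply: Rmult_lt_0_compat => //; exact: INR_S_gt0.
  by apply: lt_INR; apply/ltP; rewrite ltnS leq_maxr.
have [x0 [X x00 H]] : exists x0, exists2 X, 0 < x0 & forall x1 x2, 0 < x1 < x0 -> X < x2 ->
   Rabs (sum_n (fun j => egam k.+1 (INR j.+1) x1 - egam k.+1 (INR j.+1) x2) N -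
         sum_n (fun j => / INR j.+1 ^ k.+2) N) < e / 4.
  have T j d : 0 < d -> exists x0, exists2 X, 0 < x0 & forall x1 x2, 0 < x1 < x0 -> X < x2 ->
     Rabs (egam k.+1 (INR j.+1) x1 - egam k.+1 (INR j.+1) x2 - / INR j.+1 ^ k.+2) < d.
    move=> d0; have d2 : 0 < d / 2 by lra.
    have j0 := INR_S_gt0 j.
    have j1 : 1 <= INR j.+1 by have := pos_INR j; rewrite S_INR; lra.
    have [X HX] := egam_infty k.+1 j1 d2.
    have c : continuous (egam k.+1 (INR j.+1)) 0.
      apply: (@ex_derive_continuous R_AbsRing R_NormedModule); eexists; exact: is_derive_egam.
    move/filterlim_locally: c => /(_ (mkposreal _ d2)) [r Hr].
    exists r; exists (Rmax X 0) => [|x1 x2 Hx1 Hx2]; first exact: cond_pos.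
    have m1 := Rmax_l X 0; have m2 := Rmax_r X 0.
    have := Hr x1; rewrite /ball /= /AbsRing_ball /abs /minus /plus /opp /=.
    rewrite Ropp_0 Rplus_0_r Rabs_pos_eq; last by lra.
    rewrite {2}/egam Rmult_0_r Ropp_0 exp_0 Rmult_1_l incgam_0 // -/(INR j.+1) => /(_ (proj2 Hx1)).
    move=> /Rabs_lt_between K.
    have x20 : 0 <= x2 by lra.
    have [L1 _] := egam_bounds k.+1 j0 x20; have L2 := HX x2 ltac:(lra).
    by apply: Rabs_def1; rewrite /= in K L1 L2 *; lra.
  elim: N {HN1 HN2} (e / 4) e4 => [|N IH] d d0.
    have [x0 [X x00 H]] := T 0%N d d0; exists x0; exists X => // x1 x2 H1 H2.
    by rewrite !sum_O; apply: H.
  have d2 : 0 < d / 2 by lra.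
  have [x0 [X x00 H]] := IH _ d2; have [x0' [X' x00' H']] := T N.+1 _ d2.
  exists (Rmin x0 x0'); exists (Rmax X X'); first exact: Rmin_pos.
  move=> x1 x2 Hx1 Hx2.
  have m1 := Rmax_l X X'; have m2 := Rmax_r X X'; have m3 := Rmin_l x0 x0'; have m4 := Rmin_r x0 x0'.
  have := H x1 x2 ltac:(lra) ltac:(lra); have := H' x1 x2 ltac:(lra) ltac:(lra).
  rewrite !sum_Sn /plus /=.
  move=> /Rabs_lt_between A /Rabs_lt_between B; apply: Rabs_def1; lra.
exists x0; exists X => // x1 x2 Hx1 Hx2 x12.
rewrite (bose_rec _ N) //; last by lra.
have B := @bose_bound k N x1 x2 (proj1 Hx1) x12.
have {}H := H x1 x2 Hx1 Hx2; have K := HN0 N HN1.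
move/Rabs_lt_between: H => H; move/Rabs_lt_between: K => K.
by apply: Rabs_def1; lra.
Qed.

(** * The sides along the straight ends *)

(** The difference 1/(v - t) - 1/v of the two poles. *)
Definition side_weight (t v : R) : R := t / (v * (v - t)).

(** The coefficients of the expansion at a tangential base point, relative to the cut-off t. *)
Definition logpow (k : nat) (t v : R) : R := ln (v / t) ^ k / INR k`!.

Lemma cube_small t : 0 < t < 1 -> 0 < t ^ 3 <= t.
Proof.
move=> Ht; split; first by apply: pow_lt; lra.
have : 0 < t * t <= 1 by split; nra.
by rewrite /=; nra.
Qed.

Lemma continuous_side_weight t v : 0 < t < v -> continuous (side_weight t) v.
Proof.
move=> Ht; apply: (@ex_derive_continuous R_AbsRing R_NormedModule); rewrite /side_weight.
by auto_derive; apply: Rgt_not_eq; apply: Rmult_lt_0_compat; lra.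
Qed.

Lemma continuous_logpow k t v : 0 < t -> 0 < v -> continuous (logpow k t) v.
Proof.
move=> Ht Hv; apply: (@ex_derive_continuous R_AbsRing R_NormedModule); rewrite /logpow.
by auto_derive; apply: Rdiv_lt_0_compat.
Qed.

(** The substitution x = ln (v/t) turns t/(v (v - t)) dv into dx/(exp x - 1), and the cut-off
    t^3 into an x tending to 0. *)
Lemma side_log_limit k delta e : 0 < delta -> 0 < e -> exists2 r, 0 < r & forall t, 0 < t < r ->
  Rabs (RInt (fun v => logpow k.+1 t v * side_weight t v) (t + t ^ 3) delta - zeta k.+2) < e.
Proof.
move=> d0 e0; have [x0 [X x00 H]] := bose_integral k e0.
have eX := exp_pos (Rmax X x0).
pose r := Rmin (Rmin 1 x0) (Rmin (delta / exp (Rmax X x0)) (delta / 2)).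
exists r; first by do !apply: Rmin_pos => //; [lra | apply: Rdiv_lt_0_compat | lra].
move=> t Ht; have m1 := Rmin_l (Rmin 1 x0) (Rmin (delta / exp (Rmax X x0)) (delta / 2)).
have m2 := Rmin_r (Rmin 1 x0) (Rmin (delta / exp (Rmax X x0)) (delta / 2)).
have m3 := Rmin_l 1 x0; have m4 := Rmin_r 1 x0.
have m5 := Rmin_l (delta / exp (Rmax X x0)) (delta / 2).
have m6 := Rmin_r (delta / exp (Rmax X x0)) (delta / 2).
rewrite -/r in m1 m2.
have t1 : 0 < t < 1 by lra.
have [c1 c2] := cube_small t1.
have tt : 0 < t * t < t by nra.
have -> : RInt (fun v => logpow k.+1 t v * side_weight t v) (t + t ^ 3) delta =
    RInt (bose k.+1 0) (ln ((t + t ^ 3) / t)) (ln (delta / t)).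
  rewrite -(@RInt_comp R_CompleteNormedModule (bose k.+1 0) (fun v => ln (v / t)) (fun v => / v)).
  - apply: RInt_ext => v; rewrite Rmin_left ?Rmax_right; try lra; move=> Hv.
    rewrite /scal /= /mult /= /bose /logpow /side_weight exp_ln; last by apply: Rdiv_lt_0_compat; lra.
    rewrite [INR 0]/= Rmult_0_l Ropp_0 exp_0.
    by field; repeat split; try lra; apply: Rgt_not_eq; exact: INR_fact_gt0.
  - move=> v; rewrite Rmin_left ?Rmax_right; try lra; move=> Hv; apply: continuous_bose.
    by rewrite -ln_1; apply: ln_increasing; [lra | apply/Rlt_div_r; lra].
  move=> v; rewrite Rmin_left ?Rmax_right; try lra; move=> Hv; split.
    by auto_derive; [apply: Rdiv_lt_0_compat; lra | field; lra].
  by apply: continuous_Rinv; lra.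
have e1 : (t + t ^ 3) / t = 1 + t * t by field; lra.
have lt : ln (1 + t * t) < x0.
  have : ln (1 + t * t) < t * t.
    by rewrite -[X in _ < X]ln_exp; apply: ln_increasing; [lra | apply: exp_ineq1; lra].
  by lra.
have l0 : 0 < ln (1 + t * t) by rewrite -ln_1; apply: ln_increasing; lra.
have lX : Rmax X x0 < ln (delta / t).
  rewrite -[X in X < _]ln_exp; apply: ln_increasing => //.
  apply/Rlt_div_r; first by lra.
  have : t < delta / exp (Rmax X x0) by lra.
  by move/Rlt_div_r => K; have := K eX; lra.
have M1 := Rmax_l X x0; have M2 := Rmax_r X x0.
by rewrite e1; apply: H; lra.
Qed.

(** For k = 0 the integral is elementary and diverges like - 2 ln t, because the cut-off is
    t^3 relative to a scale t. *)
Lemma side_log_limit0 delta e : 0 < delta -> 0 < e -> exists2 r, 0 < r & forall t, 0 < t < r ->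
  Rabs (RInt (fun v => logpow 0 t v * side_weight t v) (t + t ^ 3) delta + 2 * ln t) < e.
Proof.
move=> d0 e0.
pose G t := ln ((delta - t) / delta) + ln (1 + t * t).
have c : continuous G 0.
  apply: (@ex_derive_continuous R_AbsRing R_NormedModule); rewrite /G; auto_derive.
  rewrite Ropp_0 Rplus_0_r; split; last by split => //; nra.
  by apply: Rdiv_lt_0_compat.
move/filterlim_locally: c => /(_ (mkposreal _ e0)) [r Hr].
exists (Rmin r (Rmin 1 (delta / 2))); first by do !apply: Rmin_pos; [exact: cond_pos | lra | lra].
move=> t Ht; have m1 := Rmin_l r (Rmin 1 (delta / 2)); have m2 := Rmin_r r (Rmin 1 (delta / 2)).
have m3 := Rmin_l 1 (delta / 2); have m4 := Rmin_r 1 (delta / 2).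
have t1 : 0 < t < 1 by lra.
have [c1 c2] := cube_small t1.
have -> : RInt (fun v => logpow 0 t v * side_weight t v) (t + t ^ 3) delta =
   ln ((delta - t) / delta) - ln (t ^ 3 / (t + t ^ 3)).
  apply: is_RInt_unique.
  apply: (is_RInt_ext (fun v => t / (v * (v - t)))).
    by move=> v _; rewrite /logpow /side_weight [_ ^ 0]/= [INR _]/= /Rdiv Rinv_1 !Rmult_1_l.
  have -> : ln ((delta - t) / delta) - ln (t ^ 3 / (t + t ^ 3)) =
    minus (ln ((delta - t) / delta)) (ln ((t + t ^ 3 - t) / (t + t ^ 3))).
    by rewrite (_ : t + t ^ 3 - t = t ^ 3) //; ring.
  apply: (@is_RInt_derive R_CompleteNormedModule (fun v => ln ((v - t) / v))) => v;
    rewrite Rmin_left ?Rmax_right; try lra; move=> Hv.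
    have P : 0 < (v - t) / v by apply: Rdiv_lt_0_compat; lra.
    auto_derive; first by repeat split; move: P; rewrite /Rdiv /Rminus; lra.
    by field; lra.
  by apply: continuous_side_weight; lra.
have -> : t ^ 3 / (t + t ^ 3) = t * t / (1 + t * t) by move: c1 => /= c1; field; nra.
have L : ln (t * t / (1 + t * t)) = 2 * ln t - ln (1 + t * t).
  by rewrite ln_div; [rewrite ln_mult; lra | nra | nra].
rewrite L; have := Hr t; rewrite /ball /= /AbsRing_ball /abs /minus /plus /opp /=.
rewrite Ropp_0 Rplus_0_r Rabs_pos_eq; last by lra.
move=> /(_ ltac:(lra)); rewrite /G.
rewrite (_ : (delta - 0) / delta = 1); last by field; lra.
rewrite (_ : 1 + 0 * 0 = 1); last by ring.
by rewrite ln_1; congr (Rabs _ < _); ring.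
Qed.

Lemma RtoC_dist x y : Cmod (RtoC x - RtoC y)%C = Rabs (x - y).
Proof. by rewrite -RtoC_minus Cmod_R. Qed.

Lemma Clim0_squeeze f g l (e : R -> R) r0 : 0 < r0 ->
  (forall t, 0 < t < r0 -> Cmod (f t - g t)%C <= e t) ->
  (forall d, 0 < d -> exists2 r, 0 < r & forall t, 0 < t < r -> e t < d) ->
  Clim0 g l -> Clim0 f l.
Proof.
move=> r00 H He Hg d d0; have d2 : 0 < d / 2 by lra.
have [r1 r10 H1] := He _ d2; have [r2 r20 H2] := Hg _ d2.
exists (Rmin r0 (Rmin r1 r2)); first by do !apply: Rmin_pos.
move=> t Ht; have m1 := Rmin_l r0 (Rmin r1 r2); have m2 := Rmin_r r0 (Rmin r1 r2).
have m3 := Rmin_l r1 r2; have m4 := Rmin_r r1 r2.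
have -> : (f t - l = (f t - g t) + (g t - l))%C by ring.
apply: Rle_lt_trans (Cmod_triangle _ _) _.
by have := H t ltac:(lra); have := H1 t ltac:(lra); have := H2 t ltac:(lra); lra.
Qed.

Section Side.
Variables (g g1 : R -> C) (z0 : C) (delta lb M1 : R) (K : nat) (c : nat -> C).
Variables (phi : R -> R -> C) (rho : R -> R).
Hypothesis delta01 : 0 < delta < 1.
Hypothesis g_cts : forall v, 0 < v < 1 -> Ccts g v.
Hypothesis g1_cts : forall v, 0 < v < 1 -> Ccts g1 v.
Hypothesis g_near : forall v, 0 < v <= delta -> g v = (z0 + RtoC v)%C /\ g1 v = RtoC 1.
Hypothesis lb0 : 0 < lb.
Hypothesis g_far : forall v, delta <= v < 1 -> lb <= Cmod (g v - z0)%C /\ Cmod (g1 v) <= M1.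
Hypothesis phi_cts : forall t, 0 < t < delta -> Con (phi t) t (1 - t).
Hypothesis rho0 : forall t, 0 <= rho t.
Hypothesis rho_lim : forall e, 0 < e -> exists2 r, 0 < r & forall t, 0 < t < r ->
  rho t * t * (1 - ln t) < e.
Definition log_poly t v := \csum_(k < K.+1) (c k * RtoC (logpow k t v)).
Hypothesis phi_near : forall t v, 0 < t < delta -> t <= v <= delta ->
  Cmod (phi t v - log_poly t v)%C <= rho t * (v - t).
Hypothesis phi_far : forall t v, 0 < t < delta -> delta <= v <= 1 - t -> Cmod (phi t v) <= rho t.

(** The pole of the kernel at g(t), compared with the pole at the end point z0. *)
Definition side_integrand t v : C := (phi t v * (g1 v / (g v - g t) - g1 v / (g v - z0)))%C.

(** Near the end point the integrand is a polynomial in ln (v/t) times side_weight, up to an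
    error that the hypothesis on rho makes negligible; away from it the two poles differ by
    O(t). The term in c 0 compensates the logarithmic divergence. *)
Lemma side_limit :
  Clim0 (fun t => CInt (side_integrand t) (t + t ^ 3) (1 - t) + c 0%N * RtoC (2 * ln t))%C
    (\csum_(k < K.+1) (if (k : nat) is k'.+1 then c k * RtoC (zeta k'.+2) else 0)).
Proof.
have M10 : 0 <= M1 by apply: Rle_trans (Cmod_ge_0 (g1 delta)) _; have [] := @g_far delta; lra.
pose I k t := RInt (fun v => logpow k t v * side_weight t v) (t + t ^ 3) delta.
pose T k t : C := RtoC (I k t + (if k is 0%N then 2 * ln t else 0)).
(* the main terms: one zeta integral for each power of the logarithm *)
have limT : Clim0 (fun t => \csum_(k < K.+1) (c k * T k t))
    (\csum_(k < K.+1) (if (k : nat) is k'.+1 then c k * RtoC (zeta k'.+2) else 0)).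
  apply: (Clim0_sum (F := fun (k : 'I_K.+1) t => (c k * T k t)%C)
    (l := fun k : 'I_K.+1 => if (k : nat) is k'.+1 then (c k * RtoC (zeta k'.+2))%C else 0%C)) => -[k Hk] /=.
  case: k Hk => [|k] Hk.
    rewrite -(Cmult_0_r (c 0%N)); apply: Clim0_scal => e e0.
    have [r r0 Hr] := @side_log_limit0 delta e ltac:(lra) e0.
    by exists r => // t Ht; rewrite RtoC_dist Rminus_0_r; apply: Hr.
  apply: Clim0_scal => e e0.
  have [r r0 Hr] := @side_log_limit k delta e ltac:(lra) e0.
  by exists r => // t Ht; rewrite RtoC_dist Rplus_0_r; apply: Hr.
pose t0 := Rmin (delta / 2) (Rmin (1 - delta) (lb / 2)).
have t00 : 0 < t0 by rewrite /t0; do !apply: Rmin_pos; lra.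
pose e t := (2 + 4 * M1 / (lb * lb)) * (rho t * t * (1 - ln t)).
apply: (Clim0_squeeze t00 (e := e) _ _ limT); last first.
  have C0 : 0 < 2 + 4 * M1 / (lb * lb).
    have : 0 <= 4 * M1 / (lb * lb) by apply: Rdiv_le_0_compat; nra.
    by lra.
  move=> d d0; have d' : 0 < d / (2 + 4 * M1 / (lb * lb)) by apply: Rdiv_lt_0_compat.
  have [r r0 Hr] := rho_lim d'; exists r => // t /Hr K1; rewrite /e Rmult_comm.
  by apply/Rlt_div_r.
move=> t Ht.
have m1 := Rmin_l (delta / 2) (Rmin (1 - delta) (lb / 2)).
have m2 := Rmin_r (delta / 2) (Rmin (1 - delta) (lb / 2)).
have m3 := Rmin_l (1 - delta) (lb / 2); have m4 := Rmin_r (1 - delta) (lb / 2).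
rewrite -/t0 in m1 m2.
have t1 : 0 < t < 1 by lra.
have [c1 c2] := cube_small t1.
have td : t + t ^ 3 <= delta by lra.
have gt : g t = (z0 + RtoC t)%C by have [E _] := @g_near t ltac:(lra).
have far v : delta <= v < 1 -> lb / 2 <= Cmod (g v - g t)%C.
  move=> Hv; have [L _] := g_far Hv.
  have := Cmod_triangle (g v - g t)%C (RtoC t).
  rewrite (_ : (g v - g t + RtoC t)%C = (g v - z0)%C); last by rewrite gt; ring.
  by rewrite Cmod_R Rabs_pos_eq; lra.
have nzC x : 0 < Cmod x -> x <> 0%C by move=> H E; rewrite E Cmod_0 in H; lra.
have n1 v : t < v < 1 -> (g v - g t)%C <> 0%C.
  move=> Hv; case: (Rle_lt_dec v delta) => vd; last by apply: nzC; have := @far v; lra.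
  have [-> _] := @g_near v ltac:(lra); rewrite gt => E.
  have : RtoC (v - t) = 0%C by rewrite RtoC_minus -E; ring.
  by case; lra.
have n2 v : 0 < v < 1 -> (g v - z0)%C <> 0%C.
  move=> Hv; case: (Rle_lt_dec v delta) => vd; last by apply: nzC; have := @g_far v; lra.
  have [-> _] := @g_near v ltac:(lra) => E.
  have : RtoC v = 0%C by rewrite -E; ring.
  by case; lra.
have ph : Con (phi t) t (1 - t) by apply: phi_cts; lra.
have si : Con (side_integrand t) (t + t ^ 3) (1 - t).
  move=> v Hv; apply: Ccts_mult; first by apply: ph; lra.
  apply: Ccts_minus; (apply: Ccts_mult; first by apply: g1_cts; lra);
    apply: Ccts_inv; try (apply: Ccts_minus; [by apply: g_cts; lra | exact: Ccts_const]).
    by apply: n1; lra.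
  by apply: n2; lra.
have near_eq v : t < v <= delta -> side_integrand t v = (phi t v * RtoC (side_weight t v))%C.
  move=> Hv; have [g1v g2v] := @g_near v ltac:(lra).
  have N1 := n1 v ltac:(lra); have N2 := n2 v ltac:(lra).
  rewrite /side_integrand g2v; congr Cmult; rewrite g1v gt in N1 N2 *.
  have e1 : (z0 + RtoC v - (z0 + RtoC t))%C = RtoC (v - t) by rewrite RtoC_minus; ring.
  have e2 : (z0 + RtoC v - z0)%C = RtoC v by ring.
  rewrite e1 e2; rewrite /Cdiv !Cmult_1_l -!RtoC_inv; [|lra|lra].
  by rewrite -RtoC_minus /side_weight; congr RtoC; field; lra.
rewrite (@CInt_Chasles _ _ delta) //; last by lra.
have lpc : Con (log_poly t) (t + t ^ 3) delta.
  move=> v Hv; apply: Ccts_sum => k; apply: Ccts_mult; first exact: Ccts_const.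
  by apply: Ccts_RtoC; apply: continuous_logpow; lra.
have swc : Con (fun v => RtoC (side_weight t v)) (t + t ^ 3) delta.
  by move=> v Hv; apply: Ccts_RtoC; apply: continuous_side_weight; lra.
have phc : Con (phi t) (t + t ^ 3) delta by move=> v Hv; apply: ph; lra.
have E1 : CInt (side_integrand t) (t + t ^ 3) delta =
   (CInt (fun v => log_poly t v * RtoC (side_weight t v)) (t + t ^ 3) delta +
    CInt (fun v => (phi t v - log_poly t v) * RtoC (side_weight t v)) (t + t ^ 3) delta)%C.
  rewrite -CInt_plus //; first last.
  - move=> v Hv; apply: Ccts_mult; last exact: swc.
    by apply: Ccts_minus; [apply: phc | apply: lpc].
  - by move=> v Hv; apply: Ccts_mult; [apply: lpc | apply: swc].
  by apply: CInt_ext => // v Hv; rewrite near_eq; [ring | lra].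
have E2 : CInt (fun v => log_poly t v * RtoC (side_weight t v))%C (t + t ^ 3) delta =
    \csum_(k < K.+1) (c k * RtoC (I k t)).
  have ck (k : 'I_K.+1) : Con (fun v => RtoC (logpow k t v * side_weight t v)) (t + t ^ 3) delta.
    move=> v Hv; apply: Ccts_RtoC.
    by apply: (@continuous_mult R_UniformSpace R_AbsRing); [apply: continuous_logpow | apply: continuous_side_weight]; lra.
  transitivity (CInt (fun v => \csum_(k < K.+1) (c k * RtoC (logpow k t v * side_weight t v))) (t + t ^ 3) delta).
    apply: CInt_ext => // v Hv; rewrite /log_poly (big_morph (fun x => x * RtoC (side_weight t v))%C
      (id1 := 0%C) (op1 := Cplus)) => [|x y|]; [|ring|ring].
    by apply: eq_bigr => k _; rewrite RtoC_mult; ring.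
  rewrite CInt_sum => // [|k v Hv]; last by apply: Ccts_mult; [exact: Ccts_const | apply: ck].
  apply: eq_bigr => k _; rewrite CInt_scal //; congr Cmult; apply: C_ext => //=.
  by rewrite RInt_const /scal /= /mult /=; ring.
have E3 : (\csum_(k < K.+1) (c k * T k t))%C = (\csum_(k < K.+1) (c k * RtoC (I k t)) + c 0%N * RtoC (2 * ln t))%C.
  have -> : (c 0%N * RtoC (2 * ln t))%C =
      \csum_(k < K.+1) (c k * RtoC (if (k : nat) is 0%N then 2 * ln t else 0)).
    rewrite big_ord_recl big1 => [|i _]; last by rewrite Cmult_0_r.
    by rewrite Cplus_0_r.
  by rewrite -big_split /=; apply: eq_bigr => k _; rewrite /T RtoC_plus; ring.
rewrite E3 E1 E2.
set A := CInt _ (t + t ^ 3) delta; set B := CInt _ delta (1 - t).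
rewrite (_ : (_ - _)%C = (A + B)%C); last by ring.
apply: Rle_trans (Cmod_triangle _ _) _.
have lnt : ln t < 0 by rewrite -ln_1; apply: ln_increasing; lra.
have r0 := rho0 t.
(* near the end point rho(t) (v - t) times side_weight is rho(t) t / v *)
have HA : Cmod A <= 2 * (rho t * t * (1 - ln t)).
  apply: Rle_trans (_ : 2 * RInt (fun v => rho t * t * / v) (t + t ^ 3) delta <= _).
    apply: CInt_le => // v Hv.
    - by apply: Ccts_mult; [apply: Ccts_minus; [apply: phc | apply: lpc] | apply: swc].
    - apply: (@continuous_mult R_UniformSpace R_AbsRing); first exact: continuous_const.
      by apply: continuous_Rinv; lra.
    rewrite Cmod_mult Cmod_R.
    have sw0 : 0 < side_weight t v.
      by apply: Rdiv_lt_0_compat; [lra | apply: Rmult_lt_0_compat; lra].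
    rewrite Rabs_pos_eq; last by lra.
    apply: Rle_trans (_ : rho t * (v - t) * side_weight t v <= _).
      by apply: Rmult_le_compat_r; [lra | apply: phi_near; lra].
    by apply: Req_le; rewrite /side_weight; field; lra.
  have -> : RInt (fun v => rho t * t * / v) (t + t ^ 3) delta = rho t * t * (ln delta - ln (t + t ^ 3)).
    apply: is_RInt_unique.
    have -> : rho t * t * (ln delta - ln (t + t ^ 3)) = minus (rho t * t * ln delta) (rho t * t * ln (t + t ^ 3)).
      by rewrite /minus /plus /opp /=; ring.
    apply: (@is_RInt_derive R_CompleteNormedModule (fun v => rho t * t * ln v)) => v;
      rewrite Rmin_left ?Rmax_right; try lra; move=> Hv.
      by auto_derive; [lra | field; lra].
    apply: (@continuous_mult R_UniformSpace R_AbsRing); first exact: continuous_const.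
    by apply: continuous_Rinv; lra.
  apply: Rmult_le_compat_l; first by lra.
  apply: Rmult_le_compat_l; first by nra.
  have : ln delta < 0 by rewrite -ln_1; apply: ln_increasing; lra.
  have : ln t <= ln (t + t ^ 3) by apply: Rlt_le; apply: ln_increasing; lra.
  by lra.
(* far from it the two poles differ by t / ((g v - g t) (g v - z0)) *)
have HB : Cmod B <= 4 * M1 / (lb * lb) * (rho t * t * (1 - ln t)).
  apply: Rle_trans (_ : 2 * (rho t * (M1 * (t / (lb / 2 * lb)))) * (1 - t - delta) <= _).
    apply: CInt_bound; first by lra.
      by move=> v Hv; apply: si; lra.
    move=> v Hv; rewrite /side_integrand Cmod_mult; apply: Rmult_le_compat; try exact: Cmod_ge_0.
      by apply: phi_far; lra.
    have N1 := n1 v ltac:(lra); have N2 := n2 v ltac:(lra).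
    rewrite (_ : (_ - _)%C = (g1 v * (RtoC t / ((g v - g t) * (g v - z0))))%C); last first.
      have e3 : RtoC t = (g t - z0)%C by rewrite gt; ring.
      by rewrite e3; field.
    have Nm := Cmult_neq_0 _ _ N1 N2.
    have [L1 L2] := @g_far v ltac:(lra); have L3 := @far v ltac:(lra).
    rewrite Cmod_mult Cmod_div // Cmod_mult Cmod_R Rabs_pos_eq; last by lra.
    apply: Rmult_le_compat => //; try exact: Cmod_ge_0.
      by apply: Rdiv_le_0_compat; [lra | apply: Rmult_lt_0_compat; lra].
    apply: Rmult_le_compat_l; first by lra.
    apply: Rinv_le_contravar; first by nra.
    by apply: Rmult_le_compat; lra.
  have -> : 2 * (rho t * (M1 * (t / (lb / 2 * lb)))) * (1 - t - delta) =
    4 * M1 / (lb * lb) * (rho t * t * (1 - t - delta)) by field; lra.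
  apply: Rmult_le_compat_l; first by apply: Rdiv_le_0_compat; nra.
  by apply: Rmult_le_compat_l; [nra | lra].
by rewrite /e; lra.
Qed.
End Side.

(** * The algebra of noncommutative series and the coaction on products *)

Section Series.
Variable n : nat.
Implicit Types (a b c : series n) (w v : seq 'I_n) (x i : 'I_n).
Local Open Scope series_scope.

Lemma seriesP a b : (forall w, a w = b w) -> a = b.
Proof. exact: functional_extensionality. Qed.

Lemma smul_nil a b : (a * b) [::] = (a [::] * b [::])%C.
Proof. by rewrite /smul big_ord_recl big_ord0 Cplus_0_r. Qed.

Lemma smul_cons a b x v : (a * b) (x :: v) = (a [::] * b (x :: v) + (foxR x a * b)%S v)%C.
Proof. by rewrite /smul big_ord_recl. Qed.

Lemma smul_rcons a b x v :
  (a * b) (rcons v x) = ((a * foxL x b)%S v + a (rcons v x) * b [::])%C.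
Proof.
rewrite /smul size_rcons big_ord_recr /= -{3}cats1 -[in X in drop _ X]cats1.
rewrite take_oversize ?size_cat ?addn1 // drop_oversize ?size_cat ?addn1 //.
congr Cplus; last by rewrite cats1.
apply: eq_bigr => k _; have kv : (k <= size v)%N by rewrite -ltnS ltn_ord.
by rewrite -cats1 takel_cat // drop_cat ltn_neqAle kv andbT /foxL; case: eqP => [->|_];
   rewrite ?subnn ?drop_size ?drop0 -?cats1.
Qed.

Lemma saddE a b w : (a + b) w = (a w + b w)%C. Proof. by []. Qed.
Lemma soppE a w : (- a) w = (- a w)%C. Proof. by []. Qed.
Lemma sscaleE k a w : (k *: a) w = (k * a w)%C. Proof. by []. Qed.

Lemma smulE_sum (a b : series n) w :
  (a * b) w = \csum_(k < (size w).+1) (a (take k w) * b (drop k w)).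
Proof. by []. Qed.

Lemma Csum_add (I : finType) (f g : I -> C) :
  \csum_(i : I) (f i + g i) = (\csum_(i : I) f i + \csum_(i : I) g i)%C.
Proof. exact: big_split. Qed.

Lemma Csum_scal (I : finType) k (f : I -> C) :
  \csum_(i : I) (k * f i) = (k * \csum_(i : I) f i)%C.
Proof.
by rewrite (big_morph (Cmult k) (id1 := 0%C) (op1 := Cplus)) => [//|x y|]; ring.
Qed.

Lemma Csum_sub (I : finType) (f g : I -> C) :
  \csum_(j : I) (f j - g j) = (\csum_(j : I) f j - \csum_(j : I) g j)%C.
Proof.
have -> : \csum_(j : I) f j = \csum_(j : I) (f j - g j + g j) by apply: eq_bigr => j _; ring.
by rewrite Csum_add; ring.
Qed.

Lemma smulDl a b c : (a + b) * c = a * c + b * c.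
Proof.
apply: seriesP => w; rewrite saddE !smulE_sum -Csum_add; apply: eq_bigr => k _.
by rewrite saddE; ring.
Qed.

Lemma smulDr a b c : a * (b + c) = a * b + a * c.
Proof.
apply: seriesP => w; rewrite saddE !smulE_sum -Csum_add; apply: eq_bigr => k _.
by rewrite saddE; ring.
Qed.

Lemma smulZl k a b : (k *: a) * b = k *: (a * b).
Proof.
apply: seriesP => w; rewrite sscaleE !smulE_sum -Csum_scal; apply: eq_bigr => j _.
by rewrite sscaleE; ring.
Qed.

Lemma smulZr k a b : a * (k *: b) = k *: (a * b).
Proof.
apply: seriesP => w; rewrite sscaleE !smulE_sum -Csum_scal; apply: eq_bigr => j _.
by rewrite sscaleE; ring.
Qed.

Lemma sopp_scale a : - a = (- RtoC 1)%C *: a.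
Proof. by apply: seriesP => w; rewrite soppE sscaleE; ring. Qed.

Lemma smulNl a b : (- a) * b = - (a * b).
Proof. by rewrite !sopp_scale smulZl. Qed.

Lemma smulNr a b : a * (- b) = - (a * b).
Proof. by rewrite !sopp_scale smulZr. Qed.

Lemma smulBl a b c : (a - b) * c = a * c - b * c.
Proof. by rewrite smulDl smulNl. Qed.

Lemma smulBr a b c : a * (b - c) = a * b - a * c.
Proof. by rewrite smulDr smulNr. Qed.

Lemma foxR_mul x a b : foxR x (a * b) = a [::] *: foxR x b + foxR x a * b.
Proof. by apply: seriesP => w; rewrite saddE sscaleE /foxR smul_cons. Qed.

Lemma foxL_mul x a b : foxL x (a * b) = a * foxL x b + b [::] *: foxL x a.
Proof.
by apply: seriesP => w; rewrite saddE sscaleE {1}/foxL smul_rcons /foxL; ring.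
Qed.

Lemma smulA a b c : a * (b * c) = (a * b) * c.
Proof.
apply: seriesP => w; elim: w a b => [|x v IH] a b.
  by rewrite !smul_nil; ring.
rewrite !smul_cons IH foxR_mul smulDl saddE smulZl sscaleE smul_nil; ring.
Qed.

Lemma smul0l a : szero * a = szero.
Proof. by apply: seriesP => w; rewrite smulE_sum big1 // => k _; rewrite Cmult_0_l. Qed.

Lemma smul0r a : a * szero = szero.
Proof. by apply: seriesP => w; rewrite smulE_sum big1 // => k _; rewrite Cmult_0_r. Qed.

Lemma foxR1 x : foxR x 1 = szero :> series n.
Proof. by apply: seriesP => w. Qed.

Lemma foxL1 x : foxL x 1 = szero :> series n.
Proof. by apply: seriesP => w; rewrite /foxL /sone /monomial -size_eq0 size_rcons. Qed.

Lemma smul1l a : 1 * a = a.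
Proof.
apply: seriesP; case=> [|x v].
  by rewrite smul_nil /sone /monomial eqxx Cmult_1_l.
by rewrite smul_cons foxR1 smul0l /sone /monomial eqxx Cmult_1_l Cplus_0_r.
Qed.

Lemma smul1r a : a * 1 = a.
Proof.
apply: seriesP => w; case/lastP: w => [|v x].
  by rewrite smul_nil /sone /monomial eqxx Cmult_1_r.
by rewrite smul_rcons foxL1 smul0r /sone /monomial eqxx Cmult_1_r Cplus_0_l.
Qed.

Lemma smul_letter_cons i a x v : (letter i * a) (x :: v) = if x == i then a v else 0%C.
Proof. exact: smul_letterl. Qed.

Lemma foxRL x i a : foxR x (foxL i a) = foxL i (foxR x a). Proof. by []. Qed.

(** The word h gives w by merging its equal letters j and j + 1 exactly when h is w with the
    letter j doubled. *)
Lemma double_letter_iff (j : nat) (w h : seq 'I_n) : size h = (size w).+1 -> (j < size w)%N ->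
  ((onth h j == onth h j.+1) && (w == take j.+1 h ++ drop j.+2 h)) =
  (h == take j.+1 w ++ drop j w).
Proof.
move=> szh jw.
have jh : (j < size h)%N by rewrite szh ltnS ltnW.
have jh1 : (j.+1 < size h)%N by rewrite szh ltnS.
have x0 : 'I_n by case: h jh {szh jh1} => // x.
have on k : (k < size h)%N -> onth h k = Some (nth x0 h k).
  by move=> kh; rewrite onthE (nth_map x0).
rewrite !on //=.
have st : size (take j.+1 w) = j.+1 by rewrite size_takel.
have sh : size (take j.+1 h) = j.+1 by rewrite size_takel // ltnW.
apply/andP/eqP => [[/eqP [E] /eqP wE]|hE].
  have -> : drop j w = drop j.+1 h.
    rewrite wE (take_nth x0) // cat_rcons drop_size_cat; last by rewrite size_takel // ltnW.
    by rewrite E -drop_nth.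
  by rewrite {1}wE take_size_cat // cat_take_drop.
rewrite hE; split; apply/eqP.
  congr Some; rewrite !nth_cat st ltnSn ltnn subnn nth_take //.
  by rewrite nth_drop addn0.
rewrite take_size_cat // drop_cat st ltnNge leqnSn /= subSnn drop_drop add1n.
by rewrite cat_take_drop.
Qed.

(** The coaction read on coefficients: instead of merging two equal letters, double one. *)
Lemma KKS_double a w : KKS a w = \csum_(j < size w) a (take j.+1 w ++ drop j w).
Proof.
rewrite /KKS.
transitivity (\csum_(h : (size w).+1.-tuple 'I_n) \csum_(j < size w)
   (if (onth h j == onth h j.+1) && (w == take j.+1 h ++ drop j.+2 h) then a h else 0)).
  apply: eq_bigr => h _; rewrite /KKS_word ssumE -Csum_scal.
  have -> : (size h).-1 = size w by rewrite size_tuple.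
  apply: eq_bigr => j _; case: eqP => _ /=; last by rewrite Cmult_0_r.
  by rewrite /monomial; case: eqP => _; rewrite ?Cmult_1_r ?Cmult_0_r.
rewrite exchange_big /=; apply: eq_bigr => j _.
move: (nat_of_ord j) (ltn_ord j) => {}j jw.
have sz : size (take j.+1 w ++ drop j w) == (size w).+1.
  by rewrite size_cat size_drop size_takel // addSn subnKC // ltnW.
transitivity (\csum_(h : (size w).+1.-tuple 'I_n) (if h == Tuple sz then a h else 0)).
  by apply: eq_bigr => h _; rewrite double_letter_iff ?size_tuple // -val_eqE.
rewrite (bigD1 (Tuple sz)) //= eqxx big1 ?Cplus_0_r // => h /negbTE.
by move=> ->.
Qed.

Lemma KKS_nil a : KKS a [::] = 0%C.
Proof. by rewrite KKS_double big_ord0. Qed.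

Lemma KKS_cons a x v : KKS a (x :: v) = (a (x :: x :: v) + KKS (foxR x a) v)%C.
Proof.
by rewrite !KKS_double big_ord_recl /= take0.
Qed.

(** The terms of the coaction of a b in which the last letter of a merges with the first
    letter of b. *)
Definition fox_merge a b : series n := (\ssum_(i < n) (foxL i a * (letter i * foxR i b))).

Lemma fox_merge_nil a b : fox_merge a b [::] = 0%C.
Proof.
by rewrite /fox_merge ssumE big1 // => i _; rewrite !smul_nil /letter /monomial /=; ring.
Qed.

Lemma fox_merge_cons a b x v :
  fox_merge a b (x :: v) = (a [:: x] * b (x :: v) + fox_merge (foxR x a) b v)%C.
Proof.
rewrite /fox_merge !ssumE.
transitivity (\csum_(i < n) ((if x == i then a [:: i] * b (i :: v) else 0) +
    (foxL i (foxR x a) * (letter i * foxR i b))%S v)).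
  apply: eq_bigr => i _; rewrite smul_cons smul_letter_cons foxRL; congr Cplus.
  by case: (x == i); rewrite ?Cmult_0_r.
by rewrite Csum_add (csum_pick x (fun i => a [:: i] * b (i :: v))%C).
Qed.

(** Two equal neighbours in a word cut in two lie on the left, on the right, or across the cut. *)
Lemma KKS_mul a b : KKS (a * b) = KKS a * b + a * KKS b + fox_merge a b.
Proof.
apply: seriesP => w; elim: w a => [|x v IH] a.
  by rewrite !saddE !smul_nil !KKS_nil fox_merge_nil; ring.
have KD (c d : series n) : KKS (c + d) = KKS c + KKS d.
  apply: seriesP => u; rewrite saddE !KKS_double -Csum_add; exact: eq_bigr.
have KZ k (c : series n) : KKS (k *: c) = k *: KKS c.
  apply: seriesP => u; rewrite sscaleE !KKS_double -Csum_scal; exact: eq_bigr.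
have fK c : foxR x (KKS c) = foxR x (foxR x c) + KKS (foxR x c).
  by apply: seriesP => u; rewrite {1}/foxR KKS_cons.
rewrite KKS_cons foxR_mul KD KZ saddE sscaleE IH !saddE.
rewrite !smul_cons KKS_nil fK smulDl saddE fox_merge_cons KKS_cons.
rewrite /foxR -/(foxR x a) -/(foxR x b) -/(foxR x (foxR x a)).
ring.
Qed.
End Series.

(** * Exponentials of a letter and inverses *)

Section Exp.
Variable n : nat.
Implicit Types (a b c : series n) (w v : seq 'I_n) (x i : 'I_n).
Local Open Scope series_scope.

Lemma spowS a m : spow a m.+1 = a * spow a m. Proof. by []. Qed.

Lemma spow_small a m w : a [::] = RtoC 0 -> (size w < m)%N -> spow a m w = RtoC 0.
Proof.
move=> a0; elim: m w => // m IH w wm; rewrite spowS smulE_sum big1 // => k _.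
case: k => -[|k] kw /=; first by rewrite take0 a0 Cmult_0_l.
rewrite IH ?Cmult_0_r // size_drop; move: kw; rewrite !ltnS => kw.
by case: (size w) kw wm => // s ks; rewrite ltnS => sm; rewrite subSS; apply: leq_ltn_trans (leq_subr _ _) sm.
Qed.

Lemma spow_comm a m : spow a m * a = a * spow a m.
Proof.
elim: m => [|m IH]; first by rewrite smul1l smul1r.
by rewrite spowS -smulA IH.
Qed.

Lemma spow_scaled_letter i (k : C) m w :
  spow (k *: letter i) m w = if w == nseq m i then (k ^ m)%C else RtoC 0.
Proof.
elim: m w => [|m IH] w; first by [].
rewrite spowS smulZl sscaleE; case: w => [|x v].
  by rewrite smul_nil /letter /monomial /= Cmult_0_l Cmult_0_r.
rewrite smul_letter_cons /= eqseq_cons; case: (x == i) => /=; last by rewrite Cmult_0_r.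
by rewrite IH; case: (v == _); rewrite ?Cmult_0_r.
Qed.

(** The exponential of a multiple of a letter, the local monodromy factor of the KZ equation. *)
Definition letter_exp i (k : C) : series n := sexp (k *: letter i).

Lemma subst_scaled_letter f i k w : subst_series f (k *: letter i) w =
  if w == nseq (size w) i then (f (size w) * k ^ size w)%C else RtoC 0.
Proof.
rewrite /subst_series big_ord_recr /= spow_scaled_letter big1 => [|j _].
  by rewrite Cplus_0_l; case: ifP => _; rewrite ?Cmult_0_r.
rewrite spow_scaled_letter; case: eqP => [E|]; last by rewrite Cmult_0_r.
by have := ltn_ord j; rewrite {2}E size_nseq ltnn.
Qed.

Lemma letter_expE i k w : letter_exp i k w =
  if w == nseq (size w) i then (RtoC (/ INR (size w)`!) * k ^ size w)%C else RtoC 0.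
Proof. exact: subst_scaled_letter. Qed.

Lemma letter_exp_nil i k : letter_exp i k [::] = RtoC 1.
Proof. by rewrite letter_expE /= Rinv_1 Cmult_1_l. Qed.

Definition iword i w := all (pred1 i) w.
Lemma iwordP i w : iword i w = (w == nseq (size w) i).
Proof. by rewrite /iword; apply/all_pred1P/eqP. Qed.

Lemma foxR_letter_exp_neq i x k : x != i -> foxR x (letter_exp i k) = szero.
Proof.
by move=> /negbTE xi; apply: seriesP => w; rewrite /foxR letter_expE /= eqseq_cons xi.
Qed.

Lemma foxL_letter_exp_neq i x k : x != i -> foxL x (letter_exp i k) = szero.
Proof.
move=> /negbTE xi; apply: seriesP => w.
by rewrite /foxL letter_expE -iwordP /iword all_rcons /= xi.
Qed.

Lemma foxLR_letter_exp i k : foxL i (letter_exp i k) = foxR i (letter_exp i k).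
Proof.
apply: seriesP => w; rewrite /foxL /foxR !letter_expE -!iwordP /iword all_rcons /= eqxx.
by rewrite size_rcons.
Qed.

Lemma letter_exp_foxR i k : letter i * foxR i (letter_exp i k) = letter_exp i k - 1.
Proof.
apply: seriesP; case=> [|x v]; rewrite saddE soppE.
  by rewrite smul_nil letter_exp_nil /letter /sone /monomial /=; ring.
rewrite smul_letter_cons /sone /monomial /= /foxR letter_expE.
by case: eqP => [->|xi]; rewrite ?letter_expE /= ?eqseq_cons; [ring | case: eqP => //= _; ring].
Qed.

Lemma letter_exp_foxL i k : foxL i (letter_exp i k) * letter i = letter_exp i k - 1.
Proof.
apply: seriesP => w; case/lastP: w => [|v x]; rewrite saddE soppE.
  by rewrite smul_nil letter_exp_nil /letter /sone /monomial /=; ring.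
rewrite smul_letterr /sone /monomial -size_eq0 size_rcons /= /foxL.
case: eqP => [->|/eqP/negbTE xi]; first by ring.
by rewrite letter_expE -iwordP /iword all_rcons /= xi /=; ring.
Qed.

Lemma Csum_const m (c : C) : \csum_(j < m) c = (RtoC (INR m) * c)%C.
Proof.
elim: m => [|m IH]; first by rewrite big_ord0 Cmult_0_l.
rewrite big_ord_recr IH S_INR RtoC_plus Cmult_plus_distr_r Cmult_1_l; reflexivity.
Qed.

Lemma KKS_iword a i m : KKS a (nseq m i) = (RtoC (INR m) * a (nseq m.+1 i))%C.
Proof.
rewrite KKS_double size_nseq.
rewrite (eq_bigr (fun=> a (nseq m.+1 i))) => [|j _].
  exact: Csum_const.
congr (a _); apply/eqP; rewrite -[X in _ == nseq X i](_ : size (take j.+1 (nseq m i) ++ drop j (nseq m i)) = m.+1).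
  by rewrite -iwordP /iword all_cat; apply/andP; split; apply/allP => y;
     [move/mem_take | move/mem_drop]; rewrite mem_nseq => /andP [_ /=].
by rewrite size_cat size_drop size_takel size_nseq // addSn subnKC // ltnW.
Qed.

(** A series in the single letter i is determined by the recursion of the exponential series. *)
Lemma letter_exp_char i k a : a [::] = RtoC 1 -> (forall v, ~~ iword i v -> a v = RtoC 0) ->
  (forall m, (RtoC (INR m.+1) * a (nseq m.+1 i) = k * a (nseq m i))%C) -> a = letter_exp i k.
Proof.
move=> a0 aw am; apply: seriesP => w; rewrite letter_expE -iwordP.
case: ifP => [|/negbT /aw //]; rewrite iwordP => /eqP {1}->.
elim: (size w) => [|m IH]; first by rewrite a0 /= Rinv_1 Cmult_1_l.
have m0 : RtoC (INR m.+1) <> RtoC 0.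
  by move/RtoC_inj; apply: not_0_INR.
have f0 : RtoC (INR m`!) <> RtoC 0.
  by move/RtoC_inj; apply: not_0_INR; apply/eqP; rewrite -lt0n fact_gt0.
have := am m; rewrite IH => E.
have -> : a (nseq m.+1 i) = (/ RtoC (INR m.+1) * (RtoC (INR m.+1) * a (nseq m.+1 i)))%C by field.
rewrite E factS -multE mult_INR.
have fr : INR m`! <> 0 by move=> E1; apply: f0; rewrite E1.
have mr : INR m.+1 <> 0 by move=> E1; apply: m0; rewrite E1.
rewrite !RtoC_inv //; last exact: Rmult_integral_contrapositive_currified.
by rewrite RtoC_mult /=; field.
Qed.

Lemma letter_exp_S i k m : (RtoC (INR m.+1) * letter_exp i k (nseq m.+1 i) = k * letter_exp i k (nseq m i))%C.
Proof.
rewrite !letter_expE !size_nseq !eqxx factS -multE mult_INR.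
have fr : INR m`! <> 0 by apply: not_0_INR; apply/eqP; rewrite -lt0n fact_gt0.
have mr : INR m.+1 <> 0 by apply: not_0_INR.
rewrite !RtoC_inv //; last exact: Rmult_integral_contrapositive_currified.
have fc : RtoC (INR m`!) <> RtoC 0 by move/RtoC_inj.
have mc : RtoC (INR m.+1) <> RtoC 0 by move/RtoC_inj.
by rewrite RtoC_mult [(k ^ m.+1)%C]/=; field.
Qed.

Lemma letter_exp_not_iword i k v : ~~ iword i v -> letter_exp i k v = RtoC 0.
Proof. by rewrite iwordP letter_expE => /negbTE ->. Qed.

(** On the words x_i^m both sides are the coefficient equation of the exponential series: the
    m ways of doubling a letter and the one way of adding it in front give (m + 1) of the
    coefficient of x_i^(m+1). *)
Lemma KKS_letter_exp i k : KKS (letter_exp i k) + foxR i (letter_exp i k) = k *: letter_exp i k.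
Proof.
apply: seriesP => w; rewrite saddE sscaleE /foxR.
case iw: (iword i w).
  move: iw; rewrite iwordP => /eqP ->; rewrite KKS_iword.
  rewrite -[(i :: nseq _ i)]/(nseq (size w).+1 i) -letter_exp_S S_INR RtoC_plus; ring.
have iw' := negbT iw.
rewrite (letter_exp_not_iword _ iw') (@letter_exp_not_iword _ _ (i :: w)); last by rewrite /iword /= eqxx.
rewrite KKS_double big1 ?Cplus_0_r ?Cmult_0_r // => j _; apply: letter_exp_not_iword.
apply: contra iw'; rewrite /iword all_cat => /andP [A B].
rewrite -(cat_take_drop j w) all_cat B andbT.
apply/allP => y yw; apply: (allP A).
by rewrite -(cat_take_drop j (take j.+1 w)) mem_cat take_takel // yw.
Qed.

(** Both sides solve the recursion that characterizes the exponential. *)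
Lemma letter_exp_add i k l : letter_exp i k * letter_exp i l = letter_exp i (k + l).
Proof.
set X := _ * _.
have X0 : X [::] = RtoC 1 by rewrite /X smul_nil !letter_exp_nil; ring.
have sup v : ~~ iword i v -> X v = RtoC 0.
  move=> iv; rewrite /X smulE_sum big1 // => j _.
  move: iv; rewrite -{1}(cat_take_drop j v) /iword all_cat negb_and => /orP [] H.
    by rewrite letter_exp_not_iword ?Cmult_0_l.
  by rewrite [X in (_ * X)%C]letter_exp_not_iword ?Cmult_0_r.
have D : KKS X + foxR i X = (k + l)%C *: X.
  have mE : fox_merge (letter_exp i k) (letter_exp i l) = (letter_exp i k - 1) * foxR i (letter_exp i l).
    rewrite -letter_exp_foxL -smulA /fox_merge; apply: seriesP => w; rewrite ssumE (bigD1 i) //= big1.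
      by rewrite Cplus_0_r.
    by move=> j ji; rewrite foxL_letter_exp_neq // smul0l.
  rewrite /X KKS_mul mE foxR_mul letter_exp_nil.
  have E1 := KKS_letter_exp i k; have E2 := KKS_letter_exp i l.
  have -> : (k + l)%C *: (letter_exp i k * letter_exp i l) = (k *: letter_exp i k) * letter_exp i l + letter_exp i k * (l *: letter_exp i l).
    by rewrite smulZl smulZr; apply: seriesP => w; rewrite saddE !sscaleE; ring.
  rewrite -E1 -E2 smulBl smul1l smulDl smulDr.
  by apply: seriesP => w; rewrite !saddE soppE sscaleE; ring.
apply: letter_exp_char => // m.
have := f_equal (fun a => a (nseq m i)) D; rewrite saddE sscaleE KKS_iword /foxR => <-.
by rewrite S_INR RtoC_plus -[i :: _]/(nseq m.+1 i); ring.
Qed.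

Lemma letter_exp0 i : letter_exp i 0 = 1.
Proof.
symmetry; apply: letter_exp_char => // [v|m]; last by rewrite /sone /monomial /=; ring.
by case: v.
Qed.

Lemma letter_exp_inv i k : letter_exp i (- k) * letter_exp i k = 1.
Proof. by rewrite letter_exp_add (_ : (- k + k)%C = RtoC 0) ?letter_exp0 //; ring. Qed.

Lemma letter_exp_invr i k : letter_exp i k * letter_exp i (- k) = 1.
Proof. by rewrite letter_exp_add (_ : (k + - k)%C = RtoC 0) ?letter_exp0 //; ring. Qed.

(** The geometric series in 1 - a, an inverse for a of augmentation 1. *)
Definition sinv a : series n := subst_series (fun=> RtoC 1) (1 - a).

Section Inverse.
Variable a : series n.
Hypothesis a1 : a [::] = RtoC 1.
Let u := 1 - a.
Let u0 : u [::] = RtoC 0.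
Proof. by rewrite /u saddE soppE a1 /sone /monomial /=; ring. Qed.

Lemma sinv_sum N w : (size w <= N)%N -> sinv a w = \csum_(k < N.+1) spow u k w.
Proof.
move=> wN; rewrite -(subnKC wN); elim: (N - _)%N => [|d IH].
  by rewrite addn0; apply: eq_bigr => k _; rewrite Cmult_1_l.
rewrite addnS big_ord_recr -IH (spow_small u0); first by rewrite [LHS]/= [RHS]Cplus_0_r.
by rewrite ltnS leq_addr.
Qed.

Lemma sinv_fixr : sinv a = 1 + u * sinv a.
Proof.
apply: seriesP => w; rewrite (@sinv_sum (size w).+1) // big_ord_recl; congr Cplus.
rewrite smulE_sum.
transitivity (\csum_(j < (size w).+1) \csum_(k < (size w).+1) (u (take j w) * spow u k (drop j w))).
  by rewrite exchange_big /=; apply: eq_bigr => k _.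
apply: eq_bigr => j _; rewrite (@sinv_sum (size w)) ?Csum_scal //.
by rewrite size_drop leq_subr.
Qed.

Lemma sinv_fixl : sinv a = 1 + sinv a * u.
Proof.
apply: seriesP => w; rewrite (@sinv_sum (size w).+1) // big_ord_recl; congr Cplus.
rewrite smulE_sum.
transitivity (\csum_(j < (size w).+1) \csum_(k < (size w).+1) (u (drop j w) * spow u k (take j w))).
  rewrite [RHS]exchange_big /=; apply: eq_bigr => k _.
  transitivity (spow u k.+1 w); first by [].
  by rewrite spowS -spow_comm smulE_sum; apply: eq_bigr => j _; rewrite Cmult_comm.
apply: eq_bigr => j _; rewrite (@sinv_sum (size w)) ?Csum_scal; first by rewrite Cmult_comm.
by rewrite size_take_min geq_minr.
Qed.

Let aE : a = 1 - u.
Proof. by apply: seriesP => w; rewrite /u !saddE !soppE saddE soppE; ring. Qed.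

Lemma smulrV : a * sinv a = 1.
Proof.
rewrite {1}aE smulBl smul1l {1}sinv_fixr.
by apply: seriesP => w; rewrite !saddE soppE; ring.
Qed.

Lemma smulVr : sinv a * a = 1.
Proof.
rewrite {2}aE smulBr smul1r {1}sinv_fixl.
by apply: seriesP => w; rewrite !saddE soppE; ring.
Qed.
End Inverse.

Lemma inverse_unique a b c : b * a = 1 -> a * c = 1 -> b = c.
Proof. by move=> ba ac; rewrite -(smul1r b) -ac smulA ba smul1l. Qed.

End Exp.

Section EndAlgebra.
Variable n : nat.
Local Open Scope series_scope.
Implicit Types (i : 'I_n) (a b : series n).

(** Only the letter of the exponential can merge, and foxL i E x_i = E - 1. *)
Lemma fox_merge_letter_expl i k a : fox_merge (letter_exp i k) a = (letter_exp i k - 1) * foxR i a.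
Proof.
apply: seriesP => w; rewrite /fox_merge ssumE (bigD1 i) //= smulA letter_exp_foxL big1 ?Cplus_0_r // => x xi.
by rewrite foxL_letter_exp_neq ?smul0l.
Qed.

Lemma fox_merge_letter_expr i k a : fox_merge a (letter_exp i k) = foxL i a * (letter_exp i k - 1).
Proof.
apply: seriesP => w; rewrite /fox_merge ssumE (bigD1 i) //= letter_exp_foxR big1 ?Cplus_0_r // => x xi.
by rewrite foxR_letter_exp_neq ?smul0r // smul0r.
Qed.

(** The products E_q KKS(..) E_p with E = exp of a multiple of a letter still contain that
    multiple, which is the logarithm of the cut-off. It cancels: KKS(E) + foxR(E) is a
    multiple of E, with opposite multiples at the two ends. For p <> q the
    derivatives foxR q (E_p) and foxL p (E_q) vanish. *)
Lemma conjugated_KKS p q k a : p != q -> a [::] = RtoC 1 ->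
  letter_exp q (- k) * KKS (letter_exp q k * (a * letter_exp p (- k))) * letter_exp p k
  + letter_exp q (- k) * (foxR q (letter_exp q k * a) - foxR q (letter_exp p k))
  + (foxL p (a * letter_exp p (- k)) - foxL p (letter_exp q (- k))) * letter_exp p k
  = KKS a + foxR q a + foxL p a.
Proof.
move=> pq a1; have qp : q != p by rewrite eq_sym.
rewrite (foxR_letter_exp_neq k qp) (foxL_letter_exp_neq _ pq) !KKS_mul !fox_merge_letter_expl fox_merge_letter_expr.
rewrite !foxR_mul (foxR_letter_exp_neq _ qp) foxL_mul a1 !letter_exp_nil.
have Kq := KKS_letter_exp q k; have Kp := KKS_letter_exp p (- k).
rewrite -foxLR_letter_exp in Kp.
have {}Kq : KKS (letter_exp q k) = k *: letter_exp q k - foxR q (letter_exp q k).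
  by rewrite -Kq; apply: seriesP => w; rewrite !saddE soppE; ring.
have {}Kp : KKS (letter_exp p (- k)) = (- k) *: letter_exp p (- k) - foxL p (letter_exp p (- k)).
  by rewrite -Kp; apply: seriesP => w; rewrite !saddE soppE; ring.
rewrite Kq Kp.
have c1 x : RtoC 1 *: x = x :> series n by apply: seriesP => w; rewrite sscaleE; ring.
have z1 x c : c *: szero + x = x :> series n.
  by apply: seriesP => w; rewrite saddE sscaleE /szero; ring.
have z2 x : x - szero = x :> series n.
  by apply: seriesP => w; rewrite saddE soppE /szero; ring.
rewrite !z1 !c1 !z2.
pose A := letter_exp q k; pose A' := letter_exp q (- k); pose B := letter_exp p k; pose B' := letter_exp p (- k).
have e1 : A' * A = 1 := letter_exp_inv q k.
have e2 : B' * B = 1 := letter_exp_inv p k.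
have e3 x : A' * (A * x) = x by rewrite smulA e1 smul1l.
rewrite -/A -/A' -/B -/B' !(smulDl, smulDr, smulNl, smulNr, smulZl, smulZr, smul1l, smul1r) -!smulA.
rewrite !(e1, e2, e3, smul1r).
apply: seriesP => w; rewrite !(saddE, soppE, sscaleE); ring.
Qed.
End EndAlgebra.

(** * Growth up to arbitrarily small powers *)

(** Closure properties shared by continuity, differentiability and moderate growth. A series
    has the property when its coefficients do, and each coefficient of a product, inverse,
    exponential or coaction is a polynomial in finitely many coefficients. *)
Record alg_class (T : Type) (P : (T -> C) -> Prop) : Prop := {
  ac_const : forall c, P (fun=> c);
  ac_add : forall f g, P f -> P g -> P (fun x => f x + g x)%C;
  ac_mul : forall f g, P f -> P g -> P (fun x => f x * g x)%C
}.

Section AlgClass.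
Variables (T : Type) (P : (T -> C) -> Prop) (n : nat).
Hypothesis AP : alg_class P.
Local Open Scope series_scope.

Definition sclass (X : T -> series n) := forall w, P (fun x => X x w).

Lemma ac_ext f g : (forall x, f x = g x) -> P f -> P g.
Proof. by move=> E; rewrite (functional_extensionality f g E). Qed.

Lemma ac_opp f : P f -> P (fun x => - f x)%C.
Proof.
move=> Pf; apply: ac_ext (ac_mul AP (ac_const AP (- RtoC 1)%C) Pf) => x; ring.
Qed.

Lemma ac_sub f g : P f -> P g -> P (fun x => f x - g x)%C.
Proof. by move=> Pf Pg; apply: (ac_add AP) => //; apply: ac_opp. Qed.

Lemma ac_sum (I : finType) (F : I -> T -> C) : (forall i, P (F i)) -> P (fun x => \csum_(i : I) F i x).
Proof.
move=> H; elim: (index_enum I) => [|i r IH].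
  by apply: ac_ext (ac_const AP (RtoC 0)) => x; rewrite big_nil.
by apply: ac_ext (ac_add AP (H i) IH) => x; rewrite big_cons.
Qed.

Lemma ac_pow f k : P f -> P (fun x => f x ^ k)%C.
Proof.
move=> Pf; elim: k => [|k IH]; first exact: (ac_const AP (RtoC 1)).
exact: (ac_mul AP Pf IH).
Qed.

Lemma sclass_const (a : series n) : sclass (fun=> a).
Proof. by move=> w; apply: (ac_const AP). Qed.

Lemma sclass_add X Y : sclass X -> sclass Y -> sclass (fun x => X x + Y x).
Proof. by move=> HX HY w; apply: (ac_add AP). Qed.

Lemma sclass_sub X Y : sclass X -> sclass Y -> sclass (fun x => X x - Y x).
Proof. by move=> HX HY w; apply: ac_sub. Qed.

Lemma sclass_mul X Y : sclass X -> sclass Y -> sclass (fun x => X x * Y x).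
Proof. by move=> HX HY w; apply: ac_sum => k; apply: (ac_mul AP). Qed.

Lemma sclass_foxL i X : sclass X -> sclass (fun x => foxL i (X x)).
Proof. by move=> HX w; apply: HX. Qed.

Lemma sclass_foxR i X : sclass X -> sclass (fun x => foxR i (X x)).
Proof. by move=> HX w; apply: HX. Qed.

Lemma sclass_KKS X : sclass X -> sclass (fun x => KKS (X x)).
Proof.
move=> HX w; apply: ac_ext (ac_sum (F := fun j x => X x (take (nat_of_ord j).+1 w ++ drop j w)) _) => [x|j].
  by rewrite KKS_double.
exact: HX.
Qed.

Lemma sclass_spow X k : sclass X -> sclass (fun x => spow (X x) k).
Proof.
by move=> HX; elim: k => [|k IH]; [exact: sclass_const | exact: sclass_mul].
Qed.

Lemma sclass_sinv X : sclass X -> sclass (fun x => sinv (X x)).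
Proof.
move=> HX w; apply: ac_sum => k; apply: (ac_mul AP); first exact: (ac_const AP).
by apply: sclass_spow; apply: sclass_sub => //; exact: sclass_const.
Qed.

Lemma sclass_letter_exp i f : P f -> sclass (fun x => letter_exp i (f x)).
Proof.
move=> Pf w; apply: ac_ext (_ : P (fun x => if w == nseq (size w) i
   then (RtoC (/ INR (size w)`!) * f x ^ size w)%C else RtoC 0)) => [x|]; first by rewrite letter_expE.
case: (w == _); last exact: (ac_const AP).
by apply: (ac_mul AP); [exact: (ac_const AP) | exact: ac_pow].
Qed.
End AlgClass.

Lemma ac_cts (U : UniformSpace) (x : U) : alg_class (fun f : U -> C => Ccts f x).
Proof. by split=> [c|f g|f g]; [apply: Ccts_const | apply: Ccts_plus | apply: Ccts_mult]. Qed.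

Lemma ac_der (t : R) : alg_class (fun f => exists l, Cder f t l).
Proof.
split=> [c|f g [l Hl] [m Hm]|f g [l Hl] [m Hm]]; eexists.
- exact: Cder_const.
- exact: Cder_plus Hl Hm.
- exact: Cder_mult Hl Hm.
Qed.

Section Growth.
Variables (T : Type) (D : T -> Prop) (sg : T -> R).
Hypothesis sg01 : forall x, D x -> 0 < sg x <= 1.

(** O(sigma^-al) for every al > 0: the order of a polynomial in ln sigma, in a form that
    is stable under products. *)
Definition Grow (X : T -> C) := forall al, 0 < al -> exists2 c, 0 <= c & forall x, D x ->
  Cmod (X x) <= c * Rpower (sg x) (- al).

(** O(sigma^(1 - al)) for every al > 0, negligible against every quantity of moderate growth. *)
Definition Small (X : T -> C) := forall al, 0 < al -> exists2 c, 0 <= c & forall x, D x ->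
  Cmod (X x) <= c * (sg x * Rpower (sg x) (- al)).

Lemma Rpower_ge1 s al : 0 < s <= 1 -> 0 < al -> 1 <= Rpower s (- al).
Proof.
move=> [s0 s1] a0; rewrite /Rpower -exp_0.
have : ln s <= 0 by rewrite -ln_1; case: (Req_dec s 1) => [->|?]; [lra | apply: Rlt_le; apply: ln_increasing; lra].
move=> l0; case: (Req_dec (ln s) 0) => [->|?]; first by rewrite Rmult_0_r; lra.
by apply: Rlt_le; apply: exp_increasing; nra.
Qed.

Lemma Rpower_half s al : Rpower s (- (al / 2)) * Rpower s (- (al / 2)) = Rpower s (- al).
Proof. by rewrite -Rpower_plus; congr Rpower; field. Qed.

Lemma Rpower_gt0 s al : 0 < Rpower s al.
Proof. exact: exp_pos. Qed.

Lemma Grow_bounded X M : (forall x, D x -> Cmod (X x) <= M) -> Grow X.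
Proof.
move=> H al a0; exists (Rmax 0 M); first exact: Rmax_l.
move=> x Dx; have := H x Dx; have := Rpower_ge1 (sg01 Dx) a0.
by have := Rmax_l 0 M; have := Rmax_r 0 M; nra.
Qed.

Lemma ac_grow : alg_class Grow.
Proof.
split=> [c|f g Hf Hg al a0|f g Hf Hg al a0].
- by apply: (@Grow_bounded _ (Cmod c)) => x _; lra.
- have [c c0 Hc] := Hf al a0; have [d d0 Hd] := Hg al a0.
  exists (c + d) => [|x Dx]; first by lra.
  by apply: Rle_trans (Cmod_triangle _ _) _; have := Hc x Dx; have := Hd x Dx; nra.
have a2 : 0 < al / 2 by lra.
have [c c0 Hc] := Hf _ a2; have [d d0 Hd] := Hg _ a2.
exists (c * d) => [|x Dx]; first by nra.
rewrite Cmod_mult -Rpower_half.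
have -> : c * d * (Rpower (sg x) (- (al / 2)) * Rpower (sg x) (- (al / 2))) =
  (c * Rpower (sg x) (- (al / 2))) * (d * Rpower (sg x) (- (al / 2))) by ring.
by apply: Rmult_le_compat; try exact: Cmod_ge_0; [apply: Hc | apply: Hd].
Qed.

Lemma Small_add f g : Small f -> Small g -> Small (fun x => f x + g x)%C.
Proof.
move=> Hf Hg al a0.
have [c c0 Hc] := Hf al a0; have [d d0 Hd] := Hg al a0.
exists (c + d) => [|x Dx]; first by lra.
by apply: Rle_trans (Cmod_triangle _ _) _; have := Hc x Dx; have := Hd x Dx; lra.
Qed.

Lemma Small_mul f g : Grow f -> Small g -> Small (fun x => f x * g x)%C.
Proof.
move=> Hf Hg al a0; have a2 : 0 < al / 2 by lra.
have [c c0 Hc] := Hf _ a2; have [d d0 Hd] := Hg _ a2.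
exists (c * d) => [|x Dx]; first by nra.
rewrite Cmod_mult -Rpower_half.
have -> : c * d * (sg x * (Rpower (sg x) (- (al / 2)) * Rpower (sg x) (- (al / 2)))) =
  (c * Rpower (sg x) (- (al / 2))) * (d * (sg x * Rpower (sg x) (- (al / 2)))) by ring.
by apply: Rmult_le_compat; try exact: Cmod_ge_0; [apply: Hc | apply: Hd].
Qed.

Lemma Small_0 : Small (fun=> RtoC 0).
Proof.
move=> al a0; exists 0 => [|x Dx]; first by lra.
by rewrite Cmod_0 Rmult_0_l; lra.
Qed.

Lemma Small_sum (I : finType) (F : I -> T -> C) : (forall i, Small (F i)) ->
  Small (fun x => \csum_(i : I) F i x).
Proof.
move=> H; elim: (index_enum I) => [|i r IH].
  have -> : (fun x => \big[Cplus/RtoC 0]_(i <- [::]) F i x) = (fun=> RtoC 0).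
    by apply: functional_extensionality => x; rewrite big_nil.
  exact: Small_0.
have -> : (fun x => \big[Cplus/RtoC 0]_(j <- i :: r) F j x) =
   (fun x => F i x + \big[Cplus/RtoC 0]_(j <- r) F j x)%C.
  by apply: functional_extensionality => x; rewrite big_cons.
exact: Small_add.
Qed.

Lemma Small_bounded X M : (forall x, D x -> Cmod (X x) <= M * sg x) -> Small X.
Proof.
move=> H al a0; exists (Rmax 0 M); first exact: Rmax_l.
move=> x Dx; have := H x Dx; have [s0 _] := sg01 Dx; have := Rpower_ge1 (sg01 Dx) a0.
have m1 := Rmax_l 0 M; have m2 := Rmax_r 0 M => r1 K.
apply: Rle_trans K _; apply: Rle_trans (_ : Rmax 0 M * sg x <= _); first by nra.
by apply: Rmult_le_compat_l => //; nra.
Qed.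

Lemma abs_ln_le s s' al : 0 < al -> 0 < s -> s <= s' <= 1 -> Rabs (ln s') <= / al * Rpower s (- al).
Proof.
move=> a0 s0 [ss s1].
have l1 : ln s <= ln s'.
  by case: (Req_dec s s') => [->|?]; [lra | apply: Rlt_le; apply: ln_increasing; lra].
have l2 : ln s' <= 0.
  by rewrite -ln_1; case: (Req_dec s' 1) => [->|?]; [lra | apply: Rlt_le; apply: ln_increasing; lra].
rewrite Rabs_left1 //.
have E : 1 + - al * ln s <= Rpower s (- al).
  rewrite /Rpower; case: (Req_dec (- al * ln s) 0) => [->|?]; first by rewrite exp_0; lra.
  by apply: Rlt_le; apply: exp_ineq1.
have -> : - ln s' = / al * (- al * ln s') by field; lra.
apply: Rmult_le_compat_l; first by apply: Rlt_le; apply: Rinv_0_lt_compat.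
by nra.
Qed.

Lemma Grow_ln (f : T -> R) : (forall x, D x -> sg x <= f x <= 1) -> Grow (fun x => RtoC (ln (f x))).
Proof.
move=> H al a0; exists (/ al); first by apply: Rlt_le; apply: Rinv_0_lt_compat.
by move=> x Dx; rewrite Cmod_R; apply: abs_ln_le => //; [have := sg01 Dx; lra | apply: H].
Qed.

Definition sapprox n (X Y : T -> series n) := forall w, Small (fun x => X x w - Y x w)%C.
Local Open Scope series_scope.

Lemma Small_ext f g : (forall x, f x = g x) -> Small f -> Small g.
Proof. by move=> E; rewrite (functional_extensionality f g E). Qed.

Lemma Small_extD f g : (forall x, D x -> f x = g x) -> Small f -> Small g.
Proof. by move=> E H al /H [c c0 Hc]; exists c => // x Dx; rewrite -E //; apply: Hc. Qed.

Lemma sapprox_extD n (X X' Y Y' : T -> series n) : (forall x, D x -> X x = X' x) ->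
  (forall x, D x -> Y x = Y' x) -> sapprox X Y -> sapprox X' Y'.
Proof. by move=> EX EY H w; apply: Small_extD (H w) => x Dx; rewrite EX // EY. Qed.

Lemma sapprox_refl n (X : T -> series n) : sapprox X X.
Proof. by move=> w; apply: Small_ext Small_0 => x; ring. Qed.

Lemma sapprox_sym n (X Y : T -> series n) : sapprox X Y -> sapprox Y X.
Proof.
move=> H w; apply: Small_ext (Small_mul (ac_const ac_grow (- RtoC 1)%C) (H w)) => x; ring.
Qed.

Lemma sapprox_add n (X X' Y Y' : T -> series n) : sapprox X X' -> sapprox Y Y' ->
  sapprox (fun x => X x + Y x) (fun x => X' x + Y' x).
Proof.
by move=> HX HY w; apply: Small_ext (Small_add (HX w) (HY w)) => x; rewrite !saddE; ring.
Qed.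

Lemma sapprox_opp n (X X' : T -> series n) : sapprox X X' ->
  sapprox (fun x => - X x) (fun x => - X' x).
Proof.
move=> HX w; apply: Small_ext (Small_mul (ac_const ac_grow (- RtoC 1)%C) (HX w)) => x.
by rewrite !soppE; ring.
Qed.

(** X Y - X' Y' = (X - X') Y + X' (Y - Y'). *)
Lemma sapprox_mul n (X X' Y Y' : T -> series n) : sapprox X X' -> sapprox Y Y' ->
  sclass Grow X' -> sclass Grow Y ->
  sapprox (fun x => X x * Y x) (fun x => X' x * Y' x).
Proof.
move=> HX HY GX GY w.
have S1 : Small (fun x => \csum_(k < (size w).+1) (Y x (drop k w) * (X x (take k w) - X' x (take k w)))).
  by apply: Small_sum => k; apply: Small_mul; [apply: GY | apply: HX].
have S2 : Small (fun x => \csum_(k < (size w).+1) (X' x (take k w) * (Y x (drop k w) - Y' x (drop k w)))).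
  by apply: Small_sum => k; apply: Small_mul; [apply: GX | apply: HY].
apply: Small_ext (Small_add S1 S2) => x.
rewrite !smulE_sum -[RHS]Cplus_0_r.
set A := \csum_(_ < _) _; set B := \csum_(_ < _) _; set L := bigop.body _ _ _; set M := bigop.body _ _ _.
have -> : L = (A + B + M)%C.
  by rewrite /A /B /M -!Csum_add; apply: eq_bigr => k _; ring.
by ring.
Qed.

Lemma sapprox_foxL n i (X X' : T -> series n) : sapprox X X' ->
  sapprox (fun x => foxL i (X x)) (fun x => foxL i (X' x)).
Proof. by move=> H w; apply: H. Qed.

Lemma sapprox_foxR n i (X X' : T -> series n) : sapprox X X' ->
  sapprox (fun x => foxR i (X x)) (fun x => foxR i (X' x)).
Proof. by move=> H w; apply: H. Qed.

Lemma sapprox_KKS n (X X' : T -> series n) : sapprox X X' ->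
  sapprox (fun x => KKS (X x)) (fun x => KKS (X' x)).
Proof.
move=> H w; apply: Small_ext (Small_sum (F := fun j x => (X x (take (nat_of_ord j).+1 w ++ drop j w) -
  X' x (take (nat_of_ord j).+1 w ++ drop j w))%C) _) => [x|j]; last exact: H.
by rewrite !KKS_double Csum_sub.
Qed.
End Growth.

(** * Chain rule along a path, power series on the real line *)

Lemma is_derive_epsP (f : R -> R) t l :
  (forall e, 0 < e -> exists2 r, 0 < r & forall s, Rabs (s - t) < r ->
     Rabs (f s - f t - (s - t) * l) <= e * Rabs (s - t)) <-> is_derive f t l.
Proof.
split=> [H|H].
  split; first exact: is_linear_scal_l.
  move=> x /is_filter_lim_locally_unique <- e.
  have [r r0 Hr] := H e (cond_pos e); exists (mkposreal _ r0) => s Hs.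
  exact: Hr.
move=> e e0; case: H => _ /(_ t) H.
have {}H := H (fun P HP => HP) (mkposreal _ e0).
have [r Hr] := H; exists r => [|s Hs]; first exact: cond_pos.
exact: (Hr s).
Qed.

Lemma Cder_epsP (f : R -> C) t l :
  (forall e, 0 < e -> exists2 r, 0 < r & forall s, Rabs (s - t) < r ->
     Cmod (f s - f t - RtoC (s - t) * l)%C <= e * Rabs (s - t)) <-> Cder f t l.
Proof.
split=> [H|[H1 H2] e e0].
  split; apply/is_derive_epsP => e /H [r r0 Hr]; exists r => // s Hs;
    apply: Rle_trans (Hr s Hs).
    have -> : Re (f s) - Re (f t) - (s - t) * Re l = Re (f s - f t - RtoC (s - t) * l)%C.
      by rewrite /Re /Im /=; ring.
    exact: Re_le_Cmod.
  have -> : Im (f s) - Im (f t) - (s - t) * Im l = Im (f s - f t - RtoC (s - t) * l)%C.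
    by rewrite /Re /Im /=; ring.
  exact: Im_le_Cmod.
have e2 : 0 < e / 2 by lra.
have [r1 r10 K1] := proj2 (is_derive_epsP _ _ _) H1 _ e2.
have [r2 r20 K2] := proj2 (is_derive_epsP _ _ _) H2 _ e2.
exists (Rmin r1 r2) => [|s Hs]; first exact: Rmin_pos.
have m1 := Rmin_l r1 r2; have m2 := Rmin_r r1 r2.
apply: Rle_trans (Cmod_le_parts _) _.
have -> : Re (f s - f t - RtoC (s - t) * l)%C = Re (f s) - Re (f t) - (s - t) * Re l.
  by rewrite /Re /Im /=; ring.
have -> : Im (f s - f t - RtoC (s - t) * l)%C = Im (f s) - Im (f t) - (s - t) * Im l.
  by rewrite /Re /Im /=; ring.
have := K1 s ltac:(lra); have := K2 s ltac:(lra).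
by lra.
Qed.

Lemma complex_derive_eps (f : C -> C) u l :
  is_derive (K := C_AbsRing) (V := C_NormedModule) f u l ->
  forall e, 0 < e -> exists2 r, 0 < r & forall y, Cmod (y - u)%C < r ->
     Cmod (f y - f u - (y - u) * l)%C <= e * Cmod (y - u)%C.
Proof.
move=> [_ /(_ u) H] e e0.
have {}H := H (fun P HP => HP) (mkposreal _ e0).
have [r Hr] := H; exists r => [|y Hy]; first exact: cond_pos.
exact: (Hr y).
Qed.

(** A complex derivative composed with a path; the two notions of derivative meet in the
    epsilon form of differentiability. *)
Lemma Cder_along (f : C -> C) (g : R -> C) t l m :
  is_derive (K := C_AbsRing) (V := C_NormedModule) f (g t) l -> Cder g t m ->
  Cder (fun s => f (g s)) t (m * l)%C.
Proof.
move=> Hf Hg; apply/Cder_epsP => e e0.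
have l0 := Cmod_ge_0 l; have m0 := Cmod_ge_0 m.
have e1 : 0 < e / (2 * (Cmod m + 1)) by apply: Rdiv_lt_0_compat; lra.
have e2 : 0 < Rmin 1 (e / (2 * (Cmod l + 1))).
  by apply: Rmin_pos; [lra | apply: Rdiv_lt_0_compat; lra].
have [r1 r10 K1] := complex_derive_eps Hf e1.
have [r2 r20 K2] := proj2 (Cder_epsP _ _ _) Hg _ e2.
exists (Rmin r2 (r1 / (Cmod m + 1))) => [|s Hs].
  by apply: Rmin_pos => //; apply: Rdiv_lt_0_compat; lra.
have n1 := Rmin_l r2 (r1 / (Cmod m + 1)); have n2 := Rmin_r r2 (r1 / (Cmod m + 1)).
have n3 := Rmin_l 1 (e / (2 * (Cmod l + 1))); have n4 := Rmin_r 1 (e / (2 * (Cmod l + 1))).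
have {}K2 := K2 s ltac:(lra).
set E := Rmin 1 _ in K2 e2 n3 n4.
have d0 := Rabs_pos (s - t); set d := Rabs (s - t) in K2 d0 Hs *.
have B : Cmod (g s - g t)%C <= (Cmod m + 1) * d.
  have -> : (g s - g t = (g s - g t - RtoC (s - t) * m) + RtoC (s - t) * m)%C by ring.
  apply: Rle_trans (Cmod_triangle _ _) _; rewrite (Cmod_mult (RtoC _)) Cmod_R -/d.
  by nra.
have small : Cmod (g s - g t)%C < r1.
  apply: Rle_lt_trans B _; have : d < r1 / (Cmod m + 1) by lra.
  by move/Rlt_div_r => K; have := K ltac:(lra); lra.
have {}K1 := K1 _ small.
have -> : (f (g s) - f (g t) - RtoC (s - t) * (m * l) =
   (f (g s) - f (g t) - (g s - g t) * l) + (g s - g t - RtoC (s - t) * m) * l)%C by ring.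
apply: Rle_trans (Cmod_triangle _ _) _; rewrite Cmod_mult.
have T1 : e / (2 * (Cmod m + 1)) * Cmod (g s - g t)%C <= e / 2 * d.
  apply: Rle_trans (_ : e / (2 * (Cmod m + 1)) * ((Cmod m + 1) * d) <= _).
    by apply: Rmult_le_compat_l => //; lra.
  by apply: Req_le; field; lra.
have T2 : Cmod (g s - g t - RtoC (s - t) * m)%C * Cmod l <= e / 2 * d.
  apply: Rle_trans (_ : (e / (2 * (Cmod l + 1)) * d) * Cmod l <= _).
    by apply: Rmult_le_compat_r => //; apply: Rle_trans K2 _; apply: Rmult_le_compat_r.
  have -> : e / (2 * (Cmod l + 1)) * d * Cmod l = e / 2 * d * (Cmod l / (Cmod l + 1)) by field; lra.
  have q : Cmod l / (Cmod l + 1) <= 1 by apply/Rle_div_l; lra.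
  have : 0 <= e / 2 * d by nra.
  by nra.
by lra.
Qed.

Lemma pow_n_RtoC x k : pow_n (K := C_Ring) (RtoC x) k = RtoC (x ^ k).
Proof. by elim: k => [//|k IH]; rewrite /= IH /mult /= RtoC_mult. Qed.

Lemma sum_n_parts (a : nat -> C) N :
  sum_n (G := C_AbelianMonoid) a N = (sum_n (fun k => Re (a k)) N, sum_n (fun k => Im (a k)) N).
Proof.
elim: N => [|N IH]; first by rewrite !sum_O -surjective_pairing.
by rewrite !sum_Sn IH.
Qed.

Lemma complex_pseries_parts (a : nat -> C) x l :
  is_pseries (K := C_AbsRing) (V := C_NormedModule) a (RtoC x) l ->
  is_pseries (fun k => Re (a k)) x (Re l) /\ is_pseries (fun k => Im (a k)) x (Im l).
Proof.
rewrite /is_pseries /is_series => H.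
have E k : scal (V := C_NormedModule) (pow_n (K := C_AbsRing) (RtoC x) k) (a k) = (RtoC (x ^ k) * a k)%C.
  by rewrite -pow_n_RtoC.
split; apply/filterlim_locally => e.
  move/filterlim_locally: H => /(_ e); apply: filter_imp => N [].
  rewrite sum_n_parts /= => B _; move: B; congr (ball _ _ _).
  by apply: sum_n_ext => k; etransitivity; [exact: (f_equal Re (E k)) |];
    rewrite pow_n_pow /Re /Im /scal /= /mult /=; ring.
move/filterlim_locally: H => /(_ e); apply: filter_imp => N [].
rewrite sum_n_parts /= => _ B; move: B; congr (ball _ _ _).
by apply: sum_n_ext => k; etransitivity; [exact: (f_equal Im (E k)) |];
    rewrite pow_n_pow /Re /Im /scal /= /mult /=; ring.
Qed.

(** Inside the disk of convergence the sum has a continuous derivative. *)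
Lemma pseries_lip (a : nat -> R) (F : R -> R) r : 0 < r ->
  (forall x, Rabs x < r -> is_pseries a x (F x)) ->
  exists2 M, 0 <= M & forall x y, 0 <= x <= r / 2 -> 0 <= y <= r / 2 ->
    Rabs (F x - F y) <= M * Rabs (x - y).
Proof.
move=> r0 H.
have CV : Rbar_le (Finite (3 * r / 4)) (CV_radius a).
  apply: Rbar_not_lt_le => L.
  have K : Rbar_lt (CV_radius a) (Rabs (3 * r / 4)) by rewrite Rabs_pos_eq; [|lra].
  apply: (CV_disk_outside _ _ K).
  have Hx : Rabs (3 * r / 4) < r by rewrite Rabs_pos_eq; lra.
  have /ex_series_lim_0 : ex_series (fun k => scal (pow_n (3 * r / 4) k) (a k)) by eexists; exact: H Hx.
  apply: is_lim_seq_ext => k; rewrite pow_n_pow /scal /= /mult /=; ring.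
have CV' x : 0 <= x <= r / 2 -> Rbar_lt (Rabs x) (CV_radius a).
  by move=> Hx; apply: Rbar_lt_le_trans CV; rewrite /= Rabs_pos_eq; lra.
have FE x : 0 <= x <= r / 2 -> F x = PSeries a x.
  by move=> Hx; rewrite (is_pseries_unique _ _ _ (H x _)) // Rabs_pos_eq; lra.
have r2 : 0 <= r / 2 by lra.
have [|M [Mx _]] := continuity_ab_maj (fun x => Rabs (PSeries (PS_derive a) x)) 0 (r / 2) r2.
  move=> x Hx; apply: (continuity_pt_comp (PSeries (PS_derive a)) Rabs).
    by apply: PSeries_continuity; rewrite CV_radius_derive; apply: CV'.
  exact: Rcontinuity_abs.
set m := Rabs _ in Mx.
exists m => [|x y Hx Hy]; first exact: Rabs_pos.
rewrite !FE //.
have Hz z : Rmin y x <= z <= Rmax y x -> 0 <= z <= r / 2.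
  by rewrite /Rmin /Rmax; case: Rle_dec; lra.
have [||c [Hc ->]] := MVT_gen (PSeries a) y x (PSeries (PS_derive a)).
- by move=> z Hz'; apply: is_derive_PSeries; apply: CV'; apply: Hz; lra.
- by move=> z Hz'; apply: PSeries_continuity; apply: CV'; apply: Hz.
rewrite Rabs_mult; apply: Rmult_le_compat_r; first exact: Rabs_pos.
by apply: Mx; apply: Hz.
Qed.

Lemma complex_pseries_lip (a : nat -> C) (F : R -> C) r : 0 < r ->
  (forall x, Rabs x < r ->
     is_pseries (K := C_AbsRing) (V := C_NormedModule) a (RtoC x) (F x)) ->
  exists2 M, 0 <= M & forall x y, 0 <= x <= r / 2 -> 0 <= y <= r / 2 ->
    Cmod (F x - F y)%C <= M * Rabs (x - y).
Proof.
move=> r0 H.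
have [M1 M10 K1] := @pseries_lip (fun k => Re (a k)) (fun x => Re (F x)) r r0
   (fun x Hx => proj1 (complex_pseries_parts (H x Hx))).
have [M2 M20 K2] := @pseries_lip (fun k => Im (a k)) (fun x => Im (F x)) r r0
   (fun x Hx => proj2 (complex_pseries_parts (H x Hx))).
exists (M1 + M2) => [|x y Hx Hy]; first by lra.
apply: Rle_trans (Cmod_le_parts _) _.
by have := K1 x y Hx Hy; have := K2 x y Hx Hy; rewrite /Re /Im /= /Rminus; lra.
Qed.

(** * The KZ equation along the path *)

Section Lin.
Variable n : nat.
Local Open Scope series_scope.
Implicit Types (c : 'I_n -> C) (Y : series n).

(** The element sum_i c_i x_i of degree 1, as which the connection acts along a path. *)
Definition lin c : series n := fun w => if w is [:: i] then c i else RtoC 0.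

Lemma foxR_lin c i : foxR i (lin c) = c i *: 1.
Proof.
apply: seriesP => -[|x v]; rewrite sscaleE /foxR /lin /sone /monomial /=; ring.
Qed.

Lemma lin_mul_nil c Y : (lin c * Y) [::] = RtoC 0.
Proof. by rewrite smul_nil Cmult_0_l. Qed.

Lemma lin_mul_cons c Y i v : (lin c * Y) (i :: v) = (c i * Y v)%C.
Proof. by rewrite smul_cons foxR_lin smulZl smul1l sscaleE Cmult_0_l Cplus_0_l. Qed.

Lemma foxL_lin c i : foxL i (lin c) = c i *: 1.
Proof.
by apply: seriesP => -[|x [|y v]]; rewrite sscaleE /foxL /lin /sone /monomial /=; ring.
Qed.

Lemma mul_lin_rcons c Y i v : (Y * lin c) (rcons v i) = (Y v * c i)%C.
Proof.
rewrite smul_rcons foxL_lin smulZr smul1r sscaleE /lin; ring.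
Qed.

Lemma foxR_lin_mul c Y i : foxR i (lin c * Y) = c i *: Y.
Proof. by apply: seriesP => w; rewrite {1}/foxR lin_mul_cons. Qed.

Lemma foxL_mul_lin c Y i : foxL i (Y * lin c) = c i *: Y.
Proof. by apply: seriesP => w; rewrite {1}/foxL mul_lin_rcons sscaleE; ring. Qed.

Lemma KKS_lin c : KKS (lin c) = szero.
Proof.
apply: seriesP => w; rewrite KKS_double big1 // => j _.
case: w j => [|x v] [j Hj] //=.
by case: j Hj => [|j] Hj; rewrite ?take0 //=; case: v Hj => [|y v].
Qed.

Lemma fox_merge_lin_cons c Y x v : fox_merge (lin c) Y (x :: v) = (c x * Y (x :: v))%C.
Proof.
rewrite fox_merge_cons foxR_lin /fox_merge ssumE big1 ?Cplus_0_r // => i _.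
have -> : foxL i (c x *: 1) = szero.
  by apply: seriesP => w; rewrite /foxL sscaleE /sone /monomial -size_eq0 size_rcons /= Cmult_0_r.
by rewrite smul0l.
Qed.

Lemma scale_lin k c : k *: lin c = lin (fun i => (k * c i)%C).
Proof. by apply: seriesP => -[|x [|y v]]; rewrite sscaleE /lin; ring. Qed.
End Lin.

Lemma KZ_formE n (z : 'I_n -> C) u :
  KZ_form z u = lin (fun i => (/ two_pi_i * / (u - z i))%C).
Proof.
apply: seriesP => w; rewrite /KZ_form sscaleE ssumE.
under eq_bigr do rewrite sscaleE /letter /monomial.
case: w => [|x [|y v]] /=.
- by rewrite big1 ?Cmult_0_r // => i _; rewrite Cmult_0_r.
- congr Cmult; rewrite -(csum_pick x (fun i => (/ (u - z i))%C)).
  apply: eq_bigr => i _; rewrite eqseq_cons andbT; case: (x == i); ring.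
by rewrite big1 ?Cmult_0_r // => i _; rewrite eqseq_cons andbF Cmult_0_r.
Qed.

Section Path.
Variables (n : nat) (z : 'I_n -> C) (p q : 'I_n) (gamma : R -> C).
Hypothesis PA : tangential_path z p q gamma.

Lemma path_Cder t : 0 < t < 1 -> Cder gamma t (velocity gamma t).
Proof.
move=> Ht; have [H1 H2] := path_smooth PA 1 Ht.
by split; apply: Derive_correct.
Qed.

Lemma velocity_Cder t : 0 < t < 1 -> Cder (velocity gamma) t (path_deriv 2 gamma t).
Proof.
move=> Ht; have [H1 H2] := path_smooth PA 2 Ht.
by split; apply: Derive_correct.
Qed.

Lemma acceleration_Ccts t : 0 < t < 1 -> Ccts (path_deriv 2 gamma) t.
Proof.
move=> Ht; have [H1 H2] := path_smooth PA 3 Ht.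
by split; apply: (@ex_derive_continuous R_AbsRing R_NormedModule).
Qed.

(** The coefficient of x_i in the pullback of the connection to the path. *)
Definition conn (i : 'I_n) (t : R) : C := (/ two_pi_i * (velocity gamma t / (gamma t - z i)))%C.

Lemma conn_cts i t : 0 < t < 1 -> Ccts (conn i) t.
Proof.
move=> Ht; apply: Ccts_mult; first exact: Ccts_const.
apply: Ccts_mult; first exact: Cder_cont (velocity_Cder Ht).
apply: Ccts_inv; last by apply: Csub_neq; apply: (path_in_Sigma PA Ht).
by apply: Ccts_minus; [exact: Cder_cont (path_Cder Ht) | exact: Ccts_const].
Qed.

Definition sder (X : R -> series n) t (X' : series n) := forall w, Cder (fun s => X s w) t (X' w).

(** The statement is about a function on a neighbourhood, although Phi is controlled on the
    portion only: at an end of the portion the local branch extends Phi. *)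
Lemma continued_local a b Phi t : continued_solution z gamma a b Phi -> portion a b t ->
  exists Psi : R -> series n, [/\ sder Psi t (lin (conn^~ t) * Phi t)%S &
    exists2 d, 0 < d & forall u, portion a b u -> Rabs (u - t) < d -> Phi u = Psi u].
Proof.
move=> HP Ht; have [r [Psi [r0 KZ [d d0 Hd]]]] := HP t Ht.
have [_ t01] := Ht.
exists (fun s => Psi (gamma s)); split; last by exists d => // u Hu ut; have [] := Hd u Hu ut.
have [Dt Et] := Hd t Ht ltac:(rewrite Rminus_diag Rabs_R0 //).
have [_ K] := KZ _ Dt; move=> w.
apply: Cder_eq (Cder_along (K w) (path_Cder t01)) _.
rewrite KZ_formE -Et; case: w => [|x v]; first by rewrite !lin_mul_nil Cmult_0_r.
by rewrite !lin_mul_cons /conn /Cdiv; ring.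
Qed.

Lemma continued_sder a b Phi t : continued_solution z gamma a b Phi -> 0 < t < 1 -> a < t < b ->
  sder Phi t (lin (conn^~ t) * Phi t)%S.
Proof.
move=> HP t01 tab; have [|Psi [H [d d0 Hd]]] := @continued_local a b Phi t HP.
  by split => //; lra.
have [r1 r10 H1] := near_itv t01; have [r2 r20 H2] := near_itv tab.
move=> w; apply: Cder_ext_loc (H w).
have m0 : 0 < Rmin d (Rmin r1 r2) by do !apply: Rmin_pos.
exists (mkposreal _ m0) => u; rewrite /ball /= /AbsRing_ball /abs /minus /plus /opp /= => Hu.
have n1 := Rmin_l d (Rmin r1 r2); have n2 := Rmin_r d (Rmin r1 r2).
have n3 := Rmin_l r1 r2; have n4 := Rmin_r r1 r2.
rewrite -/(u - t) in Hu.
rewrite (Hd u) //; last by lra.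
by split; [have := H2 u; lra | apply: H1; lra].
Qed.

(** Continuity relative to a portion: the function agrees there with one that is continuous. *)
Definition pcts a b (t : R) (f : R -> C) := exists2 F : R -> C, Ccts F t &
  exists2 d, 0 < d & forall u, portion a b u -> Rabs (u - t) < d -> f u = F u.

Lemma ac_pcts a b t : alg_class (pcts a b t).
Proof.
split=> [c|f g [F HF [d d0 Hd]] [G HG [d' d'0 Hd']]|f g [F HF [d d0 Hd]] [G HG [d' d'0 Hd']]].
- by exists (fun=> c); [exact: Ccts_const | exists 1 => //; exact: Rlt_0_1].
- exists (fun x => F x + G x)%C; first exact: Ccts_plus.
  exists (Rmin d d') => [|u Hu ut]; first exact: Rmin_pos.
  by have := Rmin_l d d'; have := Rmin_r d d' => m1 m2; rewrite Hd ?Hd' //; lra.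
exists (fun x => F x * G x)%C; first exact: Ccts_mult.
exists (Rmin d d') => [|u Hu ut]; first exact: Rmin_pos.
by have := Rmin_l d d'; have := Rmin_r d d' => m1 m2; rewrite Hd ?Hd' //; lra.
Qed.

Lemma continued_pcts a b Phi t : continued_solution z gamma a b Phi -> portion a b t ->
  sclass (pcts a b t) Phi.
Proof.
move=> HP Ht w; have [Psi [H [d d0 Hd]]] := continued_local HP Ht.
exists (fun s => Psi s w); first exact: Cder_cont (H w).
by exists d => // u Hu ut; rewrite Hd.
Qed.

(** Zero derivative inside and relative continuity at the ends. *)
Lemma portion_const a b (f : R -> C) :
  (forall t, portion a b t -> pcts a b t f) ->
  (forall t, 0 < t < 1 -> a < t < b -> Cder f t 0) ->
  forall u v, portion a b u -> portion a b v -> f u = f v.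
Proof.
move=> Hc Hd.
suff H u v : u < v -> portion a b u -> portion a b v -> f u = f v.
  move=> u v Hu Hv; case: (Rtotal_order u v) => [uv|[->//|vu]]; first exact: H.
  by symmetry; apply: H.
move=> uv Hu Hv.
suff E e : 0 < e -> Cmod (f u - f v)%C < e.
  have : Cmod (f u - f v)%C = 0.
    apply: Rle_antisym; last exact: Cmod_ge_0.
    by apply: Rnot_lt_le => /E; lra.
  by move/Cmod_eq_0 => E0; rewrite -[f v]Cplus_0_l -E0; ring.
move=> e0; have e2 : 0 < e / 2 by lra.
have L t : portion a b t -> exists2 r, 0 < r & forall s, portion a b s -> Rabs (s - t) < r ->
   Cmod (f s - f t)%C < e / 2.
  move=> Ht; have [F /CcontP HF [d d0 Hdd]] := Hc t Ht.
  have [r Hr] := HF _ e2.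
  exists (Rmin r d) => [|s Hs st]; first by apply: Rmin_pos => //; exact: cond_pos.
  have := Rmin_l r d; have := Rmin_r r d => m1 m2.
  rewrite (Hdd s) ?(Hdd t) //; [|by rewrite Rminus_diag Rabs_R0| lra].
  by apply: Hr; rewrite /ball /= /AbsRing_ball /abs /minus /plus /opp /= -/(s - t); lra.
have [r1 r10 H1] := L u Hu; have [r2 r20 H2] := L v Hv.
pose u' := u + Rmin r1 (v - u) / 3; pose v' := v - Rmin r2 (v - u) / 3.
have a1 := Rmin_l r1 (v - u); have a2 := Rmin_r r1 (v - u).
have b1 := Rmin_l r2 (v - u); have b2 := Rmin_r r2 (v - u).
have c1 : 0 < Rmin r1 (v - u) by apply: Rmin_pos; lra.
have c2 : 0 < Rmin r2 (v - u) by apply: Rmin_pos; lra.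
have [hu1 hu2] := Hu; have [hv1 hv2] := Hv.
have Hu' : portion a b u' by rewrite /u'; split; lra.
have Hv' : portion a b v' by rewrite /v'; split; lra.
have uv' : u' <= v' by rewrite /u' /v'; lra.
have E : f v' = f u'.
  apply: Cder0_const => // s Hs; apply: Hd; rewrite /u' /v' in Hs; lra.
have K1 := H1 u' Hu' ltac:(rewrite /u' Rabs_pos_eq; lra).
have K2 := H2 v' Hv' ltac:(rewrite /v' Rabs_left1; lra).
have -> : (f u - f v = - (f u' - f u) + (f v' - f v))%C by rewrite E; ring.
apply: Rle_lt_trans (Cmod_triangle _ _) _; rewrite Cmod_opp; lra.
Qed.
End Path.

(** * Tangential expansions and their uniqueness *)

(** The exponent ln v / (2 pi i) of the local factor on the ray along which the path leaves. *)
Definition lnarg (v : R) : C := (RtoC (ln v) / two_pi_i)%C.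

Lemma two_pi_i_neq0 : two_pi_i <> RtoC 0.
Proof.
by move=> [_ E]; have := PI_RGT_0; move: E; rewrite /=; lra.
Qed.

Section Expansion.
Variable n : nat.
Implicit Types (i : 'I_n) (f X : R -> series n).
Local Open Scope series_scope.

(** The tangential normalization along the real ray: X(v) = f(v) v^(x_i/2 pi i). Of the
    analytic function f only f(0) = 1 and a Lipschitz bound are retained. *)
Record expansion i (delta : R) f X : Prop := {
  ex_delta : 0 < delta <= 1;
  ex_one : f 0 = 1;
  ex_lip : forall w, exists2 M, 0 <= M & forall x y, 0 <= x <= delta -> 0 <= y <= delta ->
    Cmod (f x w - f y w)%C <= M * Rabs (x - y);
  ex_eq : forall v, 0 < v < delta -> X v = f v * letter_exp i (lnarg v);
  ex_aug : forall v, 0 < v < delta -> X v [::] = RtoC 1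
}.

Section NearOne.
Variables (T : Type) (D : T -> Prop) (sg : T -> R).
Hypothesis sg01 : forall x, D x -> 0 < sg x <= 1.
Variables (i : 'I_n) (delta : R) (f X : R -> series n) (v : T -> R).
Hypothesis EX : expansion i delta f X.
Hypothesis vD : forall x, D x -> sg x <= v x < delta.

Lemma expansion_aug u : 0 < u < delta -> f u [::] = RtoC 1.
Proof.
move=> Hu; have := ex_aug EX Hu; rewrite (ex_eq EX Hu) smul_nil letter_exp_nil => <-; ring.
Qed.

Lemma Grow_f : sclass (Grow D sg) (fun x => f (v x)).
Proof.
move=> w; have [M M0 HM] := ex_lip EX w; have [d0 d1] := ex_delta EX.
apply: (Grow_bounded sg01 (M := Cmod (f 0 w) + M)) => x Dx.
have Hx := vD Dx; have sx := sg01 Dx.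
have := HM (v x) 0 ltac:(lra) ltac:(lra); rewrite Rminus_0_r Rabs_pos_eq; last by lra.
move=> K; have -> : f (v x) w = ((f (v x) w - f 0 w) + f 0 w)%C by ring.
apply: Rle_trans (Cmod_triangle _ _) _.
have : M * v x <= M * 1 by apply: Rmult_le_compat_l => //; lra.
by lra.
Qed.

Lemma Grow_sinvf : sclass (Grow D sg) (fun x => sinv (f (v x))).
Proof. by apply: (sclass_sinv (ac_grow sg01)); exact: Grow_f. Qed.

Lemma Grow_lnarg : Grow D sg (fun x => lnarg (v x)).
Proof.
apply: (ac_mul (ac_grow sg01)); last exact: (ac_const (ac_grow sg01)).
by apply: (Grow_ln sg01) => x Dx; have := vD Dx; have [] := ex_delta EX; lra.
Qed.

Lemma Grow_letter_exp : sclass (Grow D sg) (fun x => letter_exp i (lnarg (v x))).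
Proof. by apply: (sclass_letter_exp (ac_grow sg01)); exact: Grow_lnarg. Qed.

Lemma Grow_letter_expN : sclass (Grow D sg) (fun x => letter_exp i (- lnarg (v x))%C).
Proof.
by apply: (sclass_letter_exp (ac_grow sg01)); apply: (ac_opp (ac_grow sg01)); exact: Grow_lnarg.
Qed.

(** The local factor changes sides when the solution is inverted. *)
Lemma sinv_expansion u : 0 < u < delta -> sinv (X u) = letter_exp i (- lnarg u)%C * sinv (f u).
Proof.
move=> Hu; have f1 := expansion_aug Hu.
apply: (inverse_unique (a := X u)); first by apply: smulVr; apply: (ex_aug EX).
by rewrite (ex_eq EX Hu) -smulA (smulA (letter_exp i (lnarg u))) letter_exp_invr smul1l smulrV.
Qed.

Lemma f_near_one : (forall x, D x -> v x = sg x) ->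
  sapprox D sg (fun x => f (v x)) (fun=> 1).
Proof.
move=> vs w; have [M M0 HM] := ex_lip EX w; have [d0 d1] := ex_delta EX.
apply: (Small_bounded sg01 (M := M)) => x Dx.
have Hx := vD Dx; have sx := sg01 Dx; have E := vs x Dx.
rewrite -(ex_one EX); have := HM (v x) 0 ltac:(lra) ltac:(lra).
by rewrite Rminus_0_r Rabs_pos_eq; [rewrite E | lra].
Qed.

End NearOne.
End Expansion.

Lemma Rpower_small e : 0 < e -> exists2 r, 0 < r & forall t, 0 < t < r -> t * Rpower t (- (1 / 2)) < e.
Proof.
move=> e0; exists (e * e) => [|t Ht]; first by nra.
have -> : t * Rpower t (- (1 / 2)) = sqrt t.
  have Et : Rpower t 1 = t by apply: Rpower_1; lra.
  rewrite -{1}Et -Rpower_plus (_ : 1 + - (1 / 2) = / 2); last by field.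
  by apply: Rpower_sqrt; lra.
have s0 := sqrt_pos t; have ss := sqrt_sqrt t ltac:(lra).
by apply: Rnot_le_lt => K; nra.
Qed.

Lemma Small_Clim0 d (f : R -> C) l : 0 < d ->
  Small (fun t => 0 < t < d) (fun t => t) (fun t => f t - l)%C -> Clim0 f l.
Proof.
move=> d0 /(_ (1 / 2)) []; first by lra.
move=> c c0 Hc e e0.
have [r r0 Hr] := @Rpower_small (e / (c + 1)) ltac:(apply: Rdiv_lt_0_compat; lra).
exists (Rmin d r) => [|t Ht]; first exact: Rmin_pos.
have m1 := Rmin_l d r; have m2 := Rmin_r d r.
apply: Rle_lt_trans (Hc t _) _; first by lra.
have K := Hr t ltac:(lra).
apply: Rle_lt_trans (_ : c * (e / (c + 1)) < _); first by apply: Rmult_le_compat_l; lra.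
have -> : c * (e / (c + 1)) = e - e / (c + 1) by field; lra.
have : 0 < e / (c + 1) by apply: Rdiv_lt_0_compat; lra.
by lra.
Qed.

Section Unique.
Variable n : nat.
Local Open Scope series_scope.

Lemma sinvf_near_one (T : Type) (D : T -> Prop) (sg : T -> R) (i : 'I_n) delta f X (v : T -> R) :
  (forall x, D x -> 0 < sg x <= 1) -> expansion i delta f X ->
  (forall x, D x -> sg x <= v x < delta) -> (forall x, D x -> v x = sg x) ->
  sapprox D sg (fun x => sinv (f (v x))) (fun=> 1).
Proof.
move=> sg01 EX vD vs; apply: (sapprox_sym sg01).
apply: (sapprox_extD (X := fun x => sinv (f (v x)) * f (v x)) (Y := fun x => sinv (f (v x)) * 1)).
- move=> x Dx; rewrite smulVr //; apply: (expansion_aug EX).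
  by have := vD x Dx; have := sg01 x Dx; lra.
- by move=> x _; rewrite smul1r.
apply: sapprox_mul.
- apply: sapprox_refl.
- exact: (f_near_one sg01 EX vD vs).
- exact: (Grow_sinvf sg01 EX vD).
exact: (Grow_f sg01 EX vD).
Qed.

(** The constant K is the product of E^-1 f^-1 f' E; since f and f' are 1 + O(v) and the powers
    of v^(x_i/2 pi i) are logarithmic, the product tends to 1. *)
Lemma expansion_unique (i : 'I_n) delta f X delta' f' X' K d :
  expansion i delta f X -> expansion i delta' f' X' -> 0 < d ->
  (forall v, 0 < v < d -> sinv (X v) * X' v = K) -> K = 1.
Proof.
move=> EX EX' d0 HK.
have [d1 d1'] := ex_delta EX; have [d2 d2'] := ex_delta EX'.
pose dm := Rmin d (Rmin delta delta').
have m1 : dm <= d := Rmin_l _ _; have m2 : dm <= Rmin delta delta' := Rmin_r _ _.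
have m3 := Rmin_l delta delta'; have m4 := Rmin_r delta delta'.
have dm0 : 0 < dm by do !apply: Rmin_pos.
pose D v := 0 < v < dm.
have sg01 v : D v -> 0 < id v <= 1 by rewrite /D /=; lra.
have vD v : D v -> id v <= v < delta by rewrite /D /=; lra.
have vD' v : D v -> id v <= v < delta' by rewrite /D /=; lra.
have AP : sapprox D id (fun=> K) (fun=> 1).
  apply: (sapprox_extD (X := fun v => letter_exp i (- lnarg v)%C * ((sinv (f v) * f' v) * letter_exp i (lnarg v)))
     (Y := fun v => letter_exp i (- lnarg v)%C * ((1 * 1) * letter_exp i (lnarg v)))).
  - move=> v Dv; rewrite -(HK v); last by rewrite /D in Dv; lra.
    rewrite (sinv_expansion EX); last by rewrite /D in Dv; lra.
    rewrite (ex_eq EX'); last by rewrite /D in Dv; lra.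
    by rewrite !smulA.
  - by move=> v _; rewrite !smul1l letter_exp_inv.
  apply: sapprox_mul; first apply: sapprox_refl.
  - apply: sapprox_mul; last exact: (Grow_letter_exp sg01 EX vD).
    + apply: sapprox_mul.
      * exact: (sinvf_near_one sg01 EX vD).
      * exact: (f_near_one sg01 EX' vD').
      * exact: (sclass_const (ac_grow sg01)).
      * exact: (Grow_f sg01 EX' vD').
    + apply: sapprox_refl.
    by apply: (sclass_mul (ac_grow sg01)); exact: (sclass_const (ac_grow sg01)).
  - exact: (Grow_letter_expN sg01 EX vD).
  apply: (sclass_mul (ac_grow sg01)); last exact: (Grow_letter_exp sg01 EX vD).
  by apply: (sclass_mul (ac_grow sg01)); [exact: (Grow_sinvf sg01 EX vD) | exact: (Grow_f sg01 EX' vD')].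
by apply: seriesP => w; apply: Clim0_unique; apply: (Small_Clim0 dm0); exact: AP w.
Qed.
End Unique.

Lemma Clog_pos v : 0 < v -> Clog (RtoC v) = RtoC (ln v).
Proof.
move=> v0; rewrite /Clog Cmod_R Rabs_pos_eq; last by lra.
by congr pair; rewrite /= /Rdiv Rmult_0_l atan_0 Rmult_0_r.
Qed.

Section Tangential.
Variables (n : nat) (z : 'I_n -> C) (p q : 'I_n) (gamma : R -> C).
Hypothesis PA : tangential_path z p q gamma.

Variables (a b c : R) (pos : R -> R) (i : 'I_n) (d0 : R).
Hypothesis pos_dist : forall v, 0 <= v -> Rabs (pos v - c) = v.
Hypothesis d00 : 0 < d0.
Hypothesis pos_near : forall v, 0 < v < d0 -> portion a b (pos v) /\ gamma (pos v) = (z i + RtoC v)%C.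

Lemma aug_const Phi u v : continued_solution z gamma a b Phi -> portion a b u -> portion a b v ->
  Phi u [::] = Phi v [::].
Proof.
move=> HP Hu Hv; apply: (portion_const (a := a) (b := b) (f := fun t => Phi t [::])) => //.
  by move=> t Ht; apply: (continued_pcts PA HP Ht).
by move=> t t01 tab; apply: Cder_eq (continued_sder PA HP t01 tab [::]) _; rewrite lin_mul_nil.
Qed.

(** Restriction of the analytic factor to the real ray from z_i; pos parametrizes the path near
    the end by the distance to it, so that both ends are covered. *)
Lemma tangential_expansion Phi : continued_solution z gamma a b Phi ->
  normalized_at z gamma a b Phi c (Tangential i) ->
  exists delta f, delta <= d0 /\ expansion i delta f (fun v => Phi (pos v)).
Proof.
move=> HP [r [Psi [r0 [_ [f [[al Hal] f1 Hf]]] [d dp Hd]]]].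
pose F v := f (z i + RtoC v)%C.
have F0 : F 0 = 1%S by rewrite /F Cplus_0_r.
pose delta := Rmin (Rmin d0 d) (Rmin (r / 2) 1).
have m1 := Rmin_l (Rmin d0 d) (Rmin (r / 2) 1); have m2 := Rmin_r (Rmin d0 d) (Rmin (r / 2) 1).
have m3 := Rmin_l d0 d; have m4 := Rmin_r d0 d.
have m5 := Rmin_l (r / 2) 1; have m6 := Rmin_r (r / 2) 1.
have delta0 : 0 < delta by do !apply: Rmin_pos => //; lra.
rewrite -/delta in m1 m2.
have lip w : exists2 M, 0 <= M & forall x y, 0 <= x <= delta -> 0 <= y <= delta ->
    Cmod (F x w - F y w)%C <= M * Rabs (x - y).
  have [|M M0 HM] := @complex_pseries_lip (fun k => al k w) (fun v => F v w) r r0.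
    move=> x Hx; have Dx : disk (z i) r (z i + RtoC x)%C.
      by rewrite /disk (_ : (z i + RtoC x - z i)%C = RtoC x) ?Cmod_R //; ring.
    have := Hal _ Dx w; rewrite (_ : (z i + RtoC x - z i)%C = RtoC x) //; ring.
  by exists M => // x y Hx Hy; apply: HM; lra.
have eqv v : 0 < v < delta -> Phi (pos v) = (F v * letter_exp i (lnarg v))%S.
  move=> Hv; have [Pv gv] := @pos_near v ltac:(lra).
  have [D1 S1 ->] := Hd _ Pv ltac:(rewrite pos_dist; lra).
  rewrite Hf // gv /F; congr smul.
  by rewrite (_ : (z i + RtoC v - z i)%C = RtoC v) ?Clog_pos //; [lra | ring].
exists delta, F; split; first by lra.
split => //; first by lra.
move=> v Hv.
have pv u : 0 < u < delta -> Phi (pos u) [::] = Phi (pos v) [::].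
  move=> Hu; apply: aug_const => //; first by have [] := @pos_near u ltac:(lra).
  by have [] := @pos_near v ltac:(lra).
have Fu u : 0 < u < delta -> F u [::] = Phi (pos v) [::].
  move=> Hu; rewrite -(pv u Hu) eqv // smul_nil letter_exp_nil; ring.
have [M M0 HM] := lip [::].
suff E e : 0 < e -> Cmod (Phi (pos v) [::] - RtoC 1)%C < e.
  have : Cmod (Phi (pos v) [::] - RtoC 1)%C = IZR 0.
    apply: Rle_antisym; last exact: Cmod_ge_0.
    by apply: Rnot_lt_le => /E; lra.
  by move/Cmod_eq_0 => E0; rewrite -[RtoC 1]Cplus_0_l -E0; ring.
move=> e0; pose u := Rmin (delta / 2) (e / (2 * (M + 1))).
have u1 : 0 < u by apply: Rmin_pos; [lra | apply: Rdiv_lt_0_compat; lra].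
have u2 : u <= delta / 2 := Rmin_l _ _.
have u3 : u <= e / (2 * (M + 1)) := Rmin_r _ _.
have := HM u 0 ltac:(lra) ltac:(lra).
rewrite F0 (Fu u ltac:(lra)) Rminus_0_r Rabs_pos_eq; last by lra.
move=> K; apply: Rle_lt_trans K _.
apply: Rle_lt_trans (_ : M * (e / (2 * (M + 1))) < _); first exact: Rmult_le_compat_l.
have -> : M * (e / (2 * (M + 1))) = e / 2 - e / (2 * (M + 1)) by field; lra.
have : 0 < e / (2 * (M + 1)) by apply: Rdiv_lt_0_compat; lra.
by lra.
Qed.

(** The augmentation of a solution is constant along the path, and is 1 in the tangential
    normalization. *)
Lemma continued_aug Phi : continued_solution z gamma a b Phi ->
  normalized_at z gamma a b Phi c (Tangential i) ->
  forall u, portion a b u -> Phi u [::] = RtoC 1.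
Proof.
move=> HP HN u Hu; have [delta [f [dd E]]] := tangential_expansion HP HN.
have [de0 de1] := ex_delta E.
rewrite -(ex_aug E (v := delta / 2)); last by lra.
by apply: aug_const => //; have [] := @pos_near (delta / 2) ltac:(lra).
Qed.
End Tangential.

(** * Products with a series in one letter *)

Lemma Cpow_mulC (x y : C) k : ((x * y) ^ k = x ^ k * y ^ k)%C.
Proof. by elim: k => [|k /= ->]; [rewrite /=; ring | ring]. Qed.

Section LetterSeries.
Variable n : nat.
Local Open Scope series_scope.
Implicit Types (i : 'I_n) (a : series n).

Lemma smul_subst_letter F x i a w : (a * subst_series F (x *: letter i)) w =
  \csum_(k < (size w).+1) (a (take (size w - k) w) *
    (if drop (size w - k) w == nseq k i then F (nat_of_ord k) * x ^ k else 0%C)).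
Proof.
rewrite smulE_sum (reindex_inj rev_ord_inj) /=; apply: eq_bigr => k _.
have kw : (k <= size w)%N by rewrite -ltnS.
by rewrite subSS subst_scaled_letter size_drop subKn.
Qed.

Lemma subst_letter_smul F x i a w : (subst_series F (x *: letter i) * a) w =
  \csum_(k < (size w).+1)
    ((if take k w == nseq k i then F (nat_of_ord k) * x ^ k else 0%C) * a (drop k w)).
Proof.
rewrite smulE_sum; apply: eq_bigr => k _.
have kw : (k <= size w)%N by rewrite -ltnS.
by rewrite subst_scaled_letter size_takel.
Qed.

(** The coefficient of w in a exp(- y x_p / (2 pi i)) is a polynomial in y with these
    coefficients, up to factorials; the end exponential at q is treated in the same way below. *)
Definition log_coef_start p a w k : C :=
  (a (take (size w - k) w) * (if drop (size w - k) w == nseq k p then (- / two_pi_i) ^ k else 0))%C.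
Definition log_coef_end q a w k : C :=
  ((if take k w == nseq k q then (/ two_pi_i) ^ k else 0) * a (drop k w))%C.

Lemma log_coef_start0 p a w : log_coef_start p a w 0 = a w.
Proof. by rewrite /log_coef_start subn0 take_size drop_size /=; ring. Qed.
Lemma log_coef_end0 q a w : log_coef_end q a w 0 = a w.
Proof. by rewrite /log_coef_end take0 drop0 /=; ring. Qed.

Lemma log_sum_start p a w (y : R) :
  (a * letter_exp p (- / two_pi_i * RtoC y)%C) w =
  \csum_(k < (size w).+1) (log_coef_start p a w k * RtoC (y ^ k / INR k`!)).
Proof.
rewrite smul_subst_letter; apply: eq_bigr => k _; rewrite /log_coef_start.
case: (_ == _); last by ring.
by rewrite Cpow_mulC RtoC_mult RtoC_pow; ring.
Qed.

Lemma log_sum_end q a w (y : R) :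
  (letter_exp q (/ two_pi_i * RtoC y)%C * a) w =
  \csum_(k < (size w).+1) (log_coef_end q a w k * RtoC (y ^ k / INR k`!)).
Proof.
rewrite subst_letter_smul; apply: eq_bigr => k _; rewrite /log_coef_end.
case: (_ == _); last by ring.
rewrite Cpow_mulC RtoC_mult RtoC_pow.
by move: (RtoC (/ INR k`!)) ((/ two_pi_i) ^ k)%C (RtoC y ^ k)%C (a _) => ? ? ? ?; ring.
Qed.

Lemma Cpow_neq0 (x : C) k : x <> RtoC 0 -> (x ^ k)%C <> RtoC 0.
Proof.
move=> x0; elim: k => [|k IH] /=; first by case; lra.
exact: Cmult_neq_0.
Qed.

Lemma Cpow_invC (x : C) k : x <> RtoC 0 -> ((/ x) ^ k = / (x ^ k))%C.
Proof.
move=> x0; elim: k => [|k /= ->]; first by rewrite /=; field; case; lra.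
by field; split => //; exact: Cpow_neq0.
Qed.

(** Replacing y^k/k! by zeta(k+1) turns the exponential into - 2 pi i r_zeta. *)
Lemma zeta_sum_start p a w :
  \csum_(k < (size w).+1) (if (k : nat) is k'.+1 then log_coef_start p a w k * RtoC (zeta k'.+2) else 0%C) =
  (- two_pi_i * (a * r_zeta (- letter p))%S w)%C.
Proof.
have pi0 := two_pi_i_neq0.
rewrite sopp_scale smul_subst_letter -Csum_scal; apply: eq_bigr => -[[|k] Hk] _ /=.
  by case: (_ == _); ring.
rewrite /log_coef_start; case: (_ == _); last by ring.
have -> : (- / two_pi_i = - RtoC 1 * / two_pi_i)%C by ring.
rewrite Cpow_mulC Cpow_invC //= .
have pk := @Cpow_neq0 two_pi_i k pi0; field.
by split.
Qed.

Lemma zeta_sum_end q a w :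
  \csum_(k < (size w).+1) (if (k : nat) is k'.+1 then log_coef_end q a w k * RtoC (zeta k'.+2) else 0%C) =
  (- two_pi_i * (r_zeta (letter q) * a)%S w)%C.
Proof.
have pi0 := two_pi_i_neq0.
have -> : letter q = RtoC 1 *: letter q by apply: seriesP => u; rewrite sscaleE; ring.
rewrite subst_letter_smul -Csum_scal; apply: eq_bigr => -[[|k] Hk] _ /=.
  by case: (_ == _); ring.
rewrite /log_coef_end; case: (_ == _); last by ring.
rewrite Cpow_invC //= Cpow_1_l.
have pk := @Cpow_neq0 two_pi_i k pi0; field.
by split.
Qed.
End LetterSeries.

(** * Holonomies as values of solutions *)

Lemma Cder_unique f t l m : Cder f t l -> Cder f t m -> l = m.
Proof.
move=> [A1 A2] [B1 B2]; apply: C_ext.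
  by rewrite -(is_derive_unique _ _ _ A1) (is_derive_unique _ _ _ B1).
by rewrite -(is_derive_unique _ _ _ A2) (is_derive_unique _ _ _ B2).
Qed.

Section SeriesDer.
Variable n : nat.
Local Open Scope series_scope.
Implicit Types (X Y : R -> series n).

Lemma sder_mul X Y t dX dY : sder X t dX -> sder Y t dY ->
  sder (fun s => X s * Y s) t (dX * Y t + X t * dY).
Proof.
move=> HX HY w; rewrite saddE !smulE_sum -Csum_add.
by apply: Cder_sum => k; apply: Cder_mult.
Qed.

Lemma sder_const (a : series n) t : sder (fun=> a) t szero.
Proof. by move=> w; apply: Cder_const. Qed.

Lemma sder_eq X t dX dY : sder X t dX -> dX = dY -> sder X t dY.
Proof. by move=> H <-. Qed.

Lemma sder_KKS X t dX : sder X t dX -> sder (fun s => KKS (X s)) t (KKS dX).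
Proof.
move=> H w; rewrite KKS_double; apply: Cder_ext (Cder_sum (F := fun j s =>
  X s (take (nat_of_ord j).+1 w ++ drop j w)) _) => [s|j]; first by rewrite KKS_double.
exact: H.
Qed.

(** From d(X) = A X and X^-1 X = 1. *)
Lemma sder_sinv X t (A : series n) : locally t (fun s => X s [::] = RtoC 1) ->
  sder X t (A * X t) -> sder (fun s => sinv (X s)) t (- (sinv (X t) * A)).
Proof.
move=> X1 HX.
have X1t : X t [::] = RtoC 1 by apply: locally_singleton X1.
pose D : series n := fun w => (Derive (fun s => Re (sinv (X s) w)) t, Derive (fun s => Im (sinv (X s) w)) t).
have HD : sder (fun s => sinv (X s)) t D.
  move=> w; have [l [H1 H2]] : exists l, Cder (fun s => sinv (X s) w) t l.
    by apply: (sclass_sinv (ac_der t)) => v; eexists; exact: HX.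
  by split; apply: Derive_correct; eexists; eassumption.
apply: (sder_eq HD).
have E : D * X t + sinv (X t) * (A * X t) = szero.
  apply: seriesP => w; apply: (Cder_unique (sder_mul HD HX w)).
  apply: Cder_ext_loc (sder_const 1 t w).
  by apply: filter_imp X1 => s Xs; rewrite smulVr.
have -> : D = (D * X t + sinv (X t) * (A * X t)) * sinv (X t) - sinv (X t) * A.
  rewrite smulDl -!smulA smulrV // !smul1r.
  by apply: seriesP => w; rewrite !saddE soppE; ring.
by rewrite E smul0l; apply: seriesP => w; rewrite saddE soppE /szero; ring.
Qed.
End SeriesDer.

Section Solutions.
Variables (n : nat) (z : 'I_n -> C) (p q : 'I_n) (gamma : R -> C).
Hypothesis PA : tangential_path z p q gamma.

Lemma locally_portion a b t : 0 < t < 1 -> a < t < b -> locally t (portion a b).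
Proof.
move=> t01 tab; have [r1 r10 H1] := near_itv t01; have [r2 r20 H2] := near_itv tab.
have m0 : 0 < Rmin r1 r2 by apply: Rmin_pos.
exists (mkposreal _ m0) => u; rewrite /ball /= /AbsRing_ball /abs /minus /plus /opp /= -/(u - t) => Hu.
have n3 := Rmin_l r1 r2; have n4 := Rmin_r r1 r2.
by split; [have := H2 u; lra | apply: H1; lra].
Qed.

(** (X^-1 Y)' = - X^-1 A Y + X^-1 A Y. *)
Lemma solutions_const a b X Y : continued_solution z gamma a b X ->
  continued_solution z gamma a b Y -> (forall u, portion a b u -> X u [::] = RtoC 1) ->
  forall u v, portion a b u -> portion a b v -> (sinv (X u) * Y u)%S = (sinv (X v) * Y v)%S.
Proof.
move=> HX HY X1 u v Hu Hv; apply: seriesP => w.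
apply: (portion_const (a := a) (b := b) (f := fun t => (sinv (X t) * Y t)%S w)) => // [t Ht|t t01 tab].
  apply: (sclass_mul (ac_pcts a b t)); last exact: (continued_pcts PA HY Ht).
  by apply: (sclass_sinv (ac_pcts a b t)); exact: (continued_pcts PA HX Ht).
have loc : locally t (fun s => X s [::] = RtoC 1).
  by apply: filter_imp (locally_portion t01 tab) => s /X1.
have H := sder_mul (sder_sinv loc (continued_sder PA HX t01 tab)) (continued_sder PA HY t01 tab).
apply: Cder_eq (H w) _.
by rewrite smulNl smulA saddE soppE; ring.
Qed.

Lemma continued_restrict a b a' b' X : a <= a' -> b' <= b -> continued_solution z gamma a b X ->
  continued_solution z gamma a' b' X.
Proof.
move=> aa bb H t Ht.
have sub u : portion a' b' u -> portion a b u by move=> [? ?]; split; lra.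
have [r [Psi [r0 KZ [d d0 Hd]]]] := H t (sub t Ht).
by exists r, Psi; split => //; exists d => // u Hu ut; apply: Hd => //; apply: sub.
Qed.

Lemma normalized_restrict a b a' b' X c i : a <= a' -> b' <= b ->
  normalized_at z gamma a b X c (Tangential i) -> normalized_at z gamma a' b' X c (Tangential i).
Proof.
move=> aa bb [r [Psi [r0 S [d d0 Hd]]]].
exists r, Psi; split => //; exists d => // u [Hu Hu'] ut; apply: Hd => //; split; lra.
Qed.

(** The constant X^-1 Y is 1 by expansion_unique. *)
Lemma tangential_unique a b c pos i d0 X Y :
  (forall v, 0 <= v -> Rabs (pos v - c) = v) -> 0 < d0 ->
  (forall v, 0 < v < d0 -> portion a b (pos v) /\ gamma (pos v) = (z i + RtoC v)%C) ->
  continued_solution z gamma a b X -> normalized_at z gamma a b X c (Tangential i) ->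
  continued_solution z gamma a b Y -> normalized_at z gamma a b Y c (Tangential i) ->
  forall u, portion a b u -> X u = Y u.
Proof.
move=> pd d00 pn HX NX HY NY u Hu.
have X1 := continued_aug PA pd d00 pn HX NX.
have [d1 [f [dd E1]]] := tangential_expansion PA pd d00 pn HX NX.
have [d2 [f' [dd' E2]]] := tangential_expansion PA pd d00 pn HY NY.
have K : (sinv (X u) * Y u)%S = 1%S.
  apply: (expansion_unique E1 E2 d00) => v Hv; apply: (solutions_const HX HY X1) => //; by have [] := pn v Hv.
by rewrite -[X u](smul1r) -K smulA smulrV ?smul1l //; exact: X1.
Qed.

Lemma start_pos tau : 0 < tau <= 1 -> exists2 d0, 0 < d0 & forall v, 0 < v < d0 ->
  portion 0 tau v /\ gamma v = (z p + RtoC v)%C.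
Proof.
move=> Ht; have [d d0 Hd] := path_start PA.
exists (Rmin d (tau / 2)) => [|v Hv]; first by apply: Rmin_pos; lra.
have m1 := Rmin_l d (tau / 2); have m2 := Rmin_r d (tau / 2).
by split; [split; lra | apply: Hd; lra].
Qed.

Lemma end_pos sg : 0 <= sg < 1 -> exists2 d0, 0 < d0 & forall v, 0 < v < d0 ->
  portion sg 1 (1 - v) /\ gamma (1 - v) = (z q + RtoC v)%C.
Proof.
move=> Hs; have [d d0 Hd] := path_end PA.
exists (Rmin d ((1 - sg) / 2)) => [|v Hv]; first by apply: Rmin_pos; lra.
have m1 := Rmin_l d ((1 - sg) / 2); have m2 := Rmin_r d ((1 - sg) / 2).
split; first by split; lra.
have e : 1 - (1 - v) = v by ring.
by rewrite Hd e //; lra.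
Qed.

Lemma start_dist v : 0 <= v -> Rabs (v - 0) = v.
Proof. by move=> v0; rewrite Rminus_0_r Rabs_pos_eq. Qed.

Lemma end_dist v : 0 <= v -> Rabs (1 - v - 1) = v.
Proof. by move=> v0; rewrite (_ : 1 - v - 1 = - v) ?Rabs_Ropp ?Rabs_pos_eq //; ring. Qed.

Lemma regular_aug a b Phi c : portion a b c -> continued_solution z gamma a b Phi -> Phi c = 1%S ->
  forall u, portion a b u -> Phi u [::] = RtoC 1.
Proof. by move=> Hc HP P1 u Hu; rewrite (aug_const PA HP Hu Hc) P1. Qed.

Lemma sinv1 : sinv (1 : series n)%S = 1%S.
Proof. by rewrite -[LHS]smul1r smulVr. Qed.

(** The holonomy of a portion is a value of the global normalized solution: the solution that is
    1 at the regular end cancels. *)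
Lemma hol_start P tau K : 0 < tau < 1 ->
  continued_solution z gamma 0 1 P -> normalized_at z gamma 0 1 P 0 (Tangential p) ->
  is_holonomy z gamma 0 (Tangential p) tau Regular K -> K = P tau.
Proof.
move=> Ht HP NP [S [E [HS NS HE NE [t [G [Hp [GE EG] ->]]]]]].
have tau1 : 0 < tau <= 1 by lra.
have [d0 d00 pn] := start_pos tau1.
have Htau : portion 0 tau tau by split; lra.
have E1 := regular_aug Htau HE NE.
have -> : G = sinv (E t).
  by apply: (inverse_unique (a := E t)) => //; apply: smulrV; apply: E1.
rewrite (solutions_const HE HS E1 Hp Htau) NE sinv1 smul1l.
have HP' : continued_solution z gamma 0 tau P by apply: continued_restrict HP; lra.
have NP' : normalized_at z gamma 0 tau P 0 (Tangential p) by apply: normalized_restrict NP; lra.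
exact: (tangential_unique start_dist d00 pn HS NS HP' NP').
Qed.

Lemma hol_end Q sg K : 0 < sg < 1 ->
  continued_solution z gamma 0 1 Q -> normalized_at z gamma 0 1 Q 1 (Tangential q) ->
  is_holonomy z gamma sg Regular 1 (Tangential q) K -> K = sinv (Q sg).
Proof.
move=> Hs HQ NQ [S [E [HS NS HE NE [t [G [Hp [GE EG] ->]]]]]].
have sg1 : 0 <= sg < 1 by lra.
have [d0 d00 pn] := end_pos sg1.
have Hsg : portion sg 1 sg by split; lra.
have E1 := continued_aug PA end_dist d00 pn HE NE.
have -> : G = sinv (E t).
  by apply: (inverse_unique (a := E t)) => //; apply: smulrV; apply: E1.
rewrite (solutions_const HE HS E1 Hp Hsg) NS smul1r.
have HQ' : continued_solution z gamma sg 1 Q by apply: continued_restrict HQ; lra.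
have NQ' : normalized_at z gamma sg 1 Q 1 (Tangential q) by apply: normalized_restrict NQ; lra.
by rewrite (tangential_unique end_dist d00 pn HE NE HQ' NQ' Hsg).
Qed.
End Solutions.

(** * The kernel built from two holonomies *)

(** A Lipschitz bound centred at (t,s), a property closed under products and satisfied by
    products of functions differentiable in one of the variables. *)
Definition lip2 (t s : R) (f : R * R -> C) := exists2 M, 0 <= M & exists2 rho, 0 < rho &
  forall t' s', Rabs (t' - t) < rho -> Rabs (s' - s) < rho ->
  Cmod (f (t', s') - f (t, s))%C <= M * (Rabs (t' - t) + Rabs (s' - s)).

Lemma ac_lip2 t s : alg_class (lip2 t s).
Proof.
split=> [c|f g [M M0 [r r0 Hr]] [M' M'0 [r' r'0 Hr']]|f g [M M0 [r r0 Hr]] [M' M'0 [r' r'0 Hr']]].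
- exists 0; first by lra.
  exists 1 => [|t' s' _ _]; first by lra.
  by rewrite (_ : (c - c)%C = RtoC 0) ?Cmod_0; [lra | ring].
- exists (M + M'); first by lra.
  exists (Rmin r r') => [|t' s' Ht Hs]; first exact: Rmin_pos.
  have m1 := Rmin_l r r'; have m2 := Rmin_r r r'.
  have -> : (f (t', s') + g (t', s') - (f (t, s) + g (t, s)) =
     (f (t', s') - f (t, s)) + (g (t', s') - g (t, s)))%C by ring.
  apply: Rle_trans (Cmod_triangle _ _) _.
  by have := Hr t' s' ltac:(lra) ltac:(lra); have := Hr' t' s' ltac:(lra) ltac:(lra); lra.
have f0 := Cmod_ge_0 (f (t, s)); have g0 := Cmod_ge_0 (g (t, s)).
exists (M * (Cmod (g (t, s)) + M' * 2) + Cmod (f (t, s)) * M'); first by nra.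
exists (Rmin (Rmin r r') 1) => [|t' s' Ht Hs]; first by do !apply: Rmin_pos; lra.
have m1 := Rmin_l (Rmin r r') 1; have m2 := Rmin_r (Rmin r r') 1.
have m3 := Rmin_l r r'; have m4 := Rmin_r r r'.
have -> : (f (t', s') * g (t', s') - f (t, s) * g (t, s) =
   (f (t', s') - f (t, s)) * g (t', s') + f (t, s) * (g (t', s') - g (t, s)))%C by ring.
have K := Hr t' s' ltac:(lra) ltac:(lra); have K' := Hr' t' s' ltac:(lra) ltac:(lra).
have a0 := Rabs_pos (t' - t); have b0 := Rabs_pos (s' - s).
set d := Rabs _ + Rabs _ in K K' *.
have d2 : 0 <= d <= 2 by rewrite /d; lra.
apply: Rle_trans (Cmod_triangle _ _) _; rewrite !Cmod_mult.
have G : Cmod (g (t', s')) <= Cmod (g (t, s)) + M' * 2.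
  have -> : g (t', s') = (g (t, s) + (g (t', s') - g (t, s)))%C by ring.
  by apply: Rle_trans (Cmod_triangle _ _) _; nra.
have T1 : Cmod (f (t', s') - f (t, s))%C * Cmod (g (t', s')) <= (M * d) * (Cmod (g (t, s)) + M' * 2).
  by apply: Rmult_le_compat => //; exact: Cmod_ge_0.
have T2 : Cmod (f (t, s)) * Cmod (g (t', s') - g (t, s))%C <= Cmod (f (t, s)) * (M' * d).
  exact: Rmult_le_compat_l.
by lra.
Qed.

Lemma lip2_fst (f : R -> C) t s l : Cder f t l -> lip2 t s (fun x => f x.1).
Proof.
move=> /Cder_lip [M M0 [r r0 Hr]]; exists M => //; exists r => // t' s' Ht _ /=.
by apply: Rle_trans (Hr _ Ht) _; apply: Rmult_le_compat_l => //; have := Rabs_pos (s' - s); lra.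
Qed.

Lemma lip2_snd (f : R -> C) t s l : Cder f s l -> lip2 t s (fun x => f x.2).
Proof.
move=> /Cder_lip [M M0 [r r0 Hr]]; exists M => //; exists r => // t' s' _ Hs /=.
by apply: Rle_trans (Hr _ Hs) _; apply: Rmult_le_compat_l => //; have := Rabs_pos (t' - t); lra.
Qed.

Section Data.
Variables (n : nat) (z : 'I_n -> C) (p q : 'I_n) (gamma : R -> C).
Hypothesis PA : tangential_path z p q gamma.
Variables (P Q : R -> series n) (H : series n).
Hypothesis HP : continued_solution z gamma 0 1 P.
Hypothesis HQ : continued_solution z gamma 0 1 Q.
Hypothesis Q1 : forall t, 0 < t < 1 -> Q t [::] = RtoC 1.

(** When Q is the solution normalized at the end point, this is the holonomy from t to the end. *)
Definition hol_to_end (t : R) : series n := sinv (Q t).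
Definition KZ_along (t : R) : series n := lin ((conn z gamma)^~ t).
Local Notation a_ := (conn z gamma).

Lemma sderP t : 0 < t < 1 -> sder P t (KZ_along t * P t)%S.
Proof. by move=> Ht; apply: (continued_sder PA HP). Qed.

Lemma sderR t : 0 < t < 1 -> sder hol_to_end t (- (hol_to_end t * KZ_along t))%S.
Proof.
move=> Ht; apply: (sder_sinv (X := Q)); last exact: (continued_sder PA HQ).
by have [r r0 Hr] := near_itv Ht; exists (mkposreal _ r0) => u Hu; apply: Q1; apply: Hr.
Qed.

Section Word.
Variable w : seq 'I_n.

(** Holonomy from t to the end times holonomy from the start to s: for s < t the portion between
    s and t is left out. On a crossing the portion left out is a loop. *)
Definition hol_product t s := (hol_to_end t * P s)%S w.
Definition hol_product_dt t s := (- (hol_to_end t * KZ_along t) * P s)%S w.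
Definition hol_product_ds t s := (hol_to_end t * (KZ_along s * P s))%S w.

(** The letter of the connection at t sits between the two factors and is merged with the first
    letter of the second one. *)
Definition hol_merge t s := (hol_to_end t * fox_merge (KZ_along t) (P s))%S w.
Definition hol_merge_ds t s := (hol_to_end t * (lin (fun i => (a_ i t * a_ i s)%C) * P s))%S w.

Lemma hol_to_end_cts2 t s : 0 < t < 1 -> sclass (fun f : R * R -> C => Ccts f (t, s)) (fun x => hol_to_end x.1).
Proof. by move=> Ht v; apply: (@Cts_fst (fun t => hol_to_end t v)); apply: Cder_cont (sderR Ht v). Qed.

Lemma P_cts2 t s : 0 < s < 1 -> sclass (fun f : R * R -> C => Ccts f (t, s)) (fun x => P x.2).
Proof. by move=> Hs v; apply: (@Cts_snd (fun t => P t v)); apply: Cder_cont (sderP Hs v). Qed.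

Lemma KZ_along_cts2 t s : 0 < t < 1 -> sclass (fun f : R * R -> C => Ccts f (t, s)) (fun x => KZ_along x.1).
Proof.
move=> Ht [|x [|y v]]; try exact: Ccts_const.
by apply: (@Cts_fst (a_ x)); apply: (conn_cts PA).
Qed.

Let AC2 (x : R * R) := ac_cts (U := prod_UniformSpace R_UniformSpace R_UniformSpace) x.

(** Partial fractions: conn_i(s) g'(t) - conn_i(t) g'(s) is - 2 pi i (g(s) - g(t)) times
    conn_i(t) conn_i(s). *)
Lemma KZ_green_data : green_data gamma (velocity gamma) (path_deriv 2 gamma) hol_product hol_product_dt hol_product_ds hol_merge hol_merge_ds.
Proof.
split.
- exact: (path_Cder PA).
- exact: (velocity_Cder PA).
- move=> t s Ht Hs; apply: Cder_eq (sder_mul (sderR Ht) (sder_const (P s) t) w) _.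
  by rewrite saddE smul0r Cplus_0_r.
- move=> t s Ht Hs; apply: Cder_eq (sder_mul (sder_const (hol_to_end t) s) (sderP Hs) w) _.
  by rewrite saddE smul0l Cplus_0_l.
- move=> t s Ht Hs; apply: (sclass_mul (@AC2 (t, s)) (X := fun x => hol_to_end x.1) (Y := fun x => P x.2)).
    exact: hol_to_end_cts2.
  exact: P_cts2.
- move=> t s Ht Hs.
  apply: (sclass_mul (@AC2 (t, s)) (X := fun x => (- (hol_to_end x.1 * KZ_along x.1))%S) (Y := fun x => P x.2)).
    move=> v; apply: (ac_opp (@AC2 (t, s))).
    by apply: (sclass_mul (@AC2 (t, s)) (X := fun x => hol_to_end x.1) (Y := fun x => KZ_along x.1));
       [exact: hol_to_end_cts2 | exact: KZ_along_cts2].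
  exact: P_cts2.
- move=> t s Ht Hs.
  apply: (sclass_mul (@AC2 (t, s)) (X := fun x => hol_to_end x.1) (Y := fun x => fox_merge (KZ_along x.1) (P x.2))).
    exact: hol_to_end_cts2.
  move=> [|x v].
    by apply: (ac_ext (P := fun f => Ccts f (t, s)) (f := fun=> RtoC 0)) => [u|];
       [rewrite fox_merge_nil | exact: Ccts_const].
  apply: (ac_ext (P := fun f => Ccts f (t, s)) (f := fun y => (a_ x y.1 * P y.2 (x :: v))%C)) => [u|].
    by rewrite fox_merge_lin_cons.
  apply: Ccts_mult; last exact: P_cts2.
  by apply: (@Cts_fst (a_ x)); apply: (conn_cts PA).
- move=> t s Ht Hs.
  have SM : sder (fun s => fox_merge (KZ_along t) (P s)) s (lin (fun i => (a_ i t * a_ i s)%C) * P s)%S.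
    move=> [|x v].
      rewrite lin_mul_nil; apply: Cder_ext (Cder_const 0 s) => u; by rewrite fox_merge_nil.
    rewrite lin_mul_cons; apply: (Cder_ext (f := fun u => (a_ x t * P u (x :: v))%C)) => [u|].
      by rewrite fox_merge_lin_cons.
    apply: Cder_eq (Cder_scal (a_ x t) (sderP Hs (x :: v))) _.
    by rewrite lin_mul_cons; ring.
  apply: Cder_eq (sder_mul (sder_const (hol_to_end t) s) SM w) _.
  by rewrite saddE smul0l Cplus_0_l.
- move=> t s Ht Hs.
  apply: (sclass_mul (ac_cts s) (X := fun=> hol_to_end t)).
    exact: (sclass_const (ac_cts s)).
  apply: (sclass_mul (ac_cts s)).
    move=> [|x [|y v]]; try exact: Ccts_const.
    by apply: Ccts_mult; [exact: Ccts_const | apply: (conn_cts PA)].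
  by move=> v; apply: Cder_cont (sderP Hs v).
- move=> t s Ht Hs.
  have [M M0 [r r0 Hr]] : lip2 t s (fun x => (hol_to_end x.1 * P x.2)%S w).
    apply: (sclass_mul (ac_lip2 t s) (X := fun x => hol_to_end x.1) (Y := fun x => P x.2)) => v.
      exact: (lip2_fst s (sderR Ht v)).
    exact: (lip2_snd t (sderP Hs v)).
  by exists M, r.
move=> t s Ht Hs.
have nt i := Csub_neq (path_in_Sigma PA Ht (i := i)).
have ns i := Csub_neq (path_in_Sigma PA Hs (i := i)).
have E : (velocity gamma t *: (KZ_along s) - velocity gamma s *: (KZ_along t) =
   (- two_pi_i * (gamma s - gamma t))%C *: lin (fun i => (a_ i t * a_ i s)%C))%S.
  apply: seriesP => v; rewrite /KZ_along !scale_lin saddE soppE /lin.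
  case: v => [|x [|y v]]; [ring| |ring].
  rewrite /conn; have := nt x; have := ns x; have := two_pi_i_neq0.
  by move=> ? ? ?; field.
have -> : (hol_product_dt t s * velocity gamma s + hol_product_ds t s * velocity gamma t)%C =
   (hol_to_end t * ((velocity gamma t *: (KZ_along s) - velocity gamma s *: (KZ_along t)) * P s))%S w.
  rewrite smulBl smulBr !smulZl !smulZr saddE soppE !sscaleE /hol_product_dt /hol_product_ds smulNl soppE -smulA; ring.
by rewrite E smulZl smulZr sscaleE /hol_merge_ds Cmult_assoc.
Qed.
End Word.
End Data.

(** * Straight ends and growth of the holonomies *)

Lemma Con_bounded f a b : Con f a b -> exists2 M, 0 <= M & forall x, a <= x <= b -> Cmod (f x) <= M.
Proof.
move=> Hf; case: (Rle_lt_dec a b) => [ab|ba]; last by exists 0 => [|x Hx]; lra.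
pose Pr c d := exists2 M, 0 <= M & forall x, c <= x <= d -> Cmod (f x) <= M.
apply: (@cousin Pr) => // [c d e _ _ [M1 M10 H1] [M2 M20 H2]|x Hx].
  exists (M1 + M2) => [|x Hx]; first by lra.
  by case: (Rle_lt_dec x d) => xd; [have := H1 x | have := H2 x]; lra.
have /CcontP := Hf x Hx => /(_ 1 Rlt_0_1) [r Hr].
exists r => [|c d _ xc [cx xd] dx _]; first exact: cond_pos.
exists (Cmod (f x) + 1) => [|y Hy]; first by have := Cmod_ge_0 (f x); lra.
have Bx : ball x r y by rewrite /ball /= /AbsRing_ball /abs /minus /plus /opp /=; apply: Rabs_def1; lra.
have := Hr y Bx; have := Cmod_triangle (f x) (f y - f x)%C.
by rewrite (_ : (f x + (f y - f x))%C = f y); [lra | ring].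
Qed.

Section GrowMore.
Variables (T : Type) (sg : T -> R).
Implicit Types (D : T -> Prop) (X : T -> C).

Lemma Grow_union D D1 D2 X : (forall x, D x -> D1 x \/ D2 x) ->
  (forall x, D x -> 0 < sg x) ->
  Grow D1 sg X -> Grow D2 sg X -> Grow D sg X.
Proof.
move=> HD s0 G1 G2 al a0; have [c1 c10 H1] := G1 al a0; have [c2 c20 H2] := G2 al a0.
exists (c1 + c2) => [|x Dx]; first by lra.
have r0 := Rpower_gt0 (sg x) (- al).
by case: (HD x Dx) => [/H1|/H2]; nra.
Qed.

Lemma Grow_extD D X Y : (forall x, D x -> X x = Y x) -> Grow D sg X -> Grow D sg Y.
Proof. by move=> E H al /H [c c0 Hc]; exists c => // x Dx; rewrite -E //; apply: Hc. Qed.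

Lemma Small_sub D D' X : (forall x, D' x -> D x) -> Small D sg X -> Small D' sg X.
Proof. by move=> HD H al /H [c c0 Hc]; exists c => // x /HD; apply: Hc. Qed.
End GrowMore.

Section Straight.
Variables (n : nat) (z : 'I_n -> C) (p q : 'I_n) (gamma : R -> C).
Hypothesis PA : tangential_path z p q gamma.

Lemma Cder_affine (c k : C) t : Cder (fun u => c + k * RtoC u)%C t k.
Proof.
apply: Cder_eq; first apply: Cder_plus; first exact: Cder_const.
  by apply: Cder_mult; [exact: Cder_const | exact: Cder_id].
by rewrite /=; ring.
Qed.

Lemma affine_derivs (c k : C) lo hi : 0 <= lo -> hi <= 1 ->
  (forall u, lo < u < hi -> gamma u = (c + k * RtoC u)%C) ->
  forall u, lo < u < hi -> velocity gamma u = k /\ path_deriv 2 gamma u = RtoC 0.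
Proof.
move=> lo0 hi1 E.
have V u : lo < u < hi -> velocity gamma u = k.
  move=> Hu; apply: (Cder_unique (path_Cder PA (t := u) _)); first by lra.
  apply: Cder_ext_loc (Cder_affine c k u).
  by have [r r0 Hr] := near_itv Hu; exists (mkposreal _ r0) => y Hy; rewrite E //; apply: Hr.
move=> u Hu; split; first exact: V.
apply: (Cder_unique (velocity_Cder PA (t := u) _)); first by lra.
apply: Cder_ext_loc (Cder_const k u).
by have [r r0 Hr] := near_itv Hu; exists (mkposreal _ r0) => y Hy; rewrite V //; apply: Hr.
Qed.

Record straight (d : R) : Prop := {
  st_start : forall v, 0 < v <= d ->
    [/\ gamma v = (z p + RtoC v)%C, velocity gamma v = RtoC 1 & path_deriv 2 gamma v = RtoC 0];
  st_end : forall v, 0 < v <= d ->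
    [/\ gamma (1 - v) = (z q + RtoC v)%C, velocity gamma (1 - v) = (- RtoC 1)%C &
        path_deriv 2 gamma (1 - v) = RtoC 0]
}.

Lemma path_straight : exists2 d, 0 < d & straight d.
Proof.
have [d1 d10 H1] := path_start PA; have [d2 d20 H2] := path_end PA.
pose d := Rmin (Rmin d1 d2) 1.
have d0 : 0 < d by do !apply: Rmin_pos => //; lra.
have m1 : d <= Rmin d1 d2 := Rmin_l _ _; have m2 : d <= 1 := Rmin_r _ _.
have m3 := Rmin_l d1 d2; have m4 := Rmin_r d1 d2.
have S v : 0 < v < d -> velocity gamma v = RtoC 1 /\ path_deriv 2 gamma v = RtoC 0.
  apply: (@affine_derivs (z p)); try lra.
  by move=> u Hu; rewrite H1; [ring | lra].
have E v : 1 - d < v < 1 -> velocity gamma v = (- RtoC 1)%C /\ path_deriv 2 gamma v = RtoC 0.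
  apply: (@affine_derivs (z q + RtoC 1)%C); try lra.
  by move=> u Hu; rewrite H2; [rewrite RtoC_minus; ring | lra].
exists (d / 2); first by lra.
split=> v Hv.
  by have [-> ->] := S v ltac:(lra); split => //; apply: H1; lra.
have [-> ->] := E (1 - v) ltac:(lra); split => //.
by rewrite H2 (_ : 1 - (1 - v) = v); [|ring|lra|ring].
Qed.

Lemma straight_le d d' : d' <= d -> straight d -> straight d'.
Proof. by move=> dd [H1 H2]; split=> v Hv; [apply: H1 | apply: H2]; lra. Qed.
End Straight.

Lemma Con_away f a b : Con f a b -> (forall x, a <= x <= b -> f x <> RtoC 0) ->
  exists2 m, 0 < m & forall x, a <= x <= b -> m <= Cmod (f x).
Proof.
move=> Hf H0; have [|M M0 HM] := @Con_bounded (fun x => / f x)%C a b.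
  by move=> x Hx; apply: Ccts_inv; [exact: Hf | exact: H0].
exists (/ (M + 1)) => [|x Hx]; first by apply: Rinv_0_lt_compat; lra.
have f0 : 0 < Cmod (f x) by apply/Cmod_gt_0; apply: H0.
have := HM x Hx; rewrite Cmod_inv; last exact: H0.
move=> K; rewrite -(Rinv_inv (Cmod (f x))); apply: Rinv_le_contravar; last by lra.
exact: Rinv_0_lt_compat.
Qed.

Lemma Rpower_log_small c e : 0 <= c -> 0 < e -> exists2 r, 0 < r & forall t, 0 < t < r ->
  c * Rpower t (- (1 / 4)) * t * (1 - ln t) < e.
Proof.
move=> c0 e0; have [r r0 Hr] := @Rpower_small (e / (5 * c + 1)) ltac:(apply: Rdiv_lt_0_compat; lra).
exists (Rmin r 1) => [|t Ht]; first by apply: Rmin_pos; lra.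
have m1 := Rmin_l r 1; have m2 := Rmin_r r 1.
have K := Hr t ltac:(lra).
have L := @abs_ln_le t t (1 / 4) ltac:(lra) ltac:(lra) ltac:(lra).
have P1 := @Rpower_ge1 t (1 / 4) ltac:(lra) ltac:(lra).
have PP := Rpower_half t (1 / 2); rewrite (_ : 1 / 2 / 2 = 1 / 4) in PP; last by field.
set x := Rpower t (- (1 / 4)) in L P1 PP *; rewrite -PP in K.
have L' : 1 - ln t <= 5 * x.
  by have := Rle_abs (- ln t); rewrite Rabs_Ropp; lra.
apply: Rle_lt_trans (_ : 5 * c * (t * (x * x)) < _).
  rewrite (_ : 5 * c * (t * (x * x)) = c * x * t * (5 * x)); last by ring.
  by apply: Rmult_le_compat_l => //; apply: Rmult_le_pos; [apply: Rmult_le_pos|]; lra.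
have q : 0 < e / (5 * c + 1) by apply: Rdiv_lt_0_compat; lra.
apply: Rle_lt_trans (_ : 5 * c * (e / (5 * c + 1)) < _); first by apply: Rmult_le_compat_l; lra.
rewrite {2}(_ : e = 5 * c * (e / (5 * c + 1)) + e / (5 * c + 1)); last by field; lra.
by lra.
Qed.

(** With an error of moderate growth times v - t, the exponent 1/4 is small enough for the
    requirement on rho in side_limit. *)
Lemma side_limit_grow (g g1 : R -> C) z0 delta K c (phi Y : R -> R -> C) :
  0 < delta < 1 ->
  (forall v, 0 < v < 1 -> Ccts g v) -> (forall v, 0 < v < 1 -> Ccts g1 v) ->
  (forall v, 0 < v <= delta -> g v = (z0 + RtoC v)%C /\ g1 v = RtoC 1) ->
  (exists2 lb, 0 < lb & exists M1, forall v, delta <= v < 1 -> lb <= Cmod (g v - z0)%C /\ Cmod (g1 v) <= M1) ->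
  (forall t, 0 < t < delta -> Con (phi t) t (1 - t)) ->
  Grow (fun x => 0 < x.1 < delta /\ delta <= x.2 <= 1 - x.1) fst (fun x => phi x.1 x.2) ->
  Grow (fun x => 0 < x.1 < delta /\ x.1 <= x.2 <= delta) fst (fun x => Y x.1 x.2) ->
  (forall t v, 0 < t < delta -> t <= v <= delta ->
    (phi t v - log_poly K c t v)%C = (RtoC (v - t) * Y t v)%C) ->
  Clim0 (fun t => CInt (side_integrand g g1 z0 phi t) (t + t ^ 3) (1 - t) + c 0%N * RtoC (2 * ln t))%C
    (\csum_(k < K.+1) (if (k : nat) is k'.+1 then c k * RtoC (zeta k'.+2) else 0)).
Proof.
move=> Hd Hg Hg1 near [lb lb0 [M1 far]] Hphi G1 G2 E.
have [c1 c10 H1] := G1 (1 / 4) ltac:(lra); have [c2 c20 H2] := G2 (1 / 4) ltac:(lra).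
(* moderate growth is used with exponent 1/4 *)
pose rho t := (c1 + c2) * Rpower t (- (1 / 4)).
apply: (@side_limit g g1 z0 delta lb M1 K c phi rho) => //.
- by move=> t; apply: Rmult_le_pos; [lra | apply: Rlt_le; apply: Rpower_gt0].
- by move=> e e0; apply: Rpower_log_small; lra.
- move=> t v Ht Hv; have r0 := Rpower_gt0 t (- (1 / 4)).
  rewrite E // Cmod_mult Cmod_R Rabs_pos_eq; last by lra.
  have := H2 (t, v) ltac:(split => /=; lra); rewrite /= /rho => B.
  rewrite Rmult_comm; apply: Rmult_le_compat_r; first by lra.
  by nra.
move=> t v Ht Hv; have r0 := Rpower_gt0 t (- (1 / 4)).
by have := H1 (t, v) ltac:(split => /=; lra); rewrite /= /rho => B; nra.
Qed.

Section Asym.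
Variables (n : nat) (z : 'I_n -> C) (p q : 'I_n) (gamma : R -> C).
Hypothesis PA : tangential_path z p q gamma.
Hypothesis z_inj : injective z.
Variables (P Q : R -> series n) (H : series n).
Hypothesis HP : continued_solution z gamma 0 1 P.
Hypothesis HQ : continued_solution z gamma 0 1 Q.
Variables (dp dq d : R) (f h : R -> series n).
Hypothesis EP : expansion p dp f P.
Hypothesis EQ : expansion q dq h (fun v => Q (1 - v)).
Hypothesis P1 : forall t, 0 < t < 1 -> P t [::] = RtoC 1.
Hypothesis Q1 : forall t, 0 < t < 1 -> Q t [::] = RtoC 1.
Hypothesis PQ : forall t, 0 < t < 1 -> P t = (Q t * H)%S.
Hypothesis d_small : [/\ 0 < d, d < dp, d < dq & d < 1 / 4].
Hypothesis ST : straight z p q gamma d.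

Lemma H_aug : H [::] = RtoC 1.
Proof.
have Ht : 0 < / 2 < 1 by lra.
have := f_equal (fun a => a [::]) (PQ Ht); rewrite smul_nil P1 // Q1 // => ->; ring.
Qed.

Lemma P_start v : 0 < v <= d -> P v = (f v * letter_exp p (lnarg v))%S.
Proof. by case: d_small => *; apply: (ex_eq EP); lra. Qed.

Lemma hol_to_end_P t : 0 < t < 1 -> hol_to_end Q t = (H * sinv (P t))%S.
Proof.
move=> Ht; apply: (inverse_unique (a := Q t)); first by apply: smulVr; apply: Q1.
have E : (Q t * (H * sinv (P t)))%S = 1%S by rewrite smulA -PQ // smulrV // P1.
exact: E.
Qed.

Lemma hol_to_end_start v : 0 < v <= d -> hol_to_end Q v = (H * (letter_exp p (- lnarg v)%C * sinv (f v)))%S.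
Proof.
by case: d_small => *; rewrite hol_to_end_P; [rewrite (sinv_expansion EP) //; lra | lra].
Qed.

Lemma P_end v : 0 < v <= d -> P (1 - v) = (h v * letter_exp q (lnarg v) * H)%S.
Proof.
by case: d_small => *; rewrite PQ; [rewrite (ex_eq EQ) //; lra | lra].
Qed.

Lemma hol_to_end_end v : 0 < v <= d -> hol_to_end Q (1 - v) = (letter_exp q (- lnarg v)%C * sinv (h v))%S.
Proof. by case: d_small => *; rewrite /hol_to_end (sinv_expansion EQ) //; lra. Qed.

Section Grow.
Variables (T : Type) (D : T -> Prop) (sg : T -> R) (v : T -> R).
Hypothesis sg01 : forall x, D x -> 0 < sg x <= 1.
Hypothesis vD : forall x, D x -> sg x <= v x <= 1 - sg x.

(** Near the start and near the end the expansions apply; in between continuity gives a bound. *)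
Lemma Grow_regions (X : R -> C) :
  Grow (fun x => D x /\ v x <= d) sg (fun x => X (v x)) ->
  Grow (fun x => D x /\ 1 - d <= v x) sg (fun x => X (1 - (1 - v x))) ->
  Con X d (1 - d) -> Grow D sg (fun x => X (v x)).
Proof.
move=> G1 G2 C3.
have {}G2 : Grow (fun x => D x /\ 1 - d <= v x) sg (fun x => X (v x)).
  by apply: Grow_extD G2 => x _; congr X; ring.
have [M M0 HM] := Con_bounded C3.
have G3 : Grow (fun x => D x /\ d <= v x <= 1 - d) sg (fun x => X (v x)).
  apply: (Grow_bounded (D := fun x => D x /\ d <= v x <= 1 - d) _ (M := M)).
    by move=> x [/sg01].
  by move=> x [_ Hx]; apply: HM.
have G4 : Grow (fun x => D x /\ d <= v x) sg (fun x => X (v x)).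
  apply: Grow_union G2 G3 => x [Dx Hx]; last by have := sg01 Dx; lra.
  by case: (Rle_lt_dec (1 - d) (v x)) => ?; [left | right]; split => //; lra.
apply: Grow_union G1 G4 => x Dx; last by have := sg01 Dx; lra.
by case: (Rle_lt_dec (v x) d) => ?; [left | right]; split => //; lra.
Qed.

Let D1 x := D x /\ v x <= d.
Let D2 x := D x /\ 1 - d <= v x.
Let sg1 x : D1 x -> 0 < sg x <= 1. Proof. by case=> /sg01. Qed.
Let sg2 x : D2 x -> 0 < sg x <= 1. Proof. by case=> /sg01. Qed.
Let vD1 x : D1 x -> sg x <= v x < dp.
Proof. by case: d_small => ? ? ? ? [/vD]; lra. Qed.
Let vD2 x : D2 x -> sg x <= 1 - v x < dq.
Proof. by case: d_small => ? ? ? ? [/vD]; lra. Qed.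

Lemma Grow_P : sclass (Grow D sg) (fun x => P (v x)).
Proof.
case: d_small => d0 _ _ d4 w; apply: (@Grow_regions (fun t => P t w)).
- apply: (Grow_extD (X := fun x => (f (v x) * letter_exp p (lnarg (v x)))%S w)).
    by move=> x [Dx Hx]; rewrite P_start //; have := vD Dx; have := sg01 Dx; lra.
  apply: (sclass_mul (ac_grow sg1)); first exact: (Grow_f sg1 EP vD1).
  exact: (Grow_letter_exp sg1 EP vD1).
- apply: (Grow_extD (X := fun x => (h (1 - v x) * letter_exp q (lnarg (1 - v x)) * H)%S w)).
    by move=> x [Dx Hx]; rewrite P_end //; have := vD Dx; have := sg01 Dx; lra.
  apply: (sclass_mul (ac_grow sg2)); last exact: (sclass_const (ac_grow sg2)).
  apply: (sclass_mul (ac_grow sg2)); first exact: (Grow_f sg2 EQ vD2).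
  exact: (Grow_letter_exp sg2 EQ vD2).
by move=> t Ht; apply: Cder_cont; apply: (sderP PA HP); lra.
Qed.

Lemma Grow_R : sclass (Grow D sg) (fun x => hol_to_end Q (v x)).
Proof.
case: d_small => d0 _ _ d4 w; apply: (@Grow_regions (fun t => hol_to_end Q t w)).
- apply: (Grow_extD (X := fun x => (H * (letter_exp p (- lnarg (v x))%C * sinv (f (v x))))%S w)).
    by move=> x [Dx Hx]; rewrite hol_to_end_start //; have := vD Dx; have := sg01 Dx; lra.
  apply: (sclass_mul (ac_grow sg1)); first exact: (sclass_const (ac_grow sg1)).
  apply: (sclass_mul (ac_grow sg1)); first exact: (Grow_letter_expN sg1 EP vD1).
  exact: (Grow_sinvf sg1 EP vD1).
- apply: (Grow_extD (X := fun x => (letter_exp q (- lnarg (1 - v x))%C * sinv (h (1 - v x)))%S w)).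
    by move=> x [Dx Hx]; rewrite hol_to_end_end //; have := vD Dx; have := sg01 Dx; lra.
  apply: (sclass_mul (ac_grow sg2)); first exact: (Grow_letter_expN sg2 EQ vD2).
  exact: (Grow_sinvf sg2 EQ vD2).
by move=> t Ht; apply: Cder_cont; apply: (sderR PA HQ Q1); lra.
Qed.

(** The pole of the connection at an end point is of order 1/v, hence bounded by 1/sigma. *)
Lemma end_pole (z0 : 'I_n) (i : 'I_n) : (forall u, 0 < u <= d -> (z z0 + RtoC u - z i)%C <> RtoC 0) ->
  exists2 M, 0 <= M & forall s u, 0 < s <= u -> u <= d -> Cmod (RtoC s / (z z0 + RtoC u - z i))%C <= M.
Proof.
move=> Hn; case: (eqVneq i z0) => [->|iz].
  exists 1 => [|s u Hs Hu]; first by lra.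
  rewrite (_ : (z z0 + RtoC u - z z0)%C = RtoC u); last by ring.
  rewrite Cmod_div; last by case; lra.
  rewrite !Cmod_R !Rabs_pos_eq; try lra.
  by apply/Rle_div_l; lra.
have C : Con (fun u => / (z z0 + RtoC u - z i))%C 0 d.
  move=> u Hu; apply: Ccts_inv.
    apply: Ccts_minus; last exact: Ccts_const.
    by apply: Ccts_plus; [exact: Ccts_const | apply: Cder_cont; exact: Cder_id].
  case: (Rle_lt_or_eq_dec 0 u (proj1 Hu)) => [u0|<-]; first by apply: Hn; lra.
  rewrite Cplus_0_r; apply: Csub_neq => /z_inj E.
  by rewrite E eqxx in iz.
have [M M0 HM] := Con_bounded C; exists M => // s u Hs Hu.
rewrite /Cdiv Cmod_mult Cmod_R Rabs_pos_eq; last by lra.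
have := HM u ltac:(lra); have := Cmod_ge_0 (/ (z z0 + RtoC u - z i))%C.
by case: d_small; nra.
Qed.

Lemma Grow_conn i : Grow D sg (fun x => RtoC (sg x) * conn z gamma i (v x))%C.
Proof.
case: d_small => d0 _ _ d4.
have pi0 := two_pi_i_neq0.
have nS t : 0 < t < 1 -> (gamma t - z i)%C <> RtoC 0.
  by move=> Ht; apply: Csub_neq; apply: (path_in_Sigma PA Ht).
have B1 : exists M, forall x, D1 x -> Cmod (RtoC (sg x) * conn z gamma i (v x))%C <= M.
  have [|M M0 HM] := @end_pole p i.
    by move=> u Hu; have [<- _ _] := st_start ST Hu; apply: nS; lra.
  exists (Cmod (/ two_pi_i)%C * M) => x [Dx Hx]; have Hv := vD Dx; have Hs := sg01 Dx.
  have [e1 e2 _] := st_start ST (v := v x) ltac:(lra).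
  rewrite /conn e1 e2 (_ : (RtoC (sg x) * _)%C = (/ two_pi_i * (RtoC (sg x) / (z p + RtoC (v x) - z i)))%C).
    by rewrite Cmod_mult; apply: Rmult_le_compat_l; [exact: Cmod_ge_0 | apply: HM; lra].
  by rewrite /Cdiv; ring.
have B2 : exists M, forall x, D2 x -> Cmod (RtoC (sg x) * conn z gamma i (v x))%C <= M.
  have [|M M0 HM] := @end_pole q i.
    by move=> u Hu; have [<- _ _] := st_end ST Hu; apply: nS; lra.
  exists (Cmod (/ two_pi_i)%C * M) => x [Dx Hx]; have Hv := vD Dx; have Hs := sg01 Dx.
  have [e1 e2 _] := st_end ST (v := 1 - v x) ltac:(lra).
  rewrite (_ : 1 - (1 - v x) = v x) in e1 e2; last by ring.
  rewrite /conn e1 e2 (_ : (RtoC (sg x) * _)%C = (- (/ two_pi_i * (RtoC (sg x) / (z q + RtoC (1 - v x) - z i))))%C).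
    by rewrite Cmod_opp Cmod_mult; apply: Rmult_le_compat_l; [exact: Cmod_ge_0 | apply: HM; lra].
  by rewrite /Cdiv; ring.
have [M3 M30 H3] : exists2 M, 0 <= M & forall t, d <= t <= 1 - d -> Cmod (conn z gamma i t) <= M.
  by apply: Con_bounded => t Ht; apply: (conn_cts PA); lra.
have [M1 H1] := B1; have [M2 H2] := B2.
apply: (Grow_bounded sg01 (M := Rmax M1 (Rmax M2 M3))) => x Dx.
have x1 := Rmax_l M1 (Rmax M2 M3); have x2 := Rmax_r M1 (Rmax M2 M3).
have x3 := Rmax_l M2 M3; have x4 := Rmax_r M2 M3.
case: (Rle_lt_dec (v x) d) => K1; first by have := H1 x (conj Dx K1); lra.
case: (Rle_lt_dec (1 - d) (v x)) => K2; first by have := H2 x (conj Dx K2); lra.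
have := H3 (v x) ltac:(lra); have Hs := sg01 Dx.
rewrite Cmod_mult Cmod_R Rabs_pos_eq; last by lra.
by have := Cmod_ge_0 (conn z gamma i (v x)); nra.
Qed.
End Grow.

(** * The diagonal integral of the merged product *)

Local Notation RR := (hol_to_end Q).
Local Notation AA := (KZ_along z gamma).
Local Notation WW := (hol_merge z gamma P Q).

Definition scaleD (tau0 : R) (x : R * R) := 0 < x.1 <= tau0 /\ x.1 <= x.2 <= 1 - x.1.

Section Grow2.
Variables (T : Type) (D : T -> Prop) (sg : T -> R) (v : T -> R).
Hypothesis sg01 : forall x, D x -> 0 < sg x <= 1.
Hypothesis vD : forall x, D x -> sg x <= v x <= 1 - sg x.

Lemma Grow_A : sclass (Grow D sg) (fun x => RtoC (sg x) *: AA (v x))%S.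
Proof.
move=> [|i [|j w]].
- apply: (ac_ext (P := Grow D sg) (f := fun=> RtoC 0)) => [x|]; [by rewrite sscaleE /KZ_along /lin; ring | exact: (ac_const (ac_grow sg01))].
- exact: (Grow_conn sg01 vD i).
by apply: (ac_ext (P := Grow D sg) (f := fun=> RtoC 0)) => [x|]; [rewrite sscaleE /KZ_along /lin; ring | exact: (ac_const (ac_grow sg01))].
Qed.

Lemma Grow_merge (Y : T -> series n) : sclass (Grow D sg) Y ->
  sclass (Grow D sg) (fun x => RtoC (sg x) *: fox_merge (AA (v x)) (Y x))%S.
Proof.
move=> GY [|i w].
  apply: (ac_ext (P := Grow D sg) (f := fun=> RtoC 0)) => [x|]; last exact: (ac_const (ac_grow sg01)).
  by rewrite sscaleE fox_merge_nil; ring.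
apply: (ac_ext (P := Grow D sg) (f := fun x => (RtoC (sg x) * conn z gamma i (v x)) * Y x (i :: w))%C) => [x|].
  by rewrite sscaleE fox_merge_lin_cons; ring.
by apply: (ac_mul (ac_grow sg01)); [exact: (Grow_conn sg01 vD i) | exact: GY].
Qed.

Lemma Small_merge (Y : T -> series n) :
  (forall w, Small D sg (fun x => RtoC (/ sg x) * Y x w)%C) ->
  forall w, Small D sg (fun x => fox_merge (AA (v x)) (Y x) w).
Proof.
move=> SY [|i w].
  by apply: Small_ext (Small_0 D sg) => x; rewrite fox_merge_nil.
apply: (Small_extD (f := fun x => ((RtoC (sg x) * conn z gamma i (v x)) * (RtoC (/ sg x) * Y x (i :: w)))%C)).
  move=> x Dx; rewrite fox_merge_lin_cons /KZ_along RtoC_inv; last by have := sg01 Dx; lra.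
  by have := sg01 Dx => s0; field; case; lra.
by apply: Small_mul; [exact: (Grow_conn sg01 vD i) | exact: SY].
Qed.
End Grow2.

Lemma sclass_smul_small (T : Type) (D : T -> Prop) (sg : T -> R) (X Y : T -> series n) :
  sclass (Grow D sg) X -> (forall w, Small D sg (fun x => Y x w)) ->
  forall w, Small D sg (fun x => (X x * Y x)%S w).
Proof. by move=> GX SY w; apply: Small_sum => k; apply: Small_mul; [apply: GX | apply: SY]. Qed.

Let sg2 tau0 : tau0 <= 1 -> forall x : R * R, scaleD tau0 x -> 0 < x.1 <= 1.
Proof. by move=> t1 x [Hx _]; lra. Qed.
Let v2 tau0 : forall x : R * R, scaleD tau0 x -> x.1 <= x.2 <= 1 - x.1.
Proof. by move=> x []. Qed.

(** An increment over a length sigma^3 of a function with derivative of order 1/sigma is of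
    order sigma^2: one power of sigma is left after division by sigma. *)
Lemma diff_bound (phi dphi : R -> C) : (forall t, 0 < t < 1 -> Cder phi t (dphi t)) ->
  (forall t, 0 < t < 1 -> Ccts dphi t) ->
  Grow (scaleD 1) fst (fun x => RtoC x.1 * dphi x.2)%C ->
  forall T (D : T -> Prop) (sg u v : T -> R),
  (forall x, D x -> [/\ 0 < sg x <= 1, sg x <= u x <= v x, v x <= 1 - sg x & v x - u x <= sg x ^ 3]) ->
  Small D sg (fun x => RtoC (/ sg x) * (phi (v x) - phi (u x)))%C.
Proof.
move=> Hd Hc G T D sg u v HD al a0; have [c c0 Hb] := G al a0.
exists (2 * c); first by lra.
move=> x Dx; have [Hs Hu Hv Huv] := HD x Dx.
have si : 0 < / sg x by apply: Rinv_0_lt_compat; lra.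
rewrite Cmod_mult Cmod_R Rabs_pos_eq; last by lra.
have rp := Rpower_gt0 (sg x) (- al).
have B : Cmod (phi (v x) - phi (u x))%C <= 2 * (c * Rpower (sg x) (- al) * / sg x) * (v x - u x).
  rewrite -(@CInt_FTC phi dphi); [|lra| |].
  - apply: CInt_bound; [lra| |] => t Ht; first by apply: Hc; lra.
    have := Hb (sg x, t) ltac:(split => /=; lra).
    rewrite /= Cmod_mult Cmod_R Rabs_pos_eq; last by lra.
    move=> K; have -> : Cmod (dphi t) = sg x * Cmod (dphi t) * / sg x by field; lra.
    by apply: Rmult_le_compat_r; lra.
  - by move=> t Ht; apply: Hd; lra.
  by move=> t Ht; apply: Hc; lra.
apply: Rle_trans (_ : / sg x * (2 * (c * Rpower (sg x) (- al) * / sg x) * sg x ^ 3) <= _).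
  apply: Rmult_le_compat_l; first by lra.
  apply: Rle_trans B _; apply: Rmult_le_compat_l => //.
  by apply: Rmult_le_pos; [lra | apply: Rmult_le_pos; nra].
by apply: Req_le; field; lra.
Qed.

Section Diff.
Variables (T : Type) (D : T -> Prop) (sg u v : T -> R).
Hypothesis HD : forall x, D x ->
  [/\ 0 < sg x <= 1, sg x <= u x <= v x, v x <= 1 - sg x & v x - u x <= sg x ^ 3].

Lemma P_diff w : Small D sg (fun x => RtoC (/ sg x) * (P (v x) w - P (u x) w))%C.
Proof.
apply: (@diff_bound (fun t => P t w) (fun t => (AA t * P t)%S w)) HD.
- by move=> t Ht; apply: (sderP PA HP Ht w).
- move=> t Ht; apply: (sclass_mul (ac_cts t)) => v'; last exact: Cder_cont (sderP PA HP Ht v').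
  by case: v' => [|i [|j v']]; try exact: Ccts_const; apply: (conn_cts PA).
have s1 := sg2 (Rle_refl 1).
apply: (ac_ext (P := Grow (scaleD 1) fst) (f := fun x => ((RtoC x.1 *: AA x.2) * P x.2)%S w)) => [x|].
  by rewrite smulZl.
apply: (sclass_mul (ac_grow s1)); first exact: (Grow_A s1 (@v2 1)).
exact: (Grow_P s1 (@v2 1)).
Qed.

Lemma R_diff w : Small D sg (fun x => RtoC (/ sg x) * (RR (v x) w - RR (u x) w))%C.
Proof.
apply: (@diff_bound (fun t => RR t w) (fun t => (- (RR t * AA t))%S w)) HD.
- by move=> t Ht; apply: (sderR PA HQ Q1 Ht w).
- move=> t Ht; apply: Ccts_opp; apply: (sclass_mul (ac_cts t)) => v'.
    exact: Cder_cont (sderR PA HQ Q1 Ht v').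
  by case: v' => [|i [|j v']]; try exact: Ccts_const; apply: (conn_cts PA).
have s1 := sg2 (Rle_refl 1).
apply: (ac_ext (P := Grow (scaleD 1) fst) (f := fun x => (- (RR x.2 * (RtoC x.1 *: AA x.2)))%S w)) => [x|].
  by rewrite smulZr !soppE sscaleE; ring.
apply: (ac_opp (ac_grow s1)); apply: (sclass_mul (ac_grow s1)); first exact: (Grow_R s1 (@v2 1)).
exact: (Grow_A s1 (@v2 1)).
Qed.

Lemma Small_unscale (X : T -> C) : Small D sg (fun x => RtoC (/ sg x) * X x)%C -> Small D sg X.
Proof.
have s1 x : D x -> 0 < sg x <= 1 by case/HD.
move=> S; apply: (Small_extD (f := fun x => (RtoC (sg x) * (RtoC (/ sg x) * X x))%C)).
  move=> x Dx; rewrite RtoC_inv; last by have := s1 x Dx; lra.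
  by have := s1 x Dx => s0; field; case; lra.
apply: Small_mul => //; apply: (Grow_bounded s1 (M := 1)) => x Dx.
by rewrite Cmod_R Rabs_pos_eq; have := s1 x Dx; lra.
Qed.
End Diff.

Lemma Small_CInt (tau0 : R) (lo hi : R -> R) (X : R -> R -> C) :
  (forall t, 0 < t <= tau0 -> 0 <= lo t <= hi t /\ hi t <= 1) ->
  Small (fun x : R * R => 0 < x.1 <= tau0 /\ lo x.1 <= x.2 <= hi x.1) fst (fun x => X x.1 x.2) ->
  (forall t, 0 < t <= tau0 -> Con (X t) (lo t) (hi t)) ->
  Small (fun t => 0 < t <= tau0) id (fun t => CInt (X t) (lo t) (hi t)).
Proof.
move=> Hl S HC al a0; have [c c0 Hb] := S al a0; exists (2 * c); first by lra.
move=> t Ht; have [H1 H2] := Hl t Ht.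
have r0 := Rpower_gt0 t (- al).
apply: Rle_trans (_ : 2 * (c * (t * Rpower t (- al))) * (hi t - lo t) <= _).
  by apply: CInt_bound; [lra | apply: HC | move=> s Hs; apply: (Hb (t, s))].
have q0 : 0 <= 2 * (c * (t * Rpower t (- al))).
  by apply: Rmult_le_pos; [lra | apply: Rmult_le_pos => //; nra].
by rewrite /id; nra.
Qed.

Lemma cube_le t : 0 < t <= 1 / 4 -> 0 < t ^ 3 <= t / 16.
Proof.
move=> Ht; split; first by apply: pow_lt; lra.
have t2 : 0 < t * t <= 1 / 16 by nra.
by rewrite (_ : t ^ 3 = t * (t * t)); [nra | ring].
Qed.

Section Word.
Variable w : seq 'I_n.
Local Notation GDw := (KZ_green_data PA HP HQ Q1 w).

Lemma W_curve_cts (b : R -> R) t : 0 < t < 1 -> 0 < b t < 1 -> continuous b t ->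
  Ccts (fun t => WW w t (b t)) t.
Proof. by move=> Ht Hb Hc; apply: (Ccts2_curve (f := WW w)) => //; apply: (gd_cW GDw). Qed.

(** The element P(t) P(a)^-1 is the holonomy from a to t. Its coaction, transported to the ends,
    is a primitive of W(t,t) - W(t,a), since by KKS_mul the derivative of the coaction merges
    the new letter with the first letter of the word. *)
Definition KKS_primitive (a t : R) : C := (RR t * KKS (P t * sinv (P a)) * P a)%S w.

Lemma KKS_primitive_Cder a t : 0 < a < 1 -> 0 < t < 1 ->
  Cder (KKS_primitive a) t (WW w t t - WW w t a)%C.
Proof.
move=> Ha Ht; set Pi := sinv (P a).
have ST1 : sder (fun t => P t * Pi)%S t (AA t * (P t * Pi))%S.
  apply: (sder_eq (sder_mul (sderP PA HP Ht) (sder_const Pi t))).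
  by rewrite smul0r smulA; apply: seriesP => u; rewrite saddE /szero; ring.
have SK := sder_KKS ST1.
have SR := sder_mul (sder_mul (sderR PA HQ Q1 Ht) SK) (sder_const (P a) t).
apply: Cder_eq (SR w) _.
rewrite [KKS (AA t * _)%S]KKS_mul [KKS (AA t)](KKS_lin) smul0l.
(* the correction to the multiplicativity of fox_merge comes from the augmentation of P t * Pi *)
have E : (fox_merge (AA t) (P t * Pi) * P a = fox_merge (AA t) (P t) - fox_merge (AA t) (P a))%S.
  apply: seriesP => -[|x u].
    by rewrite smul_nil saddE soppE !fox_merge_nil; ring.
  rewrite smul_cons fox_merge_nil saddE soppE !fox_merge_lin_cons Cmult_0_l Cplus_0_l.
  have -> : foxR x (fox_merge (AA t) (P t * Pi))%S = (conn z gamma x t *: foxR x (P t * Pi))%S.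
    by apply: seriesP => v; rewrite {1}/foxR fox_merge_lin_cons sscaleE.
  rewrite smulZl sscaleE.
  have -> : (foxR x (P t * Pi) * P a = foxR x (P t) - foxR x (P a))%S.
    have E1 : (P t = (P t * Pi) * P a)%S by rewrite -smulA smulVr ?smul1r //; apply: P1.
    rewrite {2}E1 [foxR x (_ * P a)%S]foxR_mul smul_nil (P1 Ht).
    have -> : Pi [::] = RtoC 1.
      by have := f_equal (fun a => a [::]) (smulVr (P1 Ha)); rewrite smul_nil P1 // Cmult_1_r.
    by apply: seriesP => v; rewrite !saddE soppE sscaleE; ring.
  by rewrite saddE soppE /foxR; ring.
have -> : (WW w t t - WW w t a)%C = (RR t * (fox_merge (AA t) (P t * Pi) * P a))%S w.
  by rewrite E smulBr saddE soppE /hol_merge; ring.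
rewrite smul0r.
rewrite !smulDl !smulDr !smulDl !smulNl !smulA !saddE !soppE smul0r smul0l /szero; ring.
Qed.

Lemma KKS_primitive_start a : 0 < a < 1 -> KKS_primitive a a = RtoC 0.
Proof.
move=> Ha; rewrite /KKS_primitive smulrV ?P1 //.
have -> : KKS 1 = szero :> series n.
  apply: seriesP => u; rewrite KKS_double big1 // => j _.
  rewrite /sone /monomial; case: u j => [|x u] [j Hj] //=.
by rewrite smul0r smul0l.
Qed.

(** The contribution of W to the boundary form at cut-off tau. *)
Definition diagonal_integral (tau : R) : C :=
  CInt (fun t => WW w t (Rminus t (tau ^ 3)) - WW w t tau)%C (tau + tau ^ 3) (1 - tau).

(** The shift by tau^3 on the diagonal and the missing interval of length tau^3 are negligible. *)
Lemma diagonal_integral_limit : Small (fun t => 0 < t <= 1 / 4) id (fun t => diagonal_integral t - KKS_primitive t (1 - t))%C.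
Proof.
have cid t : continuous (fun t : R => t) t by exact: continuous_id.
have csub (k : R) t : continuous (fun t => t - k) t.
  by apply: (@continuous_minus R_UniformSpace R_AbsRing R_NormedModule);
    [exact: continuous_id | exact: continuous_const].
have ccst (k : R) t : continuous (fun _ : R => k) t by exact: continuous_const.
have S1 : Small (fun t => 0 < t <= 1 / 4) id (fun t =>
    CInt (fun s => WW w s (Rminus s (t ^ 3)) - WW w s s)%C (t + t ^ 3) (1 - t)).
  apply: (@Small_CInt (1 / 4) (fun t => t + t ^ 3) (fun t => 1 - t)) => [t Ht||t Ht s Hs].
  - by have := cube_le Ht; lra.
  - pose D (x : R * R) := 0 < x.1 <= 1 / 4 /\ x.1 + x.1 ^ 3 <= x.2 <= 1 - x.1.
    have DD x : D x -> [/\ 0 < x.1 <= 1, x.1 <= Rminus x.2 (x.1 ^ 3) <= x.2, x.2 <= 1 - x.1 &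
        x.2 - (x.2 - x.1 ^ 3) <= x.1 ^ 3].
      by move=> [K1 K2]; have := cube_le K1; split; lra.
    have sD x : D x -> 0 < x.1 <= 1 by case/DD.
    have vD x : D x -> x.1 <= x.2 <= 1 - x.1 by case/DD; lra.
    have uD x : D x -> x.1 <= x.2 - x.1 ^ 3 <= 1 - x.1 by case/DD; lra.
    have SY w' := P_diff (T := R * R) (D := D) (sg := fst) (u := fun x => Rminus x.2 (x.1 ^ 3))
       (v := snd) DD w'.
    have SM := @Small_merge (R * R) D fst snd sD vD (fun x => P x.2 - P (Rminus x.2 (x.1 ^ 3)))%S SY.
    have SS := sclass_smul_small (Grow_R sD vD) SM w.
    apply: Small_ext (Small_mul (ac_const (ac_grow sD) (- RtoC 1)%C) SS) => x.
    have -> : (fox_merge (AA x.2) (P x.2 - P (Rminus x.2 (x.1 ^ 3))) =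
       fox_merge (AA x.2) (P x.2) - fox_merge (AA x.2) (P (Rminus x.2 (x.1 ^ 3))))%S.
      apply: seriesP => -[|y u']; rewrite saddE soppE ?fox_merge_nil; first by ring.
      by rewrite !fox_merge_lin_cons saddE soppE; ring.
    by rewrite smulBr saddE soppE /hol_merge; ring.
  have := cube_le Ht => Hc.
  by apply: Ccts_minus; apply: W_curve_cts => //; try lra.
have S2 : Small (fun t => 0 < t <= 1 / 4) id (fun t =>
    CInt (fun s => WW w s s - WW w s t)%C t (t + t ^ 3)).
  pose D (x : R * R) := 0 < x.1 <= 1 / 4 /\ x.1 <= x.2 <= x.1 + x.1 ^ 3.
  have sD x : D x -> 0 < x.1 <= 1 by case; lra.
  have vD x : D x -> x.1 <= x.2 <= 1 - x.1 by case=> K1 K2; have := cube_le K1; lra.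
  have tD x : D x -> x.1 <= x.1 <= 1 - x.1 by case=> K1 K2; lra.
  have G : Grow D fst (fun x => RtoC x.1 * (WW w x.2 x.2 - WW w x.2 x.1))%C.
    apply: (ac_ext (P := Grow D fst) (f := fun x => ((RR x.2 * (RtoC x.1 *: fox_merge (AA x.2) (P x.2)))%S w -
        (RR x.2 * (RtoC x.1 *: fox_merge (AA x.2) (P x.1)))%S w)%C)) => [x|].
      by rewrite !smulZr !sscaleE /hol_merge; ring.
    apply: (ac_sub (ac_grow sD)); apply: (sclass_mul (ac_grow sD)); try exact: (Grow_R sD vD).
      by apply: (Grow_merge sD vD); apply: (Grow_P sD vD).
    by apply: (Grow_merge sD vD); apply: (Grow_P sD tD).
  move=> al a0; have [c c0 Hb] := G al a0; exists (2 * c); first by lra.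
  move=> t Ht; have Hc := cube_le Ht; rewrite /id.
  have r0 := Rpower_gt0 t (- al).
  apply: Rle_trans (_ : 2 * (c * Rpower t (- al) / t) * (t + t ^ 3 - t) <= _).
    apply: CInt_bound; first by lra.
      by move=> s Hs; apply: Ccts_minus; apply: W_curve_cts => //; lra.
    move=> s Hs; have := Hb (t, s) ltac:(split => /=; lra).
    rewrite /= Cmod_mult Cmod_R Rabs_pos_eq; last by lra.
    by move=> K; apply/Rle_div_r; [lra | rewrite Rmult_comm; lra].
  rewrite (_ : 2 * (c * Rpower t (- al) / t) * (t + t ^ 3 - t) = 2 * c * (t * Rpower t (- al)) * t); last by field; lra.
  have : 0 <= 2 * c * (t * Rpower t (- al)) by apply: Rmult_le_pos; [lra | nra].
  by nra.
apply: (Small_extD (f := fun t => (CInt (fun s => WW w s (Rminus s (t ^ 3)) - WW w s s)%C (t + t ^ 3) (1 - t) +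
   (- RtoC 1) * CInt (fun s => WW w s s - WW w s t)%C t (t + t ^ 3))%C)); last first.
  apply: Small_add => //; apply: Small_mul => //.
  by apply: (ac_const (ac_grow _)) => t Ht; rewrite /id; lra.
move=> t Ht; have Hc := cube_le Ht.
have -> : KKS_primitive t (1 - t) = CInt (fun s => WW w s s - WW w s t)%C t (1 - t).
  rewrite (@CInt_FTC (KKS_primitive t)) //; try lra.
  - by rewrite KKS_primitive_start; [ring | lra].
  - by move=> s Hs; apply: KKS_primitive_Cder; lra.
  by move=> s Hs; apply: Ccts_minus; apply: W_curve_cts => //; lra.
have c1 : Con (fun s => WW w s s - WW w s t)%C t (1 - t).
  by move=> s Hs; apply: Ccts_minus; apply: W_curve_cts => //; lra.
rewrite (@CInt_Chasles _ t (t + t ^ 3) (1 - t)); [|lra|done].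
have -> : diagonal_integral t = (CInt (fun s => WW w s (Rminus s (t ^ 3)) - WW w s s)%C (t + t ^ 3) (1 - t) +
   CInt (fun s => WW w s s - WW w s t)%C (t + t ^ 3) (1 - t))%C.
  rewrite -CInt_plus; [|lra| |].
  - by apply: CInt_ext => [|s Hs]; [lra | ring].
  - by move=> s Hs; apply: Ccts_minus; apply: W_curve_cts => //; lra.
  by move=> s Hs; apply: c1; lra.
by ring.
Qed.
End Word.

(** * The finite part at the two ends *)

(** The diagonal integral together with the residues at the two end points; the divergent
    parts of the three summands cancel. *)
Definition regular_part (w : seq 'I_n) (t : R) : C :=
  (diagonal_integral w t + (RR (Rminus 1 t) * (foxR q (P (Rminus (Rminus 1 t) (t ^ 3))) - foxR q (P t)))%S w
    + ((foxL p (RR (Rplus t (t ^ 3))) - foxL p (RR (Rminus 1 t))) * P t)%S w)%C.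

Section FoxLimit.
Hypothesis pq : p != q.
Let D (t : R) := 0 < t <= d.
Let dD : [/\ 0 < d, d < dp, d < dq, d < 1 / 4 & dp <= 1].
Proof. by case: d_small => ? ? ? ?; have [_] := ex_delta EP; split. Qed.
Let sg01 t : D t -> 0 < id t <= 1. Proof. by case: dD => ? ? ? ? ? [? ?]; rewrite /id; lra. Qed.
Let vp t : D t -> id t <= t < dp. Proof. by case: dD => ? ? ? ? ? [? ?]; rewrite /id; lra. Qed.
Let vq t : D t -> id t <= t < dq. Proof. by case: dD => ? ? ? ? ? [? ?]; rewrite /id; lra. Qed.
Let tD t : D t -> id t <= t <= 1 - id t.
Proof. by case: dD => ? ? ? ? ? [? ?]; rewrite /id; lra. Qed.
Let bD t : D t -> id t <= 1 - t <= 1 - id t.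
Proof. by case: dD => ? ? ? ? ? [? ?]; rewrite /id; lra. Qed.
Let cst (a : series n) := sclass_const (n := n) (ac_grow sg01) a.
Let gmul := @sclass_mul R (Grow D id) n (ac_grow sg01).
Let E1 (t : R) := letter_exp p (lnarg t).
Let E1' (t : R) := letter_exp p (- lnarg t)%C.
Let E2 (t : R) := letter_exp q (lnarg t).
Let E2' (t : R) := letter_exp q (- lnarg t)%C.
Let G1 : sclass (Grow D id) E1 := Grow_letter_exp sg01 EP vp.
Let G1' : sclass (Grow D id) E1' := Grow_letter_expN sg01 EP vp.
Let G2 : sclass (Grow D id) E2 := Grow_letter_exp sg01 EQ vq.
Let G2' : sclass (Grow D id) E2' := Grow_letter_expN sg01 EQ vq.

Lemma near_P : sapprox D id P E1.
Proof.
apply: (sapprox_extD (X := fun t => (f t * E1 t)%S) (Y := fun t => (1 * E1 t)%S)).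
- by move=> t Dt; rewrite P_start.
- by move=> t _; rewrite smul1l.
apply: sapprox_mul (cst 1%S) G1; last exact: sapprox_refl.
exact: (f_near_one sg01 EP vp).
Qed.

Lemma near_Pinv : sapprox D id (fun t => sinv (P t)) E1'.
Proof.
apply: (sapprox_extD (X := fun t => (E1' t * sinv (f t))%S) (Y := fun t => (E1' t * 1)%S)).
- by move=> t Dt; rewrite (sinv_expansion EP) //; have := vp Dt; have := sg01 Dt; rewrite /id; lra.
- by move=> t _; rewrite smul1r.
apply: sapprox_mul G1' (Grow_sinvf sg01 EP vp); first exact: sapprox_refl.
exact: (sinvf_near_one sg01 EP vp).
Qed.

Lemma near_R : sapprox D id RR (fun t => H * E1' t)%S.
Proof.
apply: (sapprox_extD (X := fun t => (H * sinv (P t))%S) (Y := fun t => (H * E1' t)%S)) => //.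
  by move=> t Dt; rewrite hol_to_end_P //; have := tD Dt; have := sg01 Dt; case: dD; rewrite /id; lra.
apply: sapprox_mul near_Pinv (cst H) _; first exact: sapprox_refl.
exact: (sclass_sinv (ac_grow sg01) (Grow_P sg01 tD)).
Qed.

Lemma near_P_end : sapprox D id (fun t => P (Rminus 1 t)) (fun t => E2 t * H)%S.
Proof.
apply: (sapprox_extD (X := fun t => (h t * (E2 t * H))%S) (Y := fun t => (1 * (E2 t * H))%S)).
- by move=> t Dt; rewrite P_end // smulA.
- by move=> t _; rewrite smul1l.
apply: sapprox_mul (cst 1%S) (gmul G2 (cst H)); last exact: sapprox_refl.
exact: (f_near_one sg01 EQ vq).
Qed.

Lemma near_R_end : sapprox D id (fun t => RR (Rminus 1 t)) E2'.
Proof.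
apply: (sapprox_extD (X := fun t => (E2' t * sinv (h t))%S) (Y := fun t => (E2' t * 1)%S)).
- by move=> t Dt; rewrite hol_to_end_end.
- by move=> t _; rewrite smul1r.
apply: sapprox_mul G2' (Grow_sinvf sg01 EQ vq); first exact: sapprox_refl.
exact: (sinvf_near_one sg01 EQ vq).
Qed.

Lemma sapprox_trans (X Y Z : R -> series n) : sapprox D id X Y -> sapprox D id Y Z -> sapprox D id X Z.
Proof. by move=> XY YZ w; apply: Small_ext (Small_add (XY w) (YZ w)) => t; ring. Qed.

Lemma near_P_end_shift : sapprox D id (fun t => P (Rminus (Rminus 1 t) (t ^ 3))) (fun t => E2 t * H)%S.
Proof.
apply: sapprox_trans near_P_end; apply: (sapprox_sym sg01) => w.
have HD t : D t -> [/\ 0 < id t <= 1, id t <= Rminus (Rminus 1 t) (t ^ 3) <= Rminus 1 t,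
    Rminus 1 t <= 1 - id t & Rminus 1 t - Rminus (Rminus 1 t) (t ^ 3) <= id t ^ 3].
  by case: dD => ? ? ? ? ? [? ?]; have := @cube_le t ltac:(lra); rewrite /id; split; lra.
exact: (Small_unscale HD (P_diff HD w)).
Qed.

Lemma near_R_shift : sapprox D id (fun t => RR (Rplus t (t ^ 3))) (fun t => H * E1' t)%S.
Proof.
apply: sapprox_trans near_R => w.
have HD t : D t -> [/\ 0 < id t <= 1, id t <= t <= Rplus t (t ^ 3),
    Rplus t (t ^ 3) <= 1 - id t & Rplus t (t ^ 3) - t <= id t ^ 3].
  by case: dD => ? ? ? ? ? [? ?]; have := @cube_le t ltac:(lra); rewrite /id; split; lra.
exact: (Small_unscale HD (R_diff HD w)).
Qed.

(** The solutions may be replaced by their local factors, and for these conjugated_KKS gives the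
    exact value. *)
Lemma regular_part_limit w : Clim0 (regular_part w) ((KKS H + foxR q H + foxL p H)%S w).
Proof.
have ag := ac_grow sg01.
have GPt := Grow_P sg01 tD.
have GPb := Grow_P sg01 bD.
have GPi := sclass_sinv ag GPt.
have SK := sapprox_mul near_P_end near_Pinv (gmul G2 (cst H)) GPi.
have SK' := sapprox_KKS SK.
have GK := sclass_KKS ag (gmul GPb GPi).
have S1 := sapprox_mul (sapprox_mul near_R_end SK' G2' GK) near_P
   (gmul G2' (sclass_KKS ag (gmul (gmul G2 (cst H)) G1'))) GPt.
have GPs : sclass (Grow D id) (fun t => P (Rminus (Rminus 1 t) (t ^ 3))).
  apply: (Grow_P sg01) => t; case: dD => ? ? ? ? ? [? ?].
  by have := @cube_le t ltac:(lra); rewrite /id; lra.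
have S2 := sapprox_mul near_R_end
  (sapprox_add (sapprox_foxR q near_P_end_shift) (sapprox_opp sg01 (sapprox_foxR q near_P))) G2'
  (sclass_add ag (sclass_foxR q GPs) (fun w => ac_opp ag (sclass_foxR q GPt w))).
have S3 := sapprox_mul
  (sapprox_add (sapprox_foxL p near_R_shift) (sapprox_opp sg01 (sapprox_foxL p near_R_end))) near_P
  (sclass_add ag (sclass_foxL p (gmul (cst H) G1')) (fun w => ac_opp ag (sclass_foxL p G2' w))) GPt.
have S := sapprox_add (sapprox_add S1 S2) S3.
have SI : Small D id (fun t => diagonal_integral w t - KKS_primitive w t (1 - t))%C.
  by apply: Small_sub (diagonal_integral_limit w) => t; case: dD => ? ? ? ? ? [? ?]; lra.
have SS := Small_add SI (S w).
have d0 : 0 < d by case: dD.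
apply: (Small_Clim0 d0).
apply: (Small_sub (D := D)) => [t [t0 td]|]; first by split; lra.
apply: Small_ext SS => t.
have -> : (E2 t * H * E1' t = E2 t * (H * E1' t))%S by rewrite smulA.
rewrite (conjugated_KKS (lnarg t) pq H_aug) /regular_part /KKS_primitive.
by rewrite (saddE (_ + _)%S) (saddE (_ * _)%S); ring.
Qed.
End FoxLimit.

(** * The logarithmic sides *)

Let dD : [/\ 0 < d, d < dp, d < dq, d < 1 / 4 & dp <= 1].
Proof. by case: d_small => ? ? ? ?; have [_] := ex_delta EP; split. Qed.

Lemma curve_cts t : 0 < t < 1 -> Ccts gamma t.
Proof. by move=> Ht; apply: Cder_cont (path_Cder PA Ht). Qed.

Lemma speed_cts t : 0 < t < 1 -> Ccts (velocity gamma) t.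
Proof. by move=> Ht; apply: Cder_cont (velocity_Cder PA Ht). Qed.

Lemma Ccts_rev (F : R -> C) t : Ccts F (1 - t) -> Ccts (fun v => F (1 - v)) t.
Proof.
move=> HF; apply: (@Ccts_comp _ _ (fun v => 1 - v) F) => //.
apply: (@continuous_minus R_UniformSpace R_AbsRing R_NormedModule); last exact: continuous_id.
exact: continuous_const.
Qed.

Section Far.
Hypothesis pq : p != q.

Lemma far_end (i j : 'I_n) : i != j -> (forall u, 0 < u <= d -> (z j + RtoC u)%C <> z i) ->
  exists2 m, 0 < m & forall u, 0 < u <= d -> m <= Cmod (z j + RtoC u - z i)%C.
Proof.
move=> ij Hn; have [||m m0 Hm] := @Con_away (fun u => z j + RtoC u - z i)%C 0 d.
- move=> u _; apply: Ccts_minus; last exact: Ccts_const.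
  by apply: Ccts_plus; [exact: Ccts_const | apply: Cder_cont; exact: Cder_id].
- move=> u Hu; apply: Csub_neq; case: (Rle_lt_or_eq_dec 0 u (proj1 Hu)) => [u0|<-]; first by apply: Hn; lra.
  by rewrite Cplus_0_r => /z_inj E; rewrite E eqxx in ij.
by exists m => // u Hu; apply: Hm; lra.
Qed.

Lemma far_bounds (g g1 : R -> C) (i j : 'I_n) : i != j ->
  (forall v, 0 < v < 1 -> Ccts g v) -> (forall v, 0 < v < 1 -> Ccts g1 v) ->
  (forall v, 0 < v < 1 -> g v <> z i) ->
  (forall u, 0 < u <= d -> g (1 - u) = (z j + RtoC u)%C /\ Cmod (g1 (1 - u)) = 1) ->
  exists2 lb, 0 < lb & exists M1, forall v, d <= v < 1 -> lb <= Cmod (g v - z i)%C /\ Cmod (g1 v) <= M1.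
Proof.
case: dD => d0 _ _ d4 _ ij Hg Hg1 Hi He.
have [|m1 m10 H1] := far_end ij.
  by move=> u Hu; have [<- _] := He u Hu; apply: Hi; lra.
have [||m2 m20 H2] := @Con_away (fun v => g v - z i)%C d (1 - d).
- by move=> v Hv; apply: Ccts_minus; [apply: Hg; lra | exact: Ccts_const].
- by move=> v Hv; apply: Csub_neq; apply: Hi; lra.
have [|M M0 HM] := @Con_bounded g1 d (1 - d); first by move=> v Hv; apply: Hg1; lra.
exists (Rmin m1 m2); first exact: Rmin_pos.
exists (Rmax 1 M) => v Hv.
have x1 := Rmin_l m1 m2; have x2 := Rmin_r m1 m2; have x3 := Rmax_l 1 M; have x4 := Rmax_r 1 M.
case: (Rle_lt_dec v (1 - d)) => K; first by have := H2 v; have := HM v; lra.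
have [E1 E2] := He (1 - v) ltac:(lra); have := H1 (1 - v) ltac:(lra).
by move: E1 E2; rewrite (_ : 1 - (1 - v) = v); [move=> -> ->; lra | ring].
Qed.

Lemma hol_product_cts (w : seq 'I_n) u v : 0 < u < 1 -> 0 < v < 1 ->
  Ccts (fun s => hol_product P Q w s v) u /\ Ccts (fun s => hol_product P Q w u s) v.
Proof.
move=> Hu Hv; split.
  apply: (sclass_mul (ac_cts u)); last exact: (sclass_const (ac_cts u)).
  by move=> x; apply: Cder_cont (sderR PA HQ Q1 Hu x).
apply: (sclass_mul (ac_cts v) (X := fun=> hol_to_end Q u)); first exact: (sclass_const (ac_cts v)).
by move=> x; apply: Cder_cont (sderP PA HP Hv x).
Qed.

(** The pole of the kernel at the point gamma(t) of the first straight end, compared with the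
    pole at z_p itself; end_side is the same at the other end, with the path reversed. *)
Definition start_side (w : seq 'I_n) (t : R) : C :=
  CInt (side_integrand gamma (velocity gamma) (z p) (fun t v => hol_product P Q w v t) t) (t + t ^ 3) (1 - t).
Definition end_side (w : seq 'I_n) (t : R) : C :=
  CInt (side_integrand (fun v => gamma (1 - v)) (fun v => - velocity gamma (1 - v))%C (z q)
    (fun t v => hol_product P Q w (1 - t) (1 - v)) t) (t + t ^ 3) (1 - t).

Let sgD1 (x : R * R) : 0 < x.1 < d /\ d <= x.2 <= 1 - x.1 -> 0 < x.1 <= 1.
Proof. by case: dD; lra. Qed.
Let sgD2 (x : R * R) : 0 < x.1 < d /\ x.1 <= x.2 <= d -> 0 < x.1 <= 1.
Proof. by case: dD; lra. Qed.

Lemma lnarg_ratio t v : 0 < t -> 0 < v -> (- lnarg v + lnarg t)%C = (- / two_pi_i * RtoC (ln (v / t)))%C.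
Proof.
move=> t0 v0; rewrite ln_div // RtoC_minus /lnarg; have := two_pi_i_neq0 => ?; field; done.
Qed.

(** Stated through divided differences in order to have the factor v - t explicitly; at v = t the
    numerator is 0. *)
Lemma Grow_slope (k : R -> series n) (dk : R) : d < dk -> dk <= 1 ->
  (forall w, exists2 M, 0 <= M & forall x y, 0 <= x <= dk -> 0 <= y <= dk ->
    Cmod (k x w - k y w)%C <= M * Rabs (x - y)) ->
  sclass (Grow (fun x : R * R => 0 < x.1 < d /\ x.1 <= x.2 <= d) fst)
    (fun x => (/ RtoC (x.2 - x.1)) *: (k x.2 - k x.1))%S.
Proof.
move=> dd d1 Hk w; have [M M0 HM] := Hk w.
apply: (Grow_bounded sgD2 (M := M)) => -[t v] /= [Ht Hv].
rewrite sscaleE saddE soppE; case: (Req_dec v t) => [->|vt].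
  by rewrite (_ : (/ RtoC (t - t) * (k t w + - k t w))%C = RtoC 0) ?Cmod_0 //; ring.
have := HM v t ltac:(lra) ltac:(lra); rewrite Rabs_pos_eq; last by lra.
move=> K; rewrite Cmod_mult Cmod_inv; last by case; lra.
rewrite Cmod_R Rabs_pos_eq; last by lra.
rewrite Rmult_comm; apply/Rle_div_l; [lra | exact: K].
Qed.

(** On the straight end the product of holonomies is H exp(- ln (v/t) x_p/(2 pi i)) up
    to v - t times a quantity of moderate growth: the two exponentials combine and only the analytic factors differ. *)
Lemma start_side_limit w : Clim0 (fun t => start_side w t + H w * RtoC (2 * ln t))%C
  (- two_pi_i * (H * r_zeta (- letter p))%S w)%C.
Proof.
case: dD => d0 dp0 dq0 d4 dp1.
rewrite -zeta_sum_start -(log_coef_start0 p H w).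
pose Y t v := (H * letter_exp p (- lnarg v)%C * sinv (f v) *
  (- ((/ RtoC (v - t)) *: (f v - f t))) * letter_exp p (lnarg t))%S w.
apply: (@side_limit_grow gamma (velocity gamma) (z p) d (size w) (log_coef_start p H w) _ Y).
- by lra.
- exact: curve_cts.
- exact: speed_cts.
- by move=> v Hv; have [] := st_start ST Hv.
- apply: (@far_bounds gamma (velocity gamma) p q pq curve_cts speed_cts) => [v Hv|u Hu].
    exact: (path_in_Sigma PA Hv).
  by have [-> -> _] := st_end ST Hu; rewrite Cmod_opp Cmod_1.
- by move=> t Ht v Hv; apply: (proj1 (@hol_product_cts w v t _ _)); lra.
- apply: (sclass_mul (ac_grow sgD1)).
    by apply: (Grow_R sgD1) => x /=; lra.
  by apply: (Grow_P sgD1) => x /=; lra.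
- have vD (x : R * R) : 0 < x.1 < d /\ x.1 <= x.2 <= d -> x.1 <= x.2 < dp by lra.
  have tD (x : R * R) : 0 < x.1 < d /\ x.1 <= x.2 <= d -> x.1 <= x.1 < dp by lra.
  have ag := ac_grow sgD2.
  apply: (sclass_mul ag); last exact: (Grow_letter_exp sgD2 EP tD).
  apply: (sclass_mul ag).
    apply: (sclass_mul ag); last exact: (Grow_sinvf sgD2 EP vD).
    apply: (sclass_mul ag); first exact: (sclass_const ag).
    exact: (Grow_letter_expN sgD2 EP vD).
  by move=> u; apply: (ac_opp ag); apply: (Grow_slope dp0 dp1 (ex_lip EP)).
move=> t v Ht Hv.
have -> : log_poly (size w) (log_coef_start p H w) t v = (H * letter_exp p (- lnarg v + lnarg t)%C)%S w.
  by rewrite lnarg_ratio ?log_sum_start //; lra.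
rewrite /hol_product hol_to_end_start ?P_start; try lra.
have fv : (sinv (f v) * f v)%S = 1%S by apply: smulVr; apply: (expansion_aug EP); lra.
have -> : (H * (letter_exp p (- lnarg v)%C * sinv (f v)) * (f t * letter_exp p (lnarg t)))%S w =
  ((H * (letter_exp p (- lnarg v)%C * sinv (f v)) * (f t - f v) * letter_exp p (lnarg t))%S w +
   (H * letter_exp p (- lnarg v + lnarg t)%C)%S w)%C.
  rewrite smulBr smulBl saddE soppE -!smulA (smulA (sinv _) (f v)) fv smul1l letter_exp_add; ring.
rewrite /Y !smulNr !smulNl smulZr smulZl soppE sscaleE !smulBr !smulBl !saddE !soppE -!smulA.
case: (Req_dec v t) => [->|vt]; first by rewrite (_ : t - t = 0); [ring | ring].
have : RtoC (v - t) <> RtoC 0 by case; lra.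
by move=> ?; field.
Qed.

Lemma end_side_limit w : Clim0 (fun t => end_side w t + H w * RtoC (2 * ln t))%C
  (- two_pi_i * (r_zeta (letter q) * H)%S w)%C.
Proof.
case: dD => d0 dp0 dq0 d4 dp1; have [_ dq1] := ex_delta EQ.
have qp : q != p by rewrite eq_sym.
rewrite -zeta_sum_end -(log_coef_end0 q H w).
pose Y t v := (letter_exp q (- lnarg t)%C * sinv (h t) *
  ((/ RtoC (v - t)) *: (h v - h t)) * letter_exp q (lnarg v) * H)%S w.
have cr v : 0 < v < 1 -> Ccts (fun v => gamma (1 - v)) v.
  by move=> Hv; apply: Ccts_rev; apply: curve_cts; lra.
have sr v : 0 < v < 1 -> Ccts (fun v => - velocity gamma (1 - v))%C v.
  by move=> Hv; apply: Ccts_opp; apply: Ccts_rev; apply: speed_cts; lra.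
apply: (@side_limit_grow (fun v => gamma (1 - v)) (fun v => - velocity gamma (1 - v))%C (z q) d
  (size w) (log_coef_end q H w) _ Y) => //.
- by lra.
- by move=> v Hv; have [-> -> _] := st_end ST Hv; split => //; ring.
- apply: (@far_bounds (fun v => gamma (1 - v)) (fun v => - velocity gamma (1 - v))%C q p qp cr sr) => [v Hv|u Hu].
    by apply: (path_in_Sigma PA); lra.
  rewrite (_ : 1 - (1 - u) = u); last by ring.
  by have [-> -> _] := st_start ST Hu; rewrite Cmod_opp Cmod_1.
- by move=> t Ht v Hv; apply: (Ccts_rev (F := fun s => hol_product P Q w (1 - t) s)); apply: (proj2 (@hol_product_cts w (1 - t) (1 - v) _ _)); lra.
- apply: (sclass_mul (ac_grow sgD1)).
    by apply: (Grow_R sgD1) => x /=; lra.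
  by apply: (Grow_P sgD1) => x /=; lra.
- have vD (x : R * R) : 0 < x.1 < d /\ x.1 <= x.2 <= d -> x.1 <= x.2 < dq by lra.
  have tD (x : R * R) : 0 < x.1 < d /\ x.1 <= x.2 <= d -> x.1 <= x.1 < dq by lra.
  have ag := ac_grow sgD2.
  apply: (sclass_mul ag); last exact: (sclass_const ag).
  apply: (sclass_mul ag); last exact: (Grow_letter_exp sgD2 EQ vD).
  apply: (sclass_mul ag); last exact: (Grow_slope dq0 dq1 (ex_lip EQ)).
  apply: (sclass_mul ag); last exact: (Grow_sinvf sgD2 EQ tD).
  exact: (Grow_letter_expN sgD2 EQ tD).
move=> t v Ht Hv.
have -> : log_poly (size w) (log_coef_end q H w) t v = (letter_exp q (- lnarg t + lnarg v)%C * H)%S w.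
  have -> : (- lnarg t + lnarg v = / two_pi_i * RtoC (ln (v / t)))%C.
    have := @lnarg_ratio t v ltac:(lra) ltac:(lra) => E.
    transitivity (- (- lnarg v + lnarg t))%C; first by ring.
    by rewrite E; ring.
  by rewrite log_sum_end.
rewrite /hol_product hol_to_end_end ?P_end; try lra.
have ft : (sinv (h t) * h t)%S = 1%S by apply: smulVr; apply: (expansion_aug EQ); lra.
have -> : (letter_exp q (- lnarg t)%C * sinv (h t) * (h v * letter_exp q (lnarg v) * H))%S w =
  ((letter_exp q (- lnarg t)%C * sinv (h t) * (h v - h t) * letter_exp q (lnarg v) * H)%S w +
   (letter_exp q (- lnarg t + lnarg v)%C * H)%S w)%C.
  rewrite -letter_exp_add smulBr !smulBl saddE soppE -!smulA (smulA (sinv _) (h t)) ft smul1l. ring.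
rewrite /Y smulZr !smulZl sscaleE.
case: (Req_dec v t) => [->|vt].
  rewrite smulBr !smulBl saddE soppE (_ : t - t = 0); [ring | ring].
have : RtoC (v - t) <> RtoC 0 by case; lra.
by move=> ?; field.
Qed.
End Far.

(** * The exact identity at a positive cut-off *)

Section Identity.
Variables (w : seq 'I_n) (I : finType) (tt ss : I -> R).
Hypothesis Hx : forall l, gamma (tt l) = gamma (ss l) /\
  det2 (velocity gamma (tt l)) (velocity gamma (ss l)) <> 0.
Hypothesis Hinj : forall l l', tt l = tt l' -> ss l = ss l' -> l = l'.
Hypothesis Hcomp : forall u v, 0 < u < v -> v < 1 -> gamma u = gamma v ->
  exists2 l, u = tt l & v = ss l.

(** The diagonal side of the triangle. *)
Definition turning_integral (t : R) : C :=
  CInt (fun s => hol_product P Q w s (Rminus s (t ^ 3)) * ((velocity gamma (Rminus s (t ^ 3)) - velocity gamma s)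
    / (gamma (Rminus s (t ^ 3)) - gamma s)))%C (t + t ^ 3) (1 - t).

(** The term of the connection at z_p extracts the last letter x_p, so that its integral is an
    increment of the Fox derivative. *)
Lemma start_pole_integral a lo hi : 0 < a < 1 -> 0 < lo <= hi -> hi < 1 ->
  (CInt (fun s => conn z gamma p s * hol_product P Q w s a) lo hi)%C =
  (- ((foxL p (RR hi) - foxL p (RR lo)) * P a)%S w)%C.
Proof.
move=> Ha Hl Hh.
rewrite (@CInt_FTC (fun s => - (foxL p (RR s) * P a)%S w)%C); [|lra| |].
- by rewrite smulBl saddE soppE; ring.
- move=> s Hs; have S : sder (fun s => foxL p (RR s)) s (- (conn z gamma p s *: RR s))%S.
    move=> v; apply: Cder_eq (sderR PA HQ Q1 (t := s) _ (rcons v p)) _; first by lra.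
    by rewrite !soppE -[in RHS](foxL_mul_lin (conn z gamma ^~ s) (RR s) p).
  apply: Cder_eq (Cder_opp (sder_mul S (sder_const (P a) s) w)) _.
  by rewrite smul0r smulNl smulZl saddE soppE sscaleE /szero /hol_product; ring.
move=> s Hs; apply: Ccts_mult; first by apply: (conn_cts PA); lra.
by apply: (proj1 (@hol_product_cts w s a _ _)); lra.
Qed.

Lemma end_pole_integral b lo hi : 0 < b < 1 -> 0 < lo <= hi -> hi < 1 ->
  (CInt (fun s => conn z gamma q s * hol_product P Q w b s) lo hi)%C =
  (RR b * (foxR q (P hi) - foxR q (P lo)))%S w.
Proof.
move=> Hb Hl Hh.
rewrite (@CInt_FTC (fun s => (RR b * foxR q (P s))%S w)%C); [|lra| |].
- by rewrite smulBr saddE soppE; ring.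
- move=> s Hs; have S : sder (fun s => foxR q (P s)) s (conn z gamma q s *: P s)%S.
    move=> v; apply: Cder_eq (sderP PA HP (t := s) _ (q :: v)) _; first by lra.
    by rewrite -[in RHS](foxR_lin_mul (conn z gamma ^~ s) (P s) q).
  apply: Cder_eq (sder_mul (sder_const (RR b) s) S w) _.
  by rewrite smul0l smulZr saddE sscaleE /szero /hol_product; ring.
move=> s Hs; apply: Ccts_mult; first by apply: (conn_cts PA); lra.
by apply: (proj2 (@hol_product_cts w b s _ _)); lra.
Qed.

Lemma pole_conn i s : 0 < s < 1 ->
  (velocity gamma s / (gamma s - z i) = two_pi_i * conn z gamma i s)%C.
Proof.
move=> Hs; have := Csub_neq (path_in_Sigma PA Hs (i := i)); have := two_pi_i_neq0.
by rewrite /conn => ? ?; field.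
Qed.

(** The boundary terms of the triangle at cut-off t, collected. The hypothesis on the crossings
    holds for small t. *)
Lemma stokes_identity t : 0 < t <= d ->
  (forall l, [/\ t < tt l, tt l + t ^ 3 < ss l & ss l < 1 - t]) ->
  (two_pi_i * regular_part w t)%C =
  (turning_integral t + \csum_(l : I) jump_at (velocity gamma) (hol_product P Q w) tt ss l + end_side w t - start_side w t)%C.
Proof.
case: dD => d0 dp0 dq0 d4 dp1 Ht Hts.
have [e0 e1] := @cube_le t ltac:(lra).
pose a := t; pose b := Rminus 1 t; pose eta := t ^ 3.
have sep u v : 0 < u < v -> v < 1 -> (u <= a \/ b <= v \/ v - u <= eta) -> gamma u <> gamma v.
  move=> Huv Hv Hor /(Hcomp Huv Hv) [l Eu Ev]; have [h1 h2 h3] := Hts l.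
  by move: Hor; rewrite /a /b /eta Eu Ev; lra.
have St := stokes (KZ_green_data PA HP HQ Q1 w) (tt := tt) (ss := ss) (a := t) (b := Rminus 1 t) (eta := t ^ 3)
  ltac:(lra) ltac:(lra) e0 ltac:(lra) Hts Hx Hinj Hcomp.
have csh (k s : R) : continuous (fun s => Rminus s k) s.
  by apply: (@continuous_minus R_UniformSpace R_AbsRing R_NormedModule);
    [exact: continuous_id | exact: continuous_const].
have Fdiag s : 0 < s - eta -> s < 1 -> Ccts (fun s => hol_product P Q w s (Rminus s eta)) s.
  move=> s1 s2; apply: (Ccts2_curve (f := hol_product P Q w) (b := fun s => Rminus s eta)) => //.
  by apply: (gd_cF (KZ_green_data PA HP HQ Q1 w)); rewrite /eta in s1 *; lra.
have shift (k : R -> C) s : 0 < s - eta < 1 -> (forall x, 0 < x < 1 -> Ccts k x) ->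
    Ccts (fun s => k (Rminus s eta)) s.
  by move=> Hs Hk; apply: (Ccts_comp (f := k)) => //; apply: Hk.
(* On the far side the kernel form splits into the diagonal integrand, the turning integrand,
   and the pole at gamma(t), which is compared with the pole at the end point z_p. *)
pose A s := (WW w s (Rminus s (t ^ 3)) - WW w s t)%C.
pose B s := (hol_product P Q w s (Rminus s (t ^ 3)) * ((velocity gamma (Rminus s (t ^ 3)) - velocity gamma s)
    / (gamma (Rminus s (t ^ 3)) - gamma s)))%C.
pose Sg s := side_integrand gamma (velocity gamma) (z p) (fun t v => hol_product P Q w v t) t s.
pose E s := (conn z gamma p s * hol_product P Q w s t)%C.
have nz s : 0 < s < 1 -> (gamma s - z p)%C <> RtoC 0.
  by move=> Hs; apply: Csub_neq; apply: (path_in_Sigma PA Hs).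
have cA : Con A (t + t ^ 3) (1 - t).
  by move=> s Hs; apply: Ccts_minus; apply: W_curve_cts => //; try lra; apply: continuous_const.
have cB : Con B (t + t ^ 3) (1 - t).
  move=> s Hs; apply: Ccts_mult; first by apply: Fdiag; rewrite /eta; lra.
  apply: Ccts_mult; first by apply: Ccts_minus; [apply: (shift (velocity gamma)) speed_cts; rewrite /eta; lra | apply: speed_cts; lra].
  apply: Ccts_inv; last by apply: Csub_neq; apply: sep; rewrite /eta; lra.
  by apply: Ccts_minus; [apply: (shift gamma) curve_cts; rewrite /eta; lra | apply: curve_cts; lra].
have cS : Con Sg (t + t ^ 3) (1 - t).
  move=> s Hs; apply: Ccts_mult; first by apply: (proj1 (@hol_product_cts w s t _ _)); lra.
  apply: Ccts_minus; apply: Ccts_mult; try (by apply: speed_cts; lra); apply: Ccts_inv.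
  - by apply: Ccts_minus; [apply: curve_cts; lra | exact: Ccts_const].
  - by apply: Csub_neq => Eg; apply: (sep t s _ _ _ (esym Eg)); rewrite /a; lra.
  - by apply: Ccts_minus; [apply: curve_cts; lra | exact: Ccts_const].
  by apply: nz; lra.
have cE : Con E (t + t ^ 3) (1 - t).
  move=> s Hs; apply: Ccts_mult; first by apply: (conn_cts PA); lra.
  by apply: (proj1 (@hol_product_cts w s t _ _)); lra.
have Ea : CInt (side_form gamma (velocity gamma) (hol_product P Q w) (WW w) t (t ^ 3)) (t + t ^ 3) (1 - t) =
    (- two_pi_i * diagonal_integral w t + (turning_integral t + ((- RtoC 1) * start_side w t + (- two_pi_i) * CInt E (t + t ^ 3) (1 - t))))%C.
  have le1 : t + t ^ 3 <= 1 - t by lra.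
  rewrite /diagonal_integral /turning_integral /start_side -/A -/B -/Sg.
  rewrite -(@CInt_scal (- two_pi_i)%C A _ _ le1 cA) -(CInt_scal (- RtoC 1)%C le1 cS).
  rewrite -(CInt_scal (- two_pi_i)%C le1 cE).
  have sc k (g0 : R -> C) : Con g0 (t + t ^ 3) (1 - t) -> Con (fun s => k * g0 s)%C (t + t ^ 3) (1 - t).
    by move=> Hg s Hs; apply: Ccts_mult; [exact: Ccts_const | exact: Hg].
  have ad (g0 h0 : R -> C) : Con g0 (t + t ^ 3) (1 - t) -> Con h0 (t + t ^ 3) (1 - t) ->
      Con (fun s => g0 s + h0 s)%C (t + t ^ 3) (1 - t).
    by move=> Hg Hh s Hs; apply: Ccts_plus; [exact: Hg | exact: Hh].
  rewrite -CInt_plus; [|lra|exact: sc|exact: sc].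
  rewrite -CInt_plus; [|lra|exact: cB|by apply: (ad); exact: (sc)].
  rewrite -CInt_plus; [|lra|exact: sc|by apply: (ad); [exact: cB | apply: (ad); exact: (sc)]].
  apply: CInt_ext => [|s Hs]; first by lra.
  have n1 : (gamma (Rminus s (t ^ 3)) - gamma s)%C <> RtoC 0.
    by apply: Csub_neq; apply: sep; rewrite /eta; lra.
  have n2 : (gamma t - gamma s)%C <> RtoC 0 by apply: Csub_neq; apply: sep; rewrite /a; lra.
  have n3 : (gamma s - gamma t)%C <> RtoC 0 by apply: Csub_neq => /esym; apply: sep; rewrite /a; lra.
  have n4 := nz s ltac:(lra).
  have -> : (- two_pi_i * E s = - (velocity gamma s / (gamma s - z p) * hol_product P Q w s t))%C.
    by rewrite pole_conn /E; [ring | lra].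
  by rewrite /side_form /kern /A /B /Sg /side_integrand; field.
pose fb s := (hol_product P Q w b s * (- velocity gamma s / (gamma s - gamma b) - - velocity gamma s / (gamma s - z q)))%C.
pose kb := kern gamma (velocity gamma) (hol_product P Q w) b.
pose E' s := (conn z gamma q s * hol_product P Q w b s)%C.
have hb : 0 < b < 1 by rewrite /b; lra.
have nb s : t <= s <= b - eta -> (gamma s - gamma b)%C <> RtoC 0.
  by move=> Hs; apply: Csub_neq; apply: sep; rewrite /b /eta in Hs *; lra.
have ck : Con kb t (b - eta).
  move=> s Hs; apply: Ccts_mult; first by apply: (proj2 (@hol_product_cts w b s _ _)); rewrite /b /eta in Hs *; lra.
  apply: Ccts_mult; first by apply: speed_cts; rewrite /b /eta in Hs *; lra.
  apply: Ccts_inv; last exact: nb.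
  apply: Ccts_minus; last exact: Ccts_const.
  by apply: curve_cts; rewrite /b /eta in Hs *; lra.
have cE' : Con E' t (b - eta).
  move=> s Hs; apply: Ccts_mult; first by apply: (conn_cts PA); rewrite /b /eta in Hs *; lra.
  by apply: (proj2 (@hol_product_cts w b s _ _)); rewrite /b /eta in Hs *; lra.
have fE s : t <= s <= b - eta -> fb s = ((- RtoC 1) * kb s + two_pi_i * E' s)%C.
  move=> Hs; have Hs' : 0 < s < 1 by rewrite /b /eta in Hs; lra.
  have -> : (two_pi_i * E' s = velocity gamma s / (gamma s - z q) * hol_product P Q w b s)%C.
    by rewrite pole_conn // /E'; ring.
  have := nb s Hs; have := Csub_neq (path_in_Sigma PA Hs' (i := q)) => n1 n2.
  by rewrite /fb /kb /kern; field.
have cf : Con fb t (b - eta).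
  move=> s Hs; apply: Ccts_mult; first by apply: (proj2 (@hol_product_cts w b s _ _)); rewrite /b /eta in Hs *; lra.
  have Hs' : 0 < s < 1 by rewrite /b /eta in Hs; lra.
  apply: Ccts_minus; apply: Ccts_mult; try (by apply: Ccts_opp; apply: speed_cts); apply: Ccts_inv.
  - by apply: Ccts_minus; [exact: curve_cts | exact: Ccts_const].
  - exact: nb.
  - by apply: Ccts_minus; [exact: curve_cts | exact: Ccts_const].
  by apply: Csub_neq; apply: (path_in_Sigma PA Hs').
have Eb : end_side w t = ((- RtoC 1) * CInt kb t (b - eta) + two_pi_i * CInt E' t (b - eta))%C.
  have le2 : t <= b - eta by rewrite /b /eta; lra.
  rewrite -(CInt_scal (- RtoC 1)%C le2 ck) -(CInt_scal two_pi_i le2 cE').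
  have c1 : Con (fun s => - RtoC 1 * kb s)%C t (b - eta).
    by move=> s Hs; apply: Ccts_mult; [exact: Ccts_const | apply: ck].
  have c2 : Con (fun s => two_pi_i * E' s)%C t (b - eta).
    by move=> s Hs; apply: Ccts_mult; [exact: Ccts_const | apply: cE'].
  rewrite -(CInt_plus le2 c1 c2).
  have -> : end_side w t = CInt (fun v => fb (1 - v)) (t + t ^ 3) (1 - t) by [].
  have e2 : 1 - (1 - t) = t by ring.
  have e3 : 1 - (t + t ^ 3) = b - eta by rewrite /b /eta; ring.
  rewrite CInt_rev ?e2 ?e3 //; last by lra.
  by apply: CInt_ext => [|s Hs]; [rewrite /b /eta; lra | apply: fE; lra].
rewrite Ea start_pole_integral in St; try lra.
rewrite /E' end_pole_integral in Eb; try (by rewrite /b /eta; lra).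
rewrite -/b -/eta in St; rewrite -/kb in St.
(* eliminate the integral of the kernel at the last parameter *)
have Kb : CInt kb t (b - eta) = ((CInt kb t (b - eta) - \csum_(l : I) jump_at (velocity gamma) (hol_product P Q w) tt ss l) +
   \csum_(l : I) jump_at (velocity gamma) (hol_product P Q w) tt ss l)%C by ring.
rewrite Eb Kb St /regular_part -/b -/eta.
rewrite (_ : (foxL p (RR (Rplus t eta)) - foxL p (RR b)) * P t = - ((foxL p (RR b) - foxL p (RR (Rplus t eta))) * P t))%S.
  by rewrite soppE; ring.
by rewrite -smulNl; congr smul; apply: seriesP => u; rewrite !saddE !soppE !saddE !soppE; ring.
Qed.
End Identity.

(** * The rotation number *)

Section Rotation.

Let turn s := (path_deriv 2 gamma s / velocity gamma s)%C.

Lemma turn_cts s : 0 < s < 1 -> Ccts turn s.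
Proof.
move=> Hs; apply: Ccts_mult; first exact: (acceleration_Ccts PA).
by apply: Ccts_inv; [exact: speed_cts | exact: (path_immersed PA)].
Qed.

Lemma turn_ends s : 0 < s < 1 -> s <= d \/ 1 - d <= s -> turn s = RtoC 0.
Proof.
move=> Hs [sd|sd]; rewrite /turn.
  have [_ _ ->] := st_start ST (v := s) ltac:(lra).
  by rewrite /Cdiv Cmult_0_l.
have [_ _] := st_end ST (v := 1 - s) ltac:(lra).
by rewrite (_ : 1 - (1 - s) = s) => [->|]; [rewrite /Cdiv Cmult_0_l | ring].
Qed.

(** The real part of d log gamma' is d log |gamma'|, and |gamma'| = 1 at both ends. *)
Lemma turn_real : Re (CInt turn (d / 2) (1 - d / 2)) = 0.
Proof.
case: dD => d0 _ _ d4 _.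
pose N s := Re (velocity gamma s) * Re (velocity gamma s) + Im (velocity gamma s) * Im (velocity gamma s).
have N0 s : 0 < s < 1 -> 0 < N s.
  move=> Hs; rewrite /N; have v0 := path_immersed PA Hs.
  have p1 := Rle_0_sqr (Re (velocity gamma s)); have p2 := Rle_0_sqr (Im (velocity gamma s)).
  rewrite /Rsqr in p1 p2; apply: Rnot_le_lt => E; apply: v0.
  have E1 : Re (velocity gamma s) = 0 by nra.
  have E2 : Im (velocity gamma s) = 0 by nra.
  by rewrite [LHS]surjective_pairing -/(Re _) -/(Im _) E1 E2.
have dN s : 0 < s < 1 -> is_derive (fun s => ln (N s) / 2) s (Re (turn s)).
  move=> Hs; have [D1 D2] := velocity_Cder PA Hs; have Np := N0 s Hs.
  have D3 := @is_derive_plus R_AbsRing R_NormedModule _ _ _ _ _ (is_derive_multR D1 D1) (is_derive_multR D2 D2).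
  have e3 : ex_derive N s by eexists; exact: D3.
  have D4 : is_derive (fun s => ln (N s) / 2) s (Derive N s * / N s / 2).
    auto_derive; first by split.
    have -> : Derive (fun x => N x) s = Derive N s by [].
    by field; lra.
  have -> : Re (turn s) = Derive N s * / N s / 2.
    have key (va vb : C) : 0 < Re vb * Re vb + Im vb * Im vb -> Re (va / vb)%C =
        ((Re va * Re vb + Re vb * Re va) + (Im va * Im vb + Im vb * Im va)) *
        / (Re vb * Re vb + Im vb * Im vb) / 2.
      by case: vb va => [x y] [x2 y2] /= N1; field; lra.
    by rewrite (is_derive_unique _ _ _ D3) /turn key.
  exact: D4.
have le : d / 2 <= 1 - d / 2 by lra.
have := @is_RInt_derive R_CompleteNormedModule (fun s => ln (N s) / 2) (fun s => Re (turn s)) (d / 2) (1 - d / 2).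
rewrite Rmin_left ?Rmax_right // => K.
rewrite [LHS]/= (is_RInt_unique _ _ _ _ (K _ _)).
- have [_ e1 _] := st_start ST (v := d / 2) ltac:(lra); have [_ e2 _] := st_end ST (v := d / 2) ltac:(lra).
  have N1 : N (d / 2) = 1 by rewrite /N e1 /=; ring.
  have N2 : N (1 - d / 2) = 1 by rewrite /N e2 /=; ring.
  by rewrite N1 N2 /minus /plus /opp /=; ring.
- by move=> s Hs; apply: dN; lra.
by move=> s Hs; have [] := turn_cts (s := s) ltac:(lra).
Qed.

Lemma extend_by_zero (k : R -> R) : (forall s, 0 < s < 1 -> continuous k s) ->
  (forall s, 0 < s < 1 -> s <= d \/ 1 - d <= s -> k s = 0) ->
  is_RInt k 0 1 (RInt k (d / 2) (1 - d / 2)).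
Proof.
case: dD => d0 _ _ d4 _ kc k0.
have Z a b : 0 <= a <= b -> b <= 1 -> (b <= d \/ 1 - d <= a) -> is_RInt k a b 0.
  move=> Hab b1 Hz.
  apply: (@is_RInt_ext R_NormedModule (fun=> 0)).
    by rewrite Rmin_left ?Rmax_right; try lra; move=> s Hs; rewrite k0 //; lra.
  by have := @is_RInt_const R_NormedModule a b 0; rewrite /scal /= /mult /= Rmult_0_r.
have M : is_RInt k (d / 2) (1 - d / 2) (RInt k (d / 2) (1 - d / 2)).
  apply: (@RInt_correct R_CompleteNormedModule); apply: (@ex_RInt_continuous R_CompleteNormedModule).
  by move=> s; rewrite Rmin_left ?Rmax_right; try lra; move=> Hs; apply: kc; lra.
have A := @is_RInt_Chasles R_NormedModule _ _ _ _ _ _ (Z 0 (d / 2) ltac:(lra) ltac:(lra) ltac:(lra)) M.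
have B := @is_RInt_Chasles R_NormedModule _ _ _ _ _ _ A (Z (1 - d / 2) 1 ltac:(lra) ltac:(lra) ltac:(lra)).
by move: B; rewrite /plus /= Rplus_0_l Rplus_0_r.
Qed.

(** Near the ends gamma'' vanishes, so that the integral over [0,1] is the one over the middle
    part. *)
Lemma turn_integral : CInt turn (d / 2) (1 - d / 2) = (two_pi_i * RtoC (rotation_number gamma))%C.
Proof.
have R1 : is_RInt (fun s => Re (turn s)) 0 1 (RInt (fun s => Re (turn s)) (d / 2) (1 - d / 2)).
  by apply: extend_by_zero => s Hs; [have [] := turn_cts Hs | move=> He; rewrite turn_ends].
have R2 : is_RInt (fun s => Im (turn s)) 0 1 (RInt (fun s => Im (turn s)) (d / 2) (1 - d / 2)).
  by apply: extend_by_zero => s Hs; [have [] := turn_cts Hs | move=> He; rewrite turn_ends].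
have RR := @is_RInt_fct_extend_pair R_NormedModule R_NormedModule turn 0 1 _ _ R1 R2.
have E : rotation_number gamma = / (2 * PI) * RInt (fun s => Im (turn s)) (d / 2) (1 - d / 2).
  by rewrite /rotation_number (@is_RInt_unique C_R_CompleteNormedModule turn 0 1 _ RR).
have T0 := turn_real; have p0 := PI_RGT_0.
rewrite E /CInt (_ : RInt (fun s => Re (turn s)) _ _ = 0) //.
set y := RInt _ _ _; have Ey : (2 * PI) * (/ (2 * PI) * y) = y.
  by rewrite -Rmult_assoc Rinv_r; [exact: Rmult_1_l | lra].
move: (/ (2 * PI) * y) Ey => r <-.
by congr pair; rewrite /=; ring.
Qed.

(** On the diagonal the product of holonomies is the constant H. *)
Lemma turning_integral_limit w e0 : 0 < e0 ->
  (forall k y, 0 < k < e0 -> 0 < y - k ^ 3 -> y < 1 -> gamma (Rminus y (k ^ 3)) <> gamma y) ->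
  Clim0 (turning_integral w) (two_pi_i * (RtoC (rotation_number gamma) * H w))%C.
Proof.
case: dD => d0 _ _ d4 _ e00 sep.
have diag y : 0 < y < 1 -> hol_product P Q w y y = H w.
  by move=> Hy; rewrite /hol_product PQ // smulA smulVr ?smul1l //; apply: Q1.
pose e1 := Rmin e0 (d / 4).
have m1 : e1 <= e0 := Rmin_l _ _; have m2 : e1 <= d / 4 := Rmin_r _ _.
have e10 : 0 < e1 by apply: Rmin_pos; lra.
have cu k : 0 < k < e1 -> 0 < k ^ 3 <= k / 16 by move=> Hk; apply: cube_le; lra.
have Fdiag k y : 0 < k < e1 -> 0 < y - k ^ 3 -> y < 1 -> Ccts (fun s => hol_product P Q w s (Rminus s (k ^ 3))) y.
  move=> Hk s1 s2; have := cu k Hk => ck; apply: (Ccts2_curve (f := hol_product P Q w) (b := fun s => Rminus s (k ^ 3))).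
    by apply: (gd_cF (KZ_green_data PA HP HQ Q1 w)); lra.
  by apply: (@continuous_minus R_UniformSpace R_AbsRing R_NormedModule);
    [exact: continuous_id | exact: continuous_const].
have -> : (two_pi_i * (RtoC (rotation_number gamma) * H w) = H w * CInt turn (d / 2) (1 - d / 2))%C.
  by rewrite turn_integral; ring.
have Fshift x : 0 < x < 1 -> Ccts (fun u : R * R => hol_product P Q w u.2 (Rminus u.2 (Rabs u.1 ^ 3))) (0, x).
  move=> Hx; have ac := ac_cts (U := prod_UniformSpace R_UniformSpace R_UniformSpace) ((0, x) : R * R).
  apply: (sclass_mul ac (X := fun u => hol_to_end Q u.2) (Y := fun u => P (Rminus u.2 (Rabs u.1 ^ 3)))) => v.
    apply: (Ccts_comp (g := snd) (f := fun y => hol_to_end Q y v)); first exact: continuous_snd.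
    exact: Cder_cont (sderR PA HQ Q1 Hx v).
  apply: (Ccts_comp (g := fun u : R * R => Rminus u.2 (Rabs u.1 ^ 3)) (f := fun y => P y v)); first exact: shift_cts.
  rewrite (_ : Rminus (0, x).2 (Rabs (0, x).1 ^ 3) = x); last by rewrite /= Rabs_R0; ring.
  exact: Cder_cont (sderP PA HP Hx v).
have sep1 k y : 0 < k < e1 -> 0 < y - k ^ 3 -> y < 1 -> gamma (Rminus y (k ^ 3)) <> gamma y.
  by move=> Hk; apply: sep; lra.
have Fdiag1 k y : 0 < k < e1 -> d / 2 <= y <= 1 - d / 2 -> Ccts (fun s => hol_product P Q w s (Rminus s (k ^ 3))) y.
  by move=> Hk Hy; have := cu k Hk => ck; apply: Fdiag => //; lra.
have T := @turning_limit gamma (velocity gamma) (path_deriv 2 gamma) (hol_product P Q w) (H w) (d / 2) (1 - d / 2) e1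
  (path_Cder PA) (velocity_Cder PA) (acceleration_Ccts PA) (path_immersed PA) Fshift diag
  ltac:(lra) ltac:(lra) sep1 Fdiag1.
apply: Clim0_ext e10 _ T.
move=> k Hk; have ck := cu k Hk; rewrite /turning_integral.
set B := fun s : R => _.
have cB : Con B (k + k ^ 3) (1 - k).
  move=> s Hs; apply: Ccts_mult; first by apply: Fdiag; lra.
  have sh (l : R -> C) : (forall x, 0 < x < 1 -> Ccts l x) -> Ccts (fun s => l (Rminus s (k ^ 3))) s.
    move=> Hl; apply: (Ccts_comp (f := l)); last by apply: Hl; lra.
    by apply: (@continuous_minus R_UniformSpace R_AbsRing R_NormedModule);
      [exact: continuous_id | exact: continuous_const].
  apply: Ccts_mult; first by apply: Ccts_minus; [apply: (sh (velocity gamma)) speed_cts | apply: speed_cts; lra].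
  apply: Ccts_inv; last by apply: Csub_neq; apply: sep; lra.
  by apply: Ccts_minus; [apply: (sh gamma) curve_cts | apply: curve_cts; lra].
have Z a b : a <= b -> (forall s, a < s < b -> B s = RtoC 0) -> CInt B a b = RtoC 0.
  move=> ab HB; rewrite (CInt_ext ab HB) (@CInt_FTC (fun=> RtoC 0)) //; first by ring.
    by move=> s _; apply: Cder_const.
  exact: Con_const.
have z1 : CInt B (k + k ^ 3) (d / 2) = RtoC 0.
  apply: Z => [|s Hs]; first by lra.
  have [_ e2 _] := st_start ST (v := s) ltac:(lra).
  have [_ e3 _] := st_start ST (v := Rminus s (k ^ 3)) ltac:(lra).
  by rewrite /B e2 e3 /Cdiv; ring.
have z2 : CInt B (1 - d / 2) (1 - k) = RtoC 0.
  apply: Z => [|s Hs]; first by lra.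
  have [_ e2 _] := st_end ST (v := 1 - s) ltac:(lra).
  have [_ e3 _] := st_end ST (v := 1 - (s - k ^ 3)) ltac:(lra).
  rewrite (_ : 1 - (1 - s) = s) in e2; last by ring.
  rewrite (_ : 1 - (1 - (s - k ^ 3)) = Rminus s (k ^ 3)) in e3; last by ring.
  by rewrite /B e2 e3 /Cdiv; ring.
rewrite (@CInt_Chasles B (k + k ^ 3) (d / 2) (1 - k)) //; last by lra.
rewrite z1 (@CInt_Chasles B (d / 2) (1 - d / 2) (1 - k)); [|lra|by move=> s Hs; apply: cB; lra].
by rewrite z2; ring.
Qed.
End Rotation.

(** * The identity in the limit *)

Section WordIdentity.
Hypothesis pq : p != q.
Variables (w : seq 'I_n) (I : finType) (tt ss : I -> R).
Hypothesis Hts : forall l, 0 < tt l < ss l /\ ss l < 1.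
Hypothesis Hx : forall l, gamma (tt l) = gamma (ss l) /\
  det2 (velocity gamma (tt l)) (velocity gamma (ss l)) <> 0.
Hypothesis Hinj : forall l l', tt l = tt l' -> ss l = ss l' -> l = l'.
Hypothesis Hcomp : forall u v, 0 < u < v -> v < 1 -> gamma u = gamma v ->
  exists2 l, u = tt l & v = ss l.

Lemma crossings_inside : exists2 e, 0 < e <= d & forall t, 0 < t < e -> forall l,
  [/\ t < tt l, tt l + t ^ 3 < ss l & ss l < 1 - t].
Proof.
case: dD => d0 _ _ d4 _.
have [|r r0 Hr] := @near_all1 I (fun l t => 0 < t -> t < 1 / 4 -> [/\ t < tt l, tt l + t ^ 3 < ss l & ss l < 1 - t]) 0.
  move=> l; have [h1 h2] := Hts l.
  exists (Rmin (tt l) (Rmin (ss l - tt l) (1 - ss l))) => [|t Ht t0 t4]; first by do !apply: Rmin_pos; lra.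
  have m1 := Rmin_l (tt l) (Rmin (ss l - tt l) (1 - ss l)).
  have m2 := Rmin_r (tt l) (Rmin (ss l - tt l) (1 - ss l)).
  have m3 := Rmin_l (ss l - tt l) (1 - ss l); have m4 := Rmin_r (ss l - tt l) (1 - ss l).
  have := @cube_le t ltac:(lra); rewrite Rminus_0_r Rabs_pos_eq in Ht; last by lra.
  by split; lra.
exists (Rmin r d); first by split; [exact: Rmin_pos | exact: Rmin_r].
move=> t Ht l; have m1 := Rmin_l r d; have m2 := Rmin_r r d.
by apply: Hr; rewrite ?Rminus_0_r ?Rabs_pos_eq; lra.
Qed.

(** All terms of stokes_identity have limits; in the difference of the two sides along the ends
    the logarithms of the cut-off cancel. *)
Lemma word_identity : ((KKS H + foxR q H + foxL p H)%S w =
  RtoC (rotation_number gamma) * H w + \csum_(l : I) (RtoC (crossing_sign gamma (tt l) (ss l)) * hol_product P Q w (ss l) (tt l))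
  - (r_zeta (letter q) * H)%S w + (H * r_zeta (- letter p))%S w)%C.
Proof.
have pi0 := two_pi_i_neq0.
have [e [e0 ed] He] := crossings_inside.
set J := \csum_(l : I) _.
have EJ : \csum_(l : I) jump_at (velocity gamma) (hol_product P Q w) tt ss l = (two_pi_i * J)%C.
  by rewrite /J -Csum_scal; apply: eq_bigr => l _; rewrite /jump_at /crossing_sign; ring.
have sep k y : 0 < k < e -> 0 < y - k ^ 3 -> y < 1 -> gamma (Rminus y (k ^ 3)) <> gamma y.
  move=> Hk y0 y1; have k3 : 0 < k ^ 3 by apply: pow_lt; lra.
  move=> /(Hcomp (u := Rminus y (k ^ 3)) (v := y) ltac:(lra) y1) [l El Es].
  by have [_ hk _] := He k Hk l; lra.
have L1 := Clim0_scal two_pi_i (regular_part_limit pq w).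
have L2 := Clim0_plus (Clim0_plus (turning_integral_limit w e0 sep) (Clim0_const (two_pi_i * J)%C))
  (Clim0_minus (end_side_limit pq w) (start_side_limit pq w)).
(* H w times 2 ln t is added to both sides in order to use the two side limits *)
have E t : 0 < t < e -> (turning_integral w t + two_pi_i * J + (end_side w t + H w * RtoC (2 * ln t) - (start_side w t + H w * RtoC (2 * ln t))) -
    two_pi_i * regular_part w t = RtoC 0)%C.
  move=> Ht; rewrite (stokes_identity w Hx Hinj Hcomp (t := t)); [|lra|exact: He].
  by rewrite EJ; ring.
have L := Clim0_unique (Clim0_ext e0 E (Clim0_minus L2 L1)).
have {}L : (two_pi_i * ((KKS H + foxR q H + foxL p H)%S w) = two_pi_i * (
  RtoC (rotation_number gamma) * H w + J - (r_zeta (letter q) * H)%S w + (H * r_zeta (- letter p))%S w))%C.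
  rewrite -[LHS]Cplus_0_r L; ring.
have inv x : x = (/ two_pi_i * (two_pi_i * x))%C by field.
by rewrite (inv ((KKS H + foxR q H + foxL p H)%S w)) L -inv.
Qed.
End WordIdentity.
End Asym.

(** If p = q, the two ends run along the same ray, and their points are self-intersections with
    opposite velocities, which are not transverse. *)
Lemma ends_distinct n (z : 'I_n -> C) p q gamma m (t s : 'I_m -> R) :
  tangential_path z p q gamma -> transverse_crossings gamma t s -> p != q.
Proof.
move=> PA [Ht Hc]; apply/eqP => E; subst q; have [d d0 ST] := path_straight PA.
pose v := Rmin d (1 / 4).
have m1 : v <= d := Rmin_l _ _; have m2 : v <= 1 / 4 := Rmin_r _ _.
have v0 : 0 < v by apply: Rmin_pos; lra.
have [g1 k1 _] := st_start ST (v := v) ltac:(lra); have [g2 k2 _] := st_end ST (v := v) ltac:(lra).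
have [l [[El Es] _]] := Hc v (1 - v) ltac:(lra) ltac:(lra) (eq_trans g1 (esym g2)).
have [_ [_ [_]]] := Ht l; rewrite -El -Es k1 k2 /det2 /=; apply; ring.
Qed.

Theorem theorem1p1 (n : nat) (z : 'I_n -> C) (p q : 'I_n) (gamma : R -> C)
    (m : nat) (t s : 'I_m -> R)
    (H : series n) (Hol_end Hol_start : 'I_m -> series n)
    (z_distinct : injective z)
    (gamma_path : tangential_path z p q gamma)
    (gamma_crossings : transverse_crossings gamma t s)
    (H_hol : is_holonomy z gamma 0 (Tangential p) 1 (Tangential q) H)
    (* Hol_end l is Hol(A, gamma_[s_l,1]), Hol_start l is Hol(A, gamma_[0,t_l]) *)
    (Hol_endP : forall l,
      is_holonomy z gamma (s l) Regular 1 (Tangential q) (Hol_end l))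
    (Hol_startP : forall l,
      is_holonomy z gamma 0 (Tangential p) (t l) Regular (Hol_start l)) :
  KKS H =
    (H * r_zeta (- letter p) + RtoC (rotation_number gamma) *: H - r_zeta (letter q) * H
     + \ssum_(l < m)
         (RtoC (crossing_sign gamma (t l) (s l)) *: (Hol_end l * Hol_start l))
     - foxL p H - foxR q H)%S.
Proof.
have pq := ends_distinct gamma_path gamma_crossings.
have [crT crC] := gamma_crossings.
have [P [Q [HP NP HQ NQ [t0 [G [Ht0 [GE EG] EH]]]]]] := H_hol.
have [dp0 dp00 posp] := start_pos gamma_path (tau := 1) ltac:(lra).
have [dq0 dq00 posq] := end_pos gamma_path (sg := 0) ltac:(lra).
have P1' := continued_aug gamma_path start_dist dp00 posp HP NP.
have Q1' := continued_aug gamma_path end_dist dq00 posq HQ NQ.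
have por u : 0 < u < 1 -> portion 0 1 u by move=> Hu; split; lra.
have P1 u : 0 < u < 1 -> P u [::] = RtoC 1 by move=> Hu; apply: P1'; apply: por.
have Q1 u : 0 < u < 1 -> Q u [::] = RtoC 1 by move=> Hu; apply: Q1'; apply: por.
have EG' : G = sinv (Q t0).
  by apply: (inverse_unique (a := Q t0)) => //; apply: smulrV; apply: Q1'.
have PQ u : 0 < u < 1 -> P u = (Q u * H)%S.
  move=> Hu; rewrite EH EG' (solutions_const gamma_path HQ HP Q1' Ht0 (por u Hu)).
  by rewrite smulA smulrV ?smul1l //; apply: Q1.
have [dp [f [_ EP]]] := tangential_expansion gamma_path start_dist dp00 posp HP NP.
have [dq [h [_ EQ]]] := tangential_expansion gamma_path end_dist dq00 posq HQ NQ.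
have [d0 d00 ST0] := path_straight gamma_path.
have [dpp _] := ex_delta EP; have [dqp _] := ex_delta EQ.
pose d := Rmin (Rmin d0 (1 / 8)) (Rmin (dp / 2) (dq / 2)).
have m1 := Rmin_l (Rmin d0 (1 / 8)) (Rmin (dp / 2) (dq / 2)).
have m2 := Rmin_r (Rmin d0 (1 / 8)) (Rmin (dp / 2) (dq / 2)).
have m3 := Rmin_l d0 (1 / 8); have m4 := Rmin_r d0 (1 / 8).
have m5 := Rmin_l (dp / 2) (dq / 2); have m6 := Rmin_r (dp / 2) (dq / 2).
have dpos : 0 < d by do !apply: Rmin_pos; lra.
rewrite -/d in m1 m2.
have ST : straight z p q gamma d by apply: straight_le ST0; lra.
have d_small : [/\ 0 < d, d < dp, d < dq & d < 1 / 4] by split; lra.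
have Hts l : 0 < t l < s l /\ s l < 1 by have [h1 [h2 _]] := crT l.
have Hx l : gamma (t l) = gamma (s l) /\ det2 (velocity gamma (t l)) (velocity gamma (s l)) <> 0.
  by have [_ [_ ?]] := crT l.
have Hcomp u v : 0 < u < v -> v < 1 -> gamma u = gamma v -> exists2 l, u = t l & v = s l.
  by move=> uv v1 E; have [l [[? ?] _]] := crC u v uv v1 E; exists l.
have Hinj l l' : t l = t l' -> s l = s l' -> l = l'.
  move=> E1 E2; have [h1 h2] := Hts l; have [e _] := Hx l.
  have [k [_ Hk]] := crC (t l) (s l) h1 h2 e.
  by rewrite -(Hk l) // -(Hk l').
apply: seriesP => w.
have W := word_identity gamma_path z_distinct HP HQ EP EQ P1 Q1 PQ d_small ST pq w Hts Hx Hinj Hcomp.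
rewrite !saddE !soppE sscaleE ssumE.
have -> : \csum_(l < m) (RtoC (crossing_sign gamma (t l) (s l)) *: (Hol_end l * Hol_start l))%S w =
    \csum_(l < m) (RtoC (crossing_sign gamma (t l) (s l)) * hol_product P Q w (s l) (t l))%C.
  apply: eq_bigr => l _; have [h1 h2] := Hts l.
  rewrite sscaleE (hol_start gamma_path (tau := t l) _ HP NP (Hol_startP l)); last by lra.
  by rewrite (hol_end gamma_path (sg := s l) _ HQ NQ (Hol_endP l)) //; lra.
move: W; rewrite !saddE => W.
have -> : KKS H w = ((KKS H w + foxR q H w + foxL p H w) - foxR q H w - foxL p H w)%C by ring.
rewrite W; set A := bigop.body _ _ _; ring.
Qed.
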